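(* Assume the standing setting below, and: (i) for every $\delta>0$ there exists $\nu_\delta>0$ such that for all $\theta\in\Theta$, $A_\theta(x)\ge \nu_\delta I$ for all $x\in\Sigma_\delta^C:=\{x:\operatorname{dist}(x,\Sigma)>\delta\}$; (ii) there exists $\mu_0>1$ such that, with $c$ the ergodic constant: (a) $H_\theta(x,\mu p)-\mu H_\theta(x,p)\ge (1-\mu)c$ for all $(x,p)\in\mathbb T^N\times\mathbb R^N$, $\theta\in\Theta$, $1<\mu<\mu_0$; (b) there exists a (possibly empty) compact set $K\subset\Sigma$ such that $H_\theta(x,p)\ge c$ for all $(x,p)\in K\times\mathbb R^N$, $\theta\in\Theta$, and for all $x\in\Sigma$ with $\operatorname{dist}(x,K)\ne0$, all $p\ne0$ and all $1<\mu\le\mu_0$, $\inf_{\theta\in\Theta}\{H_\theta(x,\mu p)-\mu H_\theta(x,p)\}>(1-\mu)c$. Then $u(\cdot,t)+ct\to u_\infty$ uniformly on $\mathbb T^N$ as $t\to+\infty$, where $u$ is the solution of (E) and $u_\infty$ is a viscosity solution of (S).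
   Context: Standing setting. $\mathbb T^N=\mathbb R^N/\mathbb Z^N$ is the flat torus, $\Theta$ is a metric space and $C>0$ is a fixed constant. For every $\theta\in\Theta$: $\sigma_\theta\in W^{1,\infty}(\mathbb T^N;\mathcal M_N)$ with $|\sigma_\theta|,|D\sigma_\theta|\le C$, and $A_\theta=\sigma_\theta\sigma_\theta^T$; $H_\theta\in W^{1,\infty}_{\rm loc}(\mathbb T^N\times\mathbb R^N)$ with $|H_\theta(x,0)|\le C$, and for every $R>0$ there is $C_R>0$ independent of $\theta$ with $|H_\theta(x,p)-H_\theta(y,q)|\le C_R(|x-y|+|p-q|)$ for $x,y\in\mathbb T^N$, $|p|,|q|\le R$. Consider (E) $u_t+\sup_{\theta\in\Theta}\{-\mathrm{tr}(A_\theta(x)D^2u)+H_\theta(x,Du)\}=0$ in $\mathbb T^N\times(0,\infty)$, $u(x,0)=u_0(x)$; (E$_\lambda$) $\lambda v_\lambda+\sup_{\theta}\{-\mathrm{tr}(A_\theta(x)D^2v_\lambda)+H_\theta(x,Dv_\lambda)\}=0$ in $\mathbb T^N$, $\lambda>0$; (S) $\sup_{\theta}\{-\mathrm{tr}(A_\theta(x)D^2v)+H_\theta(x,Dv)\}=c$ in $\mathbb T^N$. It is assumed that there exist viscosity solutions $u\in C(\mathbb T^N\times[0,\infty))$ of (E) and $v_\lambda\in C(\mathbb T^N)$ of (E$_\lambda$) for all $\lambda>0$ with $|u(x,t)-u(y,t)|,|v_\lambda(x)-v_\lambda(y)|\le C|x-y|$ for all $x,y,t,\lambda$. Under this assumption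 a comparison principle holds for (E) and (E$_\lambda$), there is a unique constant $c\in\mathbb R$ (the ergodic constant) for which (S) has a solution $v\in W^{1,\infty}(\mathbb T^N)$, and $u+ct$ is bounded. All solutions are viscosity solutions. $\Sigma:=\{x\in\mathbb T^N: A_\theta(x)=0\text{ for all }\theta\in\Theta\}$ (possibly empty). *)

(* Defs.v *)
From mathcomp Require Import ssreflect ssrfun ssrbool eqtype ssrnat seq fintype bigop.
From Stdlib Require Import Reals.
Open Scope R_scope.

(* Points of R^N (lifts of points of the torus T^N = R^N/Z^N), N x N matrices. *)
Definition vec (N : nat) := 'I_N -> R.
Definition mat (N : nat) := 'I_N -> 'I_N -> R.

Definition zerov {N} : vec N := fun _ => 0.
Definition vadd {N} (x y : vec N) : vec N := fun i => x i + y i.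
Definition vsub {N} (x y : vec N) : vec N := fun i => x i - y i.
Definition vscal {N} (a : R) (x : vec N) : vec N := fun i => a * x i.
Definition dot {N} (x y : vec N) : R := \big[Rplus/0]_(i < N) (x i * y i).
Definition vnorm {N} (x : vec N) : R := sqrt (dot x x).

Definition msub {N} (A B : mat N) : mat N := fun i j => A i j - B i j.
Definition mnorm {N} (A : mat N) : R :=
  sqrt (\big[Rplus/0]_(i < N) \big[Rplus/0]_(j < N) (A i j * A i j)).
Definition trprod {N} (A X : mat N) : R :=
  \big[Rplus/0]_(i < N) \big[Rplus/0]_(j < N) (A i j * X j i).
Definition quad {N} (X : mat N) (h : vec N) : R :=
  \big[Rplus/0]_(i < N) \big[Rplus/0]_(j < N) (h i * X i j * h j).
Definition symmetric {N} (X : mat N) : Prop := forall i j, X i j = X j i.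
Definition diffusion {N} (s : mat N) : mat N :=
  fun i j => \big[Rplus/0]_(k < N) (s i k * s j k).

(* Z^N-periodicity (functions on the torus are periodic functions on R^N) *)
Definition zshift {N} (x : vec N) (k : 'I_N -> Z) : vec N := fun i => x i + IZR (k i).
Definition periodic {N} {T : Type} (f : vec N -> T) : Prop :=
  forall x k, f (zshift x k) = f x.
Definition periodic_set {N} (K : vec N -> Prop) : Prop :=
  forall x k, K (zshift x k) <-> K x.
Definition closed_vset {N} (K : vec N -> Prop) : Prop :=
  forall x, (forall eps, 0 < eps -> exists y, K y /\ vnorm (vsub y x) < eps) -> K x.

Definition cont_par {N} (u : vec N -> R -> R) : Prop :=
  forall x t, 0 <= t -> forall eps, 0 < eps -> exists d, 0 < d /\
    forall y s, 0 <= s -> vnorm (vsub y x) < d -> Rabs (s - t) < d ->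
      Rabs (u y s - u x t) < eps.
Definition cont_ell {N} (v : vec N -> R) : Prop :=
  forall x eps, 0 < eps -> exists d, 0 < d /\
    forall y, vnorm (vsub y x) < d -> Rabs (v y - v x) < eps.

Definition par_superjet {N} (u : vec N -> R -> R) (x : vec N) (t a : R)
    (p : vec N) (X : mat N) : Prop :=
  forall eps, 0 < eps -> exists d, 0 < d /\
    forall y s, 0 < s -> vnorm (vsub y x) < d -> Rabs (s - t) < d ->
      u y s <= u x t + a * (s - t) + dot p (vsub y x) + / 2 * quad X (vsub y x)
               + eps * (Rabs (s - t) + vnorm (vsub y x) ^ 2).
Definition par_subjet {N} (u : vec N -> R -> R) (x : vec N) (t a : R)
    (p : vec N) (X : mat N) : Prop :=
  forall eps, 0 < eps -> exists d, 0 < d /\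
    forall y s, 0 < s -> vnorm (vsub y x) < d -> Rabs (s - t) < d ->
      u y s >= u x t + a * (s - t) + dot p (vsub y x) + / 2 * quad X (vsub y x)
               - eps * (Rabs (s - t) + vnorm (vsub y x) ^ 2).
Definition ell_superjet {N} (v : vec N -> R) (x p : vec N) (X : mat N) : Prop :=
  forall eps, 0 < eps -> exists d, 0 < d /\
    forall y, vnorm (vsub y x) < d ->
      v y <= v x + dot p (vsub y x) + / 2 * quad X (vsub y x) + eps * vnorm (vsub y x) ^ 2.
Definition ell_subjet {N} (v : vec N -> R) (x p : vec N) (X : mat N) : Prop :=
  forall eps, 0 < eps -> exists d, 0 < d /\
    forall y, vnorm (vsub y x) < d ->
      v y >= v x + dot p (vsub y x) + / 2 * quad X (vsub y x) - eps * vnorm (vsub y x) ^ 2.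

(* sup_{theta} f theta <= r  and  sup_{theta} f theta >= r (sup in [-oo,+oo]) *)
Definition sup_le {Th : Type} (f : Th -> R) (r : R) : Prop := forall th, f th <= r.
Definition sup_ge {Th : Type} (f : Th -> R) (r : R) : Prop :=
  forall eps, 0 < eps -> exists th, r - eps <= f th.

Definition Hop {N} {Th : Type} (sg : Th -> vec N -> mat N) (H : Th -> vec N -> vec N -> R)
    (x p : vec N) (X : mat N) (th : Th) : R :=
  - trprod (diffusion (sg th x)) X + H th x p.

Definition visc_E {N} {Th : Type} (sg : Th -> vec N -> mat N) (H : Th -> vec N -> vec N -> R)
    (u : vec N -> R -> R) : Prop :=
  cont_par u /\
  (forall x t a p X, 0 < t -> symmetric X -> par_superjet u x t a p X ->
      sup_le (Hop sg H x p X) (- a)) /\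
  (forall x t a p X, 0 < t -> symmetric X -> par_subjet u x t a p X ->
      sup_ge (Hop sg H x p X) (- a)).

Definition visc_Elam {N} {Th : Type} (sg : Th -> vec N -> mat N) (H : Th -> vec N -> vec N -> R)
    (lam : R) (v : vec N -> R) : Prop :=
  cont_ell v /\
  (forall x p X, symmetric X -> ell_superjet v x p X -> sup_le (Hop sg H x p X) (- (lam * v x))) /\
  (forall x p X, symmetric X -> ell_subjet v x p X -> sup_ge (Hop sg H x p X) (- (lam * v x))).

Definition visc_S {N} {Th : Type} (sg : Th -> vec N -> mat N) (H : Th -> vec N -> vec N -> R)
    (c : R) (v : vec N -> R) : Prop :=
  cont_ell v /\
  (forall x p X, symmetric X -> ell_superjet v x p X -> sup_le (Hop sg H x p X) c) /\
  (forall x p X, symmetric X -> ell_subjet v x p X -> sup_ge (Hop sg H x p X) c).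

Definition Sigma {N} {Th : Type} (sg : Th -> vec N -> mat N) (x : vec N) : Prop :=
  forall th i j, diffusion (sg th x) i j = 0.
(* x in Sigma_delta^C : dist(x, Sigma) > delta  (dist = +oo if Sigma empty) *)
Definition SigmaC {N} {Th : Type} (sg : Th -> vec N -> mat N) (delta : R) (x : vec N) : Prop :=
  exists eta, 0 < eta /\ forall y, Sigma sg y -> delta + eta <= vnorm (vsub x y).

(* Main.v *)
(** Replacing [u] by [u + c t] and [H] by [H - c] reduces the claim to [c = 0].

When [Sigma] is empty the equation is uniformly elliptic. With [v] a stationary solution,
comparison gives the limit [M] of [max (u - v)]; a Gaussian barrier started in a region where
[u - v < M] lifts through time and contradicts this limit, so [u - v] tends to [M] uniformly.

When [Sigma] is nonempty, consider for [mu > 1] and [eta > 0] the functional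
[u x t - mu u x s - mu eta (s - t)], [t <= s] (Barles-Souganidis). By (ii)(a) the rescaled
[mu u] is a supersolution. If the asymptotic supremum of the functional exceeded
[(mu - 1) max |u|], a Gaussian barrier centred on [Sigma] would push its near-maxima onto [Sigma].
There the diffusion is quadratically small, so doubling variables to first order yields a gradient
that contradicts (ii)(b), except on [K], where [u] is nonincreasing in time and hence converges.
Letting [mu -> 1] and [eta -> 0], [u] is asymptotically nondecreasing in time; its limits
over long time intervals are stationary solutions, and comparison turns one good time into uniform convergence.

The comparison arguments avoid the theorem on sums: sup-convolutions are smoothed by averaging over
boxes, and a viscosity inequality for a constant-coefficient operator survives averaging because
an average commutes with the random walks that approximate its semigroup. Doubling variables with
one smooth function then produces both jets explicitly. *)
From Coquelicot Require Import Coquelicot.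
Require Import Defs.
From HB Require Import structures.
From mathcomp Require Import ssreflect ssrfun ssrbool eqtype ssrnat seq fintype bigop.
From mathcomp Require boolp classical_sets filter.
From Stdlib Require Import Reals Lra Psatz FunctionalExtensionality Classical ClassicalEpsilon.
Import Defs.
Open Scope R_scope.
Set Implicit Arguments.
Unset Strict Implicit.
Unset Printing Implicit Defensive.

(** * Sums, vectors and matrices *)

(** Averaging creates second derivatives, but with variable coefficients an average does not inherit
    a viscosity inequality. Freezing the coefficients in a small ball leaves a matrix error
    proportional to its radius, and since Hessians of semiconvex functions are bounded below, a
    stretched diffusion with a few extra directions dominates that error. The Hessian is bounded
    above only where a paraboloid touches the average, so the regularized inequality is claimed at
    such points alone; the same paraboloid forces nearby gradients of the unaveraged function to be
    close to the touching one, which makes freezing the Hamiltonian legitimate.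

    The other obstacle is time: the suprema concerned are approached only as times go to infinity.
    Maximizing over time windows, with penalties that keep the maximizing times interior, leaves
    functions of space alone, so a single elliptic comparison statement serves the comparison and
    barrier arguments. In the degenerate case the excess over [(mu - 1) max |u|] separates the two
    times by a fixed amount, which gives their windows room. *)

HB.instance Definition _ := Monoid.isComLaw.Build R 0 Rplus
  (fun x y z => esym (Rplus_assoc x y z)) Rplus_comm Rplus_0_l.

Lemma Rabs_leD a b : Rabs a <= b -> - b <= a /\ a <= b.
Proof. by move=> H; have := Rle_abs a; have := Rle_abs (- a); rewrite Rabs_Ropp; lra. Qed.

Lemma Rle_mul1l a b : 1 <= a -> 0 <= b -> b <= a * b.
Proof. nra. Qed.

Ltac pos := by repeat first [assumption | lra | apply: Rmult_lt_0_compat | apply: Rmult_le_pos].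

Section Sums.
Context {I : Type}.
Implicit Types (r : seq I) (F G : I -> R).

Lemma sumD r F G : \big[Rplus/0]_(i <- r) (F i + G i) =
  \big[Rplus/0]_(i <- r) F i + \big[Rplus/0]_(i <- r) G i.
Proof. exact: big_split. Qed.

Lemma sumZ r a F : \big[Rplus/0]_(i <- r) (a * F i) = a * \big[Rplus/0]_(i <- r) F i.
Proof.
symmetry; apply: (big_morph (fun z => a * z)) => [x y|]; [exact: Rmult_plus_distr_l|exact: Rmult_0_r].
Qed.

Lemma sumB r F G : \big[Rplus/0]_(i <- r) (F i - G i) =
  \big[Rplus/0]_(i <- r) F i - \big[Rplus/0]_(i <- r) G i.
Proof.
rewrite (eq_bigr (fun i => F i + (-1) * G i)); last by move=> i _; ring.
by rewrite sumD sumZ; ring.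
Qed.

Lemma sum_le r F G : (forall i, F i <= G i) ->
  \big[Rplus/0]_(i <- r) F i <= \big[Rplus/0]_(i <- r) G i.
Proof.
move=> le_FG; elim/big_ind2: _ => // [|a b c d H1 H2]; lra.
Qed.

Lemma sum_ge0 r F : (forall i, 0 <= F i) -> 0 <= \big[Rplus/0]_(i <- r) F i.
Proof. move=> F_ge0; elim/big_ind: _ => // [|a b H1 H2]; lra. Qed.

Lemma sum_const r a : \big[Rplus/0]_(i <- r) a = INR (size r) * a.
Proof.
elim: r => [|i r IH]; first by rewrite big_nil /=; ring.
by rewrite big_cons IH; change (size (i :: r)) with (S (size r)); rewrite S_INR; ring.
Qed.

Lemma Rabs_sum r F : Rabs (\big[Rplus/0]_(i <- r) F i) <= \big[Rplus/0]_(i <- r) Rabs (F i).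
Proof.
elim/big_ind2: _ => [|a b c d H1 H2|i _]; [by rewrite Rabs_R0; lra| |lra].
by apply: Rle_trans (Rabs_triang _ _) _; lra.
Qed.
End Sums.

Section Vectors.
Context {N : nat}.
Implicit Types (x y z h : vec N) (X : mat N).

Definition ei (i : 'I_N) : vec N := fun j => if j == i then 1 else 0.
Definition mulv X h : vec N := fun i => \big[Rplus/0]_(j < N) (X i j * h j).
Definition col (s : mat N) (k : 'I_N) : vec N := fun i => s i k.

Lemma dotC x y : dot x y = dot y x.
Proof. by apply: eq_bigr => i _; ring. Qed.
Lemma dotDl x y z : dot (vadd x y) z = dot x z + dot y z.
Proof. by rewrite /dot -sumD; apply: eq_bigr => i _; rewrite /vadd; ring. Qed.
Lemma dotDr x y z : dot z (vadd x y) = dot z x + dot z y.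
Proof. by rewrite dotC dotDl !(dotC z). Qed.
Lemma dotBl x y z : dot (vsub x y) z = dot x z - dot y z.
Proof. by rewrite /dot -sumB; apply: eq_bigr => i _; rewrite /vsub; ring. Qed.
Lemma dotBr x y z : dot z (vsub x y) = dot z x - dot z y.
Proof. by rewrite dotC dotBl !(dotC z). Qed.
Lemma dotZl a x z : dot (vscal a x) z = a * dot x z.
Proof. by rewrite /dot -sumZ; apply: eq_bigr => i _; rewrite /vscal; ring. Qed.
Lemma dotZr a x z : dot z (vscal a x) = a * dot z x.
Proof. by rewrite dotC dotZl dotC. Qed.
Lemma dot0l z : dot zerov z = 0.
Proof. by rewrite /dot big1 // => i _; rewrite /zerov; ring. Qed.
Lemma dot0r z : dot z zerov = 0.
Proof. by rewrite dotC dot0l. Qed.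
Lemma dot_ge0 x : 0 <= dot x x.
Proof. apply: sum_ge0 => i; nra. Qed.

Definition dotE := (dotDl, dotDr, dotBl, dotBr, dotZl, dotZr, @dot0l, @dot0r).

Lemma vnorm_ge0 x : 0 <= vnorm x.
Proof. exact: sqrt_pos. Qed.
Lemma vnorm_sq x : vnorm x ^ 2 = dot x x.
Proof. by rewrite /vnorm pow2_sqrt //; exact: dot_ge0. Qed.
Lemma vnorm_mul x : vnorm x * vnorm x = dot x x.
Proof. by rewrite -vnorm_sq; ring. Qed.

Lemma vnorm_le x a : 0 <= a -> dot x x <= a * a -> vnorm x <= a.
Proof. move=> a0 H; apply: Rsqr_incr_0_var => //; rewrite /Rsqr vnorm_mul; lra. Qed.

Lemma dot_CS x y : dot x y <= vnorm x * vnorm y.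
Proof.
have [y0|y0] := Req_dec (dot y y) 0.
  have : dot x y = 0.
    case: (Req_dec (dot x y) 0) => // xy0.
    have /(_ ((dot x x + 1) / (2 * dot x y))) : forall t, 0 <= dot x x - 2 * t * dot x y.
      move=> t; have := dot_ge0 (vsub x (vscal t y)); rewrite !dotE y0 (dotC y x); lra.
    have -> : 2 * ((dot x x + 1) / (2 * dot x y)) * dot x y = dot x x + 1 by field.
    lra.
  move=> ->; apply: Rmult_le_pos; exact: vnorm_ge0.
have yp : 0 < dot y y by have := dot_ge0 y; lra.
have H : dot x y * dot x y <= dot x x * dot y y.
  have := dot_ge0 (vsub (vscal (dot y y) x) (vscal (dot x y) y)).
  rewrite !dotE (dotC y x) => H; nra.
apply: Rsqr_incr_0_var; last by apply: Rmult_le_pos; exact: vnorm_ge0.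
by rewrite /Rsqr; have := vnorm_mul x; have := vnorm_mul y; nra.
Qed.

Lemma dot_CS_abs x y : Rabs (dot x y) <= vnorm x * vnorm y.
Proof.
apply: Rabs_le; split; last exact: dot_CS.
have := dot_CS (vscal (-1) x) y; rewrite dotZl.
have -> : vnorm (vscal (-1) x) = vnorm x by rewrite /vnorm !dotE; congr sqrt; ring.
lra.
Qed.

Lemma vnorm_add x y : vnorm (vadd x y) <= vnorm x + vnorm y.
Proof.
apply: vnorm_le; first by have := vnorm_ge0 x; have := vnorm_ge0 y; lra.
rewrite !dotE (dotC y x); have := dot_CS x y; have := vnorm_mul x; have := vnorm_mul y; nra.
Qed.

Lemma vnormZ a x : vnorm (vscal a x) = Rabs a * vnorm x.
Proof.
rewrite /vnorm !dotE -sqrt_Rsqr_abs -sqrt_mult; [congr sqrt; rewrite /Rsqr; ring| |exact: dot_ge0].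
exact: Rle_0_sqr.
Qed.
Lemma vnorm0 : vnorm (zerov : vec N) = 0.
Proof. by rewrite /vnorm dot0l sqrt_0. Qed.
Lemma vnorm_subC x y : vnorm (vsub x y) = vnorm (vsub y x).
Proof. rewrite /vnorm !dotE; congr sqrt; ring. Qed.
Lemma vnorm_sub x y : vnorm (vsub x y) <= vnorm x + vnorm y.
Proof.
have := vnorm_add x (vscal (-1) y); rewrite vnormZ Rabs_Ropp Rabs_R1.
have -> : vadd x (vscal (-1) y) = vsub x y by apply: functional_extensionality => i; rewrite /vadd /vscal /vsub; ring.
lra.
Qed.
Lemma vnorm_tri z x y : vnorm (vsub x y) <= vnorm (vsub x z) + vnorm (vsub z y).
Proof.
have := vnorm_add (vsub x z) (vsub z y).
by have -> : vadd (vsub x z) (vsub z y) = vsub x y by apply: functional_extensionality => i; rewrite /vadd /vsub; ring.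
Qed.
Lemma coord_sq x i : x i * x i <= dot x x.
Proof.
have -> : dot x x = x i * x i + \big[Rplus/0]_(j < N | j != i) (x j * x j) by rewrite /dot (bigD1 i).
have : 0 <= \big[Rplus/0]_(j < N | j != i) (x j * x j).
  elim/big_ind: _ => [|a b|j _]; [lra|lra|nra].
lra.
Qed.
Lemma vnorm_eq0 x : vnorm x = 0 -> x = zerov.
Proof.
move=> x0; apply: functional_extensionality => i; rewrite /zerov.
have x20 : dot x x = 0 by rewrite -vnorm_sq x0; ring.
apply: Rsqr_0_uniq; rewrite /Rsqr; have := coord_sq x i; nra.
Qed.
Lemma coord_le x i : Rabs (x i) <= vnorm x.
Proof.
apply: Rsqr_incr_0_var; last exact: vnorm_ge0.
have := coord_sq x i; have := Rsqr_abs (x i); rewrite /Rsqr vnorm_mul; lra.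
Qed.

Lemma quadE X h : quad X h = dot h (mulv X h).
Proof. by apply: eq_bigr => i _; rewrite /mulv -sumZ; apply: eq_bigr => j _; ring. Qed.
Lemma mulvD X x y : mulv X (vadd x y) = vadd (mulv X x) (mulv X y).
Proof. by apply: functional_extensionality => i; rewrite /mulv /vadd -sumD; apply: eq_bigr => j _; ring. Qed.
Lemma mulvB X x y : mulv X (vsub x y) = vsub (mulv X x) (mulv X y).
Proof. by apply: functional_extensionality => i; rewrite /mulv /vsub -sumB; apply: eq_bigr => j _; ring. Qed.
Lemma mulvZ X a x : mulv X (vscal a x) = vscal a (mulv X x).
Proof. by apply: functional_extensionality => i; rewrite /mulv /vscal -sumZ; apply: eq_bigr => j _; ring. Qed.
Lemma mulv_sym X x y : symmetric X -> dot x (mulv X y) = dot (mulv X x) y.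
Proof.
move=> sX; rewrite /dot /mulv.
transitivity (\big[Rplus/0]_(i < N) \big[Rplus/0]_(j < N) (x i * (X i j * y j))).
  by apply: eq_bigr => i _; rewrite sumZ.
rewrite exchange_big; apply: eq_bigr => j _ /=.
rewrite Rmult_comm -sumZ; apply: eq_bigr => i _; rewrite (sX j i); ring.
Qed.
Lemma quadZ X a h : quad X (vscal a h) = a * a * quad X h.
Proof. by rewrite !quadE mulvZ !dotE; ring. Qed.
Lemma quad0 X : quad X zerov = 0.
Proof. by rewrite quadE dot0l. Qed.
Lemma quad_matD X Y h : quad (fun i j => X i j + Y i j) h = quad X h + quad Y h.
Proof. by rewrite /quad -sumD; apply: eq_bigr => i _; rewrite -sumD; apply: eq_bigr => j _; ring. Qed.
Lemma quad_matZ a X h : quad (fun i j => a * X i j) h = a * quad X h.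
Proof. by rewrite /quad -sumZ; apply: eq_bigr => i _; rewrite -sumZ; apply: eq_bigr => j _; ring. Qed.
Lemma quad_matB X Y h : quad (fun i j => X i j - Y i j) h = quad X h - quad Y h.
Proof. by rewrite /quad -sumB; apply: eq_bigr => i _; rewrite -sumB; apply: eq_bigr => j _; ring. Qed.

Definition idm : mat N := fun i j => if j == i then 1 else 0.
Lemma mulv_idm h : mulv idm h = h.
Proof.
apply: functional_extensionality => i; rewrite /mulv /idm (bigD1 i) //= eqxx big1; first exact: etrans (Rplus_0_r _) (Rmult_1_l _).
by move=> j /negbTE ->; ring.
Qed.
Lemma quad_idm h : quad idm h = dot h h.
Proof. by rewrite quadE mulv_idm. Qed.
Lemma idm_sym : symmetric idm.
Proof. by move=> i j; rewrite /idm eq_sym. Qed.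

(** Every diffusion is a sum of pure second derivatives along the columns of [s]. This is the form
    that a random walk with finitely many directions can imitate. *)
Lemma trprod_diffusion (s X : mat N) :
  trprod (diffusion s) X = \big[Rplus/0]_(k < N) quad X (col s k).
Proof.
rewrite /trprod /diffusion /quad /col.
transitivity (\big[Rplus/0]_(i < N) \big[Rplus/0]_(j < N) \big[Rplus/0]_(k < N) (s j k * X j i * s i k)).
  apply: eq_bigr => i _; apply: eq_bigr => j _.
  by rewrite Rmult_comm -sumZ; apply: eq_bigr => k _; ring.
rewrite exchange_big /=.
transitivity (\big[Rplus/0]_(i < N) \big[Rplus/0]_(k < N) \big[Rplus/0]_(j < N) (s i k * X i j * s j k)).
  by apply: eq_bigr => i _; rewrite exchange_big.
by rewrite exchange_big.
Qed.

Lemma mnorm_sq (s : mat N) : mnorm s ^ 2 = \big[Rplus/0]_(k < N) dot (col s k) (col s k).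
Proof.
rewrite /mnorm pow2_sqrt; first by rewrite exchange_big.
by apply: sum_ge0 => i; apply: sum_ge0 => j; nra.
Qed.

Lemma quad_diffusion (s : mat N) h :
  quad (diffusion s) h = \big[Rplus/0]_(k < N) (dot (col s k) h * dot (col s k) h).
Proof.
rewrite /quad /diffusion /dot /col.
transitivity (\big[Rplus/0]_(i < N) \big[Rplus/0]_(j < N) \big[Rplus/0]_(k < N) ((s i k * h i) * (s j k * h j))).
  apply: eq_bigr => i _; apply: eq_bigr => j _.
  transitivity ((h i * h j) * \big[Rplus/0]_(k < N) (s i k * s j k)); first ring.
  by rewrite -sumZ; apply: eq_bigr => k _; ring.
transitivity (\big[Rplus/0]_(i < N) \big[Rplus/0]_(k < N) ((s i k * h i) * \big[Rplus/0]_(j < N) (s j k * h j))).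
  by apply: eq_bigr => i _; rewrite exchange_big; apply: eq_bigr => k _; rewrite sumZ.
rewrite exchange_big; apply: eq_bigr => k _ /=.
by rewrite -sumZ; apply: eq_bigr => i _; ring.
Qed.

Definition Lip (L : R) (f : vec N -> R) := forall x y, Rabs (f x - f y) <= L * vnorm (vsub x y).

End Vectors.

Ltac vring := apply: functional_extensionality => ?; rewrite /vadd /vsub /vscal /zerov; try ring; try field.

(** * Limits along an ultrafilter *)

Lemma ultrafilter_exists : exists U : (nat -> Prop) -> Prop,
  [/\ forall P Q : nat -> Prop, U P -> U Q -> U (fun n => P n /\ Q n),
      forall P Q : nat -> Prop, (forall n, P n -> Q n) -> U P -> U Q,
      forall P : nat -> Prop, U P \/ U (fun n => ~ P n),
      ~ U (fun _ => False) &
      forall n0 : nat, U (fun n => is_true (leq n0 n))].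
Proof.
have [U [ultraU subU]] := filter.ultraFilterLemma (T := nat) (F := filter.eventually) _.
exists U; split.
- by move=> P Q; apply: filter.filterI.
- by move=> P Q; apply: filter.filterS.
- by move=> P; apply: (filter.in_ultra_setVsetC P ultraU).
- exact: filter.filter_not_empty.
- by move=> n0; apply: subU; exists n0.
Qed.

(* A free ultrafilter: [om P] reads "[P n] for almost every [n]". Limits along it never require passing to subsequences. *)
Definition om : (nat -> Prop) -> Prop :=
  proj1_sig (constructive_indefinite_description _ ultrafilter_exists).

Lemma om_spec : [/\ forall P Q : nat -> Prop, om P -> om Q -> om (fun n => P n /\ Q n),
      forall P Q : nat -> Prop, (forall n, P n -> Q n) -> om P -> om Q,
      forall P : nat -> Prop, om P \/ om (fun n => ~ P n),
      ~ om (fun _ => False) &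
      forall n0 : nat, om (fun n => is_true (leq n0 n))].
Proof. by rewrite /om; case: constructive_indefinite_description. Qed.

Lemma omI P Q : om P -> om Q -> om (fun n => P n /\ Q n).
Proof. by case: om_spec => H *; apply: H. Qed.
Lemma omS (P Q : nat -> Prop) : (forall n, P n -> Q n) -> om P -> om Q.
Proof. by case: om_spec => _ H *; apply: H; eassumption. Qed.
Lemma omC P : om P \/ om (fun n => ~ P n).
Proof. by case: om_spec => _ _ H *; apply: H. Qed.
Lemma om_ex (P : nat -> Prop) : om P -> exists n, P n.
Proof.
move=> oP; apply: NNPP => nP; case: om_spec => _ _ _ + _; apply.
by apply: omS oP => n Pn; apply: nP; exists n.
Qed.
Lemma om_ge n0 : om (fun n => is_true (leq n0 n)).
Proof. by case: om_spec => _ _ _ _; apply. Qed.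
Lemma om_all (P : nat -> Prop) : (forall n, P n) -> om P.
Proof. by move=> H; apply: omS (om_ge 0). Qed.

Lemma INR_le_nat m n : leq m n -> INR m <= INR n.
Proof. by move=> /leP; apply: le_INR. Qed.
Lemma archi_inv eps : 0 < eps -> exists n : nat, / (INR n + 1) < eps.
Proof.
move=> e0; have [n Hn] := INR_archimed 1 (/ eps) Rlt_0_1.
exists n; apply: (Rmult_lt_reg_l (INR n + 1)); first by have := pos_INR n; lra.
rewrite Rinv_r; last by have := pos_INR n; lra.
have /(Rmult_lt_compat_r eps _ _ e0) : / eps < INR n + 1 by lra.
by rewrite Rinv_l; lra.
Qed.
Lemma om_inv eps : 0 < eps -> om (fun n => / (INR n + 1) < eps).
Proof.
move=> /archi_inv [n0 H]; apply: omS (om_ge n0) => n /INR_le_nat Hn.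
apply: Rle_lt_trans H; apply: Rinv_le_contravar; have := pos_INR n0; lra.
Qed.
Lemma om_INR a : om (fun n => a <= INR n).
Proof.
have [n0 H] := INR_archimed 1 a Rlt_0_1.
by apply: omS (om_ge n0) => n /INR_le_nat; lra.
Qed.

Definition ulim (a : nat -> R) (l : R) := forall eps, 0 < eps -> om (fun n => Rabs (a n - l) < eps).

(** The limit is the supremum of the levels that [a] reaches for almost every index. *)
Lemma ulim_ex a B : (forall n, Rabs (a n) <= B) -> exists l, ulim a l.
Proof.
move=> aB.
have [||l [ub lb]] := completeness (fun r => om (fun n => r <= a n)).
- exists B => r /om_ex [n]; have := Rle_abs (a n); have := aB n; lra.
- exists (- B); apply: om_all => n; have := aB n; rewrite /Rabs; case: Rcase_abs; lra.
exists l => eps e0.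
have H1 : om (fun n => a n < l + eps / 2).
  case: (omC (fun n => l + eps / 2 <= a n)) => [/ub|]; first lra.
  by apply: omS => n; lra.
have H2 : om (fun n => l - eps / 2 <= a n).
  apply: NNPP => nH; have : l <= l - eps / 2; last lra.
  apply: lb => r Hr; apply: Rnot_lt_le => lr; apply: nH.
  by apply: omS Hr => n; lra.
apply: omS (omI H1 H2) => n [h1 h2]; apply: Rabs_def1; lra.
Qed.

Lemma ulim_le a b l m : om (fun n => a n <= b n) -> ulim a l -> ulim b m -> l <= m.
Proof.
move=> ab al bm; apply: Rnot_lt_le => ml.
have e0 : 0 < (l - m) / 2 by lra.
have [n [h [/Rabs_def2 h1 /Rabs_def2 h2]]] := om_ex (omI ab (omI (al _ e0) (bm _ e0))).
lra.
Qed.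
Lemma ulim_const c : ulim (fun _ => c) c.
Proof. by move=> eps e0; apply: om_all => _; rewrite Rminus_diag Rabs_R0. Qed.
Lemma ulim_le_const a l m : om (fun n => a n <= m) -> ulim a l -> l <= m.
Proof. by move=> H al; apply: (ulim_le H al (ulim_const m)). Qed.
Lemma ulim_ge_const a l m : om (fun n => m <= a n) -> ulim a l -> m <= l.
Proof. by move=> H al; apply: (ulim_le H (ulim_const m) al). Qed.
Lemma ulimD a b l m : ulim a l -> ulim b m -> ulim (fun n => a n + b n) (l + m).
Proof.
move=> al bm eps e0; have e2 : 0 < eps / 2 by lra.
apply: omS (omI (al _ e2) (bm _ e2)) => n [/Rabs_def2 h1 /Rabs_def2 h2]; apply: Rabs_def1; lra.
Qed.
Lemma ulimZ c a l : ulim a l -> ulim (fun n => c * a n) (c * l).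
Proof.
move=> al eps e0; have := Rabs_pos c => c0.
apply: omS (al (eps / (Rabs c + 1)) _); last by apply: Rdiv_lt_0_compat; lra.
move=> n h; rewrite -Rmult_minus_distr_l Rabs_mult.
have h2 : eps / (Rabs c + 1) * (Rabs c + 1) = eps by field; lra.
have := Rabs_pos (a n - l); nra.
Qed.

Definition vulim {N} (x : nat -> vec N) (y : vec N) :=
  forall eps, 0 < eps -> om (fun n => vnorm (vsub (x n) y) < eps).

Lemma om_forall_fin (I : finType) (P : I -> nat -> Prop) :
  (forall i, om (P i)) -> om (fun n => forall i, P i n).
Proof.
move=> H; have : om (fun n => forall i, i \in enum I -> P i n).
  elim: (enum I) => [|j s IH]; first by apply: om_all.
  apply: omS (omI (H j) IH) => n [h1 h2] i; rewrite inE => /orP [/eqP ->//|]; exact: h2.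
by apply: omS => n h i; apply: h; rewrite mem_enum.
Qed.

Lemma vnorm_coord_bound {N} (x : vec N) a : (forall i, Rabs (x i) <= a) -> vnorm x <= INR N * a.
Proof.
case: N x => [|n] x H.
  by apply: vnorm_le; rewrite /dot ?big_ord0 /=; lra.
have a0 : 0 <= a by apply: Rle_trans (H ord0); exact: Rabs_pos.
have n1 : 1 <= INR n.+1 by rewrite S_INR; have := pos_INR n; lra.
apply: vnorm_le; first by apply: Rmult_le_pos; lra.
apply: (Rle_trans _ (\big[Rplus/0]_(i < n.+1) (a * a))).
  by apply: sum_le => i; have := Rsqr_abs (x i); rewrite /Rsqr => ->; have := Rabs_pos (x i); have := H i; nra.
rewrite sum_const /index_enum -enumT size_enum_ord; nra.
Qed.

Lemma vulim_ex {N} (x : nat -> vec N) B : (forall n, vnorm (x n) <= B) -> exists y, vulim x y.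
Proof.
move=> xB.
have /choice [y Hy] : forall i : 'I_N, exists l, ulim (fun n => x n i) l.
  by move=> i; apply: (@ulim_ex _ B) => n; apply: Rle_trans (coord_le _ _) (xB n).
exists y => eps e0.
have N0 := pos_INR N.
have e1 : 0 < eps / (INR N + 1) by apply: Rdiv_lt_0_compat; lra.
apply: omS (om_forall_fin (fun i => Hy i _ e1)) => n h.
apply: Rle_lt_trans (vnorm_coord_bound (a := eps / (INR N + 1)) _) _.
  by move=> i; apply: Rlt_le; exact: h.
apply: (Rmult_lt_reg_r (INR N + 1)); first lra.
field_simplify; [nra|lra].
Qed.

(** Compactness and continuity enter together: only the values of [f] along a sequence need a limit
    attained in [K], so [T] carries no topology. *)
Lemma max_attained (T : Type) (K : T -> Prop) (f : T -> R) :
  (exists x, K x) ->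
  (forall xs : nat -> T, (forall n, K (xs n)) -> exists x, K x /\ ulim (fun n => f (xs n)) (f x)) ->
  exists x, K x /\ forall y, K y -> f y <= f x.
Proof.
move=> [x0 Kx0] comp.
have [B HB] : exists B, forall y, K y -> f y <= B.
  apply: NNPP => nB.
  have /choice [xs Hxs] : forall n : nat, exists y, K y /\ INR n <= f y.
    move=> n; apply: NNPP => nH; apply: nB; exists (INR n) => y Ky.
    by apply: Rnot_lt_le => lt; apply: nH; exists y; split => //; lra.
  have [x [Kx lx]] := comp xs (fun n => proj1 (Hxs n)).
  have [n [h1 /Rabs_def2 h2]] := om_ex (omI (om_INR (f x + 1)) (lx 1 Rlt_0_1)).
  have := proj2 (Hxs n); lra.
have [||l [ub lb]] := completeness (fun r => exists y, K y /\ f y = r).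
- by exists B => r [y [Ky <-]]; exact: HB.
- by exists (f x0), x0.
have /choice [xs Hxs] : forall n : nat, exists y, K y /\ l - / (INR n + 1) <= f y.
  move=> n; apply: NNPP => nH.
  have n0 : 0 < / (INR n + 1) by apply: Rinv_0_lt_compat; have := pos_INR n; lra.
  have : l <= l - / (INR n + 1); last lra.
  apply: lb => r [y [Ky <-]]; apply: Rnot_lt_le => lt; apply: nH; exists y; split => //; lra.
have [x [Kx lx]] := comp xs (fun n => proj1 (Hxs n)).
exists x; split => // y Ky.
apply: (Rle_trans _ l); first by apply: ub; exists y.
apply: Rnot_lt_le => lt; have e0 : 0 < (l - f x) / 2 by lra.
have [n [h1 /Rabs_def2 h2]] := om_ex (omI (om_inv e0) (lx _ e0)).
have := proj2 (Hxs n); lra.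
Qed.

(** * Averaging operators *)

Section Averages.
Context {N : nat}.
Implicit Types (f g : vec N -> R) (x y z h : vec N).

(* A class of locally Lipschitz functions with quadratic growth that is stable under box averages. *)
Definition QL f := exists L, 0 <= L /\ forall x y,
  Rabs (f x - f y) <= L * (1 + vnorm x + vnorm y) * vnorm (vsub x y).

Lemma Lip_QL L f : 0 <= L -> Lip L f -> QL f.
Proof.
move=> L0 Lf; exists L; split => // x y; apply: Rle_trans (Lf x y) _.
have := vnorm_ge0 x; have := vnorm_ge0 y; have := vnorm_ge0 (vsub x y) => h1 h2 h3.
apply: Rmult_le_compat_r => //; nra.
Qed.
Lemma QL_const c : QL (fun _ => c).
Proof. by apply: (@Lip_QL 0); [lra|move=> x y; rewrite Rminus_diag Rabs_R0; lra]. Qed.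
Lemma QL_lin a b f g : QL f -> QL g -> QL (fun x => a * f x + b * g x).
Proof.
move=> [L [L0 Lf]] [M [M0 Mg]].
have a0 := Rabs_pos a; have b0 := Rabs_pos b.
exists (Rabs a * L + Rabs b * M); split; first nra.
move=> x y.
have -> : a * f x + b * g x - (a * f y + b * g y) = a * (f x - f y) + b * (g x - g y) by ring.
apply: Rle_trans (Rabs_triang _ _) _; rewrite !Rabs_mult.
have := Lf x y; have := Mg x y; nra.
Qed.
Lemma QL_add f g : QL f -> QL g -> QL (fun x => f x + g x).
Proof.
move=> Qf Qg; have := QL_lin 1 1 Qf Qg.
by congr QL; apply: functional_extensionality => x; ring.
Qed.
Lemma QL_scal a f : QL f -> QL (fun x => a * f x).
Proof.
move=> Qf; have := QL_lin a 0 Qf Qf.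
by congr QL; apply: functional_extensionality => x; ring.
Qed.
Lemma QL_sum I (r : seq I) (F : I -> vec N -> R) :
  (forall i, QL (F i)) -> QL (fun x => \big[Rplus/0]_(i <- r) F i x).
Proof.
move=> QF; elim: r => [|i r IH].
  by have := QL_const 0; congr QL; apply: functional_extensionality => x; rewrite big_nil.
by have := QL_add (QF i) IH; congr QL; apply: functional_extensionality => x; rewrite big_cons.
Qed.
Lemma QL_trans a f : QL f -> QL (fun x => f (vadd x a)).
Proof.
move=> [L [L0 Lf]]; have a0 := vnorm_ge0 a.
exists (L * (1 + 2 * vnorm a)); split; first nra.
move=> x y; apply: Rle_trans (Lf _ _) _.
have -> : vsub (vadd x a) (vadd y a) = vsub x y by vring.
apply: Rmult_le_compat_r; first exact: vnorm_ge0.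
have := vnorm_add x a; have := vnorm_add y a; have := vnorm_ge0 x; have := vnorm_ge0 y.
move=> h1 h2 h3 h4; rewrite Rmult_assoc; apply: Rmult_le_compat_l => //; nra.
Qed.
Lemma QL_affine p b x0 : QL (fun x => b + dot p (vsub x x0)).
Proof.
apply: QL_add; first exact: QL_const.
apply: (@Lip_QL (vnorm p)); first exact: vnorm_ge0.
move=> x y; rewrite -dotBr.
have -> : vsub (vsub x x0) (vsub y x0) = vsub x y by vring.
exact: dot_CS_abs.
Qed.
Lemma QL_sqdist x0 : QL (fun x => dot (vsub x x0) (vsub x x0)).
Proof.
have v0 := vnorm_ge0 x0.
exists (1 + 2 * vnorm x0); split; first lra.
move=> x y.
have -> : dot (vsub x x0) (vsub x x0) - dot (vsub y x0) (vsub y x0) =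
  dot (vadd (vsub x x0) (vsub y x0)) (vsub x y).
  by rewrite !dotE (dotC x y) (dotC x x0) (dotC y x0); ring.
apply: Rle_trans (dot_CS_abs _ _) _.
apply: Rmult_le_compat_r; first exact: vnorm_ge0.
have := vnorm_add (vsub x x0) (vsub y x0); have := vnorm_sub x x0; have := vnorm_sub y x0.
have := vnorm_ge0 x; have := vnorm_ge0 y; nra.
Qed.

Lemma QL_line_continuous f x h s : QL f -> continuous (fun t => f (vadd x (vscal t h))) s.
Proof.
move=> [L [L0 Lf]]; apply (proj1 (continuity_pt_filterlim (fun t => f (vadd x (vscal t h))) s)) => eps e0.
have x0 := vnorm_ge0 x; have h0 := vnorm_ge0 h; have s0 := Rabs_pos s.
set K := L * (1 + 2 * vnorm x + 2 * (Rabs s + 1) * vnorm h) * vnorm h + 1.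
have K0 : 0 < K.
  rewrite /K; suff : 0 <= L * (1 + 2 * vnorm x + 2 * (Rabs s + 1) * vnorm h) * vnorm h by lra.
  by apply: Rmult_le_pos => //; apply: Rmult_le_pos => //; nra.
exists (Rmin 1 (eps / K)); split.
  by apply: Rmin_glb_lt; [lra|exact: Rdiv_lt_0_compat].
move=> t [_]; rewrite /dist /= /R_dist => ht.
have ht1 := Rlt_le_trans _ _ _ ht (Rmin_l _ _).
have ht2 := Rlt_le_trans _ _ _ ht (Rmin_r _ _).
apply: Rle_lt_trans (Lf _ _) _.
have -> : vsub (vadd x (vscal t h)) (vadd x (vscal s h)) = vscal (t - s) h by vring.
rewrite vnormZ.
have b1 : vnorm (vadd x (vscal t h)) <= vnorm x + (Rabs s + 1) * vnorm h.
  apply: Rle_trans (vnorm_add _ _) _; rewrite vnormZ.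
  have : Rabs t <= Rabs s + 1 by have := Rabs_triang_inv t s; lra.
  nra.
have b2 : vnorm (vadd x (vscal s h)) <= vnorm x + (Rabs s + 1) * vnorm h.
  apply: Rle_trans (vnorm_add _ _) _; rewrite vnormZ; nra.
apply: (Rle_lt_trans _ (K * Rabs (t - s))).
  have ts := Rabs_pos (t - s).
  have : L * (1 + vnorm (vadd x (vscal t h)) + vnorm (vadd x (vscal s h))) <=
    L * (1 + 2 * vnorm x + 2 * (Rabs s + 1) * vnorm h) by apply: Rmult_le_compat_l => //; lra.
  move=> HH; have := Rmult_le_compat_r (Rabs (t - s) * vnorm h) _ _ (Rmult_le_pos _ _ ts h0) HH.
  rewrite /K; nra.
have : eps / K * K = eps by field; lra.
nra.
Qed.

Lemma QL_ex_RInt f x h a b : QL f -> ex_RInt (fun t => f (vadd x (vscal t h))) a b.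
Proof. by move=> Qf; apply: ex_RInt_continuous => z _; exact: QL_line_continuous. Qed.

(** Linearity and monotonicity are demanded on [QL] only, where the integrals of box averages exist.
    Translation invariance is what carries Lipschitz bounds, semiconvexity and Taylor expansions
    from [f] to [A f]. *)
Record averaging (A : (vec N -> R) -> vec N -> R) : Prop := {
  avg_QL : forall f, QL f -> QL (A f);
  avg_lin : forall a b f g x, QL f -> QL g ->
    A (fun y => a * f y + b * g y) x = a * A f x + b * A g x;
  avg_le : forall f g x, QL f -> QL g -> (forall y, f y <= g y) -> A f x <= A g x;
  avg_const : forall c x, A (fun _ => c) x = c;
  avg_trans : forall f a x, A (fun y => f (vadd y a)) x = A f (vadd x a) }.

Lemma averaging_id : averaging (fun f => f).
Proof. by split. Qed.

Lemma averaging_comp A B : averaging A -> averaging B -> averaging (fun f => A (B f)).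
Proof.
move=> aA aB; split.
- by move=> f Qf; apply: (avg_QL aA); exact: (avg_QL aB).
- move=> a b f g x Qf Qg.
  have -> : B (fun y => a * f y + b * g y) = (fun y => a * B f y + b * B g y).
    by apply: functional_extensionality => y; exact: (avg_lin aB).
  by apply: (avg_lin aA); exact: (avg_QL aB).
- move=> f g x Qf Qg fg; apply: (avg_le aA) => [||y]; try exact: (avg_QL aB).
  exact: (avg_le aB).
- move=> c x; have -> : B (fun _ => c) = (fun _ => c).
    by apply: functional_extensionality => y; exact: (avg_const aB).
  exact: (avg_const aA).
- move=> f a x; have -> : B (fun y => f (vadd y a)) = (fun y => B f (vadd y a)).
    by apply: functional_extensionality => y; exact: (avg_trans aB).
  exact: (avg_trans aA).
Qed.

Lemma averaging_iter A j : averaging A -> averaging (fun f => iter j A f).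
Proof.
move=> aA; elim: j => [|j IH]; first exact: averaging_id.
exact: averaging_comp aA IH.
Qed.

Section AveragingTheory.
Variables (A : (vec N -> R) -> vec N -> R) (aA : averaging A).

Lemma avg_add f g x : QL f -> QL g -> A (fun y => f y + g y) x = A f x + A g x.
Proof.
move=> Qf Qg; have := avg_lin aA 1 1 x Qf Qg.
have -> : (fun y => 1 * f y + 1 * g y) = (fun y => f y + g y).
  by apply: functional_extensionality => y; ring.
lra.
Qed.
Lemma avg_scal a f x : QL f -> A (fun y => a * f y) x = a * A f x.
Proof.
move=> Qf; have := avg_lin aA a 0 x Qf Qf.
have -> : (fun y => a * f y + 0 * f y) = (fun y => a * f y).
  by apply: functional_extensionality => y; ring.
lra.
Qed.
Lemma avg_addc f c x : QL f -> A (fun y => f y + c) x = A f x + c.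
Proof. by move=> Qf; rewrite avg_add ?avg_const //; exact: QL_const. Qed.
Lemma avg_sum I (r : seq I) (F : I -> vec N -> R) x : (forall i, QL (F i)) ->
  A (fun y => \big[Rplus/0]_(i <- r) F i y) x = \big[Rplus/0]_(i <- r) A (F i) x.
Proof.
move=> QF; elim: r => [|i r IH].
  rewrite big_nil; have -> : (fun y => \big[Rplus/0]_(i <- [::]) F i y) = (fun _ => 0).
    by apply: functional_extensionality => y; rewrite big_nil.
  exact: avg_const.
rewrite big_cons -IH -avg_add //; last exact: QL_sum.
by congr (A _ x); apply: functional_extensionality => y; rewrite big_cons.
Qed.
Lemma avg_abs f g x : QL f -> QL g -> (forall y, Rabs (f y) <= g y) -> Rabs (A f x) <= A g x.
Proof.
move=> Qf Qg fg; apply: Rabs_le; split.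
  have <- : A (fun y => (-1) * g y) x = - A g x by rewrite avg_scal //; ring.
  apply: (avg_le aA) => // [|y]; first exact: QL_scal.
  by have [] := Rabs_leD (fg y); lra.
apply: (avg_le aA) => // y; exact: Rle_trans (Rle_abs _) (fg y).
Qed.
Lemma avg_abs_const f c x : QL f -> (forall y, Rabs (f y) <= c) -> Rabs (A f x) <= c.
Proof.
move=> Qf fc; rewrite -[c](avg_const aA c x); apply: avg_abs => //; exact: QL_const.
Qed.
Lemma avg_Lip L f : 0 <= L -> Lip L f -> Lip L (A f).
Proof.
move=> L0 Lf x y; have Qf := Lip_QL L0 Lf.
have -> : A f x - A f y = A (fun z => f (vadd z (vsub x y)) + (-1) * f z) y.
  rewrite avg_add; [|exact: QL_trans|exact: QL_scal].
  rewrite (avg_trans aA) avg_scal //.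
  have -> : vadd y (vsub x y) = x by vring.
  ring.
apply: avg_abs_const; first by apply: QL_add; [exact: QL_trans|exact: QL_scal].
move=> z; have -> : f (vadd z (vsub x y)) + -1 * f z = f (vadd z (vsub x y)) - f z by ring.
apply: Rle_trans (Lf _ _) _.
have -> : vsub (vadd z (vsub x y)) z = vsub x y by vring.
lra.
Qed.

(** Midpoint convexity of [f + (k/2) |x|^2], in the difference form that averages preserve. *)
Definition semiconvex (k : R) f := forall x h,
  2 * f x <= f (vadd x h) + f (vsub x h) + k * dot h h.

Lemma avg_semiconvex k f : QL f -> semiconvex k f -> semiconvex k (A f).
Proof.
move=> Qf sf x h.
have E : vsub x h = vadd x (vscal (-1) h) by vring.
have Q1 : QL (fun y => f (vadd y h)) by exact: QL_trans.
have Q2 : QL (fun y => f (vadd y (vscal (-1) h))) by exact: QL_trans.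
rewrite E -!(avg_trans aA) -avg_add // -avg_scal // -avg_addc; last exact: QL_add.
apply: (avg_le aA); [exact: QL_scal|by apply: QL_add; [exact: QL_add|exact: QL_const]|].
move=> y; have := sf y h.
by have -> : vsub y h = vadd y (vscal (-1) h) by vring.
Qed.

(* [C1L] and [C2L]: Taylor expansions whose remainders are controlled uniformly in the base point. *)
Definition C1L c f (D : 'I_N -> vec N -> R) :=
  (forall i, Lip c (D i)) /\
  (forall x h, Rabs (f (vadd x h) - f x - \big[Rplus/0]_(i < N) (D i x * h i)) <= c * dot h h).

Definition C2L c f (D : 'I_N -> vec N -> R) (D2 : 'I_N -> 'I_N -> vec N -> R) :=
  [/\ forall i, QL (D i), forall i j, Lip c (D2 i j), forall i j, D2 i j = D2 j i &
  forall x h, Rabs (f (vadd x h) - f x - \big[Rplus/0]_(i < N) (D i x * h i)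
     - / 2 * quad (fun i j => D2 i j x) h) <= c * vnorm h ^ 3].

(** Since [A] is linear and commutes with translations, the Taylor remainder of [A f] is the average
    of the Taylor remainder of [f], and a bound uniform in the base point survives. *)
Lemma avg_C1L c f D : 0 <= c -> QL f -> C1L c f D -> C1L c (A f) (fun i => A (D i)).
Proof.
move=> c0 Qf [LD ED]; split => [i|x h]; first exact: avg_Lip.
have QD i : QL (D i) by exact: Lip_QL (LD i).
have Q0 : QL (fun y => f (vadd y h)) by exact: QL_trans.
have Q1 : QL (fun y => \big[Rplus/0]_(i < N) (h i * D i y)) by apply: QL_sum => i; exact: QL_scal.
have Q2 : QL (fun y => f (vadd y h) + (-1) * f y) by apply: QL_add => //; exact: QL_scal.
have -> : A f (vadd x h) - A f x - \big[Rplus/0]_(i < N) (A (D i) x * h i) =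
  A (fun y => (f (vadd y h) + (-1) * f y) + (-1) * \big[Rplus/0]_(i < N) (h i * D i y)) x.
  rewrite avg_add //; last exact: QL_scal.
  rewrite avg_add //; last exact: QL_scal.
  rewrite (avg_trans aA) !avg_scal // avg_sum; last by move=> i; exact: QL_scal.
  have -> : \big[Rplus/0]_(i < N) A (fun y => h i * D i y) x = \big[Rplus/0]_(i < N) (A (D i) x * h i).
    by apply: eq_bigr => i _; rewrite avg_scal //; ring.
  ring.
apply: avg_abs_const; first by apply: QL_add => //; exact: QL_scal.
move=> y; have := ED y h.
have -> : \big[Rplus/0]_(i < N) (D i y * h i) = \big[Rplus/0]_(i < N) (h i * D i y).
  by apply: eq_bigr => i _; ring.
by congr (Rabs _ <= _); ring.
Qed.

Lemma avg_C2L c f D D2 : 0 <= c -> QL f -> C2L c f D D2 ->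
  C2L c (A f) (fun i => A (D i)) (fun i j => A (D2 i j)).
Proof.
move=> c0 Qf [QD LD sD ED]; split => [i|i j|i j|x h].
- exact: (avg_QL aA).
- exact: avg_Lip.
- by rewrite sD.
have QD2 i j : QL (D2 i j) by exact: Lip_QL (LD i j).
have Q0 : QL (fun y => f (vadd y h)) by exact: QL_trans.
have Q1 : QL (fun y => \big[Rplus/0]_(i < N) (h i * D i y)) by apply: QL_sum => i; exact: QL_scal.
have Q2 : QL (fun y => f (vadd y h) + (-1) * f y) by apply: QL_add => //; exact: QL_scal.
have Q30 i : QL (fun y => \big[Rplus/0]_(j < N) ((h i * h j) * D2 i j y)).
  by apply: QL_sum => j; exact: QL_scal.
have Q3 : QL (fun y => \big[Rplus/0]_(i < N) \big[Rplus/0]_(j < N) ((h i * h j) * D2 i j y)) by exact: QL_sum.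
have Q4 : QL (fun y => (f (vadd y h) + (-1) * f y) + (-1) * \big[Rplus/0]_(i < N) (h i * D i y)).
  by apply: QL_add => //; exact: QL_scal.
have -> : A f (vadd x h) - A f x - \big[Rplus/0]_(i < N) (A (D i) x * h i)
   - / 2 * quad (fun i j => A (D2 i j) x) h =
  A (fun y => ((f (vadd y h) + (-1) * f y) + (-1) * \big[Rplus/0]_(i < N) (h i * D i y)) +
   (- / 2) * \big[Rplus/0]_(i < N) \big[Rplus/0]_(j < N) ((h i * h j) * D2 i j y)) x.
  rewrite avg_add //; last exact: QL_scal.
  rewrite avg_add //; last exact: QL_scal.
  rewrite avg_add //; last exact: QL_scal.
  rewrite (avg_trans aA) !avg_scal // !avg_sum //; last by move=> i; exact: QL_scal.
  have -> : \big[Rplus/0]_(i < N) A (fun y => h i * D i y) x = \big[Rplus/0]_(i < N) (A (D i) x * h i).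
    by apply: eq_bigr => i _; rewrite avg_scal //; ring.
  rewrite /quad; have -> : \big[Rplus/0]_(i < N) A (fun y => \big[Rplus/0]_(j < N) ((h i * h j) * D2 i j y)) x =
    \big[Rplus/0]_(i < N) \big[Rplus/0]_(j < N) (h i * A (D2 i j) x * h j).
    apply: eq_bigr => i _; rewrite avg_sum; last by move=> j; exact: QL_scal.
    by apply: eq_bigr => j _; rewrite avg_scal //; ring.
  ring.
apply: avg_abs_const; first by apply: QL_add => //; exact: QL_scal.
move=> y; have := ED y h.
have -> : \big[Rplus/0]_(i < N) (D i y * h i) = \big[Rplus/0]_(i < N) (h i * D i y).
  by apply: eq_bigr => i _; ring.
have -> : quad (fun i j => D2 i j y) h = \big[Rplus/0]_(i < N) \big[Rplus/0]_(j < N) ((h i * h j) * D2 i j y).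
  by apply: eq_bigr => i _; apply: eq_bigr => j _; ring.
by congr (Rabs _ <= _); ring.
Qed.
End AveragingTheory.
End Averages.

(** * Averages over segments and boxes *)

Section BoxAverage.
Context {N : nat}.
Implicit Types (f g : vec N -> R) (x y z h : vec N) (i : 'I_N).

Lemma dot_eil i h : dot (ei i) h = h i.
Proof.
rewrite /dot /ei (bigD1 i) //= eqxx big1; first exact: etrans (Rplus_0_r _) (Rmult_1_l _).
by move=> j /negbTE ->; ring.
Qed.
Lemma dot_ei i : dot (ei i) (ei i) = 1 :> R.
Proof. by rewrite dot_eil /ei eqxx. Qed.
Lemma vnorm_ei i : vnorm (ei i : vec N) = 1.
Proof. by rewrite /vnorm dot_ei sqrt_1. Qed.

Definition box i d f x := / (2 * d) * RInt (fun s => f (vadd x (vscal s (ei i)))) (- d) d.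

Lemma averaging_box i d : 0 < d -> averaging (box i d).
Proof.
move=> d0; have d20 : 0 < / (2 * d) by apply: Rinv_0_lt_compat; lra.
have lin a b f g x : QL f -> QL g ->
    box i d (fun y => a * f y + b * g y) x = a * box i d f x + b * box i d g x.
  move=> Qf Qg; rewrite /box.
  have e1 := QL_ex_RInt x (ei i) (- d) d Qf; have e2 := QL_ex_RInt x (ei i) (- d) d Qg.
  rewrite (RInt_plus (fun s => a * f (vadd x (vscal s (ei i)))) (fun s => b * g (vadd x (vscal s (ei i)))));
    try exact: ex_RInt_scal.
  rewrite (RInt_scal (fun s => f (vadd x (vscal s (ei i))))) //.
  rewrite (RInt_scal (fun s => g (vadd x (vscal s (ei i))))) //.
  rewrite /plus /scal /= /mult /=; ring.
have cst c x : box i d (fun _ => c) x = c.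
  rewrite /box RInt_const /scal /= /mult /=; field; lra.
have le f g x : QL f -> QL g -> (forall s, Rabs s <= d -> f (vadd x (vscal s (ei i))) <= g (vadd x (vscal s (ei i)))) ->
    box i d f x <= box i d g x.
  move=> Qf Qg fg; rewrite /box; apply: Rmult_le_compat_l; first lra.
  apply: RInt_le; [lra|exact: QL_ex_RInt|exact: QL_ex_RInt|].
  by move=> s [s1 s2]; apply: fg; apply: Rabs_le; lra.
have tr f a x : box i d (fun y => f (vadd y a)) x = box i d f (vadd x a).
  rewrite /box; congr (_ * _); apply: RInt_ext => s _; congr f; vring.
split=> // [f|f g x Qf Qg fg]; last by apply: le => // s _.
move=> Qf; have [L [L0 Lf]] := Qf.
exists (L * (1 + 2 * d)); split; first nra.
move=> x y.
have Q1 : QL (fun z => f (vadd z (vsub x y))) by exact: QL_trans.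
have -> : box i d f x - box i d f y = 1 * box i d (fun z => f (vadd z (vsub x y))) y + (-1) * box i d f y.
  rewrite tr; have -> : vadd y (vsub x y) = x by vring.
  ring.
rewrite -lin //.
have Q2 : QL (fun z => 1 * f (vadd z (vsub x y)) + (-1) * f z) by exact: QL_lin.
set M := _ * vnorm (vsub x y).
have bnd s : Rabs s <= d -> Rabs (1 * f (vadd (vadd y (vscal s (ei i))) (vsub x y)) + -1 * f (vadd y (vscal s (ei i)))) <= M.
  move=> sd; have := Lf (vadd (vadd y (vscal s (ei i))) (vsub x y)) (vadd y (vscal s (ei i))).
  have -> : vsub (vadd (vadd y (vscal s (ei i))) (vsub x y)) (vadd y (vscal s (ei i))) = vsub x y by vring.
  have -> : vadd (vadd y (vscal s (ei i))) (vsub x y) = vadd x (vscal s (ei i)) by vring.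
  have -> : 1 * f (vadd x (vscal s (ei i))) + -1 * f (vadd y (vscal s (ei i))) =
    f (vadd x (vscal s (ei i))) - f (vadd y (vscal s (ei i))) by ring.
  move=> H; apply: Rle_trans H _; rewrite /M; apply: Rmult_le_compat_r; first exact: vnorm_ge0.
  have := vnorm_add x (vscal s (ei i)); have := vnorm_add y (vscal s (ei i)).
  rewrite vnormZ vnorm_ei => h1 h2; rewrite Rmult_assoc; apply: Rmult_le_compat_l => //.
  have := vnorm_ge0 x; have := vnorm_ge0 y; nra.
apply: Rabs_le; split.
  rewrite -(cst (- M) y); apply: le => // [|s /bnd /Rabs_leD []//]; exact: QL_const.
by rewrite -[X in _ <= X](cst M y); apply: le => // [|s /bnd /Rabs_leD []//]; exact: QL_const.
Qed.

Lemma box_opp i d f x : 0 < d -> QL f ->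
  box i d f x = / (2 * d) * RInt (fun s => f (vsub x (vscal s (ei i)))) (- d) d.
Proof.
move=> d0 Qf; rewrite /box; congr (_ * _).
have := RInt_comp_lin (fun s => f (vadd x (vscal s (ei i)))) (-1) 0 (- d) d.
have -> : -1 * - d + 0 = d by ring.
have -> : -1 * d + 0 = - d by ring.
move=> H; have e1 := QL_ex_RInt x (ei i) d (- d) Qf.
have {}H := H e1.
rewrite -(opp_RInt_swap _ _ _ e1) -H.
have -> : (fun r : R => scal (-1) (f (vadd x (vscal (-1 * r + 0) (ei i))))) = (fun r : R => scal (-1) (f (vsub x (vscal r (ei i))))).
  apply: functional_extensionality => s; congr (scal (-1) (f _)); vring.
rewrite RInt_scal; first by rewrite /opp /scal /= /mult /=; ring.
have := QL_ex_RInt x (vscal (-1) (ei i)) (- d) d Qf.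
apply: ex_RInt_ext => s _; congr f; vring.
Qed.

Lemma box_sym i d f x : 0 < d -> QL f ->
  2 * box i d f x = / (2 * d) * RInt (fun s => f (vadd x (vscal s (ei i))) + f (vsub x (vscal s (ei i)))) (- d) d.
Proof.
move=> d0 Qf; rewrite RInt_plus; first last.
- have := QL_ex_RInt x (vscal (-1) (ei i)) (- d) d Qf.
  apply: ex_RInt_ext => s _; congr f; vring.
- exact: QL_ex_RInt.
have -> : 2 * box i d f x = box i d f x + box i d f x by ring.
rewrite {2}box_opp // /box /plus /=; ring.
Qed.

Lemma box_ge i d k f x : 0 < d -> 0 <= k -> QL f -> semiconvex k f -> f x - k * d * d / 2 <= box i d f x.
Proof.
move=> d0 k0 Qf sf; suff : 2 * f x - k * d * d <= 2 * box i d f x by lra.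
rewrite box_sym //.
have d20 : 0 < / (2 * d) by apply: Rinv_0_lt_compat; lra.
have -> : 2 * f x - k * d * d = / (2 * d) * RInt (fun _ => 2 * f x - k * d * d) (- d) d.
  rewrite RInt_const /scal /= /mult /=; field; lra.
apply: Rmult_le_compat_l; first lra.
apply: RInt_le; first lra.
- exact: ex_RInt_const.
- apply: (@ex_RInt_plus R_NormedModule); first exact: QL_ex_RInt.
  have := QL_ex_RInt x (vscal (-1) (ei i)) (- d) d Qf.
  apply: ex_RInt_ext => s _; congr f; vring.
move=> s [s1 s2]; have := sf x (vscal s (ei i)); rewrite !dotE dot_ei.
have : s * s <= d * d by nra.
nra.
Qed.

(** Moving [x] by [t] along the segment exchanges an interval of length [t] at one end for one at
    the other. The derivative is therefore a difference quotient of [f], Lipschitz with a constant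
    of order [L / d]. *)
Lemma box_C1 i d L f x t : 0 < d -> 0 <= L -> Lip L f ->
  Rabs (box i d f (vadd x (vscal t (ei i))) - box i d f x
    - t * (/ (2 * d) * (f (vadd x (vscal d (ei i))) - f (vadd x (vscal (- d) (ei i)))))) <= L / d * (t * t).
Proof.
move=> d0 L0 Lf; have Qf := Lip_QL L0 Lf.
set G := fun s => f (vadd x (vscal s (ei i))).
have exG a b : ex_RInt G a b by exact: QL_ex_RInt.
have LG a b : Rabs (G a - G b) <= L * Rabs (a - b).
  apply: Rle_trans (Lf _ _) _.
  have -> : vsub (vadd x (vscal a (ei i))) (vadd x (vscal b (ei i))) = vscal (a - b) (ei i) by vring.
  rewrite vnormZ vnorm_ei; lra.
have loc a : Rabs (RInt G a (a + t) - t * G a) <= L * (t * t).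
  have -> : t * G a = RInt (fun _ => G a) a (a + t) by rewrite RInt_const /scal /= /mult /=; ring.
  have -> : RInt G a (a + t) - RInt (fun _ => G a) a (a + t) = RInt (fun s => G s - G a) a (a + t).
    by rewrite RInt_minus //; exact: ex_RInt_const.
  have exD u v : ex_RInt (fun s => G s - G a) u v by apply: (@ex_RInt_minus R_NormedModule) => //; exact: ex_RInt_const.
  case: (Rle_dec 0 t) => [t0|/Rnot_le_lt t0].
    have := abs_RInt_le_const (fun s => G s - G a) a (a + t) (L * t).
    have -> : (a + t - a) * (L * t) = L * (t * t) by ring.
    apply; [lra|by []|move=> s hs]; apply: Rle_trans (LG _ _) _.
    by apply: Rmult_le_compat_l => //; apply: Rabs_le; lra.
  rewrite -(opp_RInt_swap _ _ _ (exD _ _)) /opp /= Rabs_Ropp.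
  have := abs_RInt_le_const (fun s => G s - G a) (a + t) a (L * (- t)).
  have -> : (a - (a + t)) * (L * (- t)) = L * (t * t) by ring.
  apply; [lra|by []|move=> s hs]; apply: Rle_trans (LG _ _) _.
  by apply: Rmult_le_compat_l => //; apply: Rabs_le; lra.
have E : box i d f (vadd x (vscal t (ei i))) = / (2 * d) * RInt G (t - d) (t + d).
  rewrite /box; congr (_ * _).
  have := RInt_comp_lin G 1 t (- d) d.
  have -> : 1 * - d + t = t - d by ring.
  have -> : 1 * d + t = t + d by ring.
  move=> <- //; apply: RInt_ext => s _; rewrite scal_one /G.
  congr f; vring.
have E2 : RInt G (t - d) (t + d) - RInt G (- d) d = RInt G d (d + t) - RInt G (- d) (- d + t).
  have := RInt_Chasles G (- d) (- d + t) (d + t) (exG _ _) (exG _ _).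
  have := RInt_Chasles G (- d) d (d + t) (exG _ _) (exG _ _).
  rewrite /plus /= => <-.
  have -> : t - d = - d + t by ring.
  have -> : t + d = d + t by ring.
  lra.
have -> : box i d f (vadd x (vscal t (ei i))) - box i d f x - t * (/ (2 * d) * (f (vadd x (vscal d (ei i))) - f (vadd x (vscal (- d) (ei i))))) =
  / (2 * d) * ((RInt G d (d + t) - t * G d) - (RInt G (- d) (- d + t) - t * G (- d))).
  rewrite E /box -/G; have -> : RInt G (t - d) (t + d) = RInt G (- d) d + (RInt G d (d + t) - RInt G (- d) (- d + t)) by lra.
  rewrite /G; ring.
have d20 : 0 < / (2 * d) by apply: Rinv_0_lt_compat; lra.
rewrite Rabs_mult (Rabs_pos_eq (/ _)); last lra.
have -> : L / d * (t * t) = / (2 * d) * (2 * (L * (t * t))) by field; lra.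
apply: Rmult_le_compat_l; first lra.
apply: Rle_trans (Rabs_triang _ _) _; rewrite Rabs_Ropp; have := loc d; have := loc (- d); lra.
Qed.

Definition boxes d (l : seq 'I_N) f := foldr (fun i g => box i d g) f l.

Lemma averaging_boxes d l : 0 < d -> averaging (boxes d l).
Proof.
move=> d0; elim: l => [|i l IH]; first exact: averaging_id.
exact: (averaging_comp (averaging_box i d0) IH).
Qed.

Lemma boxes_ge d l k f x : 0 < d -> 0 <= k -> QL f -> semiconvex k f ->
  f x - INR (size l) * (k * d * d / 2) <= boxes d l f x.
Proof.
move=> d0 k0 Qf sf; elim: l x => [|i l IH] x; first by rewrite /=; lra.
change (size (i :: l)) with (S (size l)); rewrite S_INR [boxes _ _ _ _]/=.
have aB := averaging_box i d0.
have := box_ge i x d0 k0 Qf sf => H1.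
set c := INR (size l) * (k * d * d / 2) in IH *.
have H2 : box i d (fun y => f y + (- c)) x <= box i d (boxes d l f) x.
  apply: (avg_le aB) => [||y]; [by apply: QL_add => //; exact: QL_const| |by have := IH y; lra].
  by apply: (avg_QL (averaging_boxes l d0)).
rewrite avg_addc // in H2; rewrite /c in H2 *; rewrite Rmult_plus_distr_r; lra.
Qed.

(** Averaging in one direction buys differentiability in that direction only, hence increments
    supported in [l] and an induction that adds one direction at a time; the derivatives already
    found are merely averaged again. *)
Lemma boxes_C1 d l L f : 0 < d -> 0 <= L -> Lip L f -> uniq l ->
  exists c, 0 <= c /\ exists D : 'I_N -> vec N -> R, (forall i, Lip c (D i)) /\
  forall x h, (forall j, j \notin l -> h j = 0) ->
   Rabs (boxes d l f (vadd x h) - boxes d l f x - \big[Rplus/0]_(i <- l) (D i x * h i)) <= c * dot h h.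
Proof.
move=> d0 L0 Lf; elim: l => [|i l IH] ul.
  exists 0; split; first lra; exists (fun _ _ => 0); split=> [j x y|x h h0].
    by rewrite Rminus_diag Rabs_R0; lra.
  have -> : h = zerov by apply: functional_extensionality => j; exact: h0.
  have -> : vadd x zerov = x by vring.
  by rewrite big_nil dot0l !Rminus_diag Rabs_R0; lra.
move: ul => /= /andP [il /IH [c [c0 [D [LD ED]]]]].
have aB := averaging_box i d0; have al := averaging_boxes l d0.
have Lg := avg_Lip al L0 Lf; set g := boxes d l f in Lg ED *.
have Qg : QL g by exact: Lip_QL Lg.
set D' := fun j => if j == i then (fun y => / (2 * d) * (g (vadd y (vscal d (ei i))) - g (vadd y (vscal (- d) (ei i))))) else box i d (D j).
have LDi : Lip (L / d) (fun y => / (2 * d) * (g (vadd y (vscal d (ei i))) - g (vadd y (vscal (- d) (ei i))))).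
  move=> y z; rewrite -Rmult_minus_distr_l Rabs_mult Rabs_pos_eq; last by apply: Rlt_le; apply: Rinv_0_lt_compat; lra.
  have -> : L / d * vnorm (vsub y z) = / (2 * d) * (2 * L * vnorm (vsub y z)) by field; lra.
  apply: Rmult_le_compat_l; first by apply: Rlt_le; apply: Rinv_0_lt_compat; lra.
  have h1 := Lg (vadd y (vscal d (ei i))) (vadd z (vscal d (ei i))).
  have h2 := Lg (vadd y (vscal (- d) (ei i))) (vadd z (vscal (- d) (ei i))).
  have E1 : vsub (vadd y (vscal d (ei i))) (vadd z (vscal d (ei i))) = vsub y z by vring.
  have E2 : vsub (vadd y (vscal (- d) (ei i))) (vadd z (vscal (- d) (ei i))) = vsub y z by vring.
  rewrite E1 in h1; rewrite E2 in h2.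
  move: h1 h2 => /Rabs_leD h1 /Rabs_leD h2; apply: Rabs_le; lra.
have Ld0 : 0 <= L / d by apply: Rmult_le_pos => //; apply: Rlt_le; exact: Rinv_0_lt_compat.
exists (c + 3 * (L / d)); split; first lra.
exists D'; split.
  move=> j y z; rewrite /D'; case: eqP => _.
    by apply: Rle_trans (LDi y z) _; apply: Rmult_le_compat_r; [exact: vnorm_ge0|lra].
  by apply: Rle_trans (avg_Lip aB c0 (LD j) y z) _; apply: Rmult_le_compat_r; [exact: vnorm_ge0|lra].
move=> x h h0 /=; rewrite big_cons -/g.
set h' : vec N := fun j => if j == i then 0 else h j.
set t := h i.
have hE : h = vadd h' (vscal t (ei i)).
  apply: functional_extensionality => j; rewrite /vadd /vscal /h' /ei /t; case: eqP => [->|_]; ring.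
have h'0 j : j \notin l -> h' j = 0.
  rewrite /h'; case: eqP => // /eqP ji jl; apply: h0; by rewrite inE negb_or ji.
have dotE' : dot h h = dot h' h' + t * t.
  have h'i : dot h' (ei i) = 0 by rewrite dotC dot_eil /h' eqxx.
  by rewrite {1 2}hE !dotE (dotC (ei i) h') h'i dot_ei; ring.
have sumE : \big[Rplus/0]_(j <- l) (D' j x * h j) = \big[Rplus/0]_(j <- l) (h' j * box i d (D j) x).
  apply: eq_big_seq => j jl; rewrite /D' /h'; case: eqP => [E|_]; last ring.
  by move: il; rewrite -E jl.
rewrite sumE.
have Qh' : QL (fun y => g (vadd y h')) by exact: QL_trans.
have QD j : QL (D j) by exact: Lip_QL (LD j).
have QS : QL (fun y => \big[Rplus/0]_(j <- l) (h' j * D j y)) by apply: QL_sum => j; exact: QL_scal.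
have Qm : QL (fun y => g (vadd y h') + (-1) * g y) by apply: QL_add => //; exact: QL_scal.
have S2 : Rabs (box i d g (vadd x h') - box i d g x - \big[Rplus/0]_(j <- l) (h' j * box i d (D j) x)) <= c * dot h' h'.
  have -> : box i d g (vadd x h') - box i d g x - \big[Rplus/0]_(j <- l) (h' j * box i d (D j) x) =
    box i d (fun y => (g (vadd y h') + (-1) * g y) + (-1) * \big[Rplus/0]_(j <- l) (h' j * D j y)) x.
    rewrite (avg_add aB) //; last exact: QL_scal.
    rewrite (avg_add aB) //; last exact: QL_scal.
    rewrite (avg_trans aB) !(avg_scal aB) // (avg_sum aB); last by move=> j; exact: QL_scal.
    have -> : \big[Rplus/0]_(j <- l) box i d (fun y => h' j * D j y) x = \big[Rplus/0]_(j <- l) (h' j * box i d (D j) x).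
      by apply: eq_bigr => j _; rewrite (avg_scal aB).
    ring.
  apply: (avg_abs_const aB); first by apply: QL_add => //; exact: QL_scal.
  move=> y; have := ED y h' h'0.
  have -> : \big[Rplus/0]_(j <- l) (D j y * h' j) = \big[Rplus/0]_(j <- l) (h' j * D j y) by apply: eq_bigr => j _; ring.
  by congr (Rabs _ <= _); ring.
have S1 := box_C1 i (vadd x h') t d0 L0 Lg.
have S3 := LDi (vadd x h') x.
have Ev : vsub (vadd x h') x = h' by vring.
rewrite Ev in S3.
have D'i : D' i x = / (2 * d) * (g (vadd x (vscal d (ei i))) - g (vadd x (vscal (- d) (ei i)))) by rewrite /D' eqxx.
rewrite D'i.
set E1 := / (2 * d) * (g (vadd (vadd x h') _) - _) in S1 S3.
set E0 := / (2 * d) * (g (vadd x _) - _) in S3 *.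
rewrite {1}hE.
have -> : vadd x (vadd h' (vscal t (ei i))) = vadd (vadd x h') (vscal t (ei i)) by vring.
set B1 := box i d g _ in S1 *; set B2 := box i d g (vadd x h') in S1 S2 *.
set S := \big[Rplus/0]_(j <- l) _ in S2 *.
(* The increment is split into a move along the new direction starting at [x + h'] and a move along
   the old ones starting at [x]; the last term corrects the base point of the new derivative. *)
have -> : B1 - box i d g x - (E0 * t + S) = (B1 - B2 - t * E1) + (B2 - box i d g x - S) + t * (E1 - E0) by ring.
apply: Rle_trans (Rabs_triang _ _) _; apply: Rle_trans (Rplus_le_compat_r _ _ _ (Rabs_triang _ _)) _.
have S4 : Rabs (t * (E1 - E0)) <= L / d * (dot h' h' + t * t).
  rewrite Rabs_mult; apply: (Rle_trans _ (Rabs t * (L / d * vnorm h'))).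
    by apply: Rmult_le_compat_l => //; exact: Rabs_pos.
  have := vnorm_mul h'; have : Rabs t * Rabs t = t * t by rewrite -Rabs_mult Rabs_pos_eq; nra.
  move=> <- <-; set a := Rabs t; set b := vnorm h'.
  have -> : a * (L / d * b) = L / d * (a * b) by ring.
  apply: Rmult_le_compat_l => //; have := Rle_0_sqr (a - b); rewrite /Rsqr; nra.
rewrite dotE'; have := dot_ge0 h'; nra.
Qed.

Definition mollify d f := boxes d (enum 'I_N) f.

Lemma averaging_mollify d : 0 < d -> averaging (mollify d).
Proof. exact: averaging_boxes. Qed.

Lemma mollify_ge d k f x : 0 < d -> 0 <= k -> QL f -> semiconvex k f ->
  f x - INR N * (k * d * d / 2) <= mollify d f x.
Proof. by move=> d0 k0 Qf /(boxes_ge (enum 'I_N) x d0 k0 Qf); rewrite size_enum_ord. Qed.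

Lemma mollify_le d k f x : 0 < d -> 0 <= k -> QL f -> semiconvex k (fun y => - f y) ->
  mollify d f x <= f x + INR N * (k * d * d / 2).
Proof.
move=> d0 k0 Qf sf; have Qf' : QL (fun y => (-1) * f y) by exact: QL_scal.
have := @mollify_ge d k (fun y => (-1) * f y) x d0 k0 Qf'.
rewrite (avg_scal (averaging_mollify d0)) // => H.
suff : -1 * f x - INR N * (k * d * d / 2) <= -1 * mollify d f x by lra.
by apply: H => y h; have := sf y h; lra.
Qed.

Lemma mollify_C1 d L f : 0 < d -> 0 <= L -> Lip L f ->
  exists c, 0 <= c /\ exists D, C1L c (mollify d f) D.
Proof.
move=> d0 L0 Lf; have [c [c0 [D [LD ED]]]] := boxes_C1 d0 L0 Lf (enum_uniq 'I_N).
exists c; split => //; exists D; split => // x h.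
have := ED x h; rewrite big_enum /mollify; apply => j; by rewrite mem_enum.
Qed.

(** A mean value inequality without derivatives: over [n] equal steps the quadratic errors add up to
    [c / n]. *)
Lemma small_increments (phi : R -> R) B c :
  (forall s t, 0 <= s <= 1 -> 0 <= t -> s + t <= 1 -> Rabs (phi (s + t) - phi s) <= B * t + c * (t * t)) ->
  Rabs (phi 1 - phi 0) <= B.
Proof.
move=> H.
have step n k : (k <= n.+1)%coq_nat -> Rabs (phi (INR k / INR n.+1) - phi 0) <= INR k * (B / INR n.+1 + c * (/ INR n.+1 * / INR n.+1)).
  have n0 : 0 < INR n.+1 by apply: lt_0_INR; lia.
  have i0 : 0 < / INR n.+1 by exact: Rinv_0_lt_compat.
  have i1 : / INR n.+1 * INR n.+1 = 1 by field; lra.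
  elim: k => [|k IH] kn.
    rewrite /= /Rdiv !Rmult_0_l Rminus_diag Rabs_R0; lra.
  have -> : phi (INR k.+1 / INR n.+1) - phi 0 = (phi (INR k / INR n.+1 + / INR n.+1) - phi (INR k / INR n.+1)) + (phi (INR k / INR n.+1) - phi 0).
    have -> : INR k.+1 / INR n.+1 = INR k / INR n.+1 + / INR n.+1 by rewrite (S_INR k); field; lra.
    ring.
  apply: Rle_trans (Rabs_triang _ _) _.
  have kn' : INR k + 1 <= INR n.+1 by rewrite -(S_INR k); apply: le_INR.
  have k0 := pos_INR k.
  have q0 : 0 <= INR k / INR n.+1 by apply: Rmult_le_pos; lra.
  have q1 : INR k / INR n.+1 + / INR n.+1 <= 1.
    have -> : INR k / INR n.+1 + / INR n.+1 = / INR n.+1 * (INR k + 1) by field; lra.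
    rewrite -i1; apply: Rmult_le_compat_l; lra.
  have h1 := H (INR k / INR n.+1) (/ INR n.+1).
  have q2 : 0 <= INR k / INR n.+1 <= 1 by lra.
  have {}h1 := h1 q2 (Rlt_le _ _ i0) q1.
  have h2 := IH ltac:(lia).
  rewrite (S_INR k) /Rdiv in h1 h2 *; lra.
apply: Rnot_lt_le => lt.
have [n Hn] := archi_inv (eps := (Rabs (phi 1 - phi 0) - B) / (Rabs c + 1)) ltac:(apply: Rdiv_lt_0_compat; [lra|have := Rabs_pos c; lra]).
have := step n n.+1 (le_n _); rewrite S_INR.
have n0 := pos_INR n.
have -> : (INR n + 1) / (INR n + 1) = 1 by field; lra.
have -> : (INR n + 1) * (B / (INR n + 1) + c * (/ (INR n + 1) * / (INR n + 1))) = B + c * / (INR n + 1) by field; lra.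
have i0 : 0 < / (INR n + 1) by apply: Rinv_0_lt_compat; lra.
have c0 := Rabs_pos c; have c1 := Rle_abs c.
have E : (Rabs (phi 1 - phi 0) - B) / (Rabs c + 1) * (Rabs c + 1) = Rabs (phi 1 - phi 0) - B by field; lra.
nra.
Qed.

End BoxAverage.

(** * Second-order expansions of twice averaged functions *)

Section Mollify2.
Context {N : nat}.
Implicit Types (f g : vec N -> R) (x y z h : vec N) (i : 'I_N).

Lemma fin_le_sum (c : 'I_N -> R) i : (forall j, 0 <= c j) -> c i <= \big[Rplus/0]_(j < N) c j.
Proof.
move=> c0; have -> : \big[Rplus/0]_(j < N) c j = c i + \big[Rplus/0]_(j < N | j != i) c j by rewrite (bigD1 i).
have : 0 <= \big[Rplus/0]_(j < N | j != i) c j by elim/big_ind: _ => [|a b|j _]; [lra|lra|exact: c0].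
lra.
Qed.

(** The first average has Lipschitz derivatives, so averaging those makes them differentiable in
    turn. The construction yields mixed derivatives that are not symmetric by form, hence the
    symmetrization in [D2]. *)
Lemma mollify2_C2 d L f : 0 < d -> 0 <= L -> Lip L f ->
  exists c, 0 <= c /\ exists D D2, C2L c (mollify d (mollify d f)) D D2.
Proof.
move=> d0 L0 Lf.
have aM := averaging_mollify (N := N) d0.
have [c1 [c10 [D1 CD1]]] := mollify_C1 d0 L0 Lf.
have Qg : QL (mollify d f) by apply: (avg_QL aM); exact: Lip_QL Lf.
have [LD ED] := avg_C1L aM c10 Qg CD1.
set G := mollify d (mollify d f) in ED *.
have LD1 := proj1 CD1.
have /choice [cc Hcc] : forall i, exists c, 0 <= c /\ exists D, C1L c (mollify d (D1 i)) D.
  by move=> i; exact: mollify_C1 (LD1 i).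
have /choice [E HE] : forall i, exists D, C1L (cc i) (mollify d (D1 i)) D by move=> i; exact: proj2 (Hcc i).
set c2 := \big[Rplus/0]_(j < N) cc j.
have cc2 i : cc i <= c2 by apply: fin_le_sum => j; exact: proj1 (Hcc j).
have c20 : 0 <= c2 by apply: sum_ge0 => j; exact: proj1 (Hcc j).
have LE i j y z : Rabs (E i j y - E i j z) <= c2 * vnorm (vsub y z).
  apply: Rle_trans (proj1 (HE i) j y z) _; apply: Rmult_le_compat_r => //; exact: vnorm_ge0.
have EE i y h : Rabs (mollify d (D1 i) (vadd y h) - mollify d (D1 i) y - \big[Rplus/0]_(j < N) (E i j y * h j)) <= c2 * dot h h.
  apply: Rle_trans (proj2 (HE i) y h) _; apply: Rmult_le_compat_r => //; exact: dot_ge0.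
set D2 := fun i j y => / 2 * (E i j y + E j i y).
have N0 := pos_INR N.
exists (c2 + INR N * c2); split; first nra.
exists (fun i => mollify d (D1 i)), D2; split.
- by move=> i; exact: Lip_QL (LD i).
- move=> i j y z; rewrite /D2 -Rmult_minus_distr_l Rabs_mult Rabs_pos_eq; last lra.
  have /Rabs_leD h1 := LE i j y z; have /Rabs_leD h2 := LE j i y z.
  apply: (Rle_trans _ (c2 * vnorm (vsub y z))).
    have : Rabs (E i j y + E j i y - (E i j z + E j i z)) <= 2 * (c2 * vnorm (vsub y z)) by apply: Rabs_le; lra.
    lra.
  have : 0 <= INR N * c2 by nra.
  have := vnorm_ge0 (vsub y z); nra.
- by move=> i j; apply: functional_extensionality => y; rewrite /D2; ring.
move=> x h.
set Q := \big[Rplus/0]_(i < N) (h i * \big[Rplus/0]_(j < N) (E i j x * h j)).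
have -> : quad (fun i j => D2 i j x) h = Q.
  have -> : quad (fun i j => D2 i j x) h = / 2 * (quad (fun i j => E i j x) h + quad (fun i j => E j i x) h).
    by rewrite -quad_matD -quad_matZ.
  have Q1 : quad (fun i j => E i j x) h = Q.
    by rewrite /quad /Q; apply: eq_bigr => i _; rewrite -sumZ; apply: eq_bigr => j _; ring.
  have -> : quad (fun i j => E j i x) h = quad (fun i j => E i j x) h.
    by rewrite /quad exchange_big; apply: eq_bigr => i _; apply: eq_bigr => j _; ring.
  rewrite Q1; field.
set S := \big[Rplus/0]_(i < N) (mollify d (D1 i) x * h i).
(* The quadratic Taylor polynomial is subtracted along the segment from [x] to [x + h]; the
   expansion of the gradient then bounds the increments of [phi] at rate [|h|^3]. *)
set phi := fun t : R => G (vadd x (vscal t h)) - t * S - / 2 * (t * t) * Q.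
have -> : G (vadd x h) - G x - S - / 2 * Q = phi 1 - phi 0.
  rewrite /phi; have -> : vadd x (vscal 1 h) = vadd x h by vring.
  have -> : vadd x (vscal 0 h) = x by vring.
  ring.
have hn := vnorm_ge0 h.
apply: (Rle_trans _ (INR N * c2 * vnorm h ^ 3)); last by apply: Rmult_le_compat_r; [exact: pow_le|lra].
apply: (small_increments (c := c1 * dot h h + / 2 * Rabs Q)) => s t [s0 s1] t0 _.
set xs := vadd x (vscal s h).
have E1 : vadd x (vscal (s + t) h) = vadd xs (vscal t h) by rewrite /xs; vring.
set Ss := \big[Rplus/0]_(i < N) (mollify d (D1 i) xs * vscal t h i).
have B1 := ED xs (vscal t h); rewrite -/Ss !dotE in B1.
have B2 : Rabs (Ss - t * S - t * s * Q) <= INR N * c2 * vnorm h ^ 3 * t.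
  have -> : Ss - t * S - t * s * Q = \big[Rplus/0]_(i < N) (t * h i * (mollify d (D1 i) xs - mollify d (D1 i) x - \big[Rplus/0]_(j < N) (E i j x * vscal s h j))).
    rewrite /Ss /S /Q -!sumZ -!sumB; apply: eq_bigr => i _.
    have -> : \big[Rplus/0]_(j < N) (E i j x * vscal s h j) = s * \big[Rplus/0]_(j < N) (E i j x * h j).
      by rewrite -sumZ; apply: eq_bigr => j _; rewrite /vscal; ring.
    rewrite /vscal; ring.
  apply: Rle_trans (Rabs_sum _ _) _.
  have -> : INR N * c2 * vnorm h ^ 3 * t = \big[Rplus/0]_(i < N) (t * c2 * vnorm h ^ 3).
    rewrite sum_const /index_enum -enumT size_enum_ord; ring.
  apply: sum_le => i; rewrite !Rabs_mult (Rabs_pos_eq t) //.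
  have H := EE i x (vscal s h); rewrite -/xs !dotE in H.
  have H1 := coord_le h i; have H2 := vnorm_mul h; have H3 := Rabs_pos (h i).
  apply: (Rle_trans _ (t * vnorm h * (c2 * dot h h))); last by rewrite -H2; right; ring.
  apply: Rmult_le_compat.
  - exact: Rmult_le_pos.
  - exact: Rabs_pos.
  - exact: Rmult_le_compat_l.
  apply: Rle_trans H _; apply: Rmult_le_compat_l => //.
  have s2 : s * s <= 1 by nra.
  rewrite -Rmult_assoc; have := dot_ge0 h; nra.
have -> : phi (s + t) - phi s = (G (vadd xs (vscal t h)) - G xs - Ss) + (Ss - t * S - t * s * Q) - / 2 * (t * t) * Q.
  rewrite /phi E1 -/xs; field.
have B3 : Rabs (/ 2 * (t * t) * Q) = / 2 * (t * t) * Rabs Q.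
  by rewrite Rabs_mult Rabs_pos_eq //; nra.
apply: Rle_trans (Rabs_triang _ _) _; rewrite Rabs_Ropp B3.
apply: Rle_trans (Rplus_le_compat_r _ _ _ (Rabs_triang _ _)) _.
lra.
Qed.

Lemma C2L_grad_unique c f D D2 x p k : C2L c f D D2 ->
  (forall h, f (vadd x h) <= f x + dot p h + k * dot h h) -> (fun i => D i x) = p.
Proof.
move=> [_ _ _ ED] Hf.
set q : vec N := fun i => D i x.
have [w Ew] : exists w, w = vsub q p by exists (vsub q p).
have sumD' h : \big[Rplus/0]_(i < N) (D i x * h i) = dot q h by [].
set Q := quad (fun i j => D2 i j x) w.
have K t : 0 < t <= 1 -> dot w w <= t * (k * dot w w + Rabs Q + Rabs c * vnorm w ^ 3).
  move=> [t0 t1].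
  have := ED x (vscal t w); rewrite sumD' dotZr quadZ -/Q vnormZ (Rabs_pos_eq t); last lra.
  have := Hf (vscal t w); rewrite !dotE.
  move=> h1 /Rabs_leD [h2 _].
  have E : dot q w - dot p w = dot w w by rewrite -dotBl -Ew.
  have E1 : t * dot q w - t * dot p w = t * dot w w by rewrite -E; ring.
  have h3 : t * dot w w <= t * t * (k * dot w w - / 2 * Q) + c * (t * vnorm w) ^ 3 by lra.
  have h4 : c * (t * vnorm w) ^ 3 <= t * t * (Rabs c * vnorm w ^ 3).
    have -> : c * (t * vnorm w) ^ 3 = t * t * (t * (c * vnorm w ^ 3)) by ring.
    apply: Rmult_le_compat_l; first nra.
    have w3 : 0 <= vnorm w ^ 3 by apply: pow_le; exact: vnorm_ge0.
    have := Rle_abs c; have := Rabs_pos c => c0 c1.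
    have : c * vnorm w ^ 3 <= Rabs c * vnorm w ^ 3 by apply: Rmult_le_compat_r.
    have : 0 <= Rabs c * vnorm w ^ 3 by apply: Rmult_le_pos.
    nra.
  have h5 : t * t * (- / 2 * Q) <= t * t * Rabs Q.
    apply: Rmult_le_compat_l; first nra.
    have := Rle_abs (- Q); rewrite Rabs_Ropp; have := Rabs_pos Q; lra.
  apply: (Rmult_le_reg_l t) => //; nra.
have w0 : dot w w <= 0.
  set M := k * dot w w + Rabs Q + Rabs c * vnorm w ^ 3 in K.
  apply: Rnot_lt_le => lt.
  have M0 : 0 < Rabs M + 1 by have := Rabs_pos M; lra.
  have K1 := K 1 ltac:(lra).
  have := K (Rmin 1 (dot w w / 2 / (Rabs M + 1))) ltac:(split; [apply: Rmin_glb_lt; [lra|apply: Rdiv_lt_0_compat; lra]|exact: Rmin_l]).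
  have m1 := Rmin_r 1 (dot w w / 2 / (Rabs M + 1)).
  have m0 : 0 < Rmin 1 (dot w w / 2 / (Rabs M + 1)) by apply: Rmin_glb_lt; [lra|apply: Rdiv_lt_0_compat; lra].
  have E : dot w w / 2 / (Rabs M + 1) * (Rabs M + 1) = dot w w / 2 by field; lra.
  have := Rle_abs M; nra.
have /vnorm_eq0 wz : vnorm w = 0.
  by have := vnorm_mul w; have := vnorm_ge0 w; nra.
apply: functional_extensionality => i; have := equal_f wz i; rewrite Ew /vsub /zerov /q; lra.
Qed.

Lemma C2L_hess_ge c f D D2 k x h : C2L c f D D2 -> semiconvex k f ->
  - k * dot h h <= quad (fun i j => D2 i j x) h.
Proof.
move=> [_ _ _ ED] sf; set Q := quad _ h.
apply: Rnot_lt_le => lt.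
have c0 := Rabs_pos c; have c1 := Rle_abs c; have h0 := vnorm_ge0 h.
have h3 : 0 <= vnorm h ^ 3 by exact: pow_le.
have K t : 0 < t -> - k * dot h h - Q <= 2 * (t * (Rabs c * vnorm h ^ 3)).
  move=> t0.
  have := ED x (vscal t h); have := ED x (vscal (- t) h).
  rewrite !quadZ -/Q !vnormZ Rabs_Ropp (Rabs_pos_eq t); last lra.
  have -> : \big[Rplus/0]_(i < N) (D i x * vscal (- t) h i) = - \big[Rplus/0]_(i < N) (D i x * vscal t h i).
    transitivity ((-1) * \big[Rplus/0]_(i < N) (D i x * vscal t h i)); last ring.
    by rewrite -sumZ; apply: eq_bigr => i _; rewrite /vscal; ring.
  set S := \big[Rplus/0]_(i < N) _.
  have := sf x (vscal t h); rewrite !dotE.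
  have -> : vsub x (vscal t h) = vadd x (vscal (- t) h) by vring.
  move=> s1 /Rabs_leD [_ s2] /Rabs_leD [_ s3].
  have s4 : c * (t * vnorm h) ^ 3 <= t * t * (t * (Rabs c * vnorm h ^ 3)).
    have -> : t * t * (t * (Rabs c * vnorm h ^ 3)) = Rabs c * (t * vnorm h) ^ 3 by ring.
    by apply: Rmult_le_compat_r => //; apply: pow_le; nra.
  apply: (Rmult_le_reg_l (t * t)); nra.
set a := - k * dot h h - Q in K lt *; set b := Rabs c * vnorm h ^ 3 in K.
have b0 : 0 <= b by exact: Rmult_le_pos.
have a0 : 0 < a by rewrite /a; lra.
have := K (a / (4 * (b + 1))) ltac:(apply: Rdiv_lt_0_compat; lra).
have E : a / (4 * (b + 1)) * (4 * (b + 1)) = a by field; lra.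
have q0 : 0 < a / (4 * (b + 1)) by apply: Rdiv_lt_0_compat; lra.
nra.
Qed.

Lemma C2L_hess_le c f D D2 x k p h : C2L c f D D2 ->
  (forall h, f (vadd x h) <= f x + dot p h + k * dot h h) ->
  quad (fun i j => D2 i j x) h <= 2 * k * dot h h.
Proof.
move=> CD Hf; have Dp := C2L_grad_unique CD Hf; have [_ _ _ ED] := CD; set Q := quad _ h.
apply: Rnot_lt_le => lt.
have c0 := Rabs_pos c; have c1 := Rle_abs c; have h0 := vnorm_ge0 h.
have h3 : 0 <= vnorm h ^ 3 by exact: pow_le.
have K t : 0 < t -> / 2 * Q - k * dot h h <= t * (Rabs c * vnorm h ^ 3).
  move=> t0.
  have := ED x (vscal t h); have := Hf (vscal t h).
  have -> : \big[Rplus/0]_(i < N) (D i x * vscal t h i) = dot p (vscal t h) by rewrite -Dp.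
  rewrite quadZ -/Q !dotE vnormZ (Rabs_pos_eq t); last lra.
  move=> s1 /Rabs_leD [s2 _].
  have s4 : c * (t * vnorm h) ^ 3 <= t * t * (t * (Rabs c * vnorm h ^ 3)).
    have -> : t * t * (t * (Rabs c * vnorm h ^ 3)) = Rabs c * (t * vnorm h) ^ 3 by ring.
    by apply: Rmult_le_compat_r => //; apply: pow_le; nra.
  apply: (Rmult_le_reg_l (t * t)); nra.
set a := / 2 * Q - k * dot h h in K; set b := Rabs c * vnorm h ^ 3 in K.
have b0 : 0 <= b by exact: Rmult_le_pos.
have a0 : 0 < a by rewrite /a; lra.
have := K (a / (2 * (b + 1))) ltac:(apply: Rdiv_lt_0_compat; lra).
have E : a / (2 * (b + 1)) * (2 * (b + 1)) = a by field; lra.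
have q0 : 0 < a / (2 * (b + 1)) by apply: Rdiv_lt_0_compat; lra.
nra.
Qed.

End Mollify2.

(** * Viscosity inequalities and averaging *)

Section Coercive.
Context {N : nat}.
Implicit Types (f g : vec N -> R) (x y z h p : vec N) (X : mat N).

Lemma QL_ulim f xs x : QL f -> vulim xs x -> ulim (fun n => f (xs n)) (f x).
Proof.
move=> [L [L0 Lf]] lx eps e0; have x0 := vnorm_ge0 x.
set K := L * (2 + 2 * vnorm x) + 1.
have K0 : 0 < K by rewrite /K; nra.
have d0 : 0 < eps / K by exact: Rdiv_lt_0_compat.
apply: omS (omI (lx _ d0) (lx _ Rlt_0_1)) => n [h1 h2].
apply: Rle_lt_trans (Lf _ _) _.
have h3 := vnorm_ge0 (vsub (xs n) x).
have : vnorm (xs n) <= vnorm x + 1.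
  have -> : xs n = vadd x (vsub (xs n) x) by vring.
  by apply: Rle_trans (vnorm_add _ _) _; lra.
move=> h4; apply: (Rle_lt_trans _ (K * vnorm (vsub (xs n) x))).
  apply: Rmult_le_compat_r => //; rewrite /K.
  suff : L * (1 + vnorm (xs n) + vnorm x) <= L * (2 + 2 * vnorm x) by lra.
  apply: Rmult_le_compat_l; lra.
have : eps / K * K = eps by field; lra.
nra.
Qed.

Lemma vulim_norm xs x y R0 : vulim xs x -> om (fun n => vnorm (vsub (xs n) y) <= R0) -> vnorm (vsub x y) <= R0.
Proof.
move=> lx H; apply: Rnot_lt_le => lt.
have e0 : 0 < vnorm (vsub x y) - R0 by lra.
have [n [h1 h2]] := om_ex (omI H (lx _ e0)).
have := vnorm_tri (xs n) x y; rewrite (vnorm_subC x (xs n)); lra.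
Qed.

Lemma vulim_ex_ball xs y R0 : (forall n, vnorm (vsub (xs n) y) <= R0) ->
  exists x, vulim xs x /\ vnorm (vsub x y) <= R0.
Proof.
move=> H; have [|x lx] := @vulim_ex N xs (R0 + vnorm y).
  move=> n; have -> : xs n = vadd (vsub (xs n) y) y by vring.
  by apply: Rle_trans (vnorm_add _ _) _; have := H n; lra.
exists x; split => //; apply: vulim_norm lx _; exact: om_all.
Qed.

Lemma ball_max f x0 R0 : 0 <= R0 -> QL f ->
  exists x, vnorm (vsub x x0) <= R0 /\ forall y, vnorm (vsub y x0) <= R0 -> f y <= f x.
Proof.
move=> R00 Qf; apply: max_attained.
  by exists x0; have -> : vsub x0 x0 = zerov by [vring]; rewrite vnorm0.
move=> xs Kxs; have [x [lx Kx]] := vulim_ex_ball Kxs.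
by exists x; split => //; exact: QL_ulim.
Qed.

Lemma coercive_max f x0 xm R0 : QL f -> (forall x, R0 < vnorm (vsub x x0) -> f x <= f xm) ->
  exists x, forall y, f y <= f x.
Proof.
move=> Qf H; set R1 := Rmax R0 (vnorm (vsub xm x0)).
have R10 : 0 <= R1 by apply: Rle_trans (Rmax_r _ _); exact: vnorm_ge0.
have [x [_ mx]] := ball_max x0 R10 Qf.
exists x => y; case: (Rle_dec (vnorm (vsub y x0)) R1) => [/mx //|/Rnot_le_lt lt].
apply: (Rle_trans _ (f xm)); last by apply: mx; exact: Rmax_r.
by apply: H; apply: Rle_lt_trans lt; exact: Rmax_l.
Qed.

Lemma superjet_cubic f x p X c :
  (forall h, f (vadd x h) <= f x + dot p h + / 2 * quad X h + c * vnorm h ^ 3) -> ell_superjet f x p X.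
Proof.
move=> H eps e0; have c0 := Rabs_pos c.
exists (eps / (Rabs c + 1)); split; first by apply: Rdiv_lt_0_compat; lra.
move=> y hy; have := H (vsub y x); have -> : vadd x (vsub y x) = y by vring.
set w := vsub y x in hy *; have w0 := vnorm_ge0 w.
have E : eps / (Rabs c + 1) * (Rabs c + 1) = eps by field; lra.
have -> : c * vnorm w ^ 3 = (c * vnorm w) * vnorm w ^ 2 by ring.
have : c * vnorm w <= eps by have := Rle_abs c; nra.
move=> h1 h2; have := Rmult_le_compat_r (vnorm w ^ 2) _ _ (pow2_ge_0 _) h1; lra.
Qed.

Lemma subjet_cubic f x p X c :
  (forall h, f x + dot p h + / 2 * quad X h - c * vnorm h ^ 3 <= f (vadd x h)) -> ell_subjet f x p X.
Proof.
move=> H eps e0; have c0 := Rabs_pos c.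
exists (eps / (Rabs c + 1)); split; first by apply: Rdiv_lt_0_compat; lra.
move=> y hy; have := H (vsub y x); have -> : vadd x (vsub y x) = y by vring.
set w := vsub y x in hy *; have w0 := vnorm_ge0 w.
have E : eps / (Rabs c + 1) * (Rabs c + 1) = eps by field; lra.
have -> : c * vnorm w ^ 3 = (c * vnorm w) * vnorm w ^ 2 by ring.
have : c * vnorm w <= eps by have := Rle_abs c; nra.
move=> h1 h2; have := Rmult_le_compat_r (vnorm w ^ 2) _ _ (pow2_ge_0 _) h1; lra.
Qed.
End Coercive.

(** * Random walks and averaged viscosity inequalities *)

Section RandomWalk.
Context {N : nat} (D : seq (vec N)).
Implicit Types (f g : vec N -> R) (x y z h p : vec N) (X : mat N).

Definition dir_norm1 := \big[Rplus/0]_(w <- D) vnorm w.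
Definition dir_norm2 := \big[Rplus/0]_(w <- D) dot w w.
Definition dir_norm3 := \big[Rplus/0]_(w <- D) vnorm w ^ 3.
Definition walk_mass := INR (size D) + 1.
Lemma dir_norm1_ge0 : 0 <= dir_norm1. Proof. by apply: sum_ge0 => w; exact: vnorm_ge0. Qed.
Lemma dir_norm2_ge0 : 0 <= dir_norm2. Proof. by apply: sum_ge0 => w; exact: dot_ge0. Qed.
Lemma dir_norm3_ge0 : 0 <= dir_norm3. Proof. by apply: sum_ge0 => w; apply: pow_le; exact: vnorm_ge0. Qed.
Lemma walk_mass_gt0 : 0 < walk_mass. Proof. rewrite /walk_mass; have := pos_INR (size D); lra. Qed.

(** A lazy walk: it stays put with probability [1 / walk_mass] and otherwise jumps by [r w] or
    [- r w] for some direction [w]. The option of staying put keeps [walk_mass] positive even for an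
    empty [D]. *)
Definition walk r g z := / walk_mass * (g z +
  / 2 * \big[Rplus/0]_(w <- D) (g (vadd z (vscal r w)) + g (vadd z (vscal (- r) w)))).

Lemma averaging_walk r : averaging (walk r).
Proof.
have m0 := walk_mass_gt0; have i0 : 0 < / walk_mass by exact: Rinv_0_lt_compat.
split.
- move=> f Qf; apply: QL_scal; apply: QL_add => //; apply: QL_scal; apply: QL_sum => w.
  by apply: QL_add; exact: QL_trans.
- move=> a b f g x _ _; rewrite /walk.
  have -> : \big[Rplus/0]_(w <- D) (a * f (vadd x (vscal r w)) + b * g (vadd x (vscal r w)) + (a * f (vadd x (vscal (- r) w)) + b * g (vadd x (vscal (- r) w)))) =
    a * \big[Rplus/0]_(w <- D) (f (vadd x (vscal r w)) + f (vadd x (vscal (- r) w))) +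
    b * \big[Rplus/0]_(w <- D) (g (vadd x (vscal r w)) + g (vadd x (vscal (- r) w))).
    by rewrite -!sumZ -sumD; apply: eq_bigr => w _; ring.
  ring.
- move=> f g x _ _ fg; rewrite /walk; apply: Rmult_le_compat_l; first lra.
  apply: Rplus_le_compat => //; apply: Rmult_le_compat_l; first lra.
  by apply: sum_le => w; apply: Rplus_le_compat.
- move=> c x; rewrite /walk sum_const; rewrite /walk_mass in m0 *; field; lra.
- move=> f a x; rewrite /walk.
  have -> : \big[Rplus/0]_(w <- D) (f (vadd (vadd x (vscal r w)) a) + f (vadd (vadd x (vscal (- r) w)) a)) =
    \big[Rplus/0]_(w <- D) (f (vadd (vadd x a) (vscal r w)) + f (vadd (vadd x a) (vscal (- r) w))).
    apply: eq_bigr => w _.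
    have -> : vadd (vadd x (vscal r w)) a = vadd (vadd x a) (vscal r w) by vring.
    have -> : vadd (vadd x (vscal (- r) w)) a = vadd (vadd x a) (vscal (- r) w) by vring.
    by [].
  by [].
Qed.

Lemma walk_avg_comm A r f x : averaging A -> QL f -> A (walk r f) x = walk r (A f) x.
Proof.
move=> aA Qf; rewrite /walk.
have Qw w : QL (fun y => f (vadd y (vscal r w)) + f (vadd y (vscal (- r) w))) by apply: QL_add; exact: QL_trans.
rewrite (avg_scal aA); last by apply: QL_add => //; apply: QL_scal; exact: QL_sum.
rewrite (avg_add aA) //; last by apply: QL_scal; exact: QL_sum.
rewrite (avg_scal aA); last exact: QL_sum.
rewrite (avg_sum aA) //; congr (_ * (_ + _ * _)); apply: eq_bigr => w _.
by rewrite (avg_add aA) ?(avg_trans aA) //; exact: QL_trans.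
Qed.

Lemma walk_iter_avg_comm A r j f x : averaging A -> QL f ->
  A (iter j (walk r) f) x = iter j (walk r) (A f) x.
Proof.
move=> aA Qf; elim: j x => [//|j IH] x.
rewrite [iter j.+1 (walk r) f]/= walk_avg_comm //; last exact: (avg_QL (averaging_iter j (averaging_walk r))).
by rewrite /=; congr (walk r _ x); apply: functional_extensionality => y; exact: IH.
Qed.

(** The time step: to second order, [walk r] is the identity plus [walk_variance r] times the sum of
    second derivatives along [D]. *)
Definition walk_variance r := r * r / (2 * walk_mass).

Lemma walkE r f x : walk r f x = f x +
  / (2 * walk_mass) * \big[Rplus/0]_(w <- D) (f (vadd x (vscal r w)) + f (vadd x (vscal (- r) w)) - 2 * f x).
Proof.
rewrite /walk sumB sum_const; have := walk_mass_gt0; rewrite /walk_mass => H; field; lra.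
Qed.

Definition directional_laplacian (D2 : 'I_N -> 'I_N -> vec N -> R) x := \big[Rplus/0]_(w <- D) quad (fun i j => D2 i j x) w.

Lemma directional_laplacian_Lip c D2 : 0 <= c -> (forall i j, Lip c (D2 i j)) -> Lip (c * (INR N * INR N) * dir_norm2) (directional_laplacian D2).
Proof.
move=> c0 LD x y; rewrite /directional_laplacian -sumB; apply: Rle_trans (Rabs_sum _ _) _.
have -> : c * (INR N * INR N) * dir_norm2 * vnorm (vsub x y) =
  \big[Rplus/0]_(w <- D) (c * (INR N * INR N) * vnorm (vsub x y) * dot w w) by rewrite sumZ /dir_norm2; ring.
apply: sum_le => w; rewrite -quad_matB /quad.
apply: Rle_trans (Rabs_sum _ _) _.
have -> : c * (INR N * INR N) * vnorm (vsub x y) * dot w w =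
  \big[Rplus/0]_(i < N) \big[Rplus/0]_(j < N) (c * vnorm (vsub x y) * dot w w).
  rewrite !sum_const /index_enum -enumT size_enum_ord; ring.
apply: sum_le => i; apply: Rle_trans (Rabs_sum _ _) _; apply: sum_le => j.
rewrite !Rabs_mult -vnorm_mul.
have h1 := coord_le w i; have h2 := coord_le w j; have h3 := LD i j x y.
have a1 := Rabs_pos (w i); have a2 := Rabs_pos (w j); have a3 := Rabs_pos (D2 i j x - D2 i j y).
have n0 := vnorm_ge0 w.
have -> : Rabs (w i) * Rabs (D2 i j x - D2 i j y) * Rabs (w j) = Rabs (D2 i j x - D2 i j y) * (Rabs (w i) * Rabs (w j)) by ring.
by apply: Rmult_le_compat => //; [exact: Rmult_le_pos|exact: Rmult_le_compat].
Qed.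

Lemma walk_expand r c f Df D2 x : 0 < r -> 0 <= c -> C2L c f Df D2 ->
  Rabs (walk r f x - f x - walk_variance r * directional_laplacian D2 x) <= walk_variance r * (2 * c * r * dir_norm3).
Proof.
move=> r0 c0 [_ _ _ ED]; have m0 := walk_mass_gt0.
have i0 : 0 < / (2 * walk_mass) by apply: Rinv_0_lt_compat; lra.
have -> : walk r f x - f x - walk_variance r * directional_laplacian D2 x = / (2 * walk_mass) *
  \big[Rplus/0]_(w <- D) (f (vadd x (vscal r w)) + f (vadd x (vscal (- r) w)) - 2 * f x - r * r * quad (fun i j => D2 i j x) w).
  have -> : \big[Rplus/0]_(w <- D) (f (vadd x (vscal r w)) + f (vadd x (vscal (- r) w)) - 2 * f x - r * r * quad (fun i j => D2 i j x) w) =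
    \big[Rplus/0]_(w <- D) (f (vadd x (vscal r w)) + f (vadd x (vscal (- r) w)) - 2 * f x) - r * r * directional_laplacian D2 x.
    by rewrite /directional_laplacian -sumZ -sumB.
  rewrite walkE /walk_variance; field; lra.
have -> : walk_variance r * (2 * c * r * dir_norm3) = / (2 * walk_mass) * \big[Rplus/0]_(w <- D) (2 * c * (r * r * r) * vnorm w ^ 3).
  rewrite sumZ -/dir_norm3 /walk_variance; field; lra.
rewrite Rabs_mult Rabs_pos_eq; last lra.
apply: Rmult_le_compat_l; first lra.
apply: Rle_trans (Rabs_sum _ _) _; apply: sum_le => w.
have := ED x (vscal r w); have := ED x (vscal (- r) w).
rewrite !quadZ !vnormZ Rabs_Ropp (Rabs_pos_eq r); last lra.
have -> : \big[Rplus/0]_(i < N) (Df i x * vscal (- r) w i) = - \big[Rplus/0]_(i < N) (Df i x * vscal r w i).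
  transitivity ((-1) * \big[Rplus/0]_(i < N) (Df i x * vscal r w i)); last ring.
  by rewrite -sumZ; apply: eq_bigr => i _; rewrite /vscal; ring.
move=> /Rabs_leD h1 /Rabs_leD h2; apply: Rabs_le.
have -> : 2 * c * (r * r * r) * vnorm w ^ 3 = 2 * (c * (r * vnorm w) ^ 3) by ring.
lra.
Qed.

Lemma walk_Lip r c f x : 0 < r -> 0 <= c -> Lip c f -> Rabs (walk r f x - f x) <= c * r * dir_norm1.
Proof.
move=> r0 c0 Lf; have m0 := walk_mass_gt0.
have i0 : 0 < / (2 * walk_mass) by apply: Rinv_0_lt_compat; lra.
have m11 : 1 <= walk_mass by rewrite /walk_mass; have := pos_INR (size D); lra.
rewrite walkE; set S := \big[Rplus/0]_(w <- D) _.
have -> : f x + / (2 * walk_mass) * S - f x = / (2 * walk_mass) * S by ring.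
have HS : Rabs S <= 2 * (c * r * dir_norm1).
  apply: Rle_trans (Rabs_sum _ _) _.
  have -> : 2 * (c * r * dir_norm1) = \big[Rplus/0]_(w <- D) (2 * (c * r) * vnorm w) by rewrite sumZ /dir_norm1; ring.
  apply: sum_le => w.
  have := Lf (vadd x (vscal r w)) x; have := Lf (vadd x (vscal (- r) w)) x.
  have -> : vsub (vadd x (vscal r w)) x = vscal r w by vring.
  have -> : vsub (vadd x (vscal (- r) w)) x = vscal (- r) w by vring.
  rewrite !vnormZ Rabs_Ropp (Rabs_pos_eq r); last lra.
  move=> /Rabs_leD h1 /Rabs_leD h2; apply: Rabs_le; lra.
rewrite Rabs_mult Rabs_pos_eq; last lra.
have h0 : 0 <= c * r * dir_norm1 by apply: Rmult_le_pos; [nra|exact: dir_norm1_ge0].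
have E : / (2 * walk_mass) * (2 * walk_mass) = 1 by field; lra.
apply: (Rle_trans _ (/ (2 * walk_mass) * (2 * (c * r * dir_norm1)))); first by apply: Rmult_le_compat_l; lra.
have -> : / (2 * walk_mass) * (2 * (c * r * dir_norm1)) = / walk_mass * (c * r * dir_norm1) by field; lra.
have : / walk_mass <= 1 by rewrite -Rinv_1; apply: Rinv_le_contravar; lra.
nra.
Qed.

Lemma walk_sqdist r x0 x : walk r (fun y => dot (vsub y x0) (vsub y x0)) x = dot (vsub x x0) (vsub x x0) + walk_variance r * (2 * dir_norm2).
Proof.
rewrite walkE; congr (_ + _).
have -> : \big[Rplus/0]_(w <- D) (dot (vsub (vadd x (vscal r w)) x0) (vsub (vadd x (vscal r w)) x0) +
   dot (vsub (vadd x (vscal (- r) w)) x0) (vsub (vadd x (vscal (- r) w)) x0) - 2 * dot (vsub x x0) (vsub x x0)) =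
   \big[Rplus/0]_(w <- D) (2 * (r * r) * dot w w) by apply: eq_bigr => w _; rewrite !dotE; ring.
rewrite sumZ -/dir_norm2 /walk_variance; have := walk_mass_gt0 => ?; field; lra.
Qed.

Lemma walk_iter_sqdist r x0 i : iter i (walk r) (fun y => dot (vsub y x0) (vsub y x0)) x0 = INR i * (walk_variance r * (2 * dir_norm2)).
Proof.
suff H : forall x, iter i (walk r) (fun y => dot (vsub y x0) (vsub y x0)) x = dot (vsub x x0) (vsub x x0) + INR i * (walk_variance r * (2 * dir_norm2)).
  rewrite H; have -> : vsub x0 x0 = zerov by vring.
  rewrite dot0l; ring.
elim: i => [|i IH] x; first by rewrite /=; ring.
have -> : iter i.+1 (walk r) (fun y => dot (vsub y x0) (vsub y x0)) x = walk r (fun y => dot (vsub y x0) (vsub y x0) + INR i * (walk_variance r * (2 * dir_norm2))) x.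
  by rewrite /=; congr (walk r _ x); apply: functional_extensionality.
rewrite (avg_addc (averaging_walk r)); last exact: QL_sqdist.
rewrite walk_sqdist S_INR; ring.
Qed.

(** The variation of the Laplacian away from [x0] is majorized by [e + K |y - x0|^2] (Young's
    inequality), and the walk changes squared distances by an exactly known amount, so the
    contributions of all steps can be summed in closed form. *)
Lemma walk_iter_upper r c f Df D2 x0 e j : 0 < r -> 0 <= c -> 0 < e -> QL f -> C2L c f Df D2 ->
  let CL := c * (INR N * INR N) * dir_norm2 in let S := INR j * walk_variance r in
  iter j (walk r) f x0 <= f x0 + S * (directional_laplacian D2 x0 + 2 * c * r * dir_norm3 + e + CL * CL / (4 * e) * (S * (2 * dir_norm2))).
Proof.
move=> r0 c0 e0 Qf CD CL S.
have LL : Lip CL (directional_laplacian D2) by case: CD => _ LD _ _; exact: directional_laplacian_Lip.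
have CL0 : 0 <= CL by apply: Rmult_le_pos; [apply: Rmult_le_pos => //; have := pos_INR N; nra|exact: dir_norm2_ge0].
have s00 : 0 <= walk_variance r by rewrite /walk_variance; apply: Rmult_le_pos; [nra|apply: Rlt_le; apply: Rinv_0_lt_compat; have := walk_mass_gt0; lra].
have aT := averaging_walk r.
set K := CL * CL / (4 * e).
have K0 : 0 <= K by rewrite /K; apply: Rmult_le_pos; [nra|apply: Rlt_le; apply: Rinv_0_lt_compat; lra].
have QL1 : QL (directional_laplacian D2) by exact: Lip_QL LL.
have S20 := dir_norm2_ge0.
have up y : directional_laplacian D2 y <= directional_laplacian D2 x0 + e + K * dot (vsub y x0) (vsub y x0).
  have /Rabs_leD [_ h] := LL y x0; rewrite -vnorm_mul; set a := vnorm _ in h *.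
  have : CL * a <= e + K * (a * a); last lra.
  have -> : e + K * (a * a) = CL * a + (2 * e - CL * a) * (2 * e - CL * a) * / (4 * e) by rewrite /K; field; lra.
  have : 0 <= (2 * e - CL * a) * (2 * e - CL * a) * / (4 * e).
    by apply: Rmult_le_pos; [exact: Rle_0_sqr|apply: Rlt_le; apply: Rinv_0_lt_compat; lra].
  lra.
have Qup : QL (fun y => K * dot (vsub y x0) (vsub y x0) + (directional_laplacian D2 x0 + e)).
  by apply: QL_add; [apply: QL_scal; exact: QL_sqdist|exact: QL_const].
have step i : iter i.+1 (walk r) f x0 <= iter i (walk r) f x0 + walk_variance r * (directional_laplacian D2 x0 + 2 * c * r * dir_norm3 + e + K * (INR i * walk_variance r * (2 * dir_norm2))).
  have ai := averaging_iter i aT.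
  rewrite iterSr.
  have QTf := avg_QL aT Qf.
  have h1 y : walk r f y <= 1 * f y + walk_variance r * (K * dot (vsub y x0) (vsub y x0) + (directional_laplacian D2 x0 + e + 2 * c * r * dir_norm3)).
    have /Rabs_leD [_ h] := walk_expand y r0 c0 CD.
    have := Rmult_le_compat_l _ _ _ s00 (up y); lra.
  have Qr : QL (fun y => K * dot (vsub y x0) (vsub y x0) + (directional_laplacian D2 x0 + e + 2 * c * r * dir_norm3)).
    by apply: QL_add; [apply: QL_scal; exact: QL_sqdist|exact: QL_const].
  have Q2 : QL (fun y => 1 * f y + walk_variance r * (K * dot (vsub y x0) (vsub y x0) + (directional_laplacian D2 x0 + e + 2 * c * r * dir_norm3))).
    by apply: QL_lin.
  apply: Rle_trans (avg_le ai x0 QTf Q2 h1) _.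
  rewrite (avg_lin ai) // (avg_addc ai); last by apply: QL_scal; exact: QL_sqdist.
  rewrite (avg_scal ai); last exact: QL_sqdist.
  rewrite walk_iter_sqdist; right; ring.
rewrite /S -/K; elim: j {S} => [|j IH]; first by rewrite /=; lra.
apply: Rle_trans (step j) _; apply: Rle_trans (Rplus_le_compat_r _ _ _ IH) _.
rewrite S_INR; set a := INR j; have a0 : 0 <= a by exact: pos_INR.
set b := walk_variance r in s00 *; set q := 2 * dir_norm2; have q0 : 0 <= q by rewrite /q; lra.
have : 0 <= K * (b * q * b * (a + 1)) by apply: Rmult_le_pos => //; repeat apply: Rmult_le_pos => //; lra.
set M := directional_laplacian D2 x0 + 2 * c * r * dir_norm3 + e; lra.
Qed.

(** A parabolic comparison in discrete time, with the walk in the role of the flow started at [g]. A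
    maximum point of the difference carries a smooth superjet of [f], whose inequality pays for one
    more step. The quadratic term with [B > 0] also makes that maximum exist. *)
Lemma walk_comparison f g L c Dg D2 lo B x0 r j :
  0 < r -> 0 <= L -> 0 <= c -> 0 < B -> Lip L f -> Lip L g -> C2L c g Dg D2 ->
  (forall x p X, symmetric X -> ell_superjet f x p X ->
     lo - B * dot (vsub x x0) (vsub x x0) <= \big[Rplus/0]_(w <- D) quad X w) ->
  (forall x, f x <= g x) ->
  forall x, f x <= iter j (walk r) g x - INR j * walk_variance r * (lo - B * dot (vsub x x0) (vsub x x0))
     + INR j * walk_variance r * (r * c * (2 * dir_norm3 + INR N * INR N * dir_norm2 * dir_norm1) + INR j * walk_variance r * (2 * B * dir_norm2)).
Proof.
move=> r0 L0 c0 B0 Lf Lg Cg visc fg.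
have aT := averaging_walk r; have m0 := walk_mass_gt0.
have s00 : 0 < walk_variance r by rewrite /walk_variance; apply: Rdiv_lt_0_compat; nra.
have Qg := Lip_QL L0 Lg; have Qf := Lip_QL L0 Lf.
have S20 := dir_norm2_ge0.
elim: j => [|j IH] x; first by rewrite /=; have := fg x; lra.
set S := INR j.+1 * walk_variance r.
have S0 : 0 < S by apply: Rmult_lt_0_compat => //; apply: lt_0_INR; lia.
have aj := averaging_iter j aT; have aj1 := averaging_iter j.+1 aT.
set gj := iter j (walk r) g in IH; set gj1 := iter j.+1 (walk r) g.
have Cj := avg_C2L aj c0 Qg Cg; have Cj1 := avg_C2L aj1 c0 Qg Cg.
have Lj1 : Lip L gj1 by exact: avg_Lip.
set ht := fun y => lo - B * dot (vsub y x0) (vsub y x0).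
set phi := fun y => f y - gj1 y + S * ht y.
have Qphi : QL phi.
  have -> : phi = (fun y => (f y + (-1) * gj1 y) + (S * lo + (- (S * B)) * dot (vsub y x0) (vsub y x0))).
    by apply: functional_extensionality => y; rewrite /phi /ht; ring.
  apply: QL_add; first by apply: QL_add => //; apply: QL_scal; exact: (avg_QL aj1).
  by apply: QL_add; [exact: QL_const|apply: QL_scal; exact: QL_sqdist].
have [z1 mz] : exists z1, forall y, phi y <= phi z1.
  apply: (@coercive_max N phi x0 x0 (2 * L / (S * B))) => // y hy.
  have SB : 0 < S * B by exact: Rmult_lt_0_compat.
  have /Rabs_leD [_ h1] := Lf y x0; have /Rabs_leD [h2 _] := Lj1 y x0.
  rewrite /phi /ht; have -> : vsub x0 x0 = zerov by vring.
  rewrite dot0l -vnorm_mul; set a := vnorm (vsub y x0) in hy h1 h2 *.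
  have a0 : 0 <= a by exact: vnorm_ge0.
  have E : 2 * L / (S * B) * (S * B) = 2 * L by field; lra.
  have : 2 * L <= S * B * a by nra.
  nra.
suff K : phi z1 <= S * (r * c * (2 * dir_norm3 + INR N * INR N * dir_norm2 * dir_norm1) + S * (2 * B * dir_norm2)).
  have := mz x; rewrite /phi -/(ht x) in K *; lra.
set Dj1 := fun i => iter j.+1 (walk r) (Dg i); set D2j1 := fun i k => iter j.+1 (walk r) (D2 i k).
set D2j := fun i k => iter j (walk r) (D2 i k).
have jet : ell_superjet f z1 (fun i => Dj1 i z1 + 2 * S * B * (z1 i - x0 i))
   (fun i k => D2j1 i k z1 + 2 * S * B * idm i k).
  apply: (superjet_cubic (c := c)) => h.
  have := mz (vadd z1 h); rewrite /phi /ht.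
  have [_ _ _ ED] := Cj1; have /Rabs_leD [_ h1'] := ED z1 h.
  have h1 : gj1 (vadd z1 h) - gj1 z1 - \big[Rplus/0]_(i < N) (Dj1 i z1 * h i) -
    / 2 * quad (fun i k => D2j1 i k z1) h <= c * vnorm h ^ 3 := h1'.
  have -> : dot (fun i => Dj1 i z1 + 2 * S * B * (z1 i - x0 i)) h =
    \big[Rplus/0]_(i < N) (Dj1 i z1 * h i) + 2 * S * B * dot (vsub z1 x0) h.
    by rewrite /dot -sumZ -sumD; apply: eq_bigr => i _; rewrite /vsub; ring.
  rewrite quad_matD quad_matZ quad_idm.
  have -> : dot (vsub (vadd z1 h) x0) (vsub (vadd z1 h) x0) = dot (vsub z1 x0) (vsub z1 x0) + 2 * dot (vsub z1 x0) h + dot h h.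
    by rewrite !dotE (dotC h z1) (dotC h x0); ring.
  move=> h2; lra.
have symX : symmetric (fun i k => D2j1 i k z1 + 2 * S * B * idm i k).
  by move=> i k; case: Cj1 => _ _ sD _; rewrite /D2j1 sD idm_sym.
have := visc _ _ _ symX jet; rewrite -/(ht z1).
have -> : \big[Rplus/0]_(w <- D) quad (fun i k => D2j1 i k z1 + 2 * S * B * idm i k) w = directional_laplacian D2j1 z1 + 2 * S * B * dir_norm2.
  rewrite /directional_laplacian /dir_norm2 -sumZ -sumD; apply: eq_bigr => w _.
  by rewrite quad_matD quad_matZ quad_idm.
move=> V.
have /Rabs_leD [W _] := walk_expand z1 r0 c0 Cj.
have LipLap : Lip (c * (INR N * INR N) * dir_norm2) (directional_laplacian D2j) by case: Cj => _ LD _ _; exact: directional_laplacian_Lip.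
have cN : 0 <= c * (INR N * INR N) * dir_norm2 by apply: Rmult_le_pos => //; apply: Rmult_le_pos => //; have := pos_INR N; nra.
(* The inequality for [f] involves second derivatives after [j + 1] steps, the expansion of the walk
   those after [j] steps; one step separates them, at a cost of order [r]. *)
have /Rabs_leD [_ W2] := walk_Lip z1 r0 cN LipLap.
have E : walk r (directional_laplacian D2j) z1 = directional_laplacian D2j1 z1.
  have QD i k : QL (D2 i k) by case: Cg => _ LD _ _; exact: Lip_QL (LD i k).
  have QDj i k : QL (D2j i k) by exact: (avg_QL aj).
  rewrite /directional_laplacian /quad (avg_sum aT); last first.
    by move=> w; apply: QL_sum => i; apply: QL_sum => k;
      have := QL_scal (w i * w k) (QDj i k); congr QL; apply: functional_extensionality => y; ring.
  apply: eq_bigr => w _; rewrite (avg_sum aT); last first.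
    by move=> i; apply: QL_sum => k;
      have := QL_scal (w i * w k) (QDj i k); congr QL; apply: functional_extensionality => y; ring.
  apply: eq_bigr => i _; rewrite (avg_sum aT); last first.
    by move=> k; have := QL_scal (w i * w k) (QDj i k); congr QL; apply: functional_extensionality => y; ring.
  apply: eq_bigr => k _.
  have -> : (fun y => w i * D2j i k y * w k) = (fun y => (w i * w k) * D2j i k y) by apply: functional_extensionality => y; ring.
  rewrite (avg_scal aT) //; rewrite /D2j1 /D2j /=; ring.
rewrite E in W2.
rewrite -/gj -/D2j in W; change (walk r gj z1) with (gj1 z1) in W.
have I := IH z1; rewrite -/(ht z1) in I.
set e := r * c * (2 * dir_norm3 + INR N * INR N * dir_norm2 * dir_norm1) in I *.
have V2 : walk_variance r * ht z1 <= walk_variance r * directional_laplacian D2j1 z1 + walk_variance r * (2 * S * B * dir_norm2) by nra.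
have W3 : walk_variance r * directional_laplacian D2j1 z1 <= walk_variance r * directional_laplacian D2j z1 + walk_variance r * (c * (INR N * INR N) * dir_norm2 * r * dir_norm1) by nra.
have W4 : f z1 - gj1 z1 + (INR j * walk_variance r) * ht z1 + walk_variance r * ht z1 <= INR j * walk_variance r * (e + INR j * walk_variance r * (2 * B * dir_norm2)) + walk_variance r * (e + 2 * S * B * dir_norm2).
  rewrite /e in I *; lra.
have ES : S = INR j * walk_variance r + walk_variance r by rewrite /S S_INR; ring.
have SS : INR j * walk_variance r <= S by lra.
have j0 := pos_INR j.
rewrite /phi {1}ES; apply: (Rle_trans _ (INR j * walk_variance r * (e + INR j * walk_variance r * (2 * B * dir_norm2)) + walk_variance r * (e + 2 * S * B * dir_norm2))); first lra.
have BS : 0 <= 2 * B * dir_norm2 by nra.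
have : INR j * walk_variance r * (INR j * walk_variance r * (2 * B * dir_norm2)) <= INR j * walk_variance r * (S * (2 * B * dir_norm2)).
  by apply: Rmult_le_compat_l; [nra|exact: Rmult_le_compat_r].
rewrite {4}ES; nra.
Qed.

Lemma mollify_close d L f x : 0 < d -> 0 <= L -> Lip L f -> Rabs (mollify d f x - f x) <= INR N * (L * d).
Proof.
move=> d0 L0 Lf; rewrite /mollify -[in INR N](size_enum_ord N).
elim: (enum 'I_N) x => [|i l IH] x; first by rewrite /= Rminus_diag Rabs_R0; lra.
change (size (i :: l)) with (size l).+1; rewrite S_INR [boxes _ _ _ _]/=.
have aB := averaging_box (N := N) i d0.
have Lb : Lip L (boxes d l f) by exact: (avg_Lip (averaging_boxes l d0)).
have Qf := Lip_QL L0 Lf; have Qb := Lip_QL L0 Lb.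
have step : Rabs (box i d f x - f x) <= L * d.
  have i0 : 0 < / (2 * d) by apply: Rinv_0_lt_compat; lra.
  have cst c : / (2 * d) * RInt (fun _ : R => c) (- d) d = c by rewrite RInt_const /scal /= /mult /=; field; lra.
  have bnd s : - d < s < d -> Rabs (f (vadd x (vscal s (ei i))) - f x) <= L * d.
    move=> hs; apply: Rle_trans (Lf _ _) _; have -> : vsub (vadd x (vscal s (ei i))) x = vscal s (ei i) by vring.
    rewrite vnormZ vnorm_ei Rmult_1_r; apply: Rmult_le_compat_l => //; apply: Rabs_le; lra.
  suff : f x - L * d <= box i d f x <= f x + L * d by move=> H; apply: Rabs_le; lra.
  rewrite -(cst (f x - L * d)) -(cst (f x + L * d)) /box.
  split; apply: Rmult_le_compat_l; try lra; apply: RInt_le; try lra; try exact: ex_RInt_const; try exact: QL_ex_RInt.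
    by move=> s /bnd /Rabs_leD; lra.
  by move=> s /bnd /Rabs_leD; lra.
have H : Rabs (box i d (fun y => boxes d l f y + (-1) * f y) x) <= INR (size l) * (L * d).
  apply: (avg_abs_const aB); first by apply: QL_add => //; exact: QL_scal.
  by move=> y; have := IH y; congr (Rabs _ <= _); ring.
rewrite (avg_add aB) // ?(avg_scal aB) // in H; last exact: QL_scal.
move: H step => /Rabs_leD h1 /Rabs_leD h2; apply: Rabs_le; lra.
Qed.

Lemma exists_walk_scale S rmax : 0 < S -> 0 < rmax -> exists r j, [/\ 0 < r, r <= rmax & INR j * walk_variance r = S].
Proof.
move=> S0 r0; have m0 := walk_mass_gt0.
have [n Hn] := archi_inv (eps := rmax * rmax / (2 * walk_mass * S)) ltac:(apply: Rdiv_lt_0_compat; nra).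
have n0 := pos_INR n.
set r := sqrt (2 * walk_mass * S / (INR n + 1)).
have q0 : 0 < 2 * walk_mass * S / (INR n + 1) by apply: Rdiv_lt_0_compat; [nra|lra].
have rr : r * r = 2 * walk_mass * S / (INR n + 1) by apply: sqrt_sqrt; lra.
exists r, n.+1; split.
- exact: sqrt_lt_R0.
- apply: Rsqr_incr_0_var; last lra.
  rewrite /Rsqr rr.
  have -> : rmax * rmax = (2 * walk_mass * S) * (rmax * rmax / (2 * walk_mass * S)) by field; nra.
  apply: Rmult_le_compat_l; [nra|lra].
- rewrite S_INR /walk_variance rr; field; lra.
Qed.

(* Viscosity inequalities for the constant-coefficient operator [sum_w (w . grad)^2] survive averaging. *)
Lemma viscosity_mollify f L d lo B x0 cF DF D2F :
  0 < d -> 0 <= L -> 0 < B -> Lip L f -> 0 <= cF -> C2L cF (mollify d (mollify d f)) DF D2F ->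
  (forall x p X, symmetric X -> ell_superjet f x p X ->
     lo - B * dot (vsub x x0) (vsub x x0) <= \big[Rplus/0]_(w <- D) quad X w) ->
  lo - 2 * INR N * B * d * d <= \big[Rplus/0]_(w <- D) quad (fun i j => D2F i j x0) w.
Proof.
move=> d0 L0 B0 Lf cF0 CF visc; rewrite -/(directional_laplacian D2F x0).
apply: Rle_plus_epsilon => e e0.
set A := fun f => mollify d (mollify d f).
have aA : averaging A by apply: averaging_comp; exact: averaging_mollify.
have Qf := Lip_QL L0 Lf.
have QF : QL (A f) by exact: (avg_QL aA).
set e1 := e / 8; have e10 : 0 < e1 by rewrite /e1; lra.
set CL := cF * (INR N * INR N) * dir_norm2.
have S20 := dir_norm2_ge0; have S30 := dir_norm3_ge0; have S10 := dir_norm1_ge0; have N0 := pos_INR N.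
set K1 := CL * CL / (4 * e1) * (2 * dir_norm2) + 2 * B * dir_norm2 + 1.
have K10 : 0 < K1.
  have : 0 <= CL * CL / (4 * e1) * (2 * dir_norm2).
    apply: Rmult_le_pos; last lra; apply: Rmult_le_pos; [nra|apply: Rlt_le; apply: Rinv_0_lt_compat; lra].
  rewrite /K1; nra.
(* The order of choices matters: the horizon [S] is fixed by [e], the smoothing width [d'] by [S],
   and the step [r] last, since the constant [c] of [g] depends on [d']. *)
set S := e1 / K1; have S0 : 0 < S by exact: Rdiv_lt_0_compat.
have SK : S * K1 = e1 by rewrite /S; field; lra.
set d' := e1 * S / (4 * INR N * L + 1) / 4.
have den : 0 < 4 * INR N * L + 1 by nra.
have d'0 : 0 < d' by rewrite /d'; apply: Rdiv_lt_0_compat; [apply: Rdiv_lt_0_compat => //; nra|lra].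
set eta := 2 * INR N * L * d'.
have eta0 : 0 <= eta by rewrite /eta; apply: Rmult_le_pos; [nra|lra].
have eta1 : 2 * eta <= e1 * S.
  have : d' * (4 * INR N * L + 1) = e1 * S / 4 by rewrite /d'; field; lra.
  rewrite /eta; nra.
have [c [c0 [Dg [D2 Cg0]]]] := mollify2_C2 d'0 L0 Lf.
have aM := averaging_mollify (N := N) d'0.
set g := fun y => mollify d' (mollify d' f) y + eta.
have LM := avg_Lip aM L0 Lf.
have close y : Rabs (mollify d' (mollify d' f) y - f y) <= eta.
  have /Rabs_leD h1 := mollify_close y d'0 L0 LM.
  have /Rabs_leD h2 := mollify_close y d'0 L0 Lf.
  by apply: Rabs_le; rewrite /eta; lra.
have Lg : Lip L g.
  move=> x y; rewrite /g; have := avg_Lip aM L0 LM x y; congr (Rabs _ <= _); ring.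
have Cg : C2L c g Dg D2.
  case: Cg0 => h1 h2 h3 h4; split => // x h; rewrite /g; have := h4 x h; congr (Rabs _ <= _); ring.
have fg y : f y <= g y by rewrite /g; have /Rabs_leD := close y; lra.
have gf y : g y <= f y + 2 * eta by rewrite /g; have /Rabs_leD := close y; lra.
set K2 := 2 * cF * dir_norm3 + c * (2 * dir_norm3 + INR N * INR N * dir_norm2 * dir_norm1) + 1.
have K20 : 0 < K2.
  have : 0 <= cF * dir_norm3 by nra.
  have : 0 <= c * (2 * dir_norm3 + INR N * INR N * dir_norm2 * dir_norm1).
    apply: Rmult_le_pos => //; apply: Rplus_le_le_0_compat; first lra.
    by apply: Rmult_le_pos => //; apply: Rmult_le_pos => //; nra.
  rewrite /K2; lra.
have [r [j [r0 rm Sj]]] := exists_walk_scale S0 (Rdiv_lt_0_compat _ _ e10 K20).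
have rK : r * K2 <= e1.
  have : e1 / K2 * K2 = e1 by field; lra.
  nra.
have H := walk_comparison j r0 L0 c0 B0 Lf Lg Cg visc fg.
rewrite Sj in H.
set er := r * c * _ in H.
have aT := averaging_walk r; have aj := averaging_iter j aT.
have Qg := Lip_QL L0 Lg.
have Qq := QL_sqdist x0 : QL (fun y : vec N => _).
have Q1 : QL (fun y => S * B * dot (vsub y x0) (vsub y x0) + (- (S * lo) + S * (er + S * (2 * B * dir_norm2)))).
  by apply: QL_add; [exact: QL_scal|exact: QL_const].
have Q2 : QL (fun y => iter j (walk r) g y + (S * B * dot (vsub y x0) (vsub y x0) + (- (S * lo) + S * (er + S * (2 * B * dir_norm2))))).
  by apply: QL_add => //; exact: (avg_QL aj).
(* Averaging the comparison and moving [A] inside the walk leaves the walk applied to [A g], hence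
   up to [2 eta] to [A f], whose expansion at [x0] is known. Dividing by [S] then gives the
   claim. *)
have HA : A f x0 <= A (fun y => iter j (walk r) g y + (S * B * dot (vsub y x0) (vsub y x0) + (- (S * lo) + S * (er + S * (2 * B * dir_norm2))))) x0.
  by apply: (avg_le aA) => // y; have := H y; lra.
rewrite (avg_add aA) // in HA; last exact: (avg_QL aj).
rewrite (avg_addc aA) in HA; last exact: QL_scal.
rewrite (avg_scal aA) // in HA.
rewrite (walk_iter_avg_comm r j x0 aA Qg) in HA.
have mq : A (fun y => dot (vsub y x0) (vsub y x0)) x0 <= 2 * INR N * d * d.
  have sc : semiconvex 2 (fun y => - dot (vsub y x0) (vsub y x0)).
    by move=> y h; right; rewrite !dotE (dotC h y) (dotC h x0); ring.
  have aMd := averaging_mollify (N := N) d0.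
  have walk_mass y := @mollify_le N d 2 _ y d0 ltac:(lra) Qq sc.
  have m2 : A (fun y => dot (vsub y x0) (vsub y x0)) x0 <= mollify d (fun y => dot (vsub y x0) (vsub y x0) + INR N * d * d) x0.
    apply: (avg_le aMd); [exact: (avg_QL aMd)|by apply: QL_add => //; exact: QL_const|].
    by move=> y; have := walk_mass y; lra.
  rewrite (avg_addc aMd) // in m2.
  have := walk_mass x0; have -> : vsub x0 x0 = zerov by vring.
  rewrite dot0l; lra.
have Ag y : A g y <= A f y + 2 * eta.
  rewrite -(avg_addc aA) //; apply: (avg_le aA) => //.
  by apply: QL_add => //; exact: QL_const.
have TjA : iter j (walk r) (A g) x0 <= iter j (walk r) (A f) x0 + 2 * eta.
  rewrite -(avg_addc aj) //; apply: (avg_le aj) => //; first exact: (avg_QL aA).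
  by apply: QL_add => //; exact: QL_const.
have := walk_iter_upper x0 j r0 cF0 e10 QF CF; rewrite -/CL Sj.
move=> U.
have SB : S * B * A (fun y => dot (vsub y x0) (vsub y x0)) x0 <= S * B * (2 * INR N * d * d).
  by apply: Rmult_le_compat_l => //; nra.
have fin : S * (lo - 2 * INR N * B * d * d) <= S * (directional_laplacian D2F x0 + e).
  have k1 : S * (CL * CL / (4 * e1) * (S * (2 * dir_norm2))) + S * (S * (2 * B * dir_norm2)) <= S * e1.
    have : S * e1 = S * (S * K1) by rewrite SK.
    rewrite /K1; have := Rmult_lt_0_compat _ _ S0 S0; lra.
  have k2 : S * (2 * cF * r * dir_norm3) + S * er <= S * e1.
    rewrite -Rmult_plus_distr_l; apply: Rmult_le_compat_l; first lra.
    apply: Rle_trans rK; rewrite /K2 /er; lra.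
  have k3 : S * e1 * 8 = S * e by rewrite /e1; field.
  have k4 : 0 <= S * e1 by nra.
  lra.
by apply: (Rmult_le_reg_l S).
Qed.
End RandomWalk.

(** * Jets, sup-convolutions and frozen coefficients *)

Section Jets.
Context {N : nat}.
Implicit Types (f g : vec N -> R) (x y z h p q w : vec N) (X : mat N).

Lemma quad_bound X : exists c, 0 <= c /\ forall h, Rabs (quad X h) <= c * dot h h.
Proof.
exists (\big[Rplus/0]_(i < N) \big[Rplus/0]_(j < N) Rabs (X i j)); split.
  by apply: sum_ge0 => i; apply: sum_ge0 => j; exact: Rabs_pos.
move=> h; apply: Rle_trans (Rabs_sum _ _) _.
rewrite Rmult_comm -sumZ; apply: sum_le => i; apply: Rle_trans (Rabs_sum _ _) _.
rewrite -sumZ; apply: sum_le => j; rewrite !Rabs_mult -vnorm_mul.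
have h1 := coord_le h i; have h2 := coord_le h j; have h0 := vnorm_ge0 h.
have -> : Rabs (h i) * Rabs (X i j) * Rabs (h j) = Rabs (h i) * Rabs (h j) * Rabs (X i j) by ring.
apply: Rmult_le_compat_r; first exact: Rabs_pos.
by apply: Rmult_le_compat => //; exact: Rabs_pos.
Qed.

Lemma small_scale_le (a b d : R) : 0 < d -> (forall t, 0 < t < d -> t * a <= t * t * b) -> a <= 0.
Proof.
move=> d0 H; apply: Rnot_lt_le => a0.
have b0 := Rabs_pos b; have b1 := Rle_abs b.
set t := Rmin (d / 2) (a / (2 * (Rabs b + 1))).
have t0 : 0 < t by apply: Rmin_glb_lt; [lra|apply: Rdiv_lt_0_compat; lra].
have t1 : t <= d / 2 by exact: Rmin_l.
have t2 : t <= a / (2 * (Rabs b + 1)) by exact: Rmin_r.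
have E : a / (2 * (Rabs b + 1)) * (2 * (Rabs b + 1)) = a by field; lra.
have := H t ltac:(lra).
have h1 : t * b <= t * (Rabs b + 1) by apply: Rmult_le_compat_l; lra.
have h2 : t * (2 * (Rabs b + 1)) <= a by rewrite -E; apply: Rmult_le_compat_r; lra.
have h3 : t * (t * b) <= t * (a / 2) by apply: Rmult_le_compat_l; lra.
have h4 : 0 < t * a by exact: Rmult_lt_0_compat.
lra.
Qed.

Lemma jet_grad_unique f x p q X k : ell_superjet f x p X ->
  (forall h, f x + dot q h - k * dot h h <= f (vadd x h)) -> p = q.
Proof.
move=> sj lowr; have [c [c0 Xc]] := quad_bound X.
have [d [d0 Hd]] := sj 1 Rlt_0_1.
have [w Ew] : exists w, w = vsub q p by exists (vsub q p).
have w0 : dot w w <= 0.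
  have wn := vnorm_ge0 w.
  have d'0 : 0 < d / (vnorm w + 1) by apply: Rdiv_lt_0_compat; lra.
  apply: (small_scale_le (b := (/ 2 * c + 1 + k) * dot w w) d'0) => t [t0 t1].
  have tw : t * vnorm w < d.
    have : d / (vnorm w + 1) * (vnorm w + 1) = d by field; lra.
    nra.
  have := Hd (vadd x (vscal t w)); have -> : vsub (vadd x (vscal t w)) x = vscal t w by vring.
  rewrite vnorm_sq vnormZ (Rabs_pos_eq t) ?quadZ; last lra.
  move=> /(_ tw); have := lowr (vscal t w); rewrite !dotE => h1 h2.
  have /Rabs_leD [_ h3] := Xc w.
  have E : t * dot q w - t * dot p w = t * dot w w by rewrite -Rmult_minus_distr_l -dotBl -Ew.
  have : t * t * quad X w <= t * t * (c * dot w w) by apply: Rmult_le_compat_l => //; nra.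
  lra.
have /vnorm_eq0 wz : vnorm w = 0 by have := vnorm_mul w; have := vnorm_ge0 w; nra.
apply: functional_extensionality => i; have := equal_f wz i; rewrite Ew /vsub /zerov; lra.
Qed.

Lemma jet_hess_ge f x p X k h : ell_superjet f x p X ->
  (forall h, f x + dot p h - k / 2 * dot h h <= f (vadd x h)) -> - k * dot h h <= quad X h.
Proof.
move=> sj lowr; apply: Rle_plus_epsilon => e e0.
have hn := vnorm_ge0 h; have hq := dot_ge0 h.
have e1 : 0 < e / (2 * (dot h h + 1)) by apply: Rdiv_lt_0_compat; lra.
have [d [d0 Hd]] := sj _ e1.
set t := d / (2 * (vnorm h + 1)).
have t0 : 0 < t by apply: Rdiv_lt_0_compat; lra.
have th : t * vnorm h < d.
  have : t * (2 * (vnorm h + 1)) = d by rewrite /t; field; lra.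
  nra.
have := Hd (vadd x (vscal t h)); have -> : vsub (vadd x (vscal t h)) x = vscal t h by vring.
rewrite vnorm_sq vnormZ (Rabs_pos_eq t) ?quadZ; last lra.
move=> /(_ th); have := lowr (vscal t h); rewrite !dotE => h1 h2.
have E : e / (2 * (dot h h + 1)) * dot h h <= e / 2.
  have : e / (2 * (dot h h + 1)) * (dot h h + 1) = e / 2 by field; lra.
  lra.
have tt : 0 < t * t by exact: Rmult_lt_0_compat.
apply: (Rmult_le_reg_l (t * t)) => //.
have := Rmult_le_compat_l _ _ _ (Rlt_le _ _ tt) E; lra.
Qed.

Lemma superjet_Lip f L x p X : 0 <= L -> Lip L f -> ell_superjet f x p X -> vnorm p <= L.
Proof.
move=> L0 Lf sj; have [c [c0 Xc]] := quad_bound X.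
have [d [d0 Hd]] := sj 1 Rlt_0_1.
have pn := vnorm_ge0 p.
have [pz|pz] := Req_dec (vnorm p) 0; first lra.
have d'0 : 0 < d / (vnorm p + 1) by apply: Rdiv_lt_0_compat; lra.
suff : vnorm p * vnorm p - L * vnorm p <= 0 by move=> h; apply: (Rmult_le_reg_r (vnorm p)); lra.
apply: (small_scale_le (b := (/ 2 * c + 1) * dot p p) d'0) => t [t0 t1].
have tw : t * vnorm p < d.
  have : d / (vnorm p + 1) * (vnorm p + 1) = d by field; lra.
  nra.
have := Hd (vadd x (vscal (- t) p)); have := Lf (vadd x (vscal (- t) p)) x.
have -> : vsub (vadd x (vscal (- t) p)) x = vscal (- t) p by vring.
rewrite vnorm_sq vnormZ Rabs_Ropp (Rabs_pos_eq t) ?quadZ; last lra.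
move=> /Rabs_leD [h1 _] /(_ tw); rewrite !dotE vnorm_mul => h2.
have /Rabs_leD [_ h3] := Xc p.
have : t * t * quad X p <= t * t * (c * dot p p) by apply: Rmult_le_compat_l => //; nra.
lra.
Qed.

Lemma subjet_opp f x p X : ell_subjet f x p X ->
  ell_superjet (fun y => - f y) x (vscal (-1) p) (fun i j => (-1) * X i j).
Proof.
move=> sj e e0; have [d [d0 H]] := sj e e0; exists d; split => // y hy.
have := H y hy; rewrite dotZl quad_matZ; lra.
Qed.

(** The maximizers [m] are exposed because doubling of variables takes its second point from
    them. *)
Lemma sup_convolution_argmax k L f : 0 < k -> 0 <= L -> Lip L f ->
  exists g m, [/\ Lip L g, forall x, g x = f (m x) - k / 2 * dot (vsub (m x) x) (vsub (m x) x) &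
    forall x y, f y - k / 2 * dot (vsub y x) (vsub y x) <= g x].
Proof.
move=> k0 L0 Lf; have Qf := Lip_QL L0 Lf.
have /choice [m Hm] : forall x, exists m, forall y,
    f y - k / 2 * dot (vsub y x) (vsub y x) <= f m - k / 2 * dot (vsub m x) (vsub m x).
  move=> x; apply: (@coercive_max N (fun y => f y - k / 2 * dot (vsub y x) (vsub y x)) x x (2 * L / k)).
    have := QL_add Qf (QL_scal (- (k / 2)) (QL_sqdist x)); congr QL.
    by apply: functional_extensionality => y; ring.
  move=> y hy; have /Rabs_leD [_ h1] := Lf y x.
  have -> : vsub x x = zerov by vring.
  rewrite dot0l -vnorm_mul; set a := vnorm (vsub y x) in hy h1 *.
  have E : 2 * L / k * k = 2 * L by field; lra.
  have a0 : 0 <= a by exact: vnorm_ge0.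
  have : 2 * L <= k * a by nra.
  nra.
exists (fun x => f (m x) - k / 2 * dot (vsub (m x) x) (vsub (m x) x)), m; split => //.
suff H x y : f (m x) - k / 2 * dot (vsub (m x) x) (vsub (m x) x) <=
    f (m y) - k / 2 * dot (vsub (m y) y) (vsub (m y) y) + L * vnorm (vsub x y).
  move=> x y; have := H x y; have := H y x; rewrite (vnorm_subC y x) => h1 h2; apply: Rabs_le; lra.
have := Hm y (vadd (m x) (vsub y x)).
have -> : vsub (vadd (m x) (vsub y x)) y = vsub (m x) x by vring.
have /Rabs_leD [h _] := Lf (vadd (m x) (vsub y x)) (m x).
have E : vsub (vadd (m x) (vsub y x)) (m x) = vsub y x by vring.
rewrite E (vnorm_subC y x) in h; lra.
Qed.

(** Superjets pass, with the same gradient and Hessian, to the point where the supremum is attained.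
    The gradient determines that point: it is [x + p / k]. *)
Lemma sup_convolution k L f : 0 < k -> 0 <= L -> Lip L f ->
  exists g, [/\ Lip L g, semiconvex k g, forall x, f x <= g x,
    forall x, g x <= f x + L * L / (2 * k) &
    forall x p X, ell_superjet g x p X ->
      [/\ forall h, g x + dot p h - k / 2 * dot h h <= g (vadd x h),
          ell_superjet f (vadd x (vscal (/ k) p)) p X &
          vnorm p <= L]].
Proof.
move=> k0 L0 Lf; have [g [m [Lg gE gge]]] := sup_convolution_argmax k0 L0 Lf.
have fg x : f x <= g x.
  by have := gge x x; have -> : vsub x x = zerov by [vring]; rewrite dot0l; lra.
have low x h : g x + k * dot (vsub (m x) x) h - k / 2 * dot h h <= g (vadd x h).
  have := gge (vadd x h) (m x); rewrite (gE x) !dotE.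
  rewrite (dotC h (m x)) (dotC x h) (dotC h x) (dotC x (m x)); lra.
exists g; split => //.
- move=> x h; have := low x h; have := low x (vscal (-1) h); rewrite !dotE.
  have -> : vadd x (vscal (-1) h) = vsub x h by vring.
  lra.
- move=> x; rewrite gE; have /Rabs_leD [_ h] := Lf (m x) x; rewrite -vnorm_mul.
  set a := vnorm _ in h *.
  have -> : L * L / (2 * k) = L * a - k / 2 * (a * a) + / (2 * k) * ((L - k * a) * (L - k * a)) by field; lra.
  have : 0 <= / (2 * k) * ((L - k * a) * (L - k * a)).
    by apply: Rmult_le_pos; [apply: Rlt_le; apply: Rinv_0_lt_compat; lra|exact: Rle_0_sqr].
  lra.
move=> x p X sj.
have pE : p = vscal k (vsub (m x) x).
  by apply: (jet_grad_unique (k := k / 2) sj) => h; rewrite dotZl; exact: low.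
have mE : vadd x (vscal (/ k) p) = m x.
  rewrite pE; apply: functional_extensionality => i; rewrite /vadd /vscal /vsub; field; lra.
split.
- by move=> h; rewrite pE dotZl; exact: low.
- rewrite mE => e e0; have [d [d0 H]] := sj e e0; exists d; split => // y.
  have E : vsub y (m x) = vsub (vadd x (vsub y (m x))) x by vring.
  rewrite {1}E => /H; rewrite -E => hy.
  have := gge (vadd x (vsub y (m x))) y; rewrite (gE x) in hy.
  have -> : vsub y (vadd x (vsub y (m x))) = vsub (m x) x by vring.
  lra.
- exact: superjet_Lip Lg sj.
Qed.

Lemma psd_young X R0 a b : symmetric X -> (forall h, 0 <= quad X h) -> 0 < R0 ->
  quad X (vadd a b) <= (1 + R0) * quad X a + (1 + / R0) * quad X b.
Proof.
move=> sX pos R00; have := pos (vsub (vscal R0 a) b).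
rewrite !quadE !mulvB !mulvD !mulvZ !dotE (mulv_sym b a sX) (dotC (mulv X b) a) => h.
have i0 : 0 < / R0 by exact: Rinv_0_lt_compat.
have E : / R0 * R0 = 1 by field; lra.
have := Rmult_le_compat_l _ _ _ (Rlt_le _ _ i0) h.
set aa := dot a (mulv X a); set ab := dot a (mulv X b); set bb := dot b (mulv X b).
have -> : / R0 * (R0 * (R0 * aa) - R0 * ab - (R0 * ab - bb)) = (/ R0 * R0) * (R0 * aa) - (/ R0 * R0) * (2 * ab) + / R0 * bb by ring.
rewrite E; lra.
Qed.

(** In a nonnegative form the diagonal entries dominate the others, so the trace controls every
    direction. *)
Lemma psd_trace X h : symmetric X -> (forall h, 0 <= quad X h) ->
  quad X h <= INR N * dot h h * \big[Rplus/0]_(i < N) quad X (ei i).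
Proof.
move=> sX pos.
have XE i j : dot (ei i) (mulv X (ei j)) = X i j.
  rewrite dot_eil /mulv (bigD1 j) //= big1 /ei ?eqxx; first exact: etrans (Rplus_0_r _) (Rmult_1_r _).
  by move=> l /negbTE ->; ring.
have Xd i : quad X (ei i) = X i i by rewrite quadE XE.
have d0 i : 0 <= X i i by rewrite -Xd.
have off i j : Rabs (X i j) <= / 2 * (X i i + X j j).
  have := pos (vadd (ei i) (ei j)); have := pos (vsub (ei i) (ei j)).
  rewrite !quadE mulvB mulvD !dotE !XE (sX j i) => h1 h2; apply: Rabs_le; lra.
set T := \big[Rplus/0]_(i < N) _.
have TE : T = \big[Rplus/0]_(i < N) X i i by apply: eq_bigr => i _; exact: Xd.
have -> : INR N * dot h h * T = \big[Rplus/0]_(i < N) \big[Rplus/0]_(j < N) (dot h h * (/ 2 * (X i i + X j j))).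
  transitivity (\big[Rplus/0]_(i < N) (dot h h * / 2 * (INR N * X i i + T))).
    rewrite sumZ sumD sumZ -TE sum_const /index_enum -enumT size_enum_ord; field.
  apply: eq_bigr => i _; rewrite sumZ sumZ sumD -TE sum_const /index_enum -enumT size_enum_ord; ring.
apply: sum_le => i; apply: sum_le => j.
have h1 := coord_le h i; have h2 := coord_le h j; have hn := vnorm_ge0 h.
apply: Rle_trans (Rle_abs _) _; rewrite !Rabs_mult -vnorm_mul.
have -> : Rabs (h i) * Rabs (X i j) * Rabs (h j) = Rabs (h i) * Rabs (h j) * Rabs (X i j) by ring.
apply: Rmult_le_compat => //; try exact: Rabs_pos.
  by apply: Rmult_le_pos; exact: Rabs_pos.
by apply: Rmult_le_compat => //; exact: Rabs_pos.
Qed.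

Definition frob2 (s : mat N) := \big[Rplus/0]_(k < N) dot (col s k) (col s k).
(* The paper's [tr(s s^T X)], expanded along the columns of [s]. *)
Definition tr2 (s X : mat N) := \big[Rplus/0]_(k < N) quad X (col s k).

Lemma frob2_sq s : frob2 s = mnorm s * mnorm s.
Proof. by rewrite /frob2 -mnorm_sq; ring. Qed.

Lemma tr2_young X R0 s s' : symmetric X -> (forall h, 0 <= quad X h) -> 0 < R0 ->
  tr2 s' X <= (1 + R0) * tr2 s X +
    (1 + / R0) * (INR N * frob2 (msub s' s) * \big[Rplus/0]_(i < N) quad X (ei i)).
Proof.
move=> sX pos R00.
set T := \big[Rplus/0]_(i < N) quad X (ei i).
have -> : (1 + R0) * tr2 s X + (1 + / R0) * (INR N * frob2 (msub s' s) * T) =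
  \big[Rplus/0]_(k < N) ((1 + R0) * quad X (col s k) + (1 + / R0) * (INR N * T * dot (col (msub s' s) k) (col (msub s' s) k))).
  rewrite sumD !sumZ -/(tr2 s X) -/(frob2 (msub s' s)); ring.
apply: sum_le => k.
have -> : col s' k = vadd (col s k) (col (msub s' s) k).
  apply: functional_extensionality => i; rewrite /col /vadd /msub; ring.
apply: Rle_trans (psd_young _ _ sX pos R00) _.
apply: Rplus_le_compat_l; apply: Rmult_le_compat_l.
  by have := Rinv_0_lt_compat _ R00; lra.
by have := psd_trace (col (msub s' s) k) sX pos; rewrite -/T; lra.
Qed.

Lemma tr2_idm s : tr2 s idm = frob2 s.
Proof. by apply: eq_bigr => k _; exact: quad_idm. Qed.

(** Directions of a constant-coefficient operator that, for nonnegative [X], dominates [tr2 s' X]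
    for all [s'] within order [R0] of [s]: the columns of [s] slightly stretched, plus every
    coordinate direction with weight [a R0]. *)
Definition frozen_dirs R0 a (s : mat N) : seq (vec N) :=
  [seq vscal (sqrt (1 + R0)) (col s k) | k <- index_enum 'I_N] ++ [seq vscal (sqrt (a * R0)) (ei i) | i <- index_enum 'I_N].

Lemma frozen_dirs_sum R0 a s X : 0 <= R0 -> 0 <= a ->
  \big[Rplus/0]_(w <- frozen_dirs R0 a s) quad X w =
  (1 + R0) * tr2 s X + a * R0 * \big[Rplus/0]_(i < N) quad X (ei i).
Proof.
move=> R00 a0; rewrite /frozen_dirs big_cat !big_map /=; congr (_ + _); rewrite -sumZ.
  by apply: eq_bigr => k _; rewrite quadZ sqrt_sqrt //; lra.
by apply: eq_bigr => k _; rewrite quadZ sqrt_sqrt //; nra.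
Qed.

Lemma frob2_sub s s' : frob2 (msub s s') = frob2 (msub s' s).
Proof. by apply: eq_bigr => k _; apply: eq_bigr => i _; rewrite /col /msub; ring. Qed.

Lemma sum_quad_idm : \big[Rplus/0]_(i < N) quad idm (ei i : vec N) = INR N.
Proof.
rewrite (eq_bigr (fun _ => 1)); last by move=> i _; rewrite quad_idm dot_ei.
rewrite sum_const /index_enum -enumT size_enum_ord; ring.
Qed.

(* Freezing the coefficients at [s] costs a multiple of [R0], thanks to the extra coordinate directions. *)
Lemma frozen_operator X k R0 b Cs s s' : symmetric X -> (forall h, - k * dot h h <= quad X h) ->
  0 <= k -> 0 < R0 -> R0 <= 1 -> 0 <= b -> mnorm s' <= Cs -> mnorm (msub s' s) <= b * R0 ->
  tr2 s' X - k * R0 * (3 * (Cs * Cs) + 3 * (2 * INR N * b * b) * INR N) <=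
  \big[Rplus/0]_(w <- frozen_dirs R0 (2 * INR N * b * b) s) quad X w.
Proof.
move=> sX low k0 R00 R01 b0 s'C sb; have N0 := pos_INR N.
set a := 2 * INR N * b * b; have a0 : 0 <= a by rewrite /a; nra.
rewrite frozen_dirs_sum; [|lra|by []].
set T := \big[Rplus/0]_(i < N) quad X (ei i).
have fe : frob2 (msub s' s) <= b * b * (R0 * R0).
  rewrite frob2_sq; have := sqrt_pos (\big[Rplus/0]_(i < N) \big[Rplus/0]_(j < N) (msub s' s i j * msub s' s i j)).
  rewrite -/(mnorm (msub s' s)) => h; have : 0 <= b * R0 by nra.
  nra.
have fC : frob2 s' <= Cs * Cs.
  rewrite frob2_sq; have := sqrt_pos (\big[Rplus/0]_(i < N) \big[Rplus/0]_(j < N) (s' i j * s' i j)).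
  rewrite -/(mnorm s'); nra.
have fs0 : 0 <= frob2 s' by apply: sum_ge0 => i; exact: dot_ge0.
have fe0 : 0 <= frob2 (msub s' s) by apply: sum_ge0 => i; exact: dot_ge0.
have IR : 0 < 1 + / R0 by have := Rinv_0_lt_compat _ R00; lra.
have E : (1 + / R0) * (R0 * R0) = R0 * R0 + R0 by field; lra.
have fe2 : (1 + / R0) * (INR N * frob2 (msub s' s)) <= a * R0.
  apply: (Rle_trans _ ((1 + / R0) * (INR N * (b * b * (R0 * R0))))).
    by apply: Rmult_le_compat_l; [lra|exact: Rmult_le_compat_l].
  have -> : (1 + / R0) * (INR N * (b * b * (R0 * R0))) = INR N * b * b * ((1 + / R0) * (R0 * R0)) by ring.
  rewrite E /a; have q0 : 0 <= INR N * b * b by nra.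
  have q1 : R0 * R0 + R0 <= 2 * R0 by nra.
  have := Rmult_le_compat_l _ _ _ q0 q1; lra.
(* Shifting by [k] times the identity gives a nonnegative form, to which the trace estimates apply;
   undoing the shift produces the terms in [k]. *)
set Xt : mat N := fun i j => X i j + k * idm i j.
have sXt : symmetric Xt by move=> i j; rewrite /Xt sX idm_sym.
have Xtq h : quad Xt h = quad X h + k * dot h h by rewrite quad_matD quad_matZ quad_idm.
have pos h : 0 <= quad Xt h by rewrite Xtq; have := low h; lra.
have tXt (q : mat N) : tr2 q Xt = tr2 q X + k * frob2 q.
  by rewrite /tr2 /frob2 -sumZ -sumD; apply: eq_bigr => i _.
have TXt : \big[Rplus/0]_(i < N) quad Xt (ei i) = T + k * INR N.
  rewrite -sum_quad_idm /T -sumZ -sumD; apply: eq_bigr => i _; by rewrite Xtq quad_idm.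
have T0 : 0 <= T + k * INR N by rewrite -TXt; apply: sum_ge0 => i.
have := tr2_young s s' sXt pos R00; rewrite !tXt TXt => h1.
have h2 : (1 + / R0) * (INR N * frob2 (msub s' s) * (T + k * INR N)) <= a * R0 * (T + k * INR N).
  by rewrite -Rmult_assoc; apply: Rmult_le_compat_r.
have posI (h : vec N) : 0 <= quad idm h by rewrite quad_idm; exact: dot_ge0.
have := tr2_young s' s idm_sym posI R00; rewrite !tr2_idm sum_quad_idm frob2_sub => h3.
have h4 : (1 + / R0) * (INR N * frob2 (msub s' s) * INR N) <= a * R0 * INR N.
  by rewrite -Rmult_assoc; apply: Rmult_le_compat_r.
have h5 : (1 + R0) * frob2 s - frob2 s' <= R0 * (3 * (Cs * Cs) + 2 * a * INR N).
  have : (1 + R0) * frob2 s <= (1 + R0) * ((1 + R0) * frob2 s' + a * R0 * INR N) by apply: Rmult_le_compat_l; lra.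
  have : R0 * frob2 s' <= R0 * (Cs * Cs) by apply: Rmult_le_compat_l; lra.
  have : R0 * R0 * frob2 s' <= R0 * (Cs * Cs) by apply: Rmult_le_compat => //; nra.
  have aN : 0 <= a * INR N by exact: Rmult_le_pos.
  have : R0 * (a * R0 * INR N) <= R0 * (a * INR N) by apply: Rmult_le_compat_l; nra.
  lra.
have := Rmult_le_compat_l _ _ _ k0 h5; lra.
Qed.

Lemma frozen_lower X k R0 a Cs s : (forall h, - k * dot h h <= quad X h) ->
  0 <= k -> 0 < R0 -> R0 <= 1 -> 0 <= a -> mnorm s <= Cs ->
  - (k * (2 * (Cs * Cs) + a * INR N)) <= \big[Rplus/0]_(w <- frozen_dirs R0 a s) quad X w.
Proof.
move=> low k0 R00 R01 a0 sC; have N0 := pos_INR N.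
rewrite frozen_dirs_sum; [|lra|by []].
have fC : frob2 s <= Cs * Cs.
  rewrite frob2_sq; have := sqrt_pos (\big[Rplus/0]_(i < N) \big[Rplus/0]_(j < N) (s i j * s i j)).
  rewrite -/(mnorm s); nra.
have fs0 : 0 <= frob2 s by apply: sum_ge0 => i; exact: dot_ge0.
have h1 : - k * frob2 s <= tr2 s X by rewrite /frob2 -sumZ; apply: sum_le => i.
have h2 : - k * INR N <= \big[Rplus/0]_(i < N) quad X (ei i).
  rewrite -sum_quad_idm -sumZ; apply: sum_le => i; rewrite quad_idm; exact: low.
have h3 : (1 + R0) * (- k * frob2 s) <= (1 + R0) * tr2 s X by apply: Rmult_le_compat_l; lra.
have h4 : a * R0 * (- k * INR N) <= a * R0 * \big[Rplus/0]_(i < N) quad X (ei i) by apply: Rmult_le_compat_l; nra.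
have h5 : k * ((1 + R0) * frob2 s) <= k * (2 * (Cs * Cs)) by apply: Rmult_le_compat_l => //; nra.
have h6 : a * (k * INR N) * R0 <= a * (k * INR N) * 1.
  apply: Rmult_le_compat_l => //; apply: Rmult_le_pos => //; nra.
lra.
Qed.
End Jets.

(** * Semiconvex functions whose average is touched from above *)

Section Touching.
Context {N : nat}.
Implicit Types (f g : vec N -> R) (x y z h p q w : vec N) (X : mat N).

Section Fixed.
Variables (k K d : R) (f : vec N -> R) (x0 p0 : vec N).
Hypotheses (k0 : 0 < k) (K0 : 0 <= K) (d0 : 0 < d) (Qf : QL f) (sf : semiconvex k f).
Let F := mollify d (mollify d f).
Hypothesis touch : forall h, F (vadd x0 h) <= F x0 + dot p0 h + K * dot h h.

(** The constant comes from averaging twice the paraboloid [G] of [touched_center]: it is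
    [N k + 4 N q] with [q = 2 K + k / 2]. *)
Definition touchC := INR N * (8 * K + 3 * k).

Lemma mollify2_ge x : f x - INR N * k * d * d <= F x.
Proof.
have aM := averaging_mollify (N := N) d0.
have h1 y := mollify_ge y d0 (Rlt_le _ _ k0) Qf sf.
have h2 : mollify d (fun y => f y + (- (INR N * (k * d * d / 2)))) x <= F x.
  apply: (avg_le aM) => [||y]; [by apply: QL_add => //; exact: QL_const|exact: (avg_QL aM)|].
  by have := h1 y; lra.
rewrite (avg_addc aM) // in h2; have := h1 x; lra.
Qed.

(* A convex function whose average is touched from above by a paraboloid is itself close to affine. *)
Lemma touched_center : F x0 - touchC * d * d <= f x0.
Proof.
have N0 := pos_INR N.
have aM := averaging_mollify (N := N) d0.
set q := 2 * K + k / 2.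
set G := fun y => (/ 2 * f x0 + / 2 * F x0 + / 2 * (INR N * k * d * d)) + dot p0 (vsub y x0) + q * dot (vsub y x0) (vsub y x0).
(* [y] is the midpoint of [x0] and its reflection [2 y - x0], so semiconvexity bounds [f y] by half
   of [f x0] plus half of the touching paraboloid at twice the distance. Averaging then bounds
   [F x0] by the mean of [F x0] and [f x0] up to order [d^2]. *)
have fG y : f y <= G y.
  have := sf y (vsub y x0).
  have -> : vsub y (vsub y x0) = x0 by vring.
  have := touch (vscal 2 (vsub y x0)); have := mollify2_ge (vadd x0 (vscal 2 (vsub y x0))).
  have -> : vadd x0 (vscal 2 (vsub y x0)) = vadd y (vsub y x0) by vring.
  rewrite dotZr dotZl dotZr /G /q; lra.
have QG : QL G.
  apply: QL_add; first exact: QL_affine.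
  by apply: QL_scal; exact: QL_sqdist.
have q0 : 0 <= 2 * q by rewrite /q; lra.
have sG : semiconvex (2 * q) (fun y => - G y).
  move=> y h; right; rewrite /G !dotE (dotC h y) (dotC h x0); ring.
have m1 y := mollify_le y d0 q0 QG sG.
have QMf : QL (mollify d f) by exact: (avg_QL aM).
have QMG : QL (mollify d G) by exact: (avg_QL aM).
have m2 : F x0 <= mollify d (mollify d G) x0.
  by apply: (avg_le aM) => // y; exact: (avg_le aM).
have m3 : mollify d (mollify d G) x0 <= mollify d (fun y => G y + INR N * (2 * q * d * d / 2)) x0.
  by apply: (avg_le aM) => //; apply: QL_add => //; exact: QL_const.
rewrite (avg_addc aM) // in m3.
have := m1 x0; rewrite {2}/G; have -> : vsub x0 x0 = zerov by vring.
rewrite !dot0r /touchC /q in m3 *; lra.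
Qed.

Lemma touched_upper h : f (vadd x0 h) <= F x0 + dot p0 h + K * dot h h + touchC * d * d.
Proof.
have := mollify2_ge (vadd x0 h); have := touch h.
have N0 := pos_INR N.
have : INR N * k * d * d <= touchC * d * d.
  have -> : touchC * d * d = INR N * (8 * K + 3 * k) * (d * d) by rewrite /touchC; ring.
  have -> : INR N * k * d * d = INR N * k * (d * d) by ring.
  apply: Rmult_le_compat_r; first nra.
  apply: Rmult_le_compat_l; lra.
lra.
Qed.

Lemma touched_lower h : F x0 + dot p0 h - (K + k) * dot h h - 3 * touchC * d * d <= f (vadd x0 h).
Proof.
have := sf x0 h; have := touched_center; have := touched_upper (vscal (-1) h).
have -> : vadd x0 (vscal (-1) h) = vsub x0 h by vring.
rewrite !dotE; lra.
Qed.

(** On the scale [R0] the function [f] lies between two paraboloids with common slope [p0] and a gap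
    of order [R0^2], so a slope of [f] there deviates from [p0] by order [R0] only. The increment
    tested has length [R0] and points along [p - p0]. *)
Lemma touched_gradient R0 w p : 0 < R0 -> d <= R0 -> vnorm w <= R0 ->
  (forall h, f (vadd x0 w) + dot p h - k / 2 * dot h h <= f (vadd (vadd x0 w) h)) ->
  vnorm (vsub p p0) <= (6 * touchC + 5 * (K + k) + k / 2) * R0.
Proof.
move=> R00 dR wR low.
have C10 : 0 <= touchC by rewrite /touchC; have := pos_INR N; nra.
have [e Ee] : exists e, e = vsub p p0 by exists (vsub p p0).
rewrite -Ee; have en := vnorm_ge0 e; have wn := vnorm_ge0 w.
set C2 := 6 * touchC + _ + _.
have [ez|ez] := Req_dec (vnorm e) 0; first by rewrite ez /C2; nra.
set t := R0 / vnorm e.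
have te : t * vnorm e = R0 by rewrite /t; field.
have t0 : 0 < t by apply: Rdiv_lt_0_compat; lra.
have hn : vnorm (vscal t e) = R0 by rewrite vnormZ Rabs_pos_eq; lra.
have h1 := low (vscal t e).
have E : vadd (vadd x0 w) (vscal t e) = vadd x0 (vadd w (vscal t e)) by vring.
rewrite E in h1.
have h2 := touched_upper (vadd w (vscal t e)); have h3 := touched_lower w.
have n1 : dot (vscal t e) (vscal t e) = R0 * R0 by rewrite -vnorm_mul hn.
have n2 : dot (vadd w (vscal t e)) (vadd w (vscal t e)) <= 4 * (R0 * R0).
  rewrite -vnorm_mul; have := vnorm_add w (vscal t e); have := vnorm_ge0 (vadd w (vscal t e)); rewrite hn; nra.
have n3 : dot w w <= R0 * R0 by rewrite -vnorm_mul; nra.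
have dd : d * d <= R0 * R0 by nra.
rewrite n1 dotDr in h1 h2.
have E2 : dot p (vscal t e) - dot p0 (vscal t e) = R0 * vnorm e.
  by rewrite -dotBl -Ee dotZr -vnorm_mul -te; ring.
have h4 : R0 * vnorm e <= K * (4 * (R0 * R0)) + (K + k) * (R0 * R0) + 4 * touchC * (R0 * R0) + k / 2 * (R0 * R0).
  have : K * dot (vadd w (vscal t e)) (vadd w (vscal t e)) <= K * (4 * (R0 * R0)) by exact: Rmult_le_compat_l.
  have : (K + k) * dot w w <= (K + k) * (R0 * R0) by apply: Rmult_le_compat_l; lra.
  have : touchC * (d * d) <= touchC * (R0 * R0) by exact: Rmult_le_compat_l.
  lra.
apply: (Rmult_le_reg_l R0) => //; apply: Rle_trans h4 _.
have -> : R0 * (C2 * R0) = C2 * (R0 * R0) by ring.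
have -> : K * (4 * (R0 * R0)) + (K + k) * (R0 * R0) + 4 * touchC * (R0 * R0) + k / 2 * (R0 * R0) =
  (4 * K + (K + k) + 4 * touchC + k / 2) * (R0 * R0) by ring.
apply: Rmult_le_compat_r; first nra.
rewrite /C2; lra.
Qed.
End Fixed.
End Touching.

(** * Averaged sup-convolutions satisfy the equation where touched *)

Section Equation.
Variables (N : nat) (Th : Type) (C : R) (sg : Th -> vec N -> mat N) (H : Th -> vec N -> vec N -> R).
Hypothesis C0 : 0 < C.
Hypothesis sgB : forall th x, mnorm (sg th x) <= C.
Hypothesis sgL : forall th x y, mnorm (msub (sg th x) (sg th y)) <= C * vnorm (vsub x y).
Hypothesis HB : forall th x, Rabs (H th x zerov) <= C.
Hypothesis HL : forall Rr, 0 < Rr -> exists CR, 0 < CR /\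
     forall th x y p q, vnorm p <= Rr -> vnorm q <= Rr ->
       Rabs (H th x p - H th y q) <= CR * (vnorm (vsub x y) + vnorm (vsub p q)).

Implicit Types (f g : vec N -> R) (x y z h p q w : vec N) (X : mat N).

(** The inequality is evaluated at the shifted point [x + p / k], as a sup-convolution provides it.
    The threshold [d1] depends on the bounds and not on the touching point, so the width may be
    fixed before that point is found. *)
Lemma regularized_subsolution k K L P r r1 xh f :
  0 < k -> 0 <= K -> 0 <= L -> 0 <= P -> 0 < r -> Lip L f -> semiconvex k f ->
  (forall x p X, symmetric X -> ell_superjet f x p X ->
    (forall h, f x + dot p h - k / 2 * dot h h <= f (vadd x h)) /\
    (vnorm (vsub (vadd x (vscal (/ k) p)) xh) < r -> forall th,
      - tr2 (sg th (vadd x (vscal (/ k) p))) X + H th (vadd x (vscal (/ k) p)) p <= r1)) ->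
  forall tau, 0 < tau -> exists d1, 0 < d1 /\ forall d, 0 < d -> d < d1 ->
  forall c D D2 x0 p0, 0 <= c -> C2L c (mollify d (mollify d f)) D D2 ->
  (forall h, mollify d (mollify d f) (vadd x0 h) <=
     mollify d (mollify d f) x0 + dot p0 h + K * dot h h) ->
  vnorm p0 <= P -> vnorm (vsub (vadd x0 (vscal (/ k) p0)) xh) < r / 2 -> forall th,
  - tr2 (sg th (vadd x0 (vscal (/ k) p0))) (fun i j => D2 i j x0) +
    H th (vadd x0 (vscal (/ k) p0)) p0 <= r1 + tau.
Proof.
move=> k0 K0 L0 P0 r0 Lf sf jets tau tau0.
have N0 := pos_INR N.
have [CR [CR0 HCR]] := HL (Rplus_le_lt_0_compat _ _ P0 Rlt_0_1).
set C1 := touchC (N := N) k K.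
have C10 : 0 <= C1 by rewrite /C1 /touchC; nra.
set C2 := 6 * C1 + 5 * (K + k) + k / 2; have C20 : 0 < C2 by rewrite /C2; lra.
set C3 := 1 + / k * C2.
have ik : 0 < / k by exact: Rinv_0_lt_compat.
have C30 : 0 < C3 by rewrite /C3; nra.
set C4 := CR * (C3 + C2); have C40 : 0 < C4 by rewrite /C4; nra.
set b := C * C3; have b0 : 0 < b by exact: Rmult_lt_0_compat.
set a := 2 * INR N * b * b; have a0 : 0 <= a by rewrite /a; nra.
set C5 := 3 * (C * C) + 3 * a * INR N; have C50 : 0 <= C5 by rewrite /C5; nra.
set La := k * (2 * (C * C) + a * INR N); have La0 : 0 <= La by rewrite /La; apply: Rmult_le_pos; nra.
set Hb := C + CR * P + Rabs r1 + C4 + k * C5.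
have Hb0 : 0 <= Hb by rewrite /Hb; have := Rabs_pos r1; nra.
set C7 := 2 * INR N * (Hb + La + 1); have C70 : 0 <= C7 by rewrite /C7; nra.
set C8 := C4 + k * C5 + C7 + 2 * K * (C * C) + a * (2 * K * INR N).
have C80 : 0 <= C8.
  have : 0 <= a * (2 * K * INR N) by apply: Rmult_le_pos => //; nra.
  rewrite /C8; nra.
set Q := C2 + 2 * C3 / r + C8 / tau + 1.
have q1 : 0 < 2 * C3 / r by apply: Rdiv_lt_0_compat; lra.
have q2 : 0 <= C8 / tau by apply: Rmult_le_pos => //; apply: Rlt_le; exact: Rinv_0_lt_compat.
have Q1 : 1 <= Q by rewrite /Q; lra.
exists (/ (Q * Q)); split; first by apply: Rinv_0_lt_compat; nra.
move=> d d0 dlt c D D2 x0 p0 c0 CF touch p0P near th.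
(* With [R0^2 = d] a penalty [Bc |x - x0|^2], [Bc] of order [1 / d], makes the inequality trivial
   outside the ball of radius [R0], while averaging charges only a multiple of [Bc d^2], which is of
   order [d]. *)
set R0 := sqrt d.
have R00 : 0 < R0 by exact: sqrt_lt_R0.
have RR : R0 * R0 = d by apply: sqrt_sqrt; lra.
have RQ : R0 * Q <= 1.
  apply: Rsqr_incr_0_var; last lra.
  rewrite /Rsqr; have -> : R0 * Q * (R0 * Q) = d * (Q * Q) by rewrite -RR; ring.
  have : / (Q * Q) * (Q * Q) = 1 by field; lra.
  have : 0 < Q * Q by nra.
  nra.
have R01 : R0 <= 1 by nra.
have RC2 : C2 * R0 <= 1 by rewrite /Q in RQ; have : 0 < R0 * (2 * C3 / r) by [pos]; have : 0 <= R0 * (C8 / tau) by [pos]; lra.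
have RC3 : C3 * R0 <= r / 2.
  have : R0 * (2 * C3 / r) <= 1 by rewrite /Q in RQ; have : 0 < R0 * C2 by [pos]; have : 0 <= R0 * (C8 / tau) by [pos]; lra.
  have -> : R0 * (2 * C3 / r) = C3 * R0 * (2 / r) by field; lra.
  move=> h; have : C3 * R0 * (2 / r) * (r / 2) <= 1 * (r / 2) by apply: Rmult_le_compat_r; lra.
  have -> : C3 * R0 * (2 / r) * (r / 2) = C3 * R0 by field; lra.
  lra.
have RC8 : C8 * R0 <= tau.
  have : R0 * (C8 / tau) <= 1 by rewrite /Q in RQ; have : 0 < R0 * C2 by [pos]; have : 0 < R0 * (2 * C3 / r) by [pos]; lra.
  move=> h; have : R0 * (C8 / tau) * tau <= 1 * tau by apply: Rmult_le_compat_r; lra.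
  have -> : R0 * (C8 / tau) * tau = C8 * R0 by field; lra.
  lra.
have dR : d <= R0 by rewrite -RR; nra.
set F := mollify d (mollify d f) in CF touch.
set xp := vadd x0 (vscal (/ k) p0) in near *.
set hh := H th xp p0 - r1.
set lo := hh - C4 * R0 - k * R0 * C5.
have Hhh : Rabs (H th xp p0) <= C + CR * P.
  have := HCR th xp xp p0 zerov; have -> : vsub xp xp = zerov by vring.
  have -> : vsub p0 zerov = p0 by vring.
  rewrite vnorm0 => /(_ ltac:(lra) ltac:(lra)) h1.
  have h2 := HB th xp; have := Rabs_triang (H th xp p0 - H th xp zerov) (H th xp zerov).
  have -> : H th xp p0 - H th xp zerov + H th xp zerov = H th xp p0 by ring.
  have : CR * (0 + vnorm p0) <= CR * P by apply: Rmult_le_compat_l; lra.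
  lra.
have loB : Rabs lo <= Hb.
  have kC5 : k * R0 * C5 <= k * C5 by have : 0 <= k * C5 by [nra]; nra.
  have kC50 : 0 <= k * R0 * C5 by pos.
  have C4R : C4 * R0 <= C4 by nra.
  have C4R0 : 0 <= C4 * R0 by pos.
  have /Rabs_leD h := Hhh; have := Rle_abs r1; have := Rle_abs (- r1); rewrite Rabs_Ropp => h1 h2.
  by apply: Rabs_le; rewrite /lo /hh /Hb; lra.
set Bc := (Rabs lo + La + 1) / d.
have Bc0 : 0 < Bc by apply: Rdiv_lt_0_compat => //; have := Rabs_pos lo; lra.
have Qf := Lip_QL L0 Lf.
have visc x p X : symmetric X -> ell_superjet f x p X ->
     lo - Bc * dot (vsub x x0) (vsub x x0) <= \big[Rplus/0]_(w <- frozen_dirs R0 a (sg th xp)) quad X w.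
  move=> sX sj; have [low ineq] := jets x p X sX sj.
  have Xk h : - k * dot h h <= quad X h by exact: jet_hess_ge sj low.
  case: (Rle_dec (vnorm (vsub x x0)) R0) => [wR|/Rnot_le_lt wR]; last first.
    apply: Rle_trans (frozen_lower Xk (Rlt_le _ _ k0) R00 R01 a0 (sgB th xp)).
    rewrite -/La -vnorm_mul.
    have h1 : d <= vnorm (vsub x x0) * vnorm (vsub x x0) by rewrite -RR; nra.
    have h2 := Rmult_le_compat_l _ _ _ (Rlt_le _ _ Bc0) h1.
    have h3 : Bc * d = Rabs lo + La + 1 by rewrite /Bc; field; lra.
    have := Rle_abs lo; lra.
  set w := vsub x x0 in wR.
  have xE : x = vadd x0 w by rewrite /w; vring.
  have gp : vnorm (vsub p p0) <= C2 * R0.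
    apply: (touched_gradient k0 K0 d0 Qf sf touch R00 dR wR).
    by move=> h; rewrite -xE; exact: low.
  set xp' := vadd x (vscal (/ k) p) in ineq.
  have dxp : vnorm (vsub xp' xp) <= C3 * R0.
    have -> : vsub xp' xp = vadd w (vscal (/ k) (vsub p p0)) by rewrite /xp' /xp /w; vring.
    apply: Rle_trans (vnorm_add _ _) _; rewrite vnormZ Rabs_pos_eq; last lra.
    rewrite /C3; have := Rmult_le_compat_l _ _ _ (Rlt_le _ _ ik) gp; lra.
  have near' : vnorm (vsub xp' xh) < r by apply: Rle_lt_trans (vnorm_tri xp _ _) _; lra.
  have := ineq near' th.
  have pP : vnorm p <= P + 1.
    have -> : p = vadd (vsub p p0) p0 by vring.
    by apply: Rle_trans (vnorm_add _ _) _; lra.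
  have /Rabs_leD [hH _] := HCR th xp' xp p p0 pP ltac:(lra).
  have hC4 : CR * (vnorm (vsub xp' xp) + vnorm (vsub p p0)) <= C4 * R0.
    have -> : C4 * R0 = CR * (C3 * R0 + C2 * R0) by rewrite /C4; ring.
    by apply: Rmult_le_compat_l; lra.
  have sb : mnorm (msub (sg th xp') (sg th xp)) <= b * R0.
    apply: Rle_trans (sgL th xp' xp) _.
    have := Rmult_le_compat_l _ _ _ (Rlt_le _ _ C0) dxp; rewrite /b; lra.
  have := frozen_operator sX Xk (Rlt_le _ _ k0) R00 R01 (Rlt_le _ _ b0) (sgB th xp') sb.
  rewrite -/a -/C5 => h1 h2.
  have := Rmult_le_pos _ _ (Rlt_le _ _ Bc0) (dot_ge0 (vsub x x0)).
  rewrite /lo /hh; lra.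
have := viscosity_mollify d0 L0 Bc0 Lf c0 CF visc.
rewrite frozen_dirs_sum; [|lra|by []].
set X := fun i j => D2 i j x0.
have Xle h := C2L_hess_le h CF touch.
have T0 : tr2 (sg th xp) X <= 2 * K * (C * C).
  apply: (Rle_trans _ (2 * K * frob2 (sg th xp))).
    by rewrite /frob2 -sumZ; apply: sum_le => i; exact: Xle.
  apply: Rmult_le_compat_l; first lra.
  rewrite frob2_sq; have := sgB th xp; have : 0 <= mnorm (sg th xp) by exact: sqrt_pos.
  by move=> *; apply: Rmult_le_compat.
have T1 : \big[Rplus/0]_(i < N) quad X (ei i) <= 2 * K * INR N.
  rewrite -[INR N](sum_quad_idm (N := N)) -sumZ; apply: sum_le => i; rewrite quad_idm; exact: Xle.
have BcE : 2 * INR N * Bc * d * d <= C7 * R0.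
  have -> : 2 * INR N * Bc * d * d = 2 * INR N * ((Rabs lo + La + 1) * d) by rewrite /Bc; field; lra.
  have -> : C7 * R0 = 2 * INR N * ((Hb + La + 1) * R0) by rewrite /C7; ring.
  apply: Rmult_le_compat_l; first lra.
  apply: Rmult_le_compat; try lra; have := Rabs_pos lo; lra.
have T2 : R0 * tr2 (sg th xp) X <= R0 * (2 * K * (C * C)) by apply: Rmult_le_compat_l; lra.
have T3 : a * R0 * \big[Rplus/0]_(i < N) quad X (ei i) <= a * R0 * (2 * K * INR N).
  by apply: Rmult_le_compat_l => //; pos.
rewrite /lo /hh /C8 in RC8 *; lra.
Qed.
End Equation.

(** * Comparison for strict sub- and supersolutions *)

Section Squares.
Context {N : nat}.
Implicit Types (x y h p q w : vec N) (X : mat N) (z : R).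

Lemma mulv_bound X : exists c, 0 <= c /\ forall h, vnorm (mulv X h) <= c * vnorm h.
Proof.
set B := \big[Rplus/0]_(i < N) \big[Rplus/0]_(j < N) Rabs (X i j).
have B0 : 0 <= B by apply: sum_ge0 => i; apply: sum_ge0 => j; exact: Rabs_pos.
exists (INR N * B); split; first by apply: Rmult_le_pos => //; exact: pos_INR.
move=> h; rewrite Rmult_assoc; apply: vnorm_coord_bound => i.
apply: Rle_trans (Rabs_sum _ _) _.
apply: (Rle_trans _ (\big[Rplus/0]_(j < N) Rabs (X i j) * vnorm h)).
  rewrite Rmult_comm -sumZ; apply: sum_le => j; rewrite Rabs_mult Rmult_comm.
  by apply: Rmult_le_compat_r; [exact: Rabs_pos|exact: coord_le].
apply: Rmult_le_compat_r; first exact: vnorm_ge0.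
apply: (fin_le_sum (c := fun i => \big[Rplus/0]_(j < N) Rabs (X i j))) => j.
by apply: sum_ge0 => l; exact: Rabs_pos.
Qed.

Definition sqm X : mat N := fun i j => \big[Rplus/0]_(l < N) (X i l * X l j).

Lemma quad_sqm X h : symmetric X -> quad (sqm X) h = dot (mulv X h) (mulv X h).
Proof.
move=> sX; rewrite -(mulv_sym h (mulv X h) sX) quadE; congr (dot h _).
apply: functional_extensionality => i; rewrite /mulv /sqm.
transitivity (\big[Rplus/0]_(j < N) \big[Rplus/0]_(l < N) (X i l * X l j * h j)).
  by apply: eq_bigr => j _; rewrite Rmult_comm -sumZ; apply: eq_bigr => l _; ring.
rewrite exchange_big; apply: eq_bigr => l _; rewrite -sumZ; apply: eq_bigr => j _; ring.
Qed.

Lemma sqm_sym X : symmetric X -> symmetric (sqm X).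
Proof. by move=> sX i j; apply: eq_bigr => l _; rewrite (sX i l) (sX l j) Rmult_comm. Qed.

(* The form that the max of [F x - V y - k/2 |x-y|^2 - z |x-xh|^2] yields for [V] when [F] has Hessian [X]. *)
Definition doubled k z X : mat N := fun i j => X i j + / (4 * k) * sqm X i j - 4 * z * idm i j.

Lemma doubled_sym k z X : symmetric X -> symmetric (doubled k z X).
Proof. by move=> sX i j; rewrite /doubled sX (sqm_sym sX) (idm_sym i j). Qed.

Lemma quad_doubled k z X h : symmetric X ->
  quad (doubled k z X) h = quad X h + / (4 * k) * dot (mulv X h) (mulv X h) - 4 * z * dot h h.
Proof.
by move=> sX; rewrite /doubled (quad_matB (fun i j => X i j + / (4 * k) * sqm X i j)) quad_matD !quad_matZ quad_sqm // quad_idm.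
Qed.

Lemma tr2_doubled k z X s s' : 0 < k -> 0 <= z -> z <= k -> symmetric X ->
  (forall h, quad X h <= (k + 2 * z) * dot h h) ->
  tr2 s' X - tr2 s (doubled k z X) <= 7 * k * frob2 (msub s' s) + 4 * z * frob2 s.
Proof.
move=> k0 z0 zk sX Xle; rewrite /tr2 -sumB /frob2 -!sumZ -sumD; apply: sum_le => i.
have [a Ea] : exists a, a = col s i by eexists.
have [e Ee] : exists e, e = col (msub s' s) i by eexists.
rewrite -Ea -Ee; have -> : col s' i = vadd a e.
  apply: functional_extensionality => j; rewrite Ea Ee /vadd /col /msub; ring.
rewrite quad_doubled // [quad X (vadd a e)]quadE mulvD !dotE -!quadE.
rewrite (mulv_sym a e sX) (dotC (mulv X a) e).
have := Xle e; have ee := dot_ge0 e.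
have := dot_ge0 (vsub (vscal (2 * k) e) (vscal (/ 2) (mulv X a))).
rewrite !dotE (dotC (mulv X a) e); set xa := dot (mulv X a) (mulv X a); set ex := dot e (mulv X a).
move=> h1 h2.
have i0 : 0 < / k by exact: Rinv_0_lt_compat.
have h3 : 0 <= 4 * k * dot e e - 2 * ex + / (4 * k) * xa.
  have -> : 4 * k * dot e e - 2 * ex + / (4 * k) * xa = / k * (4 * k * k * dot e e - 2 * k * ex + / 4 * xa) by field; lra.
  apply: Rmult_le_pos; lra.
have h4 : (k + 2 * z) * dot e e <= 3 * k * dot e e by apply: Rmult_le_compat_r => //; lra.
lra.
Qed.
End Squares.

Section Doubling.
Variables (N : nat) (F V : vec N -> R) (k z : R) (x0 y0 xh : vec N).
Hypotheses (k0 : 0 < k) (z0 : 0 <= z) (zk : 4 * z <= k).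
Let Phi x y := F x - V y - k / 2 * dot (vsub x y) (vsub x y) - z * dot (vsub x xh) (vsub x xh).
Hypothesis maxPhi : forall x y, Phi x y <= Phi x0 y0.

Let p0 := vadd (vscal k (vsub x0 y0)) (vscal (2 * z) (vsub x0 xh)).

Lemma doubling_touch h : F (vadd x0 h) <= F x0 + dot p0 h + (k / 2 + z) * dot h h.
Proof.
have := maxPhi (vadd x0 h) y0; rewrite /Phi /p0 !dotE.
rewrite (dotC h x0) (dotC y0 x0) (dotC xh x0) (dotC h y0) (dotC h xh); lra.
Qed.

(* [V] is tested along [y0 + h] with [x] moved to [x0 + h + X h / (2 k)]. *)
Lemma doubling_subjet c D D2 : C2L c F D D2 -> semiconvex k F ->
  ell_subjet V y0 (vscal k (vsub x0 y0)) (doubled k z (fun i j => D2 i j x0)).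
Proof.
move=> CF sF; have grad := C2L_grad_unique CF doubling_touch.
set X := fun i j => D2 i j x0.
have sX : symmetric X by move=> i j; case: CF => _ _ sD _; rewrite /X sD.
have [cX [cX0 HX]] := mulv_bound X.
set cM := 1 + / (2 * k) * cX.
have i2k : 0 < / (2 * k) by apply: Rinv_0_lt_compat; lra.
apply: (subjet_cubic (c := Rabs c * cM ^ 3)) => h.
(* The shift by [g] gains [|X h|^2 / (2 k)] and loses [k |g|^2], half to the coupling penalty and
   half to semiconvexity. This leaves [|X h|^2 / (4 k)], of which the localization [z] consumes at
   most half because [4 z <= k]. *)
have [g Eg] : exists g, g = vscal (/ (2 * k)) (mulv X h) by eexists.
have Mn : vnorm (vadd h g) <= cM * vnorm h.
  apply: Rle_trans (vnorm_add _ _) _; rewrite Eg vnormZ Rabs_pos_eq; last lra.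
  have := Rmult_le_compat_l _ _ _ (Rlt_le _ _ i2k) (HX h); rewrite /cM; lra.
have [_ _ _ ED] := CF; have /Rabs_leD [E1 _] := ED x0 (vadd h g).
have E2 : \big[Rplus/0]_(i < N) (D i x0 * vadd h g i) = dot p0 (vadd h g) by rewrite -grad.
rewrite E2 -/X in E1.
have E3 : c * vnorm (vadd h g) ^ 3 <= Rabs c * cM ^ 3 * vnorm h ^ 3.
  rewrite Rmult_assoc -Rpow_mult_distr.
  apply: (Rle_trans _ (Rabs c * vnorm (vadd h g) ^ 3)).
    by apply: Rmult_le_compat_r; [apply: pow_le; exact: vnorm_ge0|exact: Rle_abs].
  apply: Rmult_le_compat_l; first exact: Rabs_pos.
  apply: pow_incr; split => //; exact: vnorm_ge0.
have M := maxPhi (vadd x0 (vadd h g)) (vadd y0 h).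
have E4 : vsub (vadd x0 (vadd h g)) (vadd y0 h) = vadd (vsub x0 y0) g by vring.
have E5 : vsub (vadd x0 (vadd h g)) xh = vadd (vsub x0 xh) (vadd h g) by vring.
rewrite /Phi E4 E5 in M.
have [r Er] : exists r, r = vsub x0 y0 by eexists.
have [s Es] : exists s, s = vsub x0 xh by eexists.
rewrite /p0 -?Er -?Es in M E1 *.
have [v Ev] : exists v, v = mulv X h by eexists.
rewrite -Ev in Eg.
have q1 : quad X (vadd h g) = quad X h + / k * dot v v + quad X g.
  rewrite [LHS]quadE mulvD !dotE -!quadE (mulv_sym h g sX) -Ev Eg !dotE; field; lra.
have q2 : - k * dot g g <= quad X g by exact: C2L_hess_ge CF sF.
have q3 : dot g g = / (4 * k * k) * dot v v by rewrite Eg !dotE; field; lra.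
have q4 : 0 <= dot (vsub h g) (vsub h g) by exact: dot_ge0.
rewrite quad_doubled // -Ev dotZl.
rewrite q1 !dotE in E1 M; rewrite !dotE in q4.
rewrite (dotC g r) (dotC h s) (dotC g s) (dotC g h) in M; rewrite (dotC g h) in q4.
have q5 : z * dot g g <= / (16 * k) * dot v v.
  rewrite q3; have -> : / (16 * k) = k * / (16 * k * k) by field; lra.
  have vv := dot_ge0 v; have i16 : 0 < / (16 * k * k) by apply: Rinv_0_lt_compat; nra.
  have -> : z * (/ (4 * k * k) * dot v v) = 4 * z * (/ (16 * k * k) * dot v v) by field; lra.
  have t0 : 0 <= / (16 * k * k) * dot v v by apply: Rmult_le_pos; lra.
  have := Rmult_le_compat_r _ _ _ t0 zk; lra.
have q6 : k * dot g g = / (4 * k) * dot v v by rewrite q3; field; lra.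
have q7 : / k * dot v v = 16 * (/ (16 * k) * dot v v) by field; lra.
have q8 : / (4 * k) * dot v v = 4 * (/ (16 * k) * dot v v) by field; lra.
have q9 : 0 <= z * (dot h h - dot h g - (dot h g - dot g g)) by exact: Rmult_le_pos.
rewrite q7 in E1; rewrite q8 in q6 *.
set W := / (16 * k) * dot v v in q5 q6 E1 *.
lra.
Qed.
End Doubling.

Section Comparison.
Variables (N : nat) (Th : Type) (C : R) (sg : Th -> vec N -> mat N) (H : Th -> vec N -> vec N -> R).
Hypothesis C0 : 0 < C.
Hypothesis sgB : forall th x, mnorm (sg th x) <= C.
Hypothesis sgL : forall th x y, mnorm (msub (sg th x) (sg th y)) <= C * vnorm (vsub x y).
Hypothesis HB : forall th x, Rabs (H th x zerov) <= C.
Hypothesis HL : forall Rr, 0 < Rr -> exists CR, 0 < CR /\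
     forall th x y p q, vnorm p <= Rr -> vnorm q <= Rr ->
       Rabs (H th x p - H th y q) <= CR * (vnorm (vsub x y) + vnorm (vsub p q)).

Lemma mollify2_close d L (f : vec N -> R) x : 0 < d -> 0 <= L -> Lip L f ->
  Rabs (mollify d (mollify d f) x - f x) <= 2 * INR N * L * d.
Proof.
move=> d0 L0 Lf.
have /Rabs_leD h1 := mollify_close x d0 L0 (avg_Lip (averaging_mollify d0) L0 Lf).
have /Rabs_leD h2 := mollify_close x d0 L0 Lf.
apply: Rabs_le; lra.
Qed.

(** Only [U] is made smooth; [V] is merely inf-convolved, since [doubling_subjet] writes its jet out
    of the Hessian on the other side. The inequalities are asked for near the maximum point alone,
    which is all that time windows and barriers can guarantee. *)
Lemma strict_comparison (U V : vec N -> R) L xh r r1 r2 :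
  0 <= L -> 0 < r -> Lip L U -> Lip L V ->
  (forall x, U x - V x <= U xh - V xh) ->
  (forall x p X, vnorm (vsub x xh) < r -> symmetric X -> ell_superjet U x p X ->
     forall th, - tr2 (sg th x) X + H th x p <= r1) ->
  (forall x p X, vnorm (vsub x xh) < r -> symmetric X -> ell_subjet V x p X ->
     forall eps, 0 < eps -> exists th, r2 - eps <= - tr2 (sg th x) X + H th x p) ->
  r2 <= r1.
Proof.
move=> L0 r0 LU LV maxUV sub super; apply: Rnot_lt_le => r12.
set G := r2 - r1; have G0 : 0 < G by rewrite /G; lra.
have N0 := pos_INR N.
set P := 2 * L + r + 1; have P0 : 0 < P by rewrite /P; lra.
have [CR [CR0 HCR]] := HL P0.
(* The localization [z |x - xh|^2] changes traces by at most [4 z C^2] and gradients by [2 z rho];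
   [z] and [rho] keep each resulting error below [G / 8]. *)
set z := Rmin 1 (G / 32 / (C * C)).
have CC : 0 < C * C by nra.
have z0 : 0 < z by apply: Rmin_glb_lt; [lra|apply: Rdiv_lt_0_compat; lra].
have z1 : z <= 1 by exact: Rmin_l.
have z2 : 4 * z * (C * C) <= G / 8.
  have : z <= G / 32 / (C * C) by exact: Rmin_r.
  have : G / 32 / (C * C) * (C * C) = G / 32 by field; lra.
  nra.
set rho := Rmin (r / 8) (G / 16 / CR).
have rho0 : 0 < rho by apply: Rmin_glb_lt; [lra|apply: Rdiv_lt_0_compat; lra].
have rho1 : rho <= r / 8 by exact: Rmin_l.
have rho2 : CR * (2 * z * rho) <= G / 8.
  have : rho <= G / 16 / CR by exact: Rmin_r.
  have : G / 16 / CR * CR = G / 16 by field; lra.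
  have : z * rho <= rho by nra.
  nra.
set W := CR * (2 * L + P) + 7 * (C * C) * ((2 * L + P) * (2 * L + P)).
have W0 : 0 < W by rewrite /W; have : 0 <= 7 * (C * C) * ((2 * L + P) * (2 * L + P)) by [apply: Rmult_le_pos; nra]; nra.
(* One summand per demand: [4 z <= k], a shift [P / k] below [r / 8], errors [W / k] below [G / 8],
   and a maximum point within [rho] of [xh]. *)
set k := 4 + 8 * P / r + 8 * W / G + 6 * (L * L) / (z * (rho * rho)) + 1.
have zr : 0 < z * (rho * rho) by apply: Rmult_lt_0_compat => //; nra.
have k1 : 0 < 8 * P / r by apply: Rdiv_lt_0_compat; lra.
have k2 : 0 < 8 * W / G by apply: Rdiv_lt_0_compat; lra.
have k3 : 0 <= 6 * (L * L) / (z * (rho * rho)).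
  by apply: Rmult_le_pos; [nra|apply: Rlt_le; exact: Rinv_0_lt_compat].
have kk : 4 <= k by rewrite /k; lra.
have k0 : 0 < k by lra.
have kP : P / k <= r / 8.
  apply: (Rmult_le_reg_r (8 * k / r)); first by apply: Rdiv_lt_0_compat; lra.
  have -> : P / k * (8 * k / r) = 8 * P / r by field; lra.
  have -> : r / 8 * (8 * k / r) = k by field; lra.
  rewrite /k; lra.
have kW : W / k <= G / 8.
  apply: (Rmult_le_reg_r (8 * k / G)); first by apply: Rdiv_lt_0_compat; lra.
  have -> : W / k * (8 * k / G) = 8 * W / G by field; lra.
  have -> : G / 8 * (8 * k / G) = k by field; lra.
  rewrite /k; lra.
have kL : 3 * (L * L) / k <= z * (rho * rho) / 2.
  apply: (Rmult_le_reg_r (2 * k / (z * (rho * rho)))); first by apply: Rdiv_lt_0_compat; lra.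
  have -> : 3 * (L * L) / k * (2 * k / (z * (rho * rho))) = 6 * (L * L) / (z * (rho * rho)) by field; split; lra.
  have -> : z * (rho * rho) / 2 * (2 * k / (z * (rho * rho))) = k by field; split; lra.
  rewrite /k; lra.
have [f [Lf sf fU fU2 jets]] := sup_convolution k0 L0 LU.
have Kge : 0 <= k / 2 + z by lra.
have G8 : 0 < G / 8 by lra.
have jets' x p X : symmetric X -> ell_superjet f x p X ->
    (forall h, f x + dot p h - k / 2 * dot h h <= f (vadd x h)) /\
    (vnorm (vsub (vadd x (vscal (/ k) p)) xh) < r -> forall th,
      - tr2 (sg th (vadd x (vscal (/ k) p))) X + H th (vadd x (vscal (/ k) p)) p <= r1).
  move=> sX /jets [low sjU pL]; split => // near th; exact: (sub _ p X near sX sjU).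
have [tau_d [td0 REG]] := regularized_subsolution C0 sgB sgL HB HL k0 Kge L0 (Rlt_le _ _ P0) r0 Lf sf jets' G8.
set dW := z * (rho * rho) / (2 * (4 * INR N * L + 1)).
have NL : 0 <= INR N * L by exact: Rmult_le_pos.
have dW0 : 0 < dW by apply: Rdiv_lt_0_compat; lra.
set d := Rmin (tau_d / 2) dW.
have d0 : 0 < d by apply: Rmin_glb_lt; lra.
have d1 : d < tau_d by have := Rmin_l (tau_d / 2) dW; rewrite -/d; lra.
have d2 : 4 * INR N * L * d <= z * (rho * rho) / 2.
  have h := Rmin_r (tau_d / 2) dW; rewrite -/d in h.
  have E : dW * (4 * INR N * L + 1) = z * (rho * rho) / 2 by rewrite /dW; field; lra.
  have : (4 * INR N * L + 1) * d <= (4 * INR N * L + 1) * dW by apply: Rmult_le_compat_l; lra.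
  lra.
have aM := averaging_mollify (N := N) d0.
set F := mollify d (mollify d f).
have LF : Lip L F by apply: (avg_Lip aM) => //; exact: (avg_Lip aM).
have sF : semiconvex k F.
  apply: (avg_semiconvex aM); last by apply: (avg_semiconvex aM) => //; exact: Lip_QL Lf.
  by apply: (avg_QL aM); exact: Lip_QL Lf.
have Fc x := mollify2_close x d0 L0 Lf; rewrite -/F in Fc.
have LV' : Lip L (fun y => - V y).
  move=> x y; have := LV y x; rewrite (vnorm_subC y x); congr (Rabs _ <= _); ring.
have [g [m [Lg gE gge]]] := sup_convolution_argmax k0 L0 LV'.
have [x0 mx0] : exists x0, forall x, F x + g x - z * dot (vsub x xh) (vsub x xh) <= F x0 + g x0 - z * dot (vsub x0 xh) (vsub x0 xh).
  apply: (@coercive_max N (fun x => F x + g x - z * dot (vsub x xh) (vsub x xh)) xh xh (2 * L / z)).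
    have := QL_add (QL_add (Lip_QL L0 LF) (Lip_QL L0 Lg)) (QL_scal (- z) (QL_sqdist xh)).
    by congr QL; apply: functional_extensionality => x; ring.
  move=> y hy; have /Rabs_leD [_ h1] := LF y xh; have /Rabs_leD [_ h2] := Lg y xh.
  have -> : vsub xh xh = zerov by vring.
  rewrite dot0l -vnorm_mul; set a := vnorm (vsub y xh) in hy h1 h2 *.
  have E : 2 * L / z * z = 2 * L by field; lra.
  have a0 : 0 <= a by exact: vnorm_ge0.
  have : 2 * L <= z * a by nra.
  nra.
set y0 := m x0.
have maxPhi x y : F x - V y - k / 2 * dot (vsub x y) (vsub x y) - z * dot (vsub x xh) (vsub x xh) <=
    F x0 - V y0 - k / 2 * dot (vsub x0 y0) (vsub x0 y0) - z * dot (vsub x0 xh) (vsub x0 xh).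
  have := mx0 x; have := gge x y; rewrite (gE x0) -/y0.
  have -> : dot (vsub y x) (vsub y x) = dot (vsub x y) (vsub x y) by rewrite -!vnorm_mul vnorm_subC.
  have -> : dot (vsub y0 x0) (vsub y0 x0) = dot (vsub x0 y0) (vsub x0 y0) by rewrite -!vnorm_mul vnorm_subC.
  lra.
set a := vnorm (vsub x0 y0); have a0 : 0 <= a by exact: vnorm_ge0.
have aE : dot (vsub x0 y0) (vsub x0 y0) = a * a by rewrite -vnorm_mul.
have ka : k * a <= 2 * L.
  have := maxPhi x0 x0; have -> : vsub x0 x0 = zerov by vring.
  rewrite dot0l aE; have /Rabs_leD [_ h] := LV x0 y0; rewrite -/a in h.
  have [az|az] := Req_dec a 0; first by rewrite az; lra.
  move=> h2; apply: (Rmult_le_reg_r a); lra.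
set e := vnorm (vsub x0 xh); have e0 : 0 <= e by exact: vnorm_ge0.
have eE : dot (vsub x0 xh) (vsub x0 xh) = e * e by rewrite -vnorm_mul.
have La : L * a <= 2 * (L * L) / k.
  apply: (Rmult_le_reg_r k) => //.
  have -> : 2 * (L * L) / k * k = L * (2 * L) by field; lra.
  rewrite Rmult_assoc (Rmult_comm a); exact: Rmult_le_compat_l.
have LL2 : L * L / (2 * k) <= L * L / k.
  apply: Rmult_le_compat_l; first nra.
  apply: Rinv_le_contravar; lra.
(* Comparison with the diagonal pair [(xh, xh)]: sup-convolution and doubling lose at most
   [3 L^2 / k], averaging at most [4 N L d], together no more than [z rho^2]. *)
have e1 : e <= rho.
  have := maxPhi xh xh; have -> : vsub xh xh = zerov by vring.
  rewrite dot0l eE aE.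
  have /Rabs_leD [_ h1] := Fc x0; have /Rabs_leD [h2 _] := Fc xh.
  have h3 := fU xh; have h4 := fU2 x0; have h5 := maxUV x0.
  have /Rabs_leD [_ h6] := LV x0 y0; rewrite -/a in h6.
  have h7 : 0 <= k / 2 * (a * a) by pos.
  move=> h8.
  have h9 : z * (e * e) <= z * (rho * rho).
    have E : 2 * (L * L) / k + L * L / k = 3 * (L * L) / k by field; lra.
    lra.
  apply: Rsqr_incr_0_var; last lra.
  rewrite /Rsqr; exact: Rmult_le_reg_l h9.
set p0 := vadd (vscal k (vsub x0 y0)) (vscal (2 * z) (vsub x0 xh)).
set q0 := vscal k (vsub x0 y0).
have q0n : vnorm q0 <= 2 * L by rewrite /q0 vnormZ -/a Rabs_pos_eq; lra.
have zn : vnorm (vscal (2 * z) (vsub x0 xh)) <= 2 * z * rho.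
  rewrite vnormZ Rabs_pos_eq -/e; last lra.
  by apply: Rmult_le_compat_l; lra.
have p0n : vnorm p0 <= P.
  apply: Rle_trans (vnorm_add _ _) _; have : z * rho <= rho by nra.
  rewrite /P; rewrite /q0 in q0n; lra.
have touch h : F (vadd x0 h) <= F x0 + dot p0 h + (k / 2 + z) * dot h h by exact: doubling_touch maxPhi h.
set xp := vadd x0 (vscal (/ k) p0).
have ik : 0 < / k by exact: Rinv_0_lt_compat.
have xpx0 : vnorm (vsub xp x0) <= P / k.
  have -> : vsub xp x0 = vscal (/ k) p0 by rewrite /xp; vring.
  rewrite vnormZ Rabs_pos_eq; last lra.
  by have := Rmult_le_compat_l _ _ _ (Rlt_le _ _ ik) p0n; rewrite /Rdiv; lra.
have near : vnorm (vsub xp xh) < r / 2.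
  by apply: Rle_lt_trans (vnorm_tri x0 _ _) _; rewrite -/e; lra.
have ak : a <= 2 * L / k.
  apply: (Rmult_le_reg_l k) => //; have -> : k * (2 * L / k) = 2 * L by field; lra.
  by [].
have Lk : 2 * L / k <= r / 8.
  apply: Rle_trans kP; rewrite /Rdiv; apply: Rmult_le_compat_r; first lra.
  rewrite /P; lra.
have neary : vnorm (vsub y0 xh) < r.
  apply: Rle_lt_trans (vnorm_tri x0 _ _) _; rewrite -/e (vnorm_subC y0 x0) -/a; lra.
have [c [c0 [D [D2 CF]]]] := mollify2_C2 d0 L0 Lf; rewrite -/F in CF.
have reg := REG d d0 d1 c D D2 x0 p0 c0 CF touch p0n near.
set X := fun i j => D2 i j x0 in reg.
have sX : symmetric X by move=> i j; case: CF => _ _ sD _; rewrite /X sD.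
have Xle h : quad X h <= (k + 2 * z) * dot h h.
  by have := C2L_hess_le h CF touch; rewrite -/X; lra.
have sj : ell_subjet V y0 q0 (doubled k z X).
  apply: (doubling_subjet k0 (Rlt_le _ _ z0) _ maxPhi CF sF); lra.
have [th Hth] := super y0 q0 _ neary (doubled_sym k z sX) sj _ G8.
have := reg th; rewrite -/xp => Hreg.
have zk : z <= k by lra.
have TR := tr2_doubled (sg th y0) (sg th xp) k0 (Rlt_le _ _ z0) zk sX Xle.
have dxy : vnorm (vsub xp y0) <= (2 * L + P) / k.
  apply: Rle_trans (vnorm_tri x0 _ _) _; rewrite -/a; lra.
(* The factor [k] meets the square of a distance of order [1 / k]. *)
have f1 : 7 * k * frob2 (msub (sg th xp) (sg th y0)) <= 7 * (C * C) * ((2 * L + P) * (2 * L + P)) / k.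
  rewrite frob2_sq; have s1 := sgL th xp y0.
  have s0' : 0 <= mnorm (msub (sg th xp) (sg th y0)) by exact: sqrt_pos.
  have s2 : mnorm (msub (sg th xp) (sg th y0)) <= C * ((2 * L + P) / k).
    by apply: Rle_trans s1 _; apply: Rmult_le_compat_l; lra.
  have s3 : mnorm (msub (sg th xp) (sg th y0)) * mnorm (msub (sg th xp) (sg th y0)) <= C * ((2 * L + P) / k) * (C * ((2 * L + P) / k)).
    exact: Rmult_le_compat.
  have s4 := Rmult_le_compat_l (7 * k) _ _ ltac:(lra) s3.
  apply: Rle_trans s4 _; right; field; lra.
have f2 : 4 * z * frob2 (sg th y0) <= 4 * z * (C * C).
  apply: Rmult_le_compat_l; first lra.
  rewrite frob2_sq; have : 0 <= mnorm (sg th y0) by exact: sqrt_pos.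
  by move=> h; apply: Rmult_le_compat => //; exact: sgB.
have f3 : H th y0 q0 - H th xp p0 <= CR * ((2 * L + P) / k + 2 * z * rho).
  have /Rabs_leD [_ h] := HCR th y0 xp q0 p0 ltac:(rewrite /P; lra) p0n.
  apply: Rle_trans h _; apply: Rmult_le_compat_l; first lra.
  rewrite (vnorm_subC y0 xp); apply: Rplus_le_compat => //.
  have -> : vsub q0 p0 = vscal (-1) (vscal (2 * z) (vsub x0 xh)) by rewrite /q0 /p0; vring.
  rewrite vnormZ Rabs_Ropp Rabs_R1; lra.
have WE : CR * ((2 * L + P) / k) + 7 * (C * C) * ((2 * L + P) * (2 * L + P)) / k = W / k by rewrite /W; field; lra.
rewrite /G in G0 rho2 z2 kW Hth Hreg; lra.
Qed.
End Comparison.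

(** * Freezing time *)

Section Torus.
Context {N : nat}.
Implicit Types (f g : vec N -> R) (x y p : vec N) (X : mat N).

Lemma cell_representative x y : exists k, vnorm (vsub (zshift x k) y) <= INR N.
Proof.
exists (fun i => - Int_part (x i - y i))%Z.
rewrite -[INR N]Rmult_1_r; apply: vnorm_coord_bound => i.
rewrite /vsub /zshift opp_IZR; have [h1 h2] := base_Int_part (x i - y i).
apply: Rabs_le; lra.
Qed.

Lemma periodic_max f L : 0 <= L -> Lip L f -> periodic f -> exists x, forall y, f y <= f x.
Proof.
move=> L0 Lf pf.
have [x [_ mx]] := ball_max zerov (pos_INR N) (Lip_QL L0 Lf).
exists x => y; have [k hk] := cell_representative y zerov.
by rewrite -(pf y k); exact: mx.
Qed.

End Torus.

(* [q'] acts as a derivative of [q], with a one-sided quadratic remainder. *)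
Definition penalty (q q' : R -> R) B := [/\ 0 <= B,
  forall s t, q s <= q t + q' t * (s - t) + B * (s - t) ^ 2 &
  forall M, exists K, 0 <= K /\ forall s t, Rabs s <= M -> Rabs t <= M -> Rabs (q s - q t) <= K * Rabs (s - t)].

Lemma penalty_add q1 d1 B1 q2 d2 B2 : penalty q1 d1 B1 -> penalty q2 d2 B2 ->
  penalty (fun t => q1 t + q2 t) (fun t => d1 t + d2 t) (B1 + B2).
Proof.
move=> [b1 h1 c1] [b2 h2 c2]; split; first lra.
  by move=> s t; have := h1 s t; have := h2 s t; lra.
move=> M; have [K1 [k1 H1]] := c1 M; have [K2 [k2 H2]] := c2 M.
exists (K1 + K2); split; first lra; move=> s t hs ht.
have := H1 s t hs ht; have := H2 s t hs ht.
have := Rabs_triang (q1 s - q1 t) (q2 s - q2 t).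
have -> : q1 s - q1 t + (q2 s - q2 t) = q1 s + q2 s - (q1 t + q2 t) by ring.
lra.
Qed.

Lemma penalty_lin a e : penalty (fun t => a * (t - e)) (fun _ => a) 0.
Proof.
split; [lra|by move=> s t; right; ring|move=> M; exists (Rabs a); split; first exact: Rabs_pos].
by move=> s t _ _; rewrite -Rabs_mult; right; congr Rabs; ring.
Qed.

Lemma penalty_sq B e : 0 <= B -> penalty (fun t => B * (t - e) ^ 2) (fun t => 2 * B * (t - e)) B.
Proof.
move=> B0; split => // [s t|M]; first by right; ring.
exists (B * (2 * Rabs M + 2 * Rabs e)); split.
  by apply: Rmult_le_pos => //; have := Rabs_pos M; have := Rabs_pos e; lra.
move=> s t hs ht; have -> : B * (s - e) ^ 2 - B * (t - e) ^ 2 = B * (s + t - 2 * e) * (s - t) by ring.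
rewrite !Rabs_mult (Rabs_pos_eq B) //; apply: Rmult_le_compat_r; first exact: Rabs_pos.
apply: Rmult_le_compat_l => //; have := Rle_abs M; have := Rle_abs e; have := Rle_abs (- e).
rewrite Rabs_Ropp; move: hs ht => /Rabs_leD hs /Rabs_leD ht => h1 h2 h3.
apply: Rabs_le; lra.
Qed.

(** Zero up to time [e] and quadratic afterwards: it keeps a maximum off the right end of a window
    without disturbing earlier times, and its slope has a favourable sign. *)
Lemma penalty_pos B e : 0 <= B -> penalty (fun t => B * (Rmax 0 (t - e)) ^ 2) (fun t => 2 * B * Rmax 0 (t - e)) B.
Proof.
move=> B0; split => // [s t|M].
  have : (Rmax 0 (s - e)) ^ 2 <= (Rmax 0 (t - e)) ^ 2 + 2 * Rmax 0 (t - e) * (s - t) + (s - t) ^ 2.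
    have -> : s - t = (s - e) - (t - e) by ring.
    move: (s - e) (t - e) => v w; rewrite /Rmax; case: Rle_dec => [h1|/Rnot_le_lt h1]; case: Rle_dec => [h2|/Rnot_le_lt h2];
      try (right; ring); try nra; have := pow2_ge_0 (v - w); lra.
  move=> h; have := Rmult_le_compat_l _ _ _ B0 h; lra.
exists (B * (2 * Rabs M + 2 * Rabs e)); split.
  by apply: Rmult_le_pos => //; have := Rabs_pos M; have := Rabs_pos e; lra.
move=> s t hs ht.
have -> : B * Rmax 0 (s - e) ^ 2 - B * Rmax 0 (t - e) ^ 2 = B * ((Rmax 0 (s - e) + Rmax 0 (t - e)) * (Rmax 0 (s - e) - Rmax 0 (t - e))) by ring.
rewrite Rabs_mult (Rabs_pos_eq B) // Rmult_assoc; apply: Rmult_le_compat_l => //.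
rewrite Rabs_mult; apply: Rmult_le_compat; try exact: Rabs_pos.
  have := Rle_abs M; have := Rle_abs e; have := Rle_abs (- e); rewrite Rabs_Ropp.
  have := Rabs_pos M; have := Rabs_pos e.
  move: hs ht => /Rabs_leD hs /Rabs_leD ht => h1 h2 h3 h4 h5.
  rewrite /Rmax; case: Rle_dec => [h6|/Rnot_le_lt h6]; case: Rle_dec => [h7|/Rnot_le_lt h7]; apply: Rabs_le; lra.
have := Rle_abs (s - t); have := Rle_abs (- (s - t)); rewrite Rabs_Ropp => h1 h2.
rewrite /Rmax; case: Rle_dec => [h6|/Rnot_le_lt h6]; case: Rle_dec => [h7|/Rnot_le_lt h7]; apply: Rabs_le; lra.
Qed.

Section Windows.
Context {N : nat}.
Implicit Types (u : vec N -> R -> R) (f g : vec N -> R) (x y p : vec N) (X : mat N).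

Lemma interval_max (f : R -> R) a b : a <= b ->
  (forall t, a <= t <= b -> forall eps, 0 < eps -> exists d, 0 < d /\
     forall s, a <= s <= b -> Rabs (s - t) < d -> Rabs (f s - f t) < eps) ->
  exists t, a <= t <= b /\ forall s, a <= s <= b -> f s <= f t.
Proof.
move=> ab cont.
apply: (@max_attained R (fun t => a <= t <= b) f); first by exists a; lra.
move=> ts Hts.
have [|t lt] := @ulim_ex ts (Rabs a + Rabs b).
  move=> n; have [h1 h2] := Hts n; have := Rle_abs (- a); have := Rle_abs b; rewrite Rabs_Ropp => h3 h4.
  by apply: Rabs_le; have := Rabs_pos a; have := Rabs_pos b; lra.
have tab : a <= t <= b.
  split; [apply: (ulim_ge_const _ lt)|apply: (ulim_le_const _ lt)];
    by apply: om_all => n; have := Hts n; lra.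
exists t; split => // eps e0; have [d [d0 Hd]] := cont t tab eps e0.
by apply: omS (lt d d0) => n; apply: Hd.
Qed.

(* The maximum over a time window turns parabolic jets into elliptic ones: time is eliminated. *)
Definition window u q a b (U : vec N -> R) (ts : vec N -> R) :=
  [/\ forall x, a <= ts x <= b, forall x, U x = u x (ts x) - q (ts x) &
      forall x t, a <= t <= b -> u x t - q t <= U x].

Lemma window_exists_gen u q q' B a b : penalty q q' B -> a <= b ->
  (forall x t, a <= t <= b -> forall eps, 0 < eps -> exists d, 0 < d /\
     forall s, a <= s <= b -> Rabs (s - t) < d -> Rabs (u x s - u x t) < eps) ->
  exists U ts, window u q a b U ts.
Proof.
move=> [B0 _ cq] ab cu.
have /choice [ts Hts] : forall x, exists t, a <= t <= b /\ forall s, a <= s <= b -> u x s - q s <= u x t - q t.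
  move=> x; apply: interval_max => // t tab eps e0.
  have e2 : 0 < eps / 2 by lra.
  have [d [d0 Hd]] := cu x t tab _ e2.
  have [K [K0 HK]] := cq (Rabs a + Rabs b).
  have K1 : 0 < eps / 2 / (K + 1) by apply: Rdiv_lt_0_compat; lra.
  exists (Rmin d (eps / 2 / (K + 1))); split; first exact: Rmin_glb_lt.
  have bnd s : a <= s <= b -> Rabs s <= Rabs a + Rabs b.
    move=> [h1 h2]; have := Rle_abs (- a); have := Rle_abs b; rewrite Rabs_Ropp => h3 h4.
    by apply: Rabs_le; have := Rabs_pos a; have := Rabs_pos b; lra.
  move=> s sab hs.
  have hs1 := Rlt_le_trans _ _ _ hs (Rmin_l _ _); have hs2 := Rlt_le_trans _ _ _ hs (Rmin_r _ _).
  have h1 := Hd s sab hs1.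
  have h2 := HK s t (bnd s sab) (bnd t tab).
  have E : eps / 2 / (K + 1) * (K + 1) = eps / 2 by field; lra.
  have st := Rabs_pos (s - t).
  have h3 : K * Rabs (s - t) <= (K + 1) * Rabs (s - t) by nra.
  have h4 : (K + 1) * Rabs (s - t) < eps / 2 by rewrite -E Rmult_comm; apply: Rmult_lt_compat_r; lra.
  have := Rabs_triang (u x s - u x t) (- (q s - q t)); rewrite Rabs_Ropp.
  have -> : u x s - u x t + - (q s - q t) = u x s - q s - (u x t - q t) by ring.
  lra.
exists (fun x => u x (ts x) - q (ts x)), ts; split => // x.
- exact: proj1 (Hts x).
- by move=> t tab; apply: (proj2 (Hts x)).
Qed.

Lemma window_exists u q q' B a b : cont_par u -> penalty q q' B -> 0 <= a -> a <= b ->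
  exists U ts, window u q a b U ts.
Proof.
move=> cu pq a0 ab; apply: (window_exists_gen pq ab) => x t tab eps e0.
have [d [d0 Hd]] := cu x t ltac:(lra) _ e0.
exists d; split => // s sab hs; apply: Hd => //; first lra.
by have -> : vsub x x = zerov by [vring]; rewrite vnorm0.
Qed.

Lemma window_Lip_gen u q a b U ts L : window u q a b U ts ->
  (forall x y t, a <= t <= b -> Rabs (u x t - u y t) <= L * vnorm (vsub x y)) -> Lip L U.
Proof.
move=> [tab UE Uge] Lu.
suff H x y : U x <= U y + L * vnorm (vsub x y).
  move=> x y; have := H x y; have := H y x; rewrite (vnorm_subC y x) => h1 h2; apply: Rabs_le; lra.
have := Uge y _ (tab x); have /Rabs_leD [_ h] := Lu x y (ts x) (tab x).
rewrite (UE x); lra.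
Qed.

Lemma window_Lip u q a b U ts L : 0 <= a -> window u q a b U ts ->
  (forall x y t, 0 <= t -> Rabs (u x t - u y t) <= L * vnorm (vsub x y)) -> Lip L U.
Proof.
move=> a0 win Lu; apply: (window_Lip_gen win) => x y t tab; apply: Lu; lra.
Qed.

Lemma window_periodic u q a b U ts : window u q a b U ts -> (forall t, periodic (fun x => u x t)) -> periodic U.
Proof.
move=> [tab UE Uge] pu x k.
have h1 := Uge x _ (tab (zshift x k)); have h2 := Uge (zshift x k) _ (tab x).
have e1 := pu (ts x) x k; have e2 := pu (ts (zshift x k)) x k; rewrite /= in e1 e2.
by apply: Rle_antisym; [rewrite (UE (zshift x k)) e2|rewrite (UE x) -e1].
Qed.

(** [U] dominates [u - q] at every time of the window, so a spatial jet of [U] bounds [u] at nearby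
    times as well, with the slope of the penalty as time derivative; the remainder of [q] is
    quadratic in [s - t] and hence negligible against [|s - t|]. *)
Lemma window_superjet u q q' B a b U ts x p X : penalty q q' B -> window u q a b U ts ->
  a < ts x < b -> ell_superjet U x p X -> par_superjet u x (ts x) (q' (ts x)) p X.
Proof.
move=> [B0 hq _] [tab UE Uge] [ta tb] sj eps e0.
have [d [d0 Hd]] := sj eps e0.
have Be : 0 < eps / (B + 1) by apply: Rdiv_lt_0_compat; lra.
set t := ts x in ta tb *.
exists (Rmin d (Rmin (eps / (B + 1)) (Rmin (t - a) (b - t)))); split.
  by do 3! (apply: Rmin_glb_lt; first by lra); lra.
move=> y s s0 hy hs.
have hs0 := Rlt_le_trans _ _ _ hs (Rmin_r _ _).
have hs1 := Rlt_le_trans _ _ _ hs0 (Rmin_l _ _).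
have hs2 := Rlt_le_trans _ _ _ hs0 (Rmin_r _ _).
have hs3 := Rlt_le_trans _ _ _ hs2 (Rmin_l _ _).
have hs4 := Rlt_le_trans _ _ _ hs2 (Rmin_r _ _).
have := Hd y (Rlt_le_trans _ _ _ hy (Rmin_l _ _)).
have /(Uge y) : a <= s <= b by move/Rabs_def2: hs3; move/Rabs_def2: hs4; lra.
have := hq s t; rewrite (UE x) -/t.
have h : B * (s - t) ^ 2 <= eps * Rabs (s - t).
  have -> : (s - t) ^ 2 = Rabs (s - t) * Rabs (s - t) by rewrite -(pow2_abs (s - t)); ring.
  have E : eps / (B + 1) * (B + 1) = eps by field; lra.
  have st := Rabs_pos (s - t).
  have : B * Rabs (s - t) <= eps by nra.
  nra.
lra.
Qed.

Lemma par_superjet_opp mu u x t a p X : 0 < mu ->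
  par_superjet (fun y s => - (mu * u y s)) x t a p X ->
  par_subjet u x t (- (a / mu)) (vscal (- / mu) p) (fun i j => (- / mu) * X i j).
Proof.
move=> m0 sj eps e0; have [d [d0 Hd]] := sj (mu * eps) (Rmult_lt_0_compat _ _ m0 e0).
exists d; split => // y s s0 hy hs; have := Hd y s s0 hy hs.
rewrite dotZl quad_matZ => h; apply: Rle_ge.
have im : 0 < / mu by exact: Rinv_0_lt_compat.
have := Rmult_le_compat_l _ _ _ (Rlt_le _ _ im) h.
have -> : / mu * - (mu * u y s) = - u y s by field; lra.
set A := dot p _; set Q := quad X _; set E := Rabs (s - t) + _.
have -> : / mu * (- (mu * u x t) + a * (s - t) + A + / 2 * Q + mu * eps * E) =
  - u x t + a / mu * (s - t) + / mu * A + / 2 * (/ mu * Q) + eps * E by field; lra.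
lra.
Qed.
End Windows.

Section Solutions.
Variables (N : nat) (Th : Type) (sg : Th -> vec N -> mat N) (H : Th -> vec N -> vec N -> R).

Definition parabolic_sub (u : vec N -> R -> R) := forall x t a p X, 0 < t -> symmetric X ->
  par_superjet u x t a p X -> forall th, a - tr2 (sg th x) X + H th x p <= 0.
Definition parabolic_super (u : vec N -> R -> R) := forall x t a p X, 0 < t -> symmetric X ->
  par_subjet u x t a p X -> forall eps, 0 < eps -> exists th, - eps <= a - tr2 (sg th x) X + H th x p.
Definition elliptic_sub (v : vec N -> R) := forall x p X, symmetric X ->
  ell_superjet v x p X -> forall th, - tr2 (sg th x) X + H th x p <= 0.
Definition elliptic_super (v : vec N -> R) := forall x p X, symmetric X ->
  ell_subjet v x p X -> forall eps, 0 < eps -> exists th, - eps <= - tr2 (sg th x) X + H th x p.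
End Solutions.

Lemma tr2_scal N a (s X : mat N) : tr2 s (fun i j => a * X i j) = a * tr2 s X.
Proof. by rewrite /tr2 -sumZ; apply: eq_bigr => k _; rewrite quad_matZ. Qed.

Lemma Lip_sub N L1 L2 (f g : vec N -> R) : Lip L1 f -> Lip L2 g -> Lip (L1 + L2) (fun x => f x - g x).
Proof. move=> h1 h2 x y; move: (h1 x y) (h2 x y) => /Rabs_leD e1 /Rabs_leD e2; apply: Rabs_le; lra. Qed.

Lemma Lip_opp N L (f : vec N -> R) : Lip L f -> Lip L (fun x => - f x).
Proof. move=> h x y; move: (h x y) => /Rabs_leD e1; apply: Rabs_le; lra. Qed.

Lemma window_subjet N u mu q q' B a b (W : vec N -> R) ts x p X : 0 < mu -> penalty q q' B ->
  window (fun y s => - (mu * u y s)) q a b W ts ->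
  a < ts x < b -> ell_subjet (fun y => - W y) x p X ->
  par_subjet u x (ts x) (- (q' (ts x) / mu)) (vscal (/ mu) p) (fun i j => / mu * X i j).
Proof.
move=> m0 pq win tab /subjet_opp sj.
have sj' : ell_superjet W x (vscal (-1) p) (fun i j => -1 * X i j).
  by move: sj; have -> : (fun y => - - W y) = W by apply: functional_extensionality => y; ring.
have := par_superjet_opp m0 (window_superjet pq win tab sj').
have -> : vscal (- / mu) (vscal (-1) p) = vscal (/ mu) p by vring.
have -> // : (fun i j => - / mu * (-1 * X i j)) = (fun i j => / mu * X i j).
by apply: functional_extensionality => i; apply: functional_extensionality => j; ring.
Qed.

(** * Comparison of the evolution with stationary solutions *)

Section Monotonicity.
Variables (N : nat) (Th : Type) (C : R) (sg : Th -> vec N -> mat N) (H : Th -> vec N -> vec N -> R).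
Hypothesis C0 : 0 < C.
Hypothesis sgB : forall th x, mnorm (sg th x) <= C.
Hypothesis sgL : forall th x y, mnorm (msub (sg th x) (sg th y)) <= C * vnorm (vsub x y).
Hypothesis HB : forall th x, Rabs (H th x zerov) <= C.
Hypothesis HL : forall Rr, 0 < Rr -> exists CR, 0 < CR /\
     forall th x y p q, vnorm p <= Rr -> vnorm q <= Rr ->
       Rabs (H th x p - H th y q) <= CR * (vnorm (vsub x y) + vnorm (vsub p q)).

Variables (u : vec N -> R -> R) (v : vec N -> R) (L : R).
Hypotheses (L0 : 0 <= L) (uc : cont_par u) (up : forall t, periodic (fun x => u x t)).
Hypothesis uL : forall x y t, 0 <= t -> Rabs (u x t - u y t) <= L * vnorm (vsub x y).
Hypotheses (vL : Lip L v) (vp : periodic v).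

Let q eta B t0 t1 := fun t : R => eta * (t - t0) + B * Rmax 0 (t - t1) ^ 2.
Let q' eta B t1 := fun t : R => eta + 2 * B * Rmax 0 (t - t1).

Let q_penalty eta B t0 t1 : 0 <= B -> penalty (q eta B t0 t1) (q' eta B t1) (0 + B).
Proof. by move=> B0; apply: penalty_add; [exact: penalty_lin|exact: penalty_pos]. Qed.

(** The linear part of the penalty makes [U] a strict stationary subsolution; its slope spends half
    of the supposed excess [gam], and the other half excludes the initial time. The quadratic part
    beyond [t1] excludes the final time, so the maximizing times are interior. *)
Lemma comparison_sub t0 m0 : parabolic_sub sg H u -> elliptic_super sg H v -> 0 <= t0 ->
  (forall x, u x t0 - v x <= m0) -> forall t x, t0 <= t -> u x t - v x <= m0.
Proof.
move=> usub vsup t00 init t1 x1 t01; apply: Rnot_lt_le => lt.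
set gam := u x1 t1 - v x1 - m0; have gam0 : 0 < gam by rewrite /gam; lra.
have {}t01 : t0 < t1 by case: t01 => // E; have := init x1; rewrite E; lra.
set eta := gam / (2 * (t1 - t0)); have eta0 : 0 < eta by apply: Rdiv_lt_0_compat; lra.
have [xe xeM] : exists x, forall y, u y (t1 + 1) - v y <= u x (t1 + 1) - v x.
  apply: (@periodic_max N _ (L + L)); first lra.
    by apply: Lip_sub => // x y; apply: uL; lra.
  by move=> x k /=; have := up (t1 + 1) x k; rewrite /= vp => ->.
set B := Rabs (u xe (t1 + 1) - v xe - m0) + 1.
have B0 : 0 < B by rewrite /B; have := Rabs_pos (u xe (t1 + 1) - v xe - m0); lra.
have pq := q_penalty eta t0 t1 (Rlt_le _ _ B0).
have tw : t0 <= t1 + 1 by lra.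
have [U [ts win]] := window_exists uc pq t00 tw.
have [tab UE Uge] := win.
have UL := window_Lip t00 win uL.
have Up := window_periodic win up.
have [xh mxh] : exists x, forall y, U y - v y <= U x - v x.
  apply: (@periodic_max N _ (L + L)); [lra|exact: Lip_sub|].
  by move=> x k; rewrite Up vp.
have big : m0 + gam / 2 <= U xh - v xh.
  apply: Rle_trans (mxh x1); have := Uge x1 t1 ltac:(lra).
  rewrite /q Rminus_diag Rmax_left; last lra.
  have -> : eta * (t1 - t0) = gam / 2 by rewrite /eta; field; lra.
  rewrite /gam; lra.
set r := gam / (8 * (L + 1)); have r0 : 0 < r by apply: Rdiv_lt_0_compat; lra.
have rE : 2 * L * r <= gam / 4.
  have : r * (8 * (L + 1)) = gam by rewrite /r; field; lra.
  nra.
have near x : vnorm (vsub x xh) < r -> m0 < U x - v x.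
  move=> hx; have /Rabs_leD [h _] := Lip_sub UL vL x xh.
  have : (L + L) * vnorm (vsub x xh) <= (L + L) * r by apply: Rmult_le_compat_l; lra.
  lra.
have int x : vnorm (vsub x xh) < r -> t0 < ts x < t1 + 1.
  move=> /near; have [h1 h2] := tab x; rewrite (UE x) /q => hx; split.
    case: h1 => // E; move: hx; rewrite -E Rmax_left; last lra.
    by have := init x; lra.
  case: h2 => // E; move: hx; rewrite E Rmax_right; last lra.
  have := xeM x; have : 0 <= eta * (t1 + 1 - t0) by nra.
  have := Rle_abs (u xe (t1 + 1) - v xe - m0); rewrite /B.
  have -> : t1 + 1 - t1 = 1 by ring.
  lra.
have vsup' x p X : vnorm (vsub x xh) < r -> symmetric X -> ell_subjet v x p X ->
     forall eps, 0 < eps -> exists th, 0 - eps <= - tr2 (sg th x) X + H th x p.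
  move=> _ sX sj eps e0; have [th hth] := vsup x p X sX sj eps e0; exists th; lra.
have := @strict_comparison N Th C sg H C0 sgB sgL HB HL U v L xh r (- eta) 0 L0 r0 UL vL mxh _ vsup'.
suff K : forall x p X, vnorm (vsub x xh) < r -> symmetric X -> ell_superjet U x p X ->
     forall th, - tr2 (sg th x) X + H th x p <= - eta by move=> /(_ K); lra.
move=> x p X /int tx sX sj th.
have := usub x (ts x) _ p X ltac:(lra) sX (window_superjet pq win tx sj) th.
have : 0 <= 2 * B * Rmax 0 (ts x - t1) by apply: Rmult_le_pos; [lra|exact: Rmax_l].
rewrite /q'; lra.
Qed.

Lemma comparison_super t0 m0 : parabolic_super sg H u -> elliptic_sub sg H v -> 0 <= t0 ->
  (forall x, v x - u x t0 <= m0) -> forall t x, t0 <= t -> v x - u x t <= m0.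
Proof.
move=> usup vsub t00 init t1 x1 t01; apply: Rnot_lt_le => lt.
set gam := v x1 - u x1 t1 - m0; have gam0 : 0 < gam by rewrite /gam; lra.
have {}t01 : t0 < t1 by case: t01 => // E; have := init x1; rewrite E; lra.
set eta := gam / (2 * (t1 - t0)); have eta0 : 0 < eta by apply: Rdiv_lt_0_compat; lra.
have [xe xeM] : exists x, forall y, v y - u y (t1 + 1) <= v x - u x (t1 + 1).
  apply: (@periodic_max N _ (L + L)); first lra.
    by apply: Lip_sub => // x y; apply: uL; lra.
  by move=> x k /=; have := up (t1 + 1) x k; rewrite /= vp => ->.
set B := Rabs (v xe - u xe (t1 + 1) - m0) + 1.
have B0 : 0 < B by rewrite /B; have := Rabs_pos (v xe - u xe (t1 + 1) - m0); lra.
have pq := q_penalty eta t0 t1 (Rlt_le _ _ B0).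
have uc' : cont_par (fun y s => - (1 * u y s)).
  move=> x t ht e e0; have [d [d0 Hd]] := uc x ht e0; exists d; split => // y s s0 hy hs.
  by have := Hd y s s0 hy hs; rewrite -Rabs_Ropp; congr (Rabs _ < _); ring.
have uL' x y t : 0 <= t -> Rabs (- (1 * u x t) - - (1 * u y t)) <= L * vnorm (Defs.vsub x y).
  by move=> /(uL x y); rewrite -Rabs_Ropp; congr (Rabs _ <= _); ring.
have up' t : periodic (fun x => - (1 * u x t)).
  by move=> x k /=; have := up t x k => /= ->.
have tw : t0 <= t1 + 1 by lra.
have [W [ts win]] := window_exists uc' pq t00 tw.
have [tab UE Uge] := win.
have WL := window_Lip t00 win uL'.
have Wp := window_periodic win up'.
have VL := Lip_opp WL.
have [xh mxh] : exists x, forall y, v y - - W y <= v x - - W x.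
  apply: (@periodic_max N _ (L + L)); [lra|exact: Lip_sub|].
  by move=> x k; rewrite Wp vp.
have big : m0 + gam / 2 <= v xh - - W xh.
  apply: Rle_trans (mxh x1); have := Uge x1 t1 ltac:(lra).
  rewrite /q Rminus_diag Rmax_left; last lra.
  have -> : eta * (t1 - t0) = gam / 2 by rewrite /eta; field; lra.
  rewrite /gam; lra.
set r := gam / (8 * (L + 1)); have r0 : 0 < r by apply: Rdiv_lt_0_compat; lra.
have rE : 2 * L * r <= gam / 4.
  have : r * (8 * (L + 1)) = gam by rewrite /r; field; lra.
  nra.
have near x : vnorm (Defs.vsub x xh) < r -> m0 < v x + W x.
  move=> hx; have /Rabs_leD [h _] := Lip_sub vL VL x xh.
  have : (L + L) * vnorm (Defs.vsub x xh) <= (L + L) * r by apply: Rmult_le_compat_l; lra.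
  lra.
have int x : vnorm (Defs.vsub x xh) < r -> t0 < ts x < t1 + 1.
  move=> /near; have [h1 h2] := tab x; rewrite (UE x) /q => hx; split.
    case: h1 => // E; move: hx; rewrite -E Rmax_left; last lra.
    by have := init x; lra.
  case: h2 => // E; move: hx; rewrite E Rmax_right; last lra.
  have := xeM x; have : 0 <= eta * (t1 + 1 - t0) by nra.
  have := Rle_abs (v xe - u xe (t1 + 1) - m0); rewrite /B.
  have -> : t1 + 1 - t1 = 1 by ring.
  lra.
have sub' x p X : vnorm (Defs.vsub x xh) < r -> symmetric X -> ell_superjet v x p X ->
    forall th, - tr2 (sg th x) X + H th x p <= 0.
  by move=> _ sX sj; exact: vsub.
have := @strict_comparison N Th C sg H C0 sgB sgL HB HL v (fun y => - W y) L xh r 0 eta L0 r0 vL VL mxh sub'.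
suff K : forall x p X, vnorm (Defs.vsub x xh) < r -> symmetric X -> ell_subjet (fun y => - W y) x p X ->
     forall eps, 0 < eps -> exists th, eta - eps <= - tr2 (sg th x) X + H th x p by move=> /(_ K); lra.
move=> x p X /int tx sX sj eps e0.
have sX' : symmetric (fun i j => / 1 * X i j) by move=> i j; rewrite sX.
have [th hth] := usup x (ts x) _ _ _ ltac:(lra) sX' (window_subjet Rlt_0_1 pq win tx sj) eps e0.
exists th; move: hth; rewrite tr2_scal.
have -> : vscal (/ 1) p = p by vring.
have : 0 <= 2 * B * Rmax 0 (ts x - t1) by apply: Rmult_le_pos; [lra|exact: Rmax_l].
rewrite /q'; lra.
Qed.
End Monotonicity.

(** * The degenerate set and time regularity *)

Section DegenerateSet.
Variables (N : nat) (Th : Type) (C : R) (sg : Th -> vec N -> mat N).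
Hypothesis C0 : 0 < C.
Hypothesis sgL : forall th x y, mnorm (msub (sg th x) (sg th y)) <= C * vnorm (vsub x y).

Lemma mnorm_ge0 (s : mat N) : 0 <= mnorm s.
Proof. exact: sqrt_pos. Qed.

Lemma mnorm_entry (s : mat N) i j : s i j * s i j <= mnorm s * mnorm s.
Proof.
rewrite -frob2_sq; apply: (Rle_trans _ (dot (col s j) (col s j))); first exact: (coord_sq (col s j) i).
apply: (fin_le_sum (c := fun k => dot (col s k) (col s k))) => k; exact: dot_ge0.
Qed.

Lemma Sigma_zero x : Sigma sg x -> forall th, sg th x = fun _ _ => 0.
Proof.
move=> Sx th; apply: functional_extensionality => i; apply: functional_extensionality => j.
have := Sx th i i; rewrite /diffusion => E.
have := fin_le_sum (c := fun k => sg th x i k * sg th x i k) j; rewrite E => h.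
have := h (fun k => Rle_0_sqr _); have := Rle_0_sqr (sg th x i j); rewrite /Rsqr => h1 h2.
apply: Rsqr_0_uniq; rewrite /Rsqr; lra.
Qed.

(** The diffusion matrix is thus of order [|x - y|^2] near the degenerate set, which beats Hessians
    that grow more slowly than the inverse square of that distance. *)
Lemma Sigma_mnorm x y th : Sigma sg y -> mnorm (sg th x) <= C * vnorm (vsub x y).
Proof.
move=> Sy; have := sgL th x y; have -> // : msub (sg th x) (sg th y) = sg th x.
rewrite (Sigma_zero Sy th); apply: functional_extensionality => i; apply: functional_extensionality => j.
rewrite /msub; ring.
Qed.

Lemma Sigma_vulim xs x : (forall n, Sigma sg (xs n)) -> vulim xs x -> Sigma sg x.
Proof.
move=> Sxs lx th i j.
have m0 : mnorm (sg th x) = 0.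
  apply: Rle_antisym; last exact: mnorm_ge0.
  apply: Rle_plus_epsilon => e e0.
  have eC : 0 < e / C by exact: Rdiv_lt_0_compat.
  have [n hn] := om_ex (lx _ eC).
  have := Sigma_mnorm x th (Sxs n); rewrite vnorm_subC => h.
  have : C * vnorm (vsub (xs n) x) <= C * (e / C) by apply: Rmult_le_compat_l; lra.
  have -> : C * (e / C) = e by field; lra.
  lra.
rewrite /diffusion big1 // => k _.
have := mnorm_entry (sg th x) i k; rewrite m0; have := Rle_0_sqr (sg th x i k); rewrite /Rsqr => h1 h2.
have -> : sg th x i k = 0 by apply: Rsqr_0_uniq; rewrite /Rsqr; lra.
ring.
Qed.

Lemma tr2_idm_near x y th M : 0 <= M -> Sigma sg y ->
  tr2 (sg th x) (fun i j => M * idm i j) <= M * (C * C) * dot (vsub x y) (vsub x y).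
Proof.
move=> M0 Sy; rewrite tr2_scal tr2_idm frob2_sq -vnorm_mul.
have := Sigma_mnorm x th Sy; have := mnorm_ge0 (sg th x); set a := mnorm _; set b := vnorm _ => h1 h2.
have -> : M * (C * C) * (b * b) = M * ((C * b) * (C * b)) by ring.
by apply: Rmult_le_compat_l => //; apply: Rmult_le_compat.
Qed.
End DegenerateSet.

Lemma paraboloid_jet N (f : vec N -> R) M x y :
  (forall z, f z - M * dot (vsub z x) (vsub z x) <= f y - M * dot (vsub y x) (vsub y x)) ->
  ell_superjet f y (vscal (2 * M) (vsub y x)) (fun i j => 2 * M * idm i j).
Proof.
move=> mx; apply: (superjet_cubic (c := 0)) => h; have := mx (vadd y h).
rewrite quad_matZ quad_idm !dotE (dotC h y) (dotC h x) (dotC x y); lra.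
Qed.

(** * Bounds and one-sided time regularity *)

Section Basic.
Variables (N : nat) (Th : Type) (C : R) (sg : Th -> vec N -> mat N) (H : Th -> vec N -> vec N -> R).
Hypothesis C0 : 0 < C.
Hypothesis sgB : forall th x, mnorm (sg th x) <= C.
Hypothesis sgL : forall th x y, mnorm (msub (sg th x) (sg th y)) <= C * vnorm (vsub x y).
Hypothesis HB : forall th x, Rabs (H th x zerov) <= C.
Hypothesis HL : forall Rr, 0 < Rr -> exists CR, 0 < CR /\
     forall th x y p q, vnorm p <= Rr -> vnorm q <= Rr ->
       Rabs (H th x p - H th y q) <= CR * (vnorm (vsub x y) + vnorm (vsub p q)).

Lemma H_bounded Rr : 0 < Rr -> exists M, 0 < M /\ forall th x p, vnorm p <= Rr -> Rabs (H th x p) <= M.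
Proof.
move=> R0; have [CR [CR0 HCR]] := HL R0; exists (C + CR * Rr); split; first nra.
move=> th x p pR; have := HCR th x x p zerov pR ltac:(rewrite vnorm0; lra).
have -> : vsub x x = zerov by vring.
have -> : vsub p zerov = p by vring.
rewrite vnorm0 => h1; have h2 := HB th x; have := Rabs_triang (H th x p - H th x zerov) (H th x zerov).
have -> : H th x p - H th x zerov + H th x zerov = H th x p by ring.
have : CR * (0 + vnorm p) <= CR * Rr by apply: Rmult_le_compat_l; lra.
lra.
Qed.

Lemma tr2_idm_bound th x M : 0 <= M -> tr2 (sg th x) (fun i j => M * idm i j) <= M * (C * C).
Proof.
move=> M0; rewrite tr2_scal tr2_idm frob2_sq; apply: Rmult_le_compat_l => //.
by have := sgB th x; have := mnorm_ge0 (sg th x) => h1 h2; apply: Rmult_le_compat.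
Qed.

(** A supremum over no parameters would be minus infinity: the supersolution inequality at a minimum
    point of [v] has to be witnessed by some parameter. *)
Lemma parameters_inhabited v L : 0 <= L -> Lip L v -> periodic v -> elliptic_super sg H v -> exists th : Th, True.
Proof.
move=> L0 vL vp vsup.
have [x mx] : exists x, forall y, - v y <= - v x.
  by apply: (periodic_max L0); [exact: Lip_opp|move=> x k; rewrite vp].
have [||th _] := vsup x zerov (fun _ _ => 0) _ _ 1 Rlt_0_1; last by exists th.
- by [].
- move=> e e0; exists 1; split; first lra.
  move=> y _; rewrite dot0l; have -> : quad (fun _ _ => 0) (vsub y x) = 0.
    by rewrite /quad big1 // => i _; rewrite big1 // => j _; ring.
  by have := mx y; have := pow2_ge_0 (vnorm (vsub y x)); nra.
Qed.

Variable u : vec N -> R -> R.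
Hypotheses (uc : cont_par u) (up : forall t, periodic (fun x => u x t)).
Hypothesis uL : forall x y t, 0 <= t -> Rabs (u x t - u y t) <= C * vnorm (vsub x y).

Lemma solution_bounded v L : parabolic_sub sg H u -> parabolic_super sg H u ->
  0 <= L -> Lip L v -> periodic v -> elliptic_sub sg H v -> elliptic_super sg H v ->
  exists B, 0 < B /\ forall x t, 0 <= t -> Rabs (u x t) <= B.
Proof.
move=> usub usup L0 vL vp vsub vsup.
set M := C + L; have M0 : 0 <= M by rewrite /M; lra.
have uLM x y t : 0 <= t -> Rabs (u x t - u y t) <= M * vnorm (Defs.vsub x y).
  move=> /(uL x y) h; apply: Rle_trans h _; apply: Rmult_le_compat_r; [exact: vnorm_ge0|rewrite /M; lra].
have vLM : Lip M v.
  move=> x y; apply: Rle_trans (vL x y) _; apply: Rmult_le_compat_r; [exact: vnorm_ge0|rewrite /M; lra].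
have u0L : Lip M (fun x => u x 0) by move=> x y; apply: uLM; lra.
have MM : 0 <= M + M by lra.
have [x1 m1] : exists x, forall y, u y 0 - v y <= u x 0 - v x.
  by apply: (periodic_max MM (Lip_sub u0L vLM)) => x k; have := up 0 x k; rewrite /= vp => ->.
have [x2 m2] : exists x, forall y, v y - u y 0 <= v x - u x 0.
  by apply: (periodic_max MM (Lip_sub vLM u0L)) => x k; have := up 0 x k; rewrite /= vp => ->.
have [x3 m3] := periodic_max M0 vLM vp.
have [x4 m4] : exists x, forall y, - v y <= - v x.
  by apply: (periodic_max M0 (Lip_opp vLM)) => x k; rewrite vp.
have c1 := comparison_sub C0 sgB sgL HB HL M0 uc up uLM vLM vp usub vsup (Rle_refl 0) m1.
have c2 := comparison_super C0 sgB sgL HB HL M0 uc up uLM vLM vp usup vsub (Rle_refl 0) m2.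
set a1 := u x1 0 - v x1 in c1; set a2 := v x2 - u x2 0 in c2.
exists (Rabs a1 + Rabs a2 + Rabs (v x3) + Rabs (v x4) + 1).
have := (Rabs_pos a1, Rabs_pos a2, Rabs_pos (v x3), Rabs_pos (v x4)) => -[[[p1 p2] p3] p4].
split; first lra; move=> x t t0; have h1 := c1 t x t0; have h2 := c2 t x t0.
have := m3 x; have := m4 x; have := (Rle_abs a1, Rle_abs a2, Rle_abs (v x3), Rle_abs (- v x4)) => -[[[q1 q2] q3]].
rewrite Rabs_Ropp => q4 h3 h4; apply: Rabs_le; lra.
Qed.

Let q eta B t0 t1 := fun t : R => eta * (t - t0) + B * Rmax 0 (t - t1) ^ 2.
Let q' eta B t1 := fun t : R => eta + 2 * B * Rmax 0 (t - t1).
Let q_penalty eta B t0 t1 : 0 <= B -> penalty (q eta B t0 t1) (q' eta B t1) (0 + B).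
Proof. by move=> B0; apply: penalty_add; [exact: penalty_lin|exact: penalty_pos]. Qed.

Lemma paraboloid_max (f : vec N -> R) L M x : 0 <= L -> 0 < M -> Lip L f ->
  exists y, (forall z, f z - M * dot (vsub z x) (vsub z x) <= f y - M * dot (vsub y x) (vsub y x)) /\
    M * vnorm (vsub y x) <= L.
Proof.
move=> L0 M0 Lf.
have [y my] : exists y, forall z, f z - M * dot (vsub z x) (vsub z x) <= f y - M * dot (vsub y x) (vsub y x).
  apply: (@coercive_max N (fun z => f z - M * dot (vsub z x) (vsub z x)) x x (L / M)).
    have := QL_add (Lip_QL L0 Lf) (QL_scal (- M) (QL_sqdist x)).
    by congr QL; apply: functional_extensionality => z; ring.
  move=> y hy; have /Rabs_leD [_ h1] := Lf y x.
  have -> : vsub x x = zerov by vring.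
  rewrite dot0l -vnorm_mul; set a := vnorm (vsub y x) in hy h1 *.
  have E : L / M * M = L by field; lra.
  have a0 : 0 <= a by exact: vnorm_ge0.
  have : L <= M * a by nra.
  nra.
exists y; split => //.
have := my x; have -> : vsub x x = zerov by vring.
rewrite dot0l -vnorm_mul; have /Rabs_leD [_ h] := Lf y x; have a0 := vnorm_ge0 (vsub y x).
set a := vnorm (vsub y x) in h a0 *.
have [->|az] := Req_dec a 0; first lra.
move=> h2; apply: (Rmult_le_reg_r a); lra.
Qed.

(** The bound is one-sided because it rests on the supersolution property. A paraboloid of opening
    [M = C^2 / e] absorbs the Lipschitz growth in space up to [e]; with gradient and Hessian thus
    bounded, the equation forbids decrease at a rate above [K]. *)
Lemma time_modulus B0 : parabolic_super sg H u -> (forall x t, 0 <= t -> Rabs (u x t) <= B0) ->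
  forall e, 0 < e -> exists K, 0 < K /\
  forall x t s, 0 <= t -> t <= s -> u x t <= u x s + e + K * (s - t).
Proof.
move=> usup ub e e0.
set M := C * C / e; have CC : 0 < C * C by nra.
have M0 : 0 < M by exact: Rdiv_lt_0_compat.
have ME : M * e = C * C by rewrite /M; field; lra.
have [Mh [Mh0 HM]] := H_bounded C0.
set K := 2 * M * (C * C) + Mh + 2; have K0 : 0 < K by rewrite /K; nra.
exists K; split => // x t0 t1 t00 t01; apply: Rnot_lt_le => lt.
have B00 : 0 <= B0 by apply: Rle_trans (ub x 0 (Rle_refl 0)); exact: Rabs_pos.
set B := 2 * B0 + 1; have Bp : 0 <= B by rewrite /B; lra.
have pq := q_penalty K t0 t1 Bp.
have uc' : cont_par (fun y s => - (1 * u y s)).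
  move=> y t ht r r0; have [d [d0 Hd]] := uc y ht r0; exists d; split => // z s s0 hz hs.
  by have := Hd z s s0 hz hs; rewrite -Rabs_Ropp; congr (Rabs _ < _); ring.
have uL' y z t : 0 <= t -> Rabs (- (1 * u y t) - - (1 * u z t)) <= C * vnorm (vsub y z).
  by move=> /(uL y z); rewrite -Rabs_Ropp; congr (Rabs _ <= _); ring.
have tw : t0 <= t1 + 1 by lra.
have [W [ts win]] := window_exists uc' pq t00 tw.
have [tab WE Wge] := win.
have WL := window_Lip t00 win uL'.
have [y [my Ma]] := paraboloid_max x (Rlt_le _ _ C0) M0 WL.
set a := vnorm (vsub y x) in Ma; have a0 : 0 <= a by exact: vnorm_ge0.
have aE : dot (vsub y x) (vsub y x) = a * a by rewrite -vnorm_mul.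
have big : - u x t0 + e < W y - M * (a * a).
  rewrite -aE; apply: Rlt_le_trans (my x); have -> : vsub x x = zerov by vring.
  rewrite dot0l; have := Wge x t1 ltac:(lra); rewrite /q Rminus_diag Rmax_left; last lra.
  lra.
have Ca : C * a - M * (a * a) <= e.
  apply: (Rmult_le_reg_l e) => //.
  have -> : e * (C * a - M * (a * a)) = e * (C * a) - C * C * (a * a) by rewrite -ME; ring.
  have := Rle_0_sqr (e - C * a); rewrite /Rsqr.
  have : 0 <= e * (C * a) by apply: Rmult_le_pos; nra.
  lra.
have t0' : t0 < ts y < t1 + 1.
  have [h1 h2] := tab y; split.
    case: h1 => // E; move: big; rewrite (WE y) -E /q Rmax_left; last lra.
    have /Rabs_leD [h _] := uL y x t00; rewrite -/a in h; lra.
  case: h2 => // E; move: big; rewrite (WE y) E /q Rmax_right; last lra.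
  have -> : t1 + 1 - t1 = 1 by ring.
  have /Rabs_leD h3 := ub x t0 t00; have /Rabs_leD h4 := ub y (t1 + 1) ltac:(lra).
  have : 0 <= M * (a * a) by apply: Rmult_le_pos; nra.
  have : 0 <= K * (t1 + 1 - t0) by apply: Rmult_le_pos; lra.
  rewrite /B; lra.
have sj := paraboloid_jet my.
have pj := window_superjet pq win t0' sj.
have pj' := par_superjet_opp Rlt_0_1 pj.
have sX : symmetric (fun i j : 'I_N => - / 1 * (2 * M * idm i j)) by move=> i j; rewrite idm_sym.
have [th hth] := usup y (ts y) _ _ _ ltac:(lra) sX pj' 1 Rlt_0_1.
have pC : vnorm (vscal (- / 1) (vscal (2 * M) (vsub y x))) <= C.
  rewrite vnormZ Rabs_Ropp Rinv_1 Rabs_R1 Rmult_1_l; exact: superjet_Lip (Rlt_le _ _ C0) WL sj.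
have /Rabs_leD [_ Hb] := HM th y _ pC.
move: hth; rewrite tr2_scal => hth.
have := tr2_idm_bound th y (ltac:(lra) : 0 <= 2 * M).
have : 0 <= 2 * B * Rmax 0 (ts y - t1) by apply: Rmult_le_pos; [lra|exact: Rmax_l].
rewrite /q' /K in hth *; lra.
Qed.

(** Testing with a paraboloid of opening [M] centred at [xh], contact occurs at a distance [a] with
    [M a <= C]. The diffusion term is then of order [M a^2], which vanishes as [M] grows, and the
    sign of [H] at [xh] forbids a positive time slope. *)
Lemma decreasing_on_K xh B0 (th0 : Th) : parabolic_sub sg H u -> (forall x t, 0 <= t -> Rabs (u x t) <= B0) ->
  Sigma sg xh -> (forall th p, 0 <= H th xh p) ->
  forall t s, 0 <= t -> t <= s -> u xh s <= u xh t.
Proof.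
move=> usub ub Sx Hx t0 t1 t00 t01; apply: Rnot_lt_le => lt.
have {}t01 : t0 < t1 by case: t01 => // E; move: lt; rewrite E; lra.
set gam := u xh t1 - u xh t0; have gam0 : 0 < gam by rewrite /gam; lra.
set eta := gam / (2 * (t1 - t0)); have eta0 : 0 < eta by apply: Rdiv_lt_0_compat; lra.
have B00 : 0 <= B0 by apply: Rle_trans (ub xh 0 (Rle_refl 0)); exact: Rabs_pos.
set B := 2 * B0 + 1; have Bp : 0 <= B by rewrite /B; lra.
have pq := q_penalty eta t0 t1 Bp.
have tw : t0 <= t1 + 1 by lra.
have [U [ts win]] := window_exists uc pq t00 tw.
have [tab UE Uge] := win.
have UL := window_Lip t00 win uL.
have [CR [CR0 HCR]] := HL C0.
have CC : 0 < C * C by nra.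
set M := 4 * (C * C) / gam + (2 * (C * C) * (C * C) + CR * C) / eta + 1.
have m1 : 0 < 4 * (C * C) / gam by apply: Rdiv_lt_0_compat; lra.
have m2 : 0 < (2 * (C * C) * (C * C) + CR * C) / eta by apply: Rdiv_lt_0_compat => //; nra.
have M0 : 0 < M by rewrite /M; lra.
have [y [my Ma]] := paraboloid_max xh (Rlt_le _ _ C0) M0 UL.
set a := vnorm (vsub y xh) in Ma; have a0 : 0 <= a by exact: vnorm_ge0.
have aE : dot (vsub y xh) (vsub y xh) = a * a by rewrite -vnorm_mul.
have big : u xh t0 + gam / 2 <= U y - M * (a * a).
  rewrite -aE; apply: Rle_trans (my xh); have -> : vsub xh xh = zerov by vring.
  rewrite dot0l; have := Uge xh t1 ltac:(lra); rewrite /q Rminus_diag Rmax_left; last lra.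
  have -> : eta * (t1 - t0) = gam / 2 by rewrite /eta; field; lra.
  rewrite /gam; lra.
have aM2 : 0 <= M * (a * a) by apply: Rmult_le_pos; nra.
have Ca : C * a < gam / 2.
  have h1 : 4 * (C * C) / gam * a < C.
    case: (Req_dec a 0) => [->|az]; first lra.
    apply: Rlt_le_trans Ma; rewrite /M; apply: Rmult_lt_compat_r; lra.
  have h2 : 4 * (C * C) / gam * a * (gam / (4 * C)) < C * (gam / (4 * C)).
    by apply: Rmult_lt_compat_r => //; apply: Rdiv_lt_0_compat; lra.
  have e1 : 4 * (C * C) / gam * a * (gam / (4 * C)) = C * a by field; lra.
  have e2 : C * (gam / (4 * C)) = gam / 4 by field; lra.
  lra.
have t0' : t0 < ts y < t1 + 1.
  have [h1 h2] := tab y; split.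
    case: h1 => // E; move: big; rewrite (UE y) -E /q Rmax_left; last lra.
    have /Rabs_leD [_ h] := uL y xh t00; rewrite -/a in h; lra.
  case: h2 => // E; move: big; rewrite (UE y) E /q Rmax_right; last lra.
  have -> : t1 + 1 - t1 = 1 by ring.
  have /Rabs_leD h3 := ub xh t0 t00; have /Rabs_leD h4 := ub y (t1 + 1) ltac:(lra).
  have : 0 <= eta * (t1 + 1 - t0) by apply: Rmult_le_pos; lra.
  rewrite /B; lra.
have sj := paraboloid_jet my.
have pj := window_superjet pq win t0' sj.
have sX : symmetric (fun i j : 'I_N => 2 * M * idm i j) by move=> i j; rewrite idm_sym.
have := usub y (ts y) _ _ _ ltac:(lra) sX pj th0.
have pC := superjet_Lip (Rlt_le _ _ C0) UL sj.
have /Rabs_leD [h1 _] := HCR th0 y xh _ _ pC pC.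
have h2 := tr2_idm_near sgL y th0 (ltac:(lra) : 0 <= 2 * M) Sx.
have h3 := Hx th0 (vscal (2 * M) (vsub y xh)).
have h4 : 0 <= 2 * B * Rmax 0 (ts y - t1) by apply: Rmult_le_pos; [lra|exact: Rmax_l].
rewrite aE in h2; rewrite -/a in h1.
have E0 : vsub (vscal (2 * M) (vsub y xh)) (vscal (2 * M) (vsub y xh)) = zerov by vring.
rewrite E0 vnorm0 Rplus_0_r in h1.
have h5 : 2 * M * (C * C) * (a * a) <= 2 * (C * C) * (C * a).
  have -> : 2 * M * (C * C) * (a * a) = 2 * (C * C) * ((M * a) * a) by ring.
  by apply: Rmult_le_compat_l; [lra|exact: Rmult_le_compat_r].
have h6 : (2 * (C * C) * (C * C) + CR * C) * a < eta * C.
  have h7 : (2 * (C * C) * (C * C) + CR * C) / eta * a < C.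
    case: (Req_dec a 0) => [->|az]; first lra.
    apply: Rlt_le_trans Ma; rewrite /M; apply: Rmult_lt_compat_r; lra.
  have h8 := Rmult_lt_compat_l _ _ _ eta0 h7.
  have e1 : eta * ((2 * (C * C) * (C * C) + CR * C) / eta * a) = (2 * (C * C) * (C * C) + CR * C) * a by field; lra.
  lra.
move=> h7; have h8 : eta <= 2 * (C * C) * (C * a) + CR * a by rewrite /q' in h7; lra.
have := Rmult_le_compat_r _ _ _ (Rlt_le _ _ C0) h8.
have : C * a * (2 * (C * C)) * C = 2 * (C * C) * (C * C) * a by ring.
lra.
Qed.
End Basic.

(** * Asymptotically stationary solutions *)

Lemma ulim_unique a l m : ulim a l -> ulim a m -> l = m.
Proof. by move=> h1 h2; apply: Rle_antisym; [apply: (ulim_le _ h1 h2)|apply: (ulim_le _ h2 h1)]; apply: om_all => n; lra. Qed.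

Section Limits.
Variables (N : nat) (C : R).
Hypothesis C0 : 0 < C.

(** An Arzela-Ascoli argument along the ultrafilter: if uniformity failed, the bad points,
    translated into one cell, would have a limit at which pointwise convergence fails as well. *)
Lemma uniform_ulim (f : nat -> vec N -> R) (phi : vec N -> R) :
  (forall n, Lip C (f n)) -> (forall n, periodic (f n)) -> Lip C phi -> periodic phi ->
  (forall x, ulim (fun n => f n x) (phi x)) ->
  forall eps, 0 < eps -> om (fun n => forall x, Rabs (f n x - phi x) <= eps).
Proof.
move=> Lf pf Lphi pphi lim eps e0.
case: (omC (fun n => forall x, Rabs (f n x - phi x) <= eps)) => // bad.
have /choice [xs Hxs] : forall n, exists x, vnorm (vsub x zerov) <= INR N /\
    (~ (forall x, Rabs (f n x - phi x) <= eps) -> eps < Rabs (f n x - phi x)).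
  move=> n; case: (classic (forall x, Rabs (f n x - phi x) <= eps)) => h.
    exists zerov; have -> : vsub zerov zerov = zerov :> vec N by vring.
    by rewrite vnorm0; split; [exact: pos_INR|].
  have [x hx] : exists x, eps < Rabs (f n x - phi x).
    by apply: NNPP => h2; apply: h => x; apply: Rnot_lt_le => lt; apply: h2; exists x.
  have [k hk] := cell_representative x zerov.
  by exists (zshift x k); split => // _; rewrite pf pphi.
have [xh [lx _]] := vulim_ex_ball (fun n => proj1 (Hxs n)).
have e4 : 0 < eps / 4 by lra.
have eC : 0 < eps / 4 / C by exact: Rdiv_lt_0_compat.
have [n [h1 [h2 h3]]] := om_ex (omI bad (omI (lx _ eC) (lim xh _ e4))).
have h4 := proj2 (Hxs n) h1.
have hC : C * vnorm (vsub (xs n) xh) <= eps / 4.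
  have E : C * (eps / 4 / C) = eps / 4 by field; lra.
  by rewrite -E; apply: Rmult_le_compat_l; lra.
have /Rabs_leD h5 := Lf n (xs n) xh; have /Rabs_leD h6 := Lphi (xs n) xh.
move/Rabs_def2: h3 => h3.
suff : Rabs (f n (xs n) - phi (xs n)) <= eps by lra.
apply: Rabs_le; lra.
Qed.

Variable u : vec N -> R -> R.
Hypothesis up : forall t, periodic (fun x => u x t).
Hypothesis uL : forall x y t, 0 <= t -> Rabs (u x t - u y t) <= C * vnorm (vsub x y).
Variable B0 : R.
Hypothesis ub : forall x t, 0 <= t -> Rabs (u x t) <= B0.

(** Only one long interval of times is asked for each precision. This is enough to pass viscosity
    inequalities to [phi], after which comparison propagates closeness to all later times. *)
Definition nearly_stationary (phi : vec N -> R) := forall eps R0, 0 < eps -> 0 < R0 ->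
  exists T, R0 < T /\ forall x s, Rabs s <= R0 -> Rabs (u x (T + s) - phi x) <= eps.

(** The limits [w (x, t)] of [u x (n + t)] are exactly nondecreasing in [t] and therefore converge
    to some [phi]. Once [w] is close to [phi], almost monotonicity squeezes [u] between two late
    times at which it is close to [w]. *)
Lemma limit_of_increasing :
  (forall tau e, 0 < tau -> 0 < e -> exists T, forall x t s, T <= t -> 0 <= t -> t <= s -> s <= t + tau -> u x t <= u x s + e) ->
  exists phi, [/\ Lip C phi, periodic phi & nearly_stationary phi].
Proof.
move=> incr.
set f := fun (t : R) (n : nat) (x : vec N) => u x (Rmax 0 (INR n + t)).
have f0 t n : 0 <= Rmax 0 (INR n + t) by exact: Rmax_l.
have fL t n : Lip C (f t n) by move=> x y; exact: uL.
have fp t n : periodic (f t n) by move=> x k; rewrite /f; exact: (up _ x k).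
have fB t n x : Rabs (f t n x) <= B0 by exact: ub.
have /choice [w Hw] : forall xt : vec N * R, exists l, ulim (fun n => f xt.2 n xt.1) l.
  by move=> [x t]; apply: (@ulim_ex _ B0) => n; exact: fB.
have wlim x t : ulim (fun n => f t n x) (w (x, t)) := Hw (x, t).
have diff_ulim a b l m c : ulim a l -> ulim b m -> (forall n, Rabs (a n - b n) <= c) -> Rabs (l - m) <= c.
  move=> al bm h; apply: Rabs_le; split.
    have := ulim_le (a := b) (b := fun n => a n + c) (om_all _) bm (ulimD al (ulim_const c)).
    by move=> h'; have := h' ltac:(move=> n; have /Rabs_leD := h n; lra); lra.
  have := ulim_le (a := a) (b := fun n => b n + c) (om_all _) al (ulimD bm (ulim_const c)).
  by move=> h'; have := h' ltac:(move=> n; have /Rabs_leD := h n; lra); lra.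
have wL t : Lip C (fun x => w (x, t)).
  by move=> x y; apply: (diff_ulim _ _ _ _ _ (wlim x t) (wlim y t)) => n; exact: fL.
have wp t : periodic (fun x => w (x, t)).
  move=> x k; apply: (ulim_unique (wlim _ t)) => e e0.
  by have := wlim x t e e0; apply: omS => n; rewrite fp.
have wB x t : Rabs (w (x, t)) <= B0.
  have := diff_ulim _ _ _ _ B0 (wlim x t) (ulim_const 0).
  by rewrite Rminus_0_r; apply => n; rewrite Rminus_0_r.
have wincr x t s : t <= s -> w (x, t) <= w (x, s).
  move=> ts; apply: Rle_plus_epsilon => e e0.
  have [T HT] := incr (s - t + 1) e ltac:(lra) e0.
  apply: (ulim_le _ (wlim x t) (ulimD (wlim x s) (ulim_const e))).
  apply: omS (om_INR (Rabs T + Rabs t + Rabs s)) => n hn.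
  have := (Rle_abs T, Rle_abs (- t), Rle_abs (- s), Rabs_pos T, Rabs_pos s, Rabs_pos t) => -[[[[[h1 h2] h3] h4] h5] h6].
  rewrite !Rabs_Ropp in h2 h3; rewrite /f !Rmax_right; try lra.
  apply: HT; lra.
have /choice [phi Hphi] : forall x, exists l, ulim (fun k => w (x, INR k)) l.
  by move=> x; apply: (@ulim_ex _ B0) => k.
have phiL : Lip C phi.
  by move=> x y; apply: (diff_ulim _ _ _ _ _ (Hphi x) (Hphi y)) => n; exact: wL.
have phip : periodic phi.
  move=> x k; apply: (ulim_unique (Hphi _)) => e e0.
  by have := Hphi x e e0; apply: omS => n; have := wp (INR n) x k => /= ->.
have wphi x t : w (x, t) <= phi x.
  apply: (ulim_ge_const _ (Hphi x)); apply: omS (om_INR t) => n hn; exact: wincr.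
exists phi; split => // eps R0 e0 R00.
have e4 : 0 < eps / 4 by lra.
have [k0 hk0] := om_ex (uniform_ulim (fun n => wL (INR n)) (fun n => wp (INR n)) phiL phip Hphi e4).
(* The midpoint of a squeezed interval of length [M] leaves [R0 + 1] on either side. *)
set M := 2 * R0 + 2.
have [T HT] := incr M (eps / 4) ltac:(rewrite /M; lra) e4.
have o1 := uniform_ulim (fL (INR k0)) (fp (INR k0)) (wL _) (wp _) (fun x => wlim x (INR k0)) e4.
have o2 := uniform_ulim (fL (INR k0 + M)) (fp (INR k0 + M)) (wL _) (wp _) (fun x => wlim x (INR k0 + M)) e4.
have [n [h1 [h2 h3]]] := om_ex (omI o1 (omI o2 (om_INR (Rabs T)))).
have nT := Rle_abs T; have T0 := Rabs_pos T; have k00 := pos_INR k0.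
exists (INR n + INR k0 + M / 2); split; first by rewrite /M; lra.
move=> x s /Rabs_leD [s1 s2].
have a1 := h1 x; have a2 := h2 x; rewrite /f !Rmax_right in a1 a2; try (rewrite /M; lra).
move/Rabs_leD: a1 => a1; move/Rabs_leD: a2 => a2.
have /Rabs_leD a3 := hk0 x; have a4 := wphi x (INR k0 + M); have a5 := wincr x (INR k0) (INR k0 + M) ltac:(rewrite /M; lra).
have b1 := HT x (INR n + INR k0) (INR n + INR k0 + M / 2 + s) ltac:(lra) ltac:(lra) ltac:(rewrite /M; lra) ltac:(rewrite /M; lra).
have b2 := HT x (INR n + INR k0 + M / 2 + s) (INR n + (INR k0 + M)) ltac:(rewrite /M; lra) ltac:(rewrite /M; lra) ltac:(rewrite /M; lra) ltac:(rewrite /M; lra).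
apply: Rabs_le; lra.
Qed.
End Limits.

(** * Stability of viscosity inequalities in the long-time limit *)

Section Stability.
Variables (N : nat) (C : R).
Hypothesis C0 : 0 < C.

Lemma quad_expand (X : mat N) a h : symmetric X ->
  quad X (vadd a h) = quad X a + 2 * dot (mulv X a) h + quad X h.
Proof.
move=> sX; rewrite [LHS]quadE mulvD !dotE -!quadE (mulv_sym a h sX) (dotC h (mulv X a)); ring.
Qed.

(** The contact at [x] is made strict by [2 eps |y - x|^2] in space and [B (t - T)^2] in time, and
    strict contact survives uniform perturbation. The window has half-length one and [2 B <= rho],
    so the time slope is at most [rho]. *)
Lemma stable_jet u (phi : vec N -> R) : cont_par u ->
  (forall x y t, 0 <= t -> Rabs (u x t - u y t) <= C * vnorm (vsub x y)) ->
  nearly_stationary u phi ->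
  forall x p X, symmetric X -> ell_superjet phi x p X ->
  forall rho, 0 < rho -> exists y t a q m, [/\ 0 < t, 0 <= m <= rho,
    par_superjet u y t a q (fun i j => X i j + m * idm i j) /\ vnorm (vsub y x) <= rho,
    Rabs a <= rho & vnorm (vsub q p) <= rho].
Proof.
move=> uc uL ns x p X sX sj rho rho0.
have [cX [cX0 HcX]] := mulv_bound X.
set eps := Rmin (rho / 4) 1.
have e0 : 0 < eps by apply: Rmin_glb_lt; lra.
have e1 : eps <= rho / 4 := Rmin_l _ _.
have e2 : eps <= 1 := Rmin_r _ _.
have [d [d0 Hd]] := sj eps e0.
set b := Rmin (Rmin (d / 2) (rho / (cX + 5))) (Rmin rho 1).
have rc : 0 < rho / (cX + 5) by apply: Rdiv_lt_0_compat; lra.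
have b0 : 0 < b by do 2 (apply: Rmin_glb_lt; first by (try apply: Rmin_glb_lt; lra)); lra.
have b1 : b <= d / 2 by apply: Rle_trans (Rmin_l _ _) (Rmin_l _ _).
have b2 : b <= rho / (cX + 5) by apply: Rle_trans (Rmin_l _ _) (Rmin_r _ _).
have b3 : b <= rho by apply: Rle_trans (Rmin_r _ _) (Rmin_l _ _).
set B := Rmin 1 (rho / 2).
have B0 : 0 < B by apply: Rmin_glb_lt; lra.
have BR : B <= rho / 2 := Rmin_r _ _.
(* The distance between [u] and [phi] must undercut both margins: [eps b^2] on the sphere of radius
   [b] and [B] at the ends of the time window. *)
set del := Rmin (eps * (b * b)) B / 4.
have bb : 0 < eps * (b * b) by apply: Rmult_lt_0_compat => //; nra.
have del0 : 0 < del by rewrite /del; have := Rmin_glb_lt _ _ _ bb B0; lra.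
have del1 : 4 * del <= eps * (b * b) by rewrite /del; have := Rmin_l (eps * (b * b)) B; lra.
have del2 : 4 * del <= B by rewrite /del; have := Rmin_r (eps * (b * b)) B; lra.
have [T [T1 HT]] := ns del 1 del0 Rlt_0_1.
have pq := penalty_sq T (Rlt_le _ _ B0).
have [U [ts win]] := window_exists uc pq (ltac:(lra) : 0 <= T - 1) (ltac:(lra) : T - 1 <= T + 1).
have [tab UE Uge] := win.
have UL := window_Lip (ltac:(lra) : 0 <= T - 1) win uL.
have Uup y : U y <= phi y + del.
  have [t1 t2] := tab y; have := HT y (ts y - T) ltac:(apply: Rabs_le; lra).
  have -> : T + (ts y - T) = ts y by ring.
  move/Rabs_leD; rewrite (UE y); have := pow2_ge_0 (ts y - T); nra.
have Ulo : phi x - del <= U x.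
  have := Uge x T ltac:(lra); have := HT x 0 ltac:(rewrite Rabs_R0; lra); rewrite Rplus_0_r Rminus_diag.
  move/Rabs_leD; lra.
set g := fun y => U y - (dot p (vsub y x) + / 2 * quad X (vsub y x) + 2 * eps * dot (vsub y x) (vsub y x)).
have qcont : forall xs y, vulim xs y -> ulim (fun n => g (xs n)) (g y).
  move=> xs y lx.
  have Qdot (v : vec N) : QL (fun z => dot v (vsub z x)).
    by have := QL_affine v 0 x; congr QL; apply: functional_extensionality => z; ring.
  have -> : g = (fun z => (U z + (-1) * dot p (vsub z x) + (- (2 * eps)) * dot (vsub z x) (vsub z x)) + (- / 2) * quad X (vsub z x)).
    by apply: functional_extensionality => z; rewrite /g; ring.
  apply: (@ulimD (fun n => U (xs n) + (-1) * dot p (vsub (xs n) x) + (- (2 * eps)) * dot (vsub (xs n) x) (vsub (xs n) x)) (fun n => (- / 2) * quad X (vsub (xs n) x))).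
    apply: (QL_ulim (f := fun z => U z + (-1) * dot p (vsub z x) + (- (2 * eps)) * dot (vsub z x) (vsub z x))) => //.
    apply: QL_add; last by apply: QL_scal; exact: QL_sqdist.
    by apply: QL_add; [exact: (Lip_QL (Rlt_le _ _ C0) UL)|exact: QL_scal].
  apply: (@ulimZ (- / 2) (fun n => quad X (vsub (xs n) x))).
  have cq := quad_bound X; move: cq => [c2 [c20 Hc2]] r r0.
  have yn := vnorm_ge0 (mulv X (vsub y x)).
  set K := 2 * vnorm (mulv X (vsub y x)) + c2 + 1.
  have K0 : 0 < K by rewrite /K; lra.
  apply: omS (omI (lx _ Rlt_0_1) (lx _ (Rdiv_lt_0_compat _ _ r0 K0))) => n [h1 h2].
  have [e Ee] : exists e, e = vsub (xs n) y by eexists.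
  rewrite -Ee in h1 h2; have en := vnorm_ge0 e.
  have -> : vsub (xs n) x = vadd (vsub y x) e by rewrite Ee; vring.
  rewrite quad_expand //.
  have -> : quad X (vsub y x) + 2 * dot (mulv X (vsub y x)) e + quad X e - quad X (vsub y x) = 2 * dot (mulv X (vsub y x)) e + quad X e by ring.
  have h3 := dot_CS_abs (mulv X (vsub y x)) e; have h4 := Hc2 e; rewrite -vnorm_mul in h4.
  have E : r / K * K = r by field; lra.
  have h5 : K * vnorm e < r by rewrite -E Rmult_comm; apply: Rmult_lt_compat_r.
  move/Rabs_leD: h3 => h3; move/Rabs_leD: h4 => h4.
  have h6 : c2 * (vnorm e * vnorm e) <= c2 * vnorm e by apply: Rmult_le_compat_l => //; nra.
  apply: Rabs_def1; rewrite /K in h5; nra.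
have [y [yb my]] : exists y, vnorm (vsub y x) <= b /\ forall z, vnorm (vsub z x) <= b -> g z <= g y.
  apply: (@max_attained (vec N) (fun z => vnorm (vsub z x) <= b) g).
    by exists x; have -> : vsub x x = zerov by [vring]; rewrite vnorm0; lra.
  by move=> xs hxs; have [z [lz hz]] := vulim_ex_ball hxs; exists z; split => //; exact: qcont.
have gx : g x = U x.
  by rewrite /g; have -> : vsub x x = zerov by [vring]; rewrite quad0 !dot0r; ring.
have gyx : U x <= g y.
  by rewrite -gx; apply: my; have -> : vsub x x = zerov by [vring]; rewrite vnorm0; lra.
have ylt : vnorm (vsub y x) < b.
  case: yb => // E; have := Hd y ltac:(lra); have := Uup y.
  move: gyx; rewrite /g vnorm_sq -vnorm_mul E; nra.
have jU : ell_superjet U y (vadd p (vadd (mulv X (vsub y x)) (vscal (4 * eps) (vsub y x)))) (fun i j => X i j + 4 * eps * idm i j).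
  move=> r r0; exists (b - vnorm (vsub y x)); split; first lra.
  move=> z hz; have hzx : vnorm (vsub z x) <= b by apply: Rle_trans (vnorm_tri y _ _) _; lra.
  have := my z hzx; rewrite /g.
  have [h Eh] : exists h, h = vsub z y by eexists.
  have [w Ew] : exists w, w = vsub y x by eexists.
  have -> : vsub z x = vadd w h by rewrite Eh Ew; vring.
  rewrite -Eh -Ew quad_expand // quad_matD quad_matZ quad_idm !dotE (dotC h w).
  have := pow2_ge_0 (vnorm h); nra.
have tint : T - 1 < ts y < T + 1.
  have [h1 h2] := tab y.
  have bad : Rabs (ts y - T) = 1 -> False.
    move=> h; have hT := HT y (ts y - T) ltac:(lra); move: hT.
    have -> : T + (ts y - T) = ts y by ring.
    have E : (ts y - T) ^ 2 = 1 by rewrite -pow2_abs h; ring.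
    move/Rabs_leD => hT; have UEy := UE y; rewrite E in UEy.
    have := Hd y ltac:(lra); rewrite vnorm_sq => hd; move: gyx; rewrite /g.
    have := dot_ge0 (vsub y x); nra.
  split.
    by case: h1 => // E; case: bad; rewrite -E; have -> : T - 1 - T = - (1) by [ring]; rewrite Rabs_Ropp Rabs_R1.
  by case: h2 => // E; case: bad; rewrite E; have -> : T + 1 - T = 1 by [ring]; rewrite Rabs_R1.
exists y, (ts y), (2 * B * (ts y - T)), (vadd p (vadd (mulv X (vsub y x)) (vscal (4 * eps) (vsub y x)))), (4 * eps).
split; [lra|lra| | |].
- by split; [exact: (window_superjet pq win tint jU)|lra].
- rewrite Rabs_mult Rabs_pos_eq; last lra.
  have : Rabs (ts y - T) <= 1 by apply: Rabs_le; lra.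
  have := Rabs_pos (ts y - T); nra.
have -> : vsub (vadd p (vadd (mulv X (vsub y x)) (vscal (4 * eps) (vsub y x)))) p = vadd (mulv X (vsub y x)) (vscal (4 * eps) (vsub y x)) by vring.
apply: Rle_trans (vnorm_add _ _) _; rewrite vnormZ Rabs_pos_eq; last lra.
have := HcX (vsub y x); have yn := vnorm_ge0 (vsub y x).
have E : rho / (cX + 5) * (cX + 5) = rho by field; lra.
have : (cX + 5) * vnorm (vsub y x) <= rho by rewrite -E Rmult_comm; apply: Rmult_le_compat_r; lra.
have : 4 * eps * vnorm (vsub y x) <= 4 * vnorm (vsub y x) by nra.
lra.
Qed.
End Stability.

Section Convergence.
Variables (N : nat) (Th : Type) (C : R) (sg : Th -> vec N -> mat N) (H : Th -> vec N -> vec N -> R).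
Hypothesis C0 : 0 < C.
Hypothesis sgB : forall th x, mnorm (sg th x) <= C.
Hypothesis sgL : forall th x y, mnorm (msub (sg th x) (sg th y)) <= C * vnorm (vsub x y).
Hypothesis HB : forall th x, Rabs (H th x zerov) <= C.
Hypothesis HL : forall Rr, 0 < Rr -> exists CR, 0 < CR /\
     forall th x y p q, vnorm p <= Rr -> vnorm q <= Rr ->
       Rabs (H th x p - H th y q) <= CR * (vnorm (vsub x y) + vnorm (vsub p q)).

Lemma col_mnorm (s : mat N) k : vnorm (col s k) <= mnorm s.
Proof.
apply: vnorm_le; first exact: mnorm_ge0.
rewrite -frob2_sq; apply: (fin_le_sum (c := fun k => dot (col s k) (col s k))) => j; exact: dot_ge0.
Qed.

Lemma tr2_near X : symmetric X -> exists c, 0 <= c /\ forall th x y,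
  Rabs (tr2 (sg th y) X - tr2 (sg th x) X) <= c * vnorm (vsub y x).
Proof.
move=> sX; have [cX [cX0 HcX]] := mulv_bound X; have [cQ [cQ0 HcQ]] := quad_bound X.
have N0 := pos_INR N.
exists (INR N * ((2 * cX * C + cQ * (2 * C)) * C)); split; first by apply: Rmult_le_pos; nra.
move=> th x y; rewrite /tr2 -sumB; apply: Rle_trans (Rabs_sum _ _) _.
set K := (2 * cX * C + cQ * (2 * C)) * C.
have -> : INR N * K * vnorm (vsub y x) = \big[Rplus/0]_(k < N) (K * vnorm (vsub y x)).
  rewrite sum_const /index_enum -enumT size_enum_ord; ring.
apply: sum_le => k.
have [e Ee] : exists e, e = col (msub (sg th y) (sg th x)) k by eexists.
have [s Es] : exists s, s = col (sg th x) k by eexists.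
have -> : col (sg th y) k = vadd s e.
  apply: functional_extensionality => i; rewrite Es Ee /vadd /col /msub; ring.
rewrite -Es quad_expand //.
have -> : quad X s + 2 * dot (mulv X s) e + quad X e - quad X s = 2 * dot (mulv X s) e + quad X e by ring.
have sn : vnorm s <= C by rewrite Es; apply: Rle_trans (col_mnorm _ _) (sgB th x).
have en : vnorm e <= C * vnorm (vsub y x).
  by rewrite Ee; apply: Rle_trans (col_mnorm _ _) (sgL th y x).
have en2 : vnorm e <= 2 * C.
  have -> : e = vsub (col (sg th y) k) (col (sg th x) k) by rewrite Ee; apply: functional_extensionality => i; rewrite /vsub /col /msub.
  apply: Rle_trans (vnorm_sub _ _) _; have := col_mnorm (sg th y) k; have := col_mnorm (sg th x) k.
  have := sgB th x; have := sgB th y; lra.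
have e0 := vnorm_ge0 e; have s0 := vnorm_ge0 s.
have h1 : Rabs (2 * dot (mulv X s) e) <= 2 * cX * C * vnorm e.
  rewrite Rabs_mult Rabs_pos_eq; last lra.
  have := dot_CS_abs (mulv X s) e; have := HcX s; have := vnorm_ge0 (mulv X s) => a1 a2 a3.
  have : vnorm (mulv X s) * vnorm e <= cX * C * vnorm e by apply: Rmult_le_compat_r => //; nra.
  lra.
have h2 : Rabs (quad X e) <= cQ * (2 * C) * vnorm e.
  apply: Rle_trans (HcQ e) _; rewrite -vnorm_mul; have -> : cQ * (2 * C) * vnorm e = cQ * (2 * C * vnorm e) by ring.
  by apply: Rmult_le_compat_l => //; apply: Rmult_le_compat_r.
apply: Rle_trans (Rabs_triang _ _) _.
apply: (Rle_trans _ ((2 * cX * C + cQ * (2 * C)) * vnorm e)); first lra.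
have -> : K * vnorm (vsub y x) = (2 * cX * C + cQ * (2 * C)) * (C * vnorm (vsub y x)) by rewrite /K; ring.
by apply: Rmult_le_compat_l => //; nra.
Qed.

Variable u : vec N -> R -> R.
Hypotheses (uc : cont_par u) (up : forall t, periodic (fun x => u x t)).
Hypothesis uL : forall x y t, 0 <= t -> Rabs (u x t - u y t) <= C * vnorm (vsub x y).
Hypotheses (usub : parabolic_sub sg H u) (usup : parabolic_super sg H u).

Lemma operator_near x p X : symmetric X -> exists K, 0 < K /\ forall rho, 0 < rho -> rho <= 1 ->
  forall th y q m, Rabs m <= rho -> vnorm (vsub y x) <= rho -> vnorm (vsub q p) <= rho ->
  Rabs ((- tr2 (sg th y) (fun i j => X i j + m * idm i j) + H th y q) - (- tr2 (sg th x) X + H th x p)) <= K * rho.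
Proof.
move=> sX; have [c [c0 Hc]] := tr2_near sX.
have pn := vnorm_ge0 p.
have [CR [CR0 HCR]] := HL (Rle_lt_0_plus_1 _ pn).
exists (c + C * C + 2 * CR); split; first nra.
move=> rho r0 r1 th y q m /Rabs_leD mr yr qr.
have qn : vnorm q <= vnorm p + 1.
  have -> : q = vadd p (vsub q p) by vring.
  by apply: Rle_trans (vnorm_add _ _) _; lra.
have /Rabs_leD h1 := HCR th y x q p qn ltac:(lra).
have /Rabs_leD h2 := Hc th x y.
have E : tr2 (sg th y) (fun i j => X i j + m * idm i j) = tr2 (sg th y) X + m * frob2 (sg th y).
  by rewrite -tr2_idm -tr2_scal /tr2 -sumD; apply: eq_bigr => k _; exact: quad_matD.
have h3 : 0 <= frob2 (sg th y) by apply: sum_ge0 => k; exact: dot_ge0.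
have h4 : frob2 (sg th y) <= C * C.
  by rewrite frob2_sq; have := sgB th y; have := mnorm_ge0 (sg th y) => a1 a2; apply: Rmult_le_compat.
have h5 : Rabs (m * frob2 (sg th y)) <= rho * (C * C).
  rewrite Rabs_mult (Rabs_pos_eq (frob2 _)) //; apply: Rmult_le_compat => //; first exact: Rabs_pos.
  exact: Rabs_le.
have h6 : c * vnorm (vsub y x) <= c * rho by exact: Rmult_le_compat_l.
have h7 : CR * (vnorm (vsub y x) + vnorm (vsub q p)) <= CR * (2 * rho) by apply: Rmult_le_compat_l; lra.
move/Rabs_leD: h5 => h5; rewrite E; apply: Rabs_le; lra.
Qed.

Variable phi : vec N -> R.
Hypotheses (phiL : Lip C phi) (phip : periodic phi) (ns : nearly_stationary u phi).

Lemma stability_sub : elliptic_sub sg H phi.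
Proof.
move=> x p X sX sj th; apply: Rle_plus_epsilon => e e0; rewrite Rplus_0_l.
have [K [K0 HK]] := operator_near x p sX.
set rho := Rmin 1 (e / (K + 1)).
have r0 : 0 < rho by apply: Rmin_glb_lt; [lra|apply: Rdiv_lt_0_compat; lra].
have r2 : (K + 1) * rho <= e.
  have : rho <= e / (K + 1) := Rmin_r _ _.
  have : e / (K + 1) * (K + 1) = e by field; lra.
  nra.
have [y [t [a [q [m [t0 mr [pj yr] ar qr]]]]]] := stable_jet C0 uc uL ns sX sj r0.
have sY : symmetric (fun i j => X i j + m * idm i j) by move=> i j; rewrite sX idm_sym.
have mr' : Rabs m <= rho by apply: Rabs_le; lra.
have := usub t0 sY pj th; have /Rabs_leD := HK rho r0 (Rmin_l _ _) th y q m mr' yr qr.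
move/Rabs_leD: ar; lra.
Qed.

Lemma stability_super : elliptic_super sg H phi.
Proof.
move=> x p X sX sj e e0.
have [K [K0 HK]] := operator_near x p sX.
set rho := Rmin 1 (e / 2 / (K + 1)).
have r0 : 0 < rho by apply: Rmin_glb_lt; [lra|apply: Rdiv_lt_0_compat; lra].
have r2 : (K + 1) * rho <= e / 2.
  have : rho <= e / 2 / (K + 1) := Rmin_r _ _.
  have : e / 2 / (K + 1) * (K + 1) = e / 2 by field; lra.
  nra.
have uc' : cont_par (fun y s => - (1 * u y s)).
  move=> y t ht r r00; have [d [d0 Hd]] := uc y ht r00; exists d; split => // z s s0 hz hs.
  by have := Hd z s s0 hz hs; rewrite -Rabs_Ropp; congr (Rabs _ < _); ring.
have uL' y z t : 0 <= t -> Rabs (- (1 * u y t) - - (1 * u z t)) <= C * vnorm (vsub y z).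
  by move=> /(uL y z); rewrite -Rabs_Ropp; congr (Rabs _ <= _); ring.
have ns' : nearly_stationary (fun y s => - (1 * u y s)) (fun y => - phi y).
  move=> r R0 r00 R00; have [T [T0 HT]] := ns r00 R00; exists T; split => // y s hs.
  by have := HT y s hs; rewrite -Rabs_Ropp; congr (Rabs _ <= _); ring.
have sX' : symmetric (fun i j => -1 * X i j) by move=> i j; rewrite sX.
have [y [t [a [q [m [t0 [m0 mr] [pj yr] ar qr]]]]]] := stable_jet C0 uc' uL' ns' sX' (subjet_opp sj) r0.
have pj' := par_superjet_opp Rlt_0_1 pj.
have ME : (fun i j => - / 1 * (-1 * X i j + m * idm i j)) = (fun i j => X i j + (- m) * idm i j).
  by apply: functional_extensionality => i; apply: functional_extensionality => j; field.
have qE : vnorm (vsub (vscal (- / 1) q) p) <= rho.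
  have -> : vsub (vscal (- / 1) q) p = vscal (-1) (vsub q (vscal (-1) p)) by vring.
  by rewrite vnormZ Rabs_Ropp Rabs_R1 Rmult_1_l.
rewrite ME in pj'.
have sY : symmetric (fun i j => X i j + (- m) * idm i j) by move=> i j; rewrite sX idm_sym.
have [th hth] := usup t0 sY pj' (ltac:(lra) : 0 < e / 2).
exists th.
have mr' : Rabs (- m) <= rho by rewrite Rabs_Ropp Rabs_pos_eq.
have /Rabs_leD := HK rho r0 (Rmin_l _ _) th y _ _ mr' yr qE.
move/Rabs_leD: ar; lra.
Qed.

Lemma nearly_stationary_convergence eps : 0 < eps -> exists T, forall t x, T <= t -> Rabs (u x t - phi x) <= eps.
Proof.
move=> e0; have [T [T0 HT]] := ns e0 Rlt_0_1.
have h x : Rabs (u x T - phi x) <= eps by have := HT x 0; rewrite Rplus_0_r Rabs_R0; apply; lra.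
have C0' := Rlt_le _ _ C0.
have c1 := @comparison_sub N Th C sg H C0 sgB sgL HB HL u phi C C0' uc up uL phiL phip T eps usub stability_super
  ltac:(lra) (fun x => proj2 (Rabs_leD (h x))).
have h' x : phi x - u x T <= eps by have := Rabs_leD (h x); lra.
have c2 := @comparison_super N Th C sg H C0 sgB sgL HB HL u phi C C0' uc up uL phiL phip T eps usup stability_sub
  ltac:(lra) h'.
exists T => t x tT; have := c1 t x tT; have := c2 t x tT => a1 a2; apply: Rabs_le; lra.
Qed.
End Convergence.

(** * Gaussian barriers *)

Lemma derive_ge0_le (f df : R -> R) a b : a <= b -> (forall x, is_derive f x (df x)) ->
  (forall x, a <= x <= b -> 0 <= df x) -> f a <= f b.
Proof.
move=> ab Hd Hp.
have [||c [[c1 c2] E]] := @MVT_gen f a b df.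
- by move=> x _; exact: Hd.
- move=> x _; apply (proj2 (continuity_pt_filterlim f x)).
  by apply: (@ex_derive_continuous R_AbsRing R_NormedModule); exists (df x); exact: Hd.
rewrite Rmin_left // in c1; rewrite Rmax_right // in c2.
have := Hp c (conj c1 c2); nra.
Qed.

(** A bound from below, valid for both signs of [d], suffices for a second-order expansion of the
    barrier from below. *)
Lemma exp_cubic d : 1 + d + d * d / 2 + d * d * d / 6 <= exp d.
Proof.
have quad_pos x : 0 <= x -> 1 + x + x * x / 2 <= exp x.
  move=> x0; have := @derive_ge0_le (fun y => exp y - (1 + y + y * y / 2)) (fun y => exp y - (1 + y)) 0 x x0.
  rewrite exp_0 => h; suff : 1 - (1 + 0 + 0 * 0 / 2) <= exp x - (1 + x + x * x / 2) by lra.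
  apply: h => [y|y _]; last by have := exp_ineq1_le y; lra.
  by auto_derive => //; field.
have quad_neg x : x <= 0 -> exp x <= 1 + x + x * x / 2.
  move=> x0; have := @derive_ge0_le (fun y => exp y - (1 + y + y * y / 2)) (fun y => exp y - (1 + y)) x 0 x0.
  rewrite exp_0 => h; suff : exp x - (1 + x + x * x / 2) <= 1 - (1 + 0 + 0 * 0 / 2) by lra.
  apply: h => [y|y _]; last by have := exp_ineq1_le y; lra.
  by auto_derive => //; field.
case: (Rle_dec 0 d) => [d0|/Rnot_le_lt d0].
  have := @derive_ge0_le (fun y => exp y - (1 + y + y * y / 2 + y * y * y / 6)) (fun y => exp y - (1 + y + y * y / 2)) 0 d d0.
  rewrite exp_0 => h; suff : 1 - (1 + 0 + 0 * 0 / 2 + 0 * 0 * 0 / 6) <= exp d - (1 + d + d * d / 2 + d * d * d / 6) by lra.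
  apply: h => [y|y [y0 _]]; last by have := quad_pos y y0; lra.
  by auto_derive => //; field.
have := @derive_ge0_le (fun y => (1 + y + y * y / 2 + y * y * y / 6) - exp y) (fun y => (1 + y + y * y / 2) - exp y) d 0 (Rlt_le _ _ d0).
rewrite exp_0 => h; suff : 1 + d + d * d / 2 + d * d * d / 6 - exp d <= 1 + 0 + 0 * 0 / 2 + 0 * 0 * 0 / 6 - 1 by lra.
apply: h => [y|y [_ y0]]; last by have := quad_neg y y0; lra.
by auto_derive => //; field.
Qed.

Section Barrier.
Variables (N : nat) (la al t1 : R) (x1 : vec N).
Hypotheses (la0 : 0 <= la) (al1 : 1 <= al).

Definition barrier x t := exp (la * (t - t1) - al * dot (vsub x x1) (vsub x x1)).

Lemma barrier_gt0 x t : 0 < barrier x t.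
Proof. exact: exp_pos. Qed.

Lemma barrier_le x t D : t <= t1 -> D <= al * dot (vsub x x1) (vsub x x1) -> barrier x t <= exp (- D).
Proof.
move=> tt hD; rewrite /barrier.
have h : la * (t - t1) - al * dot (vsub x x1) (vsub x x1) <= - D by nra.
by case: h => [/exp_increasing|->]; lra.
Qed.

Lemma barrier_le1 x t : t <= t1 -> barrier x t <= 1.
Proof.
move=> tt; have -> : 1 = exp (- 0) by rewrite Ropp_0 exp_0.
apply: barrier_le => //; have := dot_ge0 (vsub x x1); nra.
Qed.

Lemma barrier_time_continuous x t eps : 0 < eps -> exists d, 0 < d /\
  forall s, Rabs (s - t) < d -> Rabs (barrier x s - barrier x t) < eps.
Proof.
move=> e0.
have : continuity_pt (fun s => barrier x s) t.
  apply (proj2 (continuity_pt_filterlim (fun s => barrier x s) t)).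
  apply: (@ex_derive_continuous R_AbsRing R_NormedModule).
  by rewrite /barrier; auto_derive.
move=> /(_ eps e0) [d [d0 Hd]]; exists d; split => // s hs.
have [->|st] := Req_dec s t; first by rewrite Rminus_diag Rabs_R0.
by apply: Hd; split => //; split => // E; apply: st.
Qed.

(** [1 + al s^2 <= exp (al s^2)] gives [s exp (- al s^2) <= 1] when [al >= 1], which bounds the
    radial derivative by [2 al]. *)
Lemma barrier_Lip t : t <= t1 -> Lip (2 * al) (fun x => barrier x t).
Proof.
move=> tt.
have key a b : 0 <= a -> a <= b -> exp (la * (t - t1) - al * (a * a)) - exp (la * (t - t1) - al * (b * b)) <= 2 * al * (b - a).
  move=> a0 ab.
  have := @derive_ge0_le (fun s => 2 * al * s + exp (la * (t - t1) - al * (s * s)))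
     (fun s => 2 * al + (- 2 * al * s) * exp (la * (t - t1) - al * (s * s))) a b ab.
  move=> h; suff : 2 * al * a + exp (la * (t - t1) - al * (a * a)) <= 2 * al * b + exp (la * (t - t1) - al * (b * b)) by lra.
  apply: h => [s|s [s0 _]]; first by auto_derive => //; rewrite /Rminus; ring.
  have E : exp (la * (t - t1) - al * (s * s)) * (1 + al * (s * s)) <= 1.
    apply: (Rle_trans _ (exp (la * (t - t1) - al * (s * s)) * exp (al * (s * s)))).
      by apply: Rmult_le_compat_l; [apply: Rlt_le; exact: exp_pos|exact: exp_ineq1_le].
    rewrite -exp_plus.
    have h2 : la * (t - t1) - al * (s * s) + al * (s * s) <= 0 by nra.
    by rewrite -exp_0; case: h2 => [/exp_increasing|->]; lra.
  have ep := exp_pos (la * (t - t1) - al * (s * s)).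
  move: E ep; set E0 := exp (la * (t - t1) - al * (s * s)) => E ep.
  have h2 : s <= 1 + al * (s * s).
    have : s * s <= al * (s * s) by nra.
    have := Rle_0_sqr (s - 1); rewrite /Rsqr; nra.
  have h3 : 0 <= al * (1 - E0 * s) -> 0 <= 2 * al + -2 * al * s * E0 by lra.
  apply: h3; have : E0 * s <= 1 by apply: Rle_trans E; apply: Rmult_le_compat_l; lra.
  move=> h4; apply: Rmult_le_pos; lra.
have key2 x y : vnorm (vsub x x1) <= vnorm (vsub y x1) -> 0 <= barrier x t - barrier y t <= 2 * al * vnorm (vsub x y).
  move=> xy; have x0 := vnorm_ge0 (vsub x x1).
  rewrite /barrier -!vnorm_mul; split.
    have : la * (t - t1) - al * (vnorm (vsub y x1) * vnorm (vsub y x1)) <= la * (t - t1) - al * (vnorm (vsub x x1) * vnorm (vsub x x1)).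
      have : vnorm (vsub x x1) * vnorm (vsub x x1) <= vnorm (vsub y x1) * vnorm (vsub y x1) by nra.
      nra.
    by case=> [/exp_increasing|->]; lra.
  apply: Rle_trans (key _ _ x0 xy) _.
  apply: Rmult_le_compat_l; first lra.
  have := vnorm_tri x y x1; rewrite (vnorm_subC y x); lra.
move=> x y; case: (Rle_dec (vnorm (vsub x x1)) (vnorm (vsub y x1))) => [h|/Rnot_le_lt /Rlt_le h].
  have := key2 _ _ h; move=> hh; apply: Rabs_le; lra.
have := key2 _ _ h; rewrite vnorm_subC => hh; apply: Rabs_le; lra.
Qed.

(** An expansion from below: moved across a superjet of [u + z barrier], it leaves a superjet of [u]
    itself. *)
Lemma barrier_expand x t eps : 0 < eps -> exists r, 0 < r /\ forall y s,
  vnorm (vsub y x) < r -> Rabs (s - t) < r ->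
  barrier x t * (1 + la * (s - t) - 2 * al * dot (vsub x x1) (vsub y x)
    + (2 * al * al * (dot (vsub x x1) (vsub y x)) ^ 2 - al * dot (vsub y x) (vsub y x)))
  - eps * (Rabs (s - t) + vnorm (vsub y x) ^ 2) <= barrier y s.
Proof.
move=> e0.
have b0 := barrier_gt0 x t; set b := barrier x t in b0 *.
have [w Ew] : exists w, w = vsub x x1 by eexists.
rewrite -Ew.
have wn := vnorm_ge0 w.
set K := la + 2 * al * vnorm w + al + 1; have K1 : 1 <= K by rewrite /K; nra.
(* All remainders are at most [10 K^3 r (c + n^2)] with [c = |s - t|] and [n = |y - x|]; this fixes
   [r]. *)
set r := Rmin 1 (eps / (b + 1) / (10 * (K * K * K))).
have KKK : 0 < K * K * K by apply: Rmult_lt_0_compat; nra.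
have eb : 0 < eps / (b + 1) by apply: Rdiv_lt_0_compat; lra.
have r0 : 0 < r by apply: Rmin_glb_lt; [lra|apply: Rdiv_lt_0_compat; lra].
have r1 : r <= 1 := Rmin_l _ _.
have r2 : 10 * (K * K * K) * r <= eps / (b + 1).
  have : r <= eps / (b + 1) / (10 * (K * K * K)) := Rmin_r _ _.
  have : eps / (b + 1) / (10 * (K * K * K)) * (10 * (K * K * K)) = eps / (b + 1) by field; lra.
  nra.
exists r; split => // y s hy hs.
have [h Eh] : exists h, h = vsub y x by eexists.
rewrite -Eh in hy *; have hn := vnorm_ge0 h.
set g := s - t in hs *; set c := Rabs g in hs *.
have c0 : 0 <= c by exact: Rabs_pos.
have /Rabs_leD gc : Rabs g <= c by rewrite /c; lra.
set n := vnorm h in hy hn *.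
set m := dot w h.
have /Rabs_leD hm : Rabs m <= vnorm w * n by exact: dot_CS_abs.
have hh : dot h h = n * n by rewrite -vnorm_mul.
set d := la * g - al * (2 * m + n * n).
have bE : barrier y s = b * exp d.
  rewrite /b /barrier -exp_plus; congr exp.
  have -> : vsub y x1 = vadd w h by rewrite Ew Eh; vring.
  rewrite -Ew !dotE (dotC h w) -/m hh /d /g; ring.
have ec := exp_cubic d.
set q := la * g - al * (n * n).
have dq : d = q - 2 * al * m by rewrite /d /q; ring.
have qb : Rabs q <= K * (c + n * n).
  apply: Rabs_le; rewrite /q /K.
  have : 0 <= 2 * al * vnorm w by nra.
  have : la * c <= K * c by rewrite /K; apply: Rmult_le_compat_r => //; nra.
  have : al * (n * n) <= K * (n * n) by rewrite /K; apply: Rmult_le_compat_r; nra.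
  rewrite /K; nra.
have db : Rabs d <= K * (c + n).
  apply: Rabs_le; rewrite /d /K.
  have : n * n <= n by nra.
  have : 0 <= al * vnorm w * n by apply: Rmult_le_pos => //; nra.
  have : 0 <= al * vnorm w * c by apply: Rmult_le_pos => //; nra.
  nra.
have mb : Rabs (2 * al * m) <= K * n.
  apply: Rabs_le; rewrite /K; have : 0 <= (la + al + 1) * n by nra.
  nra.
have d2 : 4 * al * al * (m * m) - 2 * (K * n * (K * (c + n * n))) <= d * d.
  have : Rabs (2 * al * m * q) <= K * n * (K * (c + n * n)).
    rewrite Rabs_mult; apply: Rmult_le_compat => //; exact: Rabs_pos.
  move/Rabs_leD; rewrite dq; have := Rle_0_sqr q; rewrite /Rsqr; lra.
have d3 : - (K * K * K * ((c + n) * (c + n) * (c + n))) <= d * d * d.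
  have : Rabs (d * d * d) <= K * (c + n) * (K * (c + n)) * (K * (c + n)).
    rewrite !Rabs_mult; apply: Rmult_le_compat => //; try exact: Rabs_pos.
      by apply: Rmult_le_pos; exact: Rabs_pos.
    by apply: Rmult_le_compat => //; exact: Rabs_pos.
  move/Rabs_leD; lra.
have e1 : (c + n) * (c + n) * (c + n) <= 4 * r * (c + n * n) + 4 * r * (c + n * n).
  have : (c + n) * (c + n) <= 2 * (c * c) + 2 * (n * n) by have := Rle_0_sqr (c - n); rewrite /Rsqr; lra.
  have : c * c <= c by nra.
  have cn : c + n <= 2 * r by lra.
  move=> h1 h2; have h3 : (c + n) * (c + n) <= 2 * (c + n * n) by lra.
  have h4 : 0 <= (c + n) * (c + n) by nra.
  have : (c + n) * (c + n) * (c + n) <= 2 * (c + n * n) * (2 * r) by apply: Rmult_le_compat; lra.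
  have : 0 <= r * (c + n * n) by apply: Rmult_le_pos; nra.
  lra.
have e2 : K * n * (K * (c + n * n)) <= K * K * r * (c + n * n).
  have -> : K * n * (K * (c + n * n)) = K * K * (c + n * n) * n by ring.
  have -> : K * K * r * (c + n * n) = K * K * (c + n * n) * r by ring.
  apply: Rmult_le_compat_l; last lra.
  by apply: Rmult_le_pos; nra.
set Z := r * (c + n * n); have Z0 : 0 <= Z by apply: Rmult_le_pos; nra.
have e3 : K * K * Z <= K * K * K * Z by apply: Rmult_le_compat_r => //; nra.
have e4 : K * K * K * ((c + n) * (c + n) * (c + n)) <= K * K * K * (8 * Z) by apply: Rmult_le_compat_l; [exact: Rlt_le|rewrite /Z; lra].
have e5 : 1 + la * g - 2 * al * m + (2 * al * al * m ^ 2 - al * (n * n)) - 10 * (K * K * K) * Z <= exp d.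
  have e30 : 0 <= K * K * K * Z by apply: Rmult_le_pos => //; exact: Rlt_le.
  have d1 : d = la * g - al * (n * n) - 2 * al * m by rewrite dq /q.
  have e2' : K * n * (K * (c + n * n)) <= K * K * Z by rewrite /Z; lra.
  have -> : m ^ 2 = m * m by ring.
  move: ec d2 d3 d1 e2' e3 e4 e30; clearbody d Z q; lra.
have e6 : b * (10 * (K * K * K) * Z) <= eps * (c + n ^ 2).
  have h1 : 10 * (K * K * K) * Z <= eps / (b + 1) * (c + n * n).
    have -> : 10 * (K * K * K) * Z = 10 * (K * K * K) * r * (c + n * n) by rewrite /Z; ring.
    by apply: Rmult_le_compat_r => //; nra.
  have h2 : 0 <= 10 * (K * K * K) * Z by apply: Rmult_le_pos => //; lra.
  have h3 : (b + 1) * (10 * (K * K * K) * Z) <= eps * (c + n * n).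
    have -> : eps * (c + n * n) = (b + 1) * (eps / (b + 1) * (c + n * n)) by field; lra.
    by apply: Rmult_le_compat_l; lra.
  have -> : n ^ 2 = n * n by ring.
  lra.
have e7 := Rmult_le_compat_l _ _ _ (Rlt_le _ _ b0) e5.
rewrite bE hh; lra.
Qed.

End Barrier.

Section BarrierSub.
Variables (N : nat) (Th : Type) (C : R) (sg : Th -> vec N -> mat N) (H : Th -> vec N -> vec N -> R).
Hypothesis C0 : 0 < C.
Hypothesis sgB : forall th x, mnorm (sg th x) <= C.

Definition outer_product (w : vec N) : mat N := fun i j => w i * w j.
Lemma quad_outer w h : quad (outer_product w) h = dot w h ^ 2.
Proof.
rewrite /quad /outer_product /dot; set S := \big[Rplus/0]_(i < N) (w i * h i).
transitivity (\big[Rplus/0]_(i < N) (S * (w i * h i))); last by rewrite sumZ -/S; ring.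
apply: eq_bigr => i _; rewrite Rmult_comm -sumZ; apply: eq_bigr => j _; ring.
Qed.
Lemma tr2_outer (s : mat N) w : tr2 s (outer_product w) = quad (diffusion s) w.
Proof. by rewrite quad_diffusion /tr2; apply: eq_bigr => k _; rewrite quad_outer (dotC w); ring. Qed.

(* Far from its centre the barrier is a strict subsolution of the extremal equation once [al] is large. *)
Lemma barrier_subsolution u la al t1 x1 z Rp CR nu de x t a p X :
  parabolic_sub sg H u -> 0 <= la -> 1 <= al -> 0 < z -> z * (2 * al) <= 1 -> t <= t1 ->
  (forall th x p q, vnorm p <= Rp + 1 -> vnorm q <= Rp + 1 -> Rabs (H th x p - H th x q) <= CR * vnorm (vsub p q)) ->
  0 < CR -> 0 < nu -> 0 < de -> de <= vnorm (vsub x x1) ->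
  (forall th xi, nu * dot xi xi <= quad (diffusion (sg th x)) xi) ->
  C * C / (de * de) + CR / de <= al * nu -> la <= al * al * nu * (de * de) ->
  0 < t -> symmetric X -> vnorm p <= Rp ->
  par_superjet (fun y s => u y s + z * barrier la al t1 x1 y s) x t a p X ->
  forall th, a - tr2 (sg th x) X + H th x p <= - (al * al * nu * (de * de) * (z * barrier la al t1 x1 x t)).
Proof.
move=> usub la0 al1 z0 zal tt HH CR0 nu0 de0 far ell aln lal t0 sX pR sj th.
have b0 := barrier_gt0 la al t1 x1 x t; set b := barrier la al t1 x1 x t in b0 *.
have [w Ew] : exists w, w = vsub x x1 by eexists.
rewrite -Ew in far.
set p' := vadd p (vscal (z * b * (2 * al)) w).
set X' : mat N := fun i j => X i j + ((- (z * b * (4 * al * al))) * outer_product w i j + z * b * (2 * al) * idm i j).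
have sX' : symmetric X'.
  by move=> i j; rewrite /X' sX (idm_sym i j) /outer_product; ring.
have qX' h : quad X' h = quad X h + (- (z * b * (4 * al * al)) * dot w h ^ 2 + z * b * (2 * al) * dot h h).
  by rewrite /X' quad_matD (quad_matD (fun i j => - (z * b * (4 * al * al)) * outer_product w i j)) !quad_matZ quad_outer quad_idm.
have sj' : par_superjet u x t (a - z * b * la) p' X'.
  move=> eps e0; have e2 : 0 < eps / 2 by lra.
  have [d [d0 Hd]] := sj _ e2.
  have [r [r0 Hr]] := barrier_expand t1 x1 la0 al1 x t (Rdiv_lt_0_compat _ _ e2 z0).
  exists (Rmin d r); split; first exact: Rmin_glb_lt.
  move=> y s s0 hy hs.
  have := Hd y s s0 (Rlt_le_trans _ _ _ hy (Rmin_l _ _)) (Rlt_le_trans _ _ _ hs (Rmin_l _ _)).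
  have := Hr y s (Rlt_le_trans _ _ _ hy (Rmin_r _ _)) (Rlt_le_trans _ _ _ hs (Rmin_r _ _)).
  rewrite -/b -Ew => h1 h2.
  have h3 := Rmult_le_compat_l _ _ _ (Rlt_le _ _ z0) h1.
  have [h Eh] : exists h, h = vsub y x by eexists.
  rewrite -Eh in h2 h3 *.
  rewrite qX' /p' !dotE.
  set E := Rabs (s - t) + vnorm h ^ 2 in h2 h3 *.
  have E1 : z * (eps / 2 / z * E) = eps / 2 * E by field; lra.
  lra.
have := usub x t _ _ _ t0 sX' sj' th.
set G := tr2 (sg th x) (outer_product w).
have -> : tr2 (sg th x) X' = tr2 (sg th x) X + (- (z * b * (4 * al * al)) * G + z * b * (2 * al) * frob2 (sg th x)).
  rewrite -tr2_idm /G -!tr2_scal /tr2 -!sumD; apply: eq_bigr => k _.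
  by rewrite /X' quad_matD (quad_matD (fun i j => - (z * b * (4 * al * al)) * outer_product w i j)).
have n0 := vnorm_ge0 w; set n := vnorm w in far n0 *.
have G0 : nu * (n * n) <= G by have := ell th w; rewrite -vnorm_mul -/n /G tr2_outer.
have f0 : frob2 (sg th x) <= C * C.
  by rewrite frob2_sq; have := sgB th x; have := mnorm_ge0 (sg th x) => h1 h2; apply: Rmult_le_compat.
have bn : b * n <= 1.
  have b1 : b * (1 + al * (n * n)) <= 1.
    rewrite /b /barrier -Ew -vnorm_mul -/n.
    apply: (Rle_trans _ (exp (la * (t - t1) - al * (n * n)) * exp (al * (n * n)))).
      by apply: Rmult_le_compat_l; [apply: Rlt_le; exact: exp_pos|exact: exp_ineq1_le].
    rewrite -exp_plus; have h2 : la * (t - t1) - al * (n * n) + al * (n * n) <= 0 by nra.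
    by rewrite -exp_0; case: h2 => [/exp_increasing|->]; lra.
  have : n <= 1 + al * (n * n).
    have : n * n <= al * (n * n) by nra.
    have := Rle_0_sqr (n - 1); rewrite /Rsqr; nra.
  move=> h2; apply: Rle_trans b1; apply: Rmult_le_compat_l; lra.
have zb0 : 0 < z * b by exact: Rmult_lt_0_compat.
have dp : vnorm (vsub p p') = z * b * (2 * al) * n.
  have -> : vsub p p' = vscal (- (z * b * (2 * al))) w by rewrite /p'; vring.
  rewrite vnormZ Rabs_Ropp Rabs_pos_eq //; nra.
have dp1 : z * b * (2 * al) * n <= 1.
  have -> : z * b * (2 * al) * n = z * (2 * al) * (b * n) by ring.
  have : 0 <= z * (2 * al) by nra.
  have : 0 <= b * n by nra.
  nra.
have p'R : vnorm p' <= Rp + 1.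
  have -> : p' = vsub p (vsub p p') by vring.
  by apply: Rle_trans (vnorm_sub _ _) _; rewrite dp; lra.
have /Rabs_leD [_ hH] := HH th x p p' ltac:(lra) p'R; rewrite dp in hH.
move=> V.
(* The good term is [4 al^2 nu n^2]: half of it absorbs the terms of first order in [al], a quarter
   absorbs [la] because [de <= n], and the last quarter is the strictness. *)
have q1 : 2 * al * (C * C) + CR * (2 * al * n) <= 2 * (al * al) * nu * (n * n).
  have h1 : C * C / (de * de) * (n * n) + CR / de * (n * n) <= al * nu * (n * n).
    by rewrite -Rmult_plus_distr_r; apply: Rmult_le_compat_r => //; nra.
  have dd : 0 < de * de by nra.
  have h2 : C * C <= C * C / (de * de) * (n * n).
    have -> : C * C / (de * de) * (n * n) = C * C * (n * n / (de * de)) by field; lra.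
    have : 1 <= n * n / (de * de).
      apply: (Rmult_le_reg_r (de * de)) => //; have -> : n * n / (de * de) * (de * de) = n * n by field; lra.
      nra.
    have : 0 <= C * C by nra.
    nra.
  have h3 : CR * n <= CR / de * (n * n).
    have -> : CR / de * (n * n) = CR * (n * (n / de)) by field; lra.
    apply: Rmult_le_compat_l; first lra.
    have : 1 <= n / de.
      apply: (Rmult_le_reg_r de) => //; have -> : n / de * de = n by field; lra.
      lra.
    nra.
  have h4 : C * C + CR * n <= al * nu * (n * n) by lra.
  have := Rmult_le_compat_l (2 * al) _ _ ltac:(lra) h4; lra.
have q2 : al * al * nu * (de * de) <= al * al * nu * (n * n).
  apply: Rmult_le_compat_l; first pos.
  by apply: Rmult_le_compat; lra.
have q3 : 4 * al * al * (nu * (n * n)) <= 4 * al * al * G by apply: Rmult_le_compat_l => //; nra.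
have q4 : 2 * al * frob2 (sg th x) <= 2 * al * (C * C) by apply: Rmult_le_compat_l; lra.
have q5 : la + 2 * al * frob2 (sg th x) + CR * (2 * al * n) - 4 * al * al * G <= - (al * al * nu * (de * de)) by lra.
have := Rmult_le_compat_l _ _ _ (Rlt_le _ _ zb0) q5.
lra.
Qed.
End BarrierSub.

(** * The uniformly elliptic case *)

Lemma Lip_weaken N L1 L2 (f : vec N -> R) : L1 <= L2 -> Lip L1 f -> Lip L2 f.
Proof. by move=> l h x y; apply: Rle_trans (h x y) _; apply: Rmult_le_compat_r => //; exact: vnorm_ge0. Qed.

Lemma barrier_ge N la al t1 (x1 : vec N) x t D : la * (t1 - t) + al * dot (vsub x x1) (vsub x x1) <= D ->
  exp (- D) <= barrier la al t1 x1 x t.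
Proof.
move=> h; rewrite /barrier.
have : - D <= la * (t - t1) - al * dot (vsub x x1) (vsub x x1) by lra.
by case=> [/exp_increasing|->]; lra.
Qed.

Section UniformlyElliptic.
Variables (N : nat) (Th : Type) (C : R) (sg : Th -> vec N -> mat N) (H : Th -> vec N -> vec N -> R).
Hypothesis C0 : 0 < C.
Hypothesis sgB : forall th x, mnorm (sg th x) <= C.
Hypothesis sgL : forall th x y, mnorm (msub (sg th x) (sg th y)) <= C * vnorm (vsub x y).
Hypothesis HB : forall th x, Rabs (H th x zerov) <= C.
Hypothesis HL : forall Rr, 0 < Rr -> exists CR, 0 < CR /\
     forall th x y p q, vnorm p <= Rr -> vnorm q <= Rr ->
       Rabs (H th x p - H th y q) <= CR * (vnorm (vsub x y) + vnorm (vsub p q)).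
Variable nu : R.
Hypothesis nu0 : 0 < nu.
Hypothesis ell : forall th x xi, nu * dot xi xi <= quad (diffusion (sg th x)) xi.

Variable u : vec N -> R -> R.
Hypotheses (uc : cont_par u) (up : forall t, periodic (fun x => u x t)).
Hypothesis uL : forall x y t, 0 <= t -> Rabs (u x t - u y t) <= C * vnorm (vsub x y).
Hypotheses (usub : parabolic_sub sg H u) (usup : parabolic_super sg H u).
Variable B0 : R.
Hypothesis ub : forall x t, 0 <= t -> Rabs (u x t) <= B0.
Variables (v : vec N -> R) (L : R).
Hypotheses (L0 : 0 <= L) (vL : Lip L v) (vp : periodic v).
Hypothesis vsups : elliptic_super sg H v.

(** [M] is the largest level that the spatial maximum of [u - v] reaches at every time; by
    comparison, a level once left is never exceeded again. *)
Lemma asymptotic_supremum : exists M,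
  (forall e, 0 < e -> exists T, 0 <= T /\ forall t x, T <= t -> u x t - v x <= M + e) /\
  (forall t e, 0 <= t -> 0 < e -> exists x, M - e < u x t - v x).
Proof.
have [xa ma] := periodic_max L0 vL vp.
have [xi mi] : exists x, forall y, - v y <= - v x.
  by apply: (periodic_max L0 (Lip_opp vL)) => x k; rewrite vp.
pose S r := forall t, 0 <= t -> exists x, r <= u x t - v x.
have [M [Mub Mlub]] : exists M, is_lub S M.
  have Sb : bound S.
    exists (B0 - v xi) => r Sr; have [x hx] := Sr 0 (Rle_refl 0).
    have /Rabs_leD := ub x (Rle_refl 0); have := mi x; lra.
  have Sn : exists r, S r.
    exists (- B0 - v xa) => t t0; exists xa; have /Rabs_leD := ub xa t0; lra.
  by have [M hM] := completeness S Sb Sn; exists M.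
exists M; split=> [e e0|t e t0 e0].
  have : ~ S (M + e) by move=> /Mub; lra.
  move=> /not_all_ex_not [T hT].
  have [T0 hT2] : 0 <= T /\ ~ exists x, M + e <= u x T - v x by apply: imply_to_and hT.
  exists T; split => // t x tT.
  have L' : 0 <= C + L by lra.
  apply: (@comparison_sub N Th C sg H C0 sgB sgL HB HL u v (C + L) L' uc up _ _ vp T) => //.
  - move=> y z s s0; apply: Rle_trans (uL y z s0) _; apply: Rmult_le_compat_r; [exact: vnorm_ge0|lra].
  - by apply: Lip_weaken vL; lra.
  - by move=> y; apply: Rnot_lt_le => h; apply: hT2; exists y; lra.
have [r [Sr hr]] : exists r, S r /\ M - e < r.
  apply: NNPP => h; have : M <= M - e; last lra.
  by apply: Mlub => r Sr; apply: Rnot_lt_le => h2; apply: h; exists r.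
by have [x hx] := Sr t t0; exists x; lra.
Qed.

(** A deficit [g] at [(x1, t1)] persists, reduced to [g / 4], on the ball of radius [de] and back to
    time [t1 - th]. This removes the neighbourhood of [x1] where the barrier need not be a
    subsolution, and there [z <= g / 4] keeps the sum below [M]. *)
Lemma Harnack_alternative M : 
  (forall e, 0 < e -> exists T, 0 <= T /\ forall t x, T <= t -> u x t - v x <= M + e) ->
  (forall t e, 0 <= t -> 0 < e -> exists x, M - e < u x t - v x) ->
  forall g, 0 < g -> exists T, forall t x, T <= t -> M - g <= u x t - v x.
Proof.
move=> Mup Mlo g g0.
have g4 : 0 < g / 4 by lra.
have [K [K0 HK]] := time_modulus C0 sgB HB HL uc uL usup ub g4.
set th := g / (4 * K); have th0 : 0 < th by apply: Rdiv_lt_0_compat; lra.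
have Kth : K * th = g / 4 by rewrite /th; field; lra.
set L1 := C + L; have L10 : 0 < L1 by rewrite /L1; lra.
set de := g / (4 * L1); have de0 : 0 < de by apply: Rdiv_lt_0_compat; lra.
have Lde : L1 * de = g / 4 by rewrite /de; field; lra.
have R0 : 0 < C + 1 + 1 by lra.
have [CR [CR0 HCR]] := HL R0.
have dd : 0 < de * de by pos.
have nn : 0 <= INR N * INR N by have := pos_INR N; nra.
set k1 := (C * C / (de * de) + CR / de) / nu.
(* [la] is quadratic in [al], so a large [al] makes [la th / 2] exceed [al N^2 + 2]: within half a
   window the barrier grows by more than it decays across a cell. *)
set k2 := 2 * (INR N * INR N + 2) / (nu * (de * de) * th).
have k10 : 0 <= k1.
  apply: Rlt_le; apply: Rdiv_lt_0_compat => //; have : 0 < C * C / (de * de) by apply: Rdiv_lt_0_compat => //; nra.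
  have : 0 < CR / de by exact: Rdiv_lt_0_compat.
  lra.
have nd : 0 < nu * (de * de) by exact: Rmult_lt_0_compat.
have k20 : 0 <= k2 by apply: Rlt_le; apply: Rdiv_lt_0_compat; [lra|exact: Rmult_lt_0_compat].
set al := 1 + k1 + k2; have al1 : 1 <= al by rewrite /al; lra.
have aln : C * C / (de * de) + CR / de <= al * nu.
  have -> : C * C / (de * de) + CR / de = k1 * nu by rewrite /k1; field; lra.
  by apply: Rmult_le_compat_r; rewrite /al; lra.
set la := al * al * nu * (de * de).
have la0 : 0 < la by rewrite /la; apply: Rmult_lt_0_compat => //; apply: Rmult_lt_0_compat => //; nra.
have lath : al * (INR N * INR N) + 2 <= la * th / 2.
  have e1 : k2 * (nu * (de * de) * th) = 2 * (INR N * INR N + 2) by rewrite /k2; field; lra.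
  have e2 : 2 * (INR N * INR N + 2) <= al * (nu * (de * de) * th).
    rewrite -e1; apply: Rmult_le_compat_r; last by rewrite /al; lra.
    by apply: Rlt_le; exact: Rmult_lt_0_compat.
  have -> : la * th / 2 = al * (al * (nu * (de * de) * th)) / 2 by rewrite /la; field.
  have := Rmult_le_compat_l al _ _ ltac:(lra) e2; lra.
set z := Rmin (g / 4) (/ (2 * al)).
have ial : 0 < / (2 * al) by apply: Rinv_0_lt_compat; lra.
have z0 : 0 < z by exact: Rmin_glb_lt.
have zg : z <= g / 4 := Rmin_l _ _.
have zal : z * (2 * al) <= 1.
  have : z <= / (2 * al) := Rmin_r _ _.
  have : / (2 * al) * (2 * al) = 1 by field; lra.
  nra.
(* The largest value of the barrier term at the start of the window. *)
set e := z * exp (- (la * th)); have e0 : 0 < e by apply: Rmult_lt_0_compat => //; exact: exp_pos.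
have [T1 [T10 HT1]] := Mup e e0.
exists (T1 + th + 1) => t1 x1 t1T; apply: Rnot_lt_le => low.
set a := t1 - th; set tm := t1 - th / 2.
have aT : T1 <= a by rewrite /a; lra.
have ab : a <= t1 by rewrite /a; lra.
set be := barrier la al t1 x1.
set B := 4 * (z + 1) / (th * th).
have thth : 0 < th * th by pos.
have Bp : 0 <= B by apply: Rlt_le; apply: Rdiv_lt_0_compat; lra.
have BE : B * (th / 2) ^ 2 = z + 1 by rewrite /B; field; lra.
have pq := penalty_pos tm Bp.
have wc x t : a <= t <= t1 -> forall eps, 0 < eps -> exists d, 0 < d /\
     forall s, a <= s <= t1 -> Rabs (s - t) < d -> Rabs (u x s + z * be x s - (u x t + z * be x t)) < eps.
  move=> tab eps eps0; have eps2 : 0 < eps / 2 by lra.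
  have [d [d0 Hd]] := uc x (ltac:(lra) : 0 <= t) eps2.
  have [d' [d'0 Hd']] := barrier_time_continuous la al t1 x1 x t (Rdiv_lt_0_compat _ _ eps2 z0).
  exists (Rmin d d'); split; first exact: Rmin_glb_lt.
  move=> s sab hs.
  have h1 := Hd x s ltac:(lra) ltac:(by have -> : vsub x x = zerov by [vring]; rewrite vnorm0) (Rlt_le_trans _ _ _ hs (Rmin_l _ _)).
  have h2 := Hd' s (Rlt_le_trans _ _ _ hs (Rmin_r _ _)); rewrite -/be in h2.
  have h3 := Rmult_lt_compat_l _ _ _ z0 h2.
  have e1 : z * (eps / 2 / z) = eps / 2 by field; lra.
  move/Rabs_def2: h1 => h1; rewrite -{1}(Rabs_pos_eq z) in h3; last lra.
  rewrite -Rabs_mult e1 in h3; move/Rabs_def2: h3 => h3; apply: Rabs_def1; lra.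
have [U [ts win]] := window_exists_gen pq ab wc.
have [tab UE Uge] := win.
have UL : Lip (C + 1) U.
  apply: (window_Lip_gen win) => x y t tt.
  have /Rabs_leD h1 := uL x y (ltac:(lra) : 0 <= t).
  have /Rabs_leD h2 := barrier_Lip x1 (Rlt_le _ _ la0) al1 (proj2 tt) x y; rewrite -/be in h2.
  have vn := vnorm_ge0 (vsub x y).
  have h3 : z * (2 * al * vnorm (vsub x y)) <= vnorm (vsub x y).
    have -> : z * (2 * al * vnorm (vsub x y)) = z * (2 * al) * vnorm (vsub x y) by ring.
    by have := Rmult_le_compat_r _ _ _ vn zal; lra.
  have h4 := Rmult_le_compat_l z _ _ (Rlt_le _ _ z0) (proj1 h2).
  have h5 := Rmult_le_compat_l z _ _ (Rlt_le _ _ z0) (proj2 h2).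
  apply: Rabs_le; lra.
set L2 := C + 1 + L; have L20 : 0 <= L2 by rewrite /L2; lra.
have UL2 : Lip L2 U by apply: Lip_weaken UL; rewrite /L2; lra.
have vL2 : Lip L2 v by apply: Lip_weaken vL; rewrite /L2; lra.
have be1 x t : t <= t1 -> z * be x t <= z.
  by move=> tt; have := Rmult_le_compat_l z _ _ (Rlt_le _ _ z0) (barrier_le1 x1 (Rlt_le _ _ la0) al1 x tt); rewrite -/be; lra.
(* At mid-window a point where [u - v] exceeds [M - e] is translated to the cell of [x1], where the
   barrier term has grown to at least [6 e]. At the initial time the sum is at most [M + 2 e]. *)
have [xg xg1] : exists x, M + 5 * e <= U x - v x.
  have [y hy] := Mlo tm e ltac:(rewrite /tm; lra) e0.
  have [k hk] := cell_representative y x1.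
  exists (zshift y k).
  have := Uge (zshift y k) tm ltac:(rewrite /a /tm; lra).
  rewrite Rminus_diag Rmax_left; last lra.
  have := up tm y k; rewrite /= vp => ->.
  have D : la * (t1 - tm) + al * dot (vsub (zshift y k) x1) (vsub (zshift y k) x1) <= la * th - 2.
    have -> : t1 - tm = th / 2 by rewrite /tm; ring.
    rewrite -vnorm_mul; have vn := vnorm_ge0 (vsub (zshift y k) x1).
    have h1 : vnorm (vsub (zshift y k) x1) * vnorm (vsub (zshift y k) x1) <= INR N * INR N by apply: Rmult_le_compat.
    have := Rmult_le_compat_l al _ _ ltac:(lra) h1; lra.
  have h2 := barrier_ge D; rewrite -/be in h2.
  have h3 : 6 * exp (- (la * th)) <= exp (- (la * th - 2)).
    have -> : - (la * th - 2) = 2 + - (la * th) by ring.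
    rewrite exp_plus; apply: Rmult_le_compat_r; first by apply: Rlt_le; exact: exp_pos.
    have := exp_cubic 2; lra.
  have h4 : z * (6 * exp (- (la * th))) <= z * be (zshift y k) tm by apply: Rmult_le_compat_l; lra.
  rewrite /e in hy *; lra.
have Uup x : U x - v x <= M + e + z * be x (ts x) - B * Rmax 0 (ts x - tm) ^ 2.
  by have [h1 h2] := tab x; have := HT1 (ts x) x ltac:(lra); rewrite (UE x); lra.
have q0 x : 0 <= B * Rmax 0 (ts x - tm) ^ 2 by apply: Rmult_le_pos => //; exact: pow2_ge_0.
have [xh mxh] : exists x, forall y, U y - v y <= U x - v x.
  apply: (@coercive_max _ (fun x => U x - v x) x1 xg (la * th + 1)).
    exact: (Lip_QL (ltac:(lra) : 0 <= L2 + L2) (Lip_sub UL2 vL2)).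
  move=> x hx; have lt0 : 0 < la * th by exact: Rmult_lt_0_compat.
  have D : la * th <= al * dot (vsub x x1) (vsub x x1).
    rewrite -vnorm_mul; have : la * th <= vnorm (vsub x x1) * vnorm (vsub x x1).
      by have := Rmult_le_compat (la * th + 1) (vnorm (vsub x x1)) 1 (vnorm (vsub x x1)) ltac:(lra) ltac:(lra) ltac:(lra) ltac:(lra); lra.
    move=> h1; apply: Rle_trans h1 _; apply: Rle_mul1l => //; have := vnorm_ge0 (vsub x x1) => h1; pos.
  have := barrier_le (Rlt_le _ _ la0) (proj2 (tab x)) D; rewrite -/be => h1.
  have h2 := Rmult_le_compat_l z _ _ (Rlt_le _ _ z0) h1; rewrite -/e in h2.
  have := Uup x; have := q0 x; lra.
have big := Rle_trans _ _ _ xg1 (mxh xg).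
set r := e / (2 * L2); have r0 : 0 < r by apply: Rdiv_lt_0_compat => //; rewrite /L2; lra.
have rE : (L2 + L2) * r = e by rewrite /r; field; rewrite /L2; lra.
have near x : vnorm (vsub x xh) < r -> M + 4 * e <= U x - v x.
  move=> hx; have /Rabs_leD [h _] := Lip_sub UL2 vL2 x xh.
  have : (L2 + L2) * vnorm (vsub x xh) <= (L2 + L2) * r by apply: Rmult_le_compat_l; lra.
  lra.
have int x : vnorm (vsub x xh) < r -> a < ts x < t1.
  move=> /near hx; have [h1 h2] := tab x; have hU := Uup x; have qx := q0 x; split.
    case: h1 => // E; have dp := dot_ge0 (vsub x x1).
    have h3 : be x (ts x) <= exp (- (la * th)).
      rewrite -E /be /barrier.
      have : la * (a - t1) - al * dot (vsub x x1) (vsub x x1) <= - (la * th).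
        have : 0 <= al * dot (vsub x x1) (vsub x x1) by pos.
        rewrite /a; have -> : t1 - th - t1 = - th by ring.
        lra.
      by case=> [/exp_increasing|->]; lra.
    have := Rmult_le_compat_l z _ _ (Rlt_le _ _ z0) h3; rewrite -/e; lra.
  case: h2 => // E; have := be1 x (ts x) ltac:(lra); rewrite E in hU *; move: hU.
  have -> : t1 - tm = th / 2 by rewrite /tm; ring.
  rewrite Rmax_right; last lra; rewrite BE; lra.
have out x : vnorm (vsub x xh) < r -> de <= vnorm (vsub x x1).
  move=> /near hx; apply: Rnot_lt_le => lt; have [h1 h2] := tab x.
  have := be1 x (ts x) h2; have := UE x; have := q0 x.
  have := HK x1 (ts x) t1 ltac:(lra) h2.
  have hK : K * (t1 - ts x) <= K * th by apply: Rmult_le_compat_l; [lra|rewrite /a in h1; lra].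
  have /Rabs_leD [_ h3] := uL x x1 (ltac:(lra) : 0 <= ts x).
  have /Rabs_leD [h4 _] := vL x x1.
  have : L1 * vnorm (vsub x x1) <= L1 * de by apply: Rmult_le_compat_l; lra.
  rewrite /L1 in Lde *; lra.
have := @strict_comparison N Th C sg H C0 sgB sgL HB HL U v L2 xh r (- (3 * e * la)) 0 L20 r0 UL2 vL2 mxh.
have ela : 0 < 3 * e * la by apply: Rmult_lt_0_compat; lra.
suff h1 : forall x p X, vnorm (vsub x xh) < r -> symmetric X -> ell_superjet U x p X ->
     forall th, - tr2 (sg th x) X + H th x p <= - (3 * e * la).
  move=> /(_ h1) h2; suff h3 : forall x p X, vnorm (vsub x xh) < r -> symmetric X -> ell_subjet v x p X ->
     forall eps, 0 < eps -> exists th, 0 - eps <= - tr2 (sg th x) X + H th x p by have := h2 h3; lra.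
  move=> x p X _ sX sj eps eps0; have [t ht] := vsups sX sj eps0; exists t; lra.
move=> x p X hx sX sj thh.
have tx := int x hx.
have pR := superjet_Lip (ltac:(lra) : 0 <= C + 1) UL sj.
have pj := window_superjet pq win tx sj.
have HH th' (y p' q' : vec N) : vnorm p' <= C + 1 + 1 -> vnorm q' <= C + 1 + 1 -> Rabs (H th' y p' - H th' y q') <= CR * vnorm (vsub p' q').
  move=> h1 h2; have := HCR th' y y p' q' h1 h2; have -> : vsub y y = zerov by vring.
  by rewrite vnorm0 Rplus_0_l.
have := @barrier_subsolution N Th C sg H sgB u la al t1 x1 z (C + 1) CR nu de x (ts x) _ p X usub (Rlt_le _ _ la0) al1 z0 zal
  (proj2 (tab x)) HH CR0 nu0 de0 (out x hx) (fun th => ell th x) aln (Rle_refl la) ltac:(lra) sX pR pj thh.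
rewrite -/be -/la.
have : 0 <= 2 * B * Rmax 0 (ts x - tm) by apply: Rmult_le_pos; [lra|exact: Rmax_l].
have : 3 * e <= z * be x (ts x) by have := near x hx; have := Uup x; have := q0 x; lra.
move=> h; have := Rmult_le_compat_l la _ _ (Rlt_le _ _ la0) h; lra.
Qed.

Lemma convergence_elliptic : exists phi, [/\ Lip (C + L) phi, periodic phi &
  forall eps, 0 < eps -> exists T, forall t x, T <= t -> Rabs (u x t - phi x) <= eps].
Proof.
have [M [Mup Mlo]] := asymptotic_supremum.
exists (fun x => v x + M); split.
- move=> x y; have -> : v x + M - (v y + M) = v x - v y by ring.
  by apply: (@Lip_weaken _ L) => //; lra.
- by move=> x k; rewrite vp.
move=> eps e0; have [T1 [_ H1]] := Mup eps e0; have [T2 H2] := Harnack_alternative Mup Mlo e0.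
exists (Rmax T1 T2) => t x ht.
have := H1 t x (Rle_trans _ _ _ (Rmax_l _ _) ht); have := H2 t x (Rle_trans _ _ _ (Rmax_r _ _) ht).
move=> a b; apply: Rabs_le; lra.
Qed.
End UniformlyElliptic.

(** * The degenerate case *)

(** A limit superior over pairs of late times, built as the supremum of the levels reached at
    arbitrarily late times. *)
Lemma asymptotic_sup A (F : A -> R -> R -> R) Bu lo :
  (forall x t s, 0 <= t -> t <= s -> F x t s <= Bu) ->
  (forall T, 0 <= T -> exists x t s, [/\ T <= t, t <= s & lo <= F x t s]) ->
  exists M, [/\ lo <= M,
    forall e, 0 < e -> exists T, 0 <= T /\ forall x t s, T <= t -> t <= s -> F x t s <= M + e &
    forall T e, 0 <= T -> 0 < e -> exists x t s, [/\ T <= t, t <= s & M - e <= F x t s]].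
Proof.
move=> Fb Flo.
pose S r := forall T, 0 <= T -> exists x t s, [/\ T <= t, t <= s & r <= F x t s].
have Sb : bound S.
  exists Bu => r Sr; have [x [t [s [h1 h2 h3]]]] := Sr 0 (Rle_refl 0); have := Fb x t s h1 h2; lra.
have [M [Mub Mlub]] := completeness S Sb (ex_intro _ lo Flo).
exists M; split; first exact: Mub.
- move=> e e0; have : ~ S (M + e) by move=> /Mub; lra.
  move=> /not_all_ex_not [T hT].
  have [T0 hT2] := imply_to_and _ _ hT.
  exists T; split => // x t s h1 h2; apply: Rnot_lt_le => h; apply: hT2; exists x, t, s; split => //; lra.
move=> T e T0 e0.
have [r [Sr hr]] : exists r, S r /\ M - e < r.
  apply: NNPP => h; have : M <= M - e; last lra.
  by apply: Mlub => r Sr; apply: Rnot_lt_le => h2; apply: h; exists r.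
have [x [t [s [h1 h2 h3]]]] := Sr T T0; exists x, t, s; split => //; lra.
Qed.

Section TimeDoubling.
Variables (N : nat) (C : R).
Hypothesis C0 : 0 < C.
Variable u : vec N -> R -> R.
Hypotheses (uc : cont_par u).
Hypothesis uL : forall x y t, 0 <= t -> Rabs (u x t - u y t) <= C * vnorm (vsub x y).
Variables (mu eta : R).
Hypotheses (mu1 : 1 < mu).

(* The Barles-Souganidis functional, with a spatial perturbation [f]. *)
Definition gap (f : vec N -> R) x t s := u x t + f x - mu * u x s - mu * eta * (s - t).

Lemma gap_Lip f Lf x y t s : 0 <= t -> 0 <= s -> Lip Lf f ->
  gap f x t s <= gap f y t s + (C + Lf + mu * C) * vnorm (vsub x y).
Proof.
move=> t0 s0 fL; rewrite /gap.
have /Rabs_leD h1 := uL x y t0; have /Rabs_leD h2 := uL x y s0; have /Rabs_leD h3 := fL x y.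
have h4 := Rmult_le_compat_l mu _ _ ltac:(lra) (proj1 h2); lra.
Qed.

(* Near-maximizing times are frozen by maximizing over two disjoint time windows. *)
Lemma time_windows f Lf M e T d t0 s0 : 0 <= T -> 0 < e -> 0 < d -> Lip Lf f ->
  (forall x t s, T <= t -> t <= s -> gap f x t s <= M + e) ->
  T <= t0 - d -> t0 + d <= s0 - d ->
  exists U W, [/\ forall x, exists t s, [/\ T <= t, t <= s & U x + W x <= gap f x t s],
    forall x, gap f x t0 s0 <= U x + W x,
    Lip (C + Lf) U /\ Lip (mu * C) W,
    forall x p X, M - 2 * e <= U x + W x -> ell_superjet U x p X ->
      exists t a, [/\ 0 < t, - (mu * eta) - 8 * e / d <= a & par_superjet (fun y s => u y s + f y) x t a p X] &
    forall x p X, M - 2 * e <= U x + W x -> ell_superjet W x p X ->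
      exists s a, [/\ 0 < s, mu * eta - 8 * e / d <= a & par_superjet (fun y s => - (mu * u y s)) x s a p X]].
Proof.
move=> T0 e0 d0 fL Fup Td tsd.
(* At the ends of a window the penalty [D d^2 = 4 e] exceeds the slack [3 e] between near-maximal
   values and [M + e], so the maximizing times are interior. The price is a time slope of at most
   [2 D d = 8 e / d]. *)
set D := 4 * e / (d * d).
have D0 : 0 < D by apply: Rdiv_lt_0_compat; nra.
have DE : D * (d * d) = 4 * e by rewrite /D; field; lra.
have D2E : 2 * D * d = 8 * e / d by rewrite /D; field; lra.
have pq1 := penalty_add (penalty_lin (- (mu * eta)) t0) (penalty_sq t0 (Rlt_le _ _ D0)).
have pq2 := penalty_add (penalty_lin (mu * eta) t0) (penalty_sq s0 (Rlt_le _ _ D0)).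
have uc1 : cont_par (fun y s => u y s + f y).
  move=> x t ht r r0; have r2 : 0 < r / 2 by lra.
  have [k [k0 Hk]] := uc x ht r2.
  have Lf0 := Rabs_pos Lf.
  set k2 := r / 2 / (Rabs Lf + 1); have k20 : 0 < k2 by apply: Rdiv_lt_0_compat; lra.
  exists (Rmin k k2); split; first exact: Rmin_glb_lt.
  move=> y s s00 hy hs.
  have /Rabs_def2 h1 := Hk y s s00 (Rlt_le_trans _ _ _ hy (Rmin_l _ _)) (Rlt_le_trans _ _ _ hs (Rmin_l _ _)).
  have h2 := Rlt_le_trans _ _ _ hy (Rmin_r _ _).
  have h3 : (Rabs Lf + 1) * vnorm (vsub y x) < r / 2.
    have -> : r / 2 = (Rabs Lf + 1) * k2 by rewrite /k2; field; lra.
    by apply: Rmult_lt_compat_l; lra.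
  have /Rabs_leD h4 := fL y x; have vn := vnorm_ge0 (vsub y x); have := Rle_abs Lf => h5.
  have h6 : Lf * vnorm (vsub y x) <= Rabs Lf * vnorm (vsub y x) by exact: Rmult_le_compat_r.
  apply: Rabs_def1; lra.
have uc2 : cont_par (fun y s => - (mu * u y s)).
  move=> x t ht r r0; have r2 : 0 < r / mu by apply: Rdiv_lt_0_compat; lra.
  have [k [k0 Hk]] := uc x ht r2; exists k; split => // y s s00 hy hs.
  have -> : - (mu * u y s) - - (mu * u x t) = - (mu * (u y s - u x t)) by ring.
  rewrite Rabs_Ropp Rabs_mult Rabs_pos_eq; last lra.
  have -> : r = mu * (r / mu) by field; lra.
  by apply: Rmult_lt_compat_l; [lra|exact: Hk].
have [U [ts winU]] := window_exists uc1 pq1 (ltac:(lra) : 0 <= t0 - d) (ltac:(lra) : t0 - d <= t0 + d).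
have [W [ss winW]] := window_exists uc2 pq2 (ltac:(lra) : 0 <= s0 - d) (ltac:(lra) : s0 - d <= s0 + d).
have [tabU UE Uge] := winU; have [tabW WE Wge] := winW.
have sum x : U x + W x = gap f x (ts x) (ss x) - D * (ts x - t0) ^ 2 - D * (ss x - s0) ^ 2.
  by rewrite (UE x) (WE x) /gap; ring.
have gapup x : gap f x (ts x) (ss x) <= M + e by have := tabU x; have := tabW x => h1 h2; apply: Fup; lra.
have sq0 a : 0 <= D * a ^ 2 by apply: Rmult_le_pos; [lra|exact: pow2_ge_0].
have bd : D * d ^ 2 = 4 * e by rewrite -DE; ring.
exists U, W; split.
- move=> x; exists (ts x), (ss x); have [h1 h2] := tabU x; have [h3 h4] := tabW x; rewrite sum.
  by have := sq0 (ts x - t0); have := sq0 (ss x - s0); split; lra.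
- move=> x; have := Uge x t0 ltac:(lra); have := Wge x s0 ltac:(lra); rewrite /gap !Rminus_diag; lra.
- split.
    apply: (@window_Lip _ (fun y s => u y s + f y) _ _ _ _ _ _ (ltac:(lra) : 0 <= t0 - d) winU) => x y t tt.
    have /Rabs_leD h1 := uL x y tt; have /Rabs_leD h2 := fL x y; apply: Rabs_le; lra.
  apply: (window_Lip (ltac:(lra) : 0 <= s0 - d) winW) => x y t tt.
  have -> : - (mu * u x t) - - (mu * u y t) = - (mu * (u x t - u y t)) by ring.
  rewrite Rabs_Ropp Rabs_mult Rabs_pos_eq; last lra.
  rewrite Rmult_assoc; apply: Rmult_le_compat_l; [lra|exact: uL].
- move=> x p X hx sj.
  have hs := sum x; have hg := gapup x; have q1 := sq0 (ts x - t0); have q2 := sq0 (ss x - s0).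
  have [h1 h2] := tabU x; have [h3 h4] := tabW x.
  have int : t0 - d < ts x < t0 + d.
    split.
      case: h1 => // E; move: hs; rewrite -E.
      have -> : (t0 - d - t0) ^ 2 = d ^ 2 by ring.
      rewrite bd E; lra.
    case: h2 => // E; move: hs; rewrite E.
    have -> : (t0 + d - t0) ^ 2 = d ^ 2 by ring.
    rewrite bd -E; lra.
  exists (ts x), (- (mu * eta) + 2 * D * (ts x - t0)); split.
  + lra.
  + rewrite -D2E; have : D * (t0 - ts x) <= D * d by apply: Rmult_le_compat_l; lra.
    lra.
  + exact: (window_superjet pq1 winU int sj).
move=> x p X hx sj.
have hs := sum x; have hg := gapup x; have q1 := sq0 (ts x - t0); have q2 := sq0 (ss x - s0).
have [h3 h4] := tabW x.
have int : s0 - d < ss x < s0 + d.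
  split.
    case: h3 => // E; move: hs; rewrite -E.
    have -> : (s0 - d - s0) ^ 2 = d ^ 2 by ring.
    rewrite bd E; lra.
  case: h4 => // E; move: hs; rewrite E.
  have -> : (s0 + d - s0) ^ 2 = d ^ 2 by ring.
  rewrite bd -E; lra.
exists (ss x), (mu * eta + 2 * D * (ss x - s0)); split.
- lra.
- rewrite -D2E; have : D * (s0 - ss x) <= D * d by apply: Rmult_le_compat_l; lra.
  lra.
- exact: (window_superjet pq2 winW int sj).
Qed.
End TimeDoubling.

(** * The asymptotic supremum is reached on the degenerate set *)

Section DegenerateMaximum.
Variables (N : nat) (Th : Type) (C : R) (sg : Th -> vec N -> mat N) (H : Th -> vec N -> vec N -> R).
Hypothesis C0 : 0 < C.
Hypothesis sgp : forall th, periodic (sg th).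
Hypothesis sgB : forall th x, mnorm (sg th x) <= C.
Hypothesis sgL : forall th x y, mnorm (msub (sg th x) (sg th y)) <= C * vnorm (vsub x y).
Hypothesis HB : forall th x, Rabs (H th x zerov) <= C.
Hypothesis HL : forall Rr, 0 < Rr -> exists CR, 0 < CR /\
     forall th x y p q, vnorm p <= Rr -> vnorm q <= Rr ->
       Rabs (H th x p - H th y q) <= CR * (vnorm (vsub x y) + vnorm (vsub p q)).
Hypothesis ell : forall delta, 0 < delta -> exists nu, 0 < nu /\
     forall th x, SigmaC sg delta x -> forall xi, nu * dot xi xi <= quad (diffusion (sg th x)) xi.

Variable u : vec N -> R -> R.
Hypotheses (uc : cont_par u) (up : forall t, periodic (fun x => u x t)).
Hypothesis uL : forall x y t, 0 <= t -> Rabs (u x t - u y t) <= C * vnorm (vsub x y).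
Hypotheses (usub : parabolic_sub sg H u) (usup : parabolic_super sg H u).
Variable B : R.
Hypothesis ub : forall x t, 0 <= t -> Rabs (u x t) <= B.
Variables (mu eta : R).
Hypotheses (mu1 : 1 < mu) (eta0 : 0 < eta).
Hypothesis Hmu : forall th x p, mu * H th x p <= H th x (vscal mu p).
Variables (M g : R).
Hypotheses (g0 : 0 < g) (Mg : (mu - 1) * B + g <= M).

Let W := gap u mu eta (fun _ => 0).
Hypothesis Mup : forall e, 0 < e -> exists T, 0 <= T /\ forall x t s, T <= t -> t <= s -> W x t s <= M + e.
Hypothesis Mlo : forall T e, 0 <= T -> 0 < e -> exists x t s, [/\ T <= t, t <= s & M - e <= W x t s].

Let WL x y t s : 0 <= t -> 0 <= s -> W x t s <= W y t s + (C + mu * C) * vnorm (vsub x y).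
Proof.
move=> t0 s0; have z : Lip 0 (fun _ : vec N => 0).
  by move=> a b; rewrite Rminus_diag Rabs_R0 Rmult_0_l; lra.
have := gap_Lip uL eta mu1 x y t0 s0 z; rewrite -/W Rplus_0_r; exact.
Qed.

Let Wp x k t s : W (zshift x k) t s = W x t s.
Proof. by rewrite /W /gap; have := up t x k; have := up s x k; rewrite /= => -> ->. Qed.

(** Bounding [u x t] by [u x s] through [time_modulus] leaves at most
    [(mu - 1) B + g / 4 + K (s - t)], so a value above [M - g / 2] forces [K (s - t) >= g / 4]. *)
Lemma time_gap : exists d, 0 < d /\ forall x t s, 0 <= t -> t <= s -> M - g / 2 <= W x t s -> t + 4 * d <= s.
Proof.
have g4 : 0 < g / 4 by lra.
have [K [K0 HK]] := time_modulus C0 sgB HB HL uc uL usup ub g4.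
exists (g / (16 * K)); split; first by apply: Rdiv_lt_0_compat; lra.
move=> x t s t0 ts; rewrite /W /gap => h; have h1 := HK x t s t0 ts.
have /Rabs_leD [h2 _] := ub x (ltac:(lra) : 0 <= s).
have h3 : (mu - 1) * (- B) <= (mu - 1) * u x s by apply: Rmult_le_compat_l; lra.
have h4 : 0 <= mu * eta * (s - t) by apply: Rmult_le_pos; [apply: Rmult_le_pos|]; lra.
have h5 : g / 4 <= K * (s - t) by lra.
apply: (Rmult_le_reg_l K) => //.
have -> : K * (t + 4 * (g / (16 * K))) = K * t + g / 4 by field; lra.
lra.
Qed.

Lemma Sigma_zshift x k : Sigma sg x -> Sigma sg (zshift x k).
Proof. by move=> Sx th i j; rewrite sgp. Qed.

Definition asymptotic_max xh := forall T e, 0 <= T -> 0 < e ->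
  exists t s, [/\ T <= t, t <= s & M - e <= W xh t s].

(** By compactness: near-maxima on the degenerate set, translated into one cell, would accumulate at
    a point of the closed set [Sigma]. Only the times may escape to infinity, and [asymptotic_max]
    allows that. *)
Lemma degenerate_gap : ~ (exists xh, Sigma sg xh /\ asymptotic_max xh) ->
  exists e0 T0, [/\ 0 < e0, 0 <= T0 & forall x t s, Sigma sg x -> T0 <= t -> t <= s -> W x t s <= M - e0].
Proof.
move=> no; apply: NNPP => bad; apply: no.
have muC : 0 < mu * C by pos.
have L1 : 0 < C + mu * C by lra.
have /choice [a Ha] : forall n, exists a : vec N * (R * R), [/\ Sigma sg a.1, vnorm (vsub a.1 zerov) <= INR N, INR n <= a.2.1 /\ a.2.1 <= a.2.2 & M - / (INR n + 1) <= W a.1 a.2.1 a.2.2].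
  move=> n; apply: NNPP => h; apply: bad; have n0 := pos_INR n.
  exists (/ (INR n + 1)), (INR n); split => //; first by apply: Rinv_0_lt_compat; lra.
  move=> x t s Sx h1 h2; apply: Rnot_lt_le => h3; apply: h.
  have [k hk] := cell_representative x zerov.
  exists (zshift x k, (t, s)); split => //=; first exact: Sigma_zshift.
  by rewrite Wp; lra.
have [xh [lx _]] := vulim_ex_ball (fun n => ltac:(by case: (Ha n)) : vnorm (vsub (a n).1 zerov) <= INR N).
exists xh; split.
  by apply: (Sigma_vulim C0 sgL _ lx) => n; case: (Ha n).
move=> T e T0 e0; have e2 : 0 < e / 2 by lra.
have [n [h1 [h2 h3]]] := om_ex (omI (om_INR T) (omI (om_inv e2) (lx _ (Rdiv_lt_0_compat _ _ e2 L1)))).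
have [_ _ [h4 h5] h6] := Ha n.
exists (a n).2.1, (a n).2.2; split => //; first lra.
have := WL (a n).1 xh (ltac:(lra) : 0 <= (a n).2.1) (ltac:(lra) : 0 <= (a n).2.2).
have : (C + mu * C) * vnorm (vsub (a n).1 xh) <= e / 2.
  have -> : e / 2 = (C + mu * C) * (e / 2 / (C + mu * C)) by field; lra.
  by apply: Rmult_le_compat_l; lra.
lra.
Qed.

(** If the functional stayed [e0] below [M] on the degenerate set, near-maxima would keep a distance
    [2 de] from it; there the diffusion is elliptic and a barrier centred at [x1] is strict. A
    barrier constant in time suffices, because the supremum already runs over all late times. *)
Lemma degenerate_maximum x1 : Sigma sg x1 -> exists xh, Sigma sg xh /\ asymptotic_max xh.
Proof.
move=> S1; apply: NNPP => /degenerate_gap [e0 [T0 [e00 T00 HW]]].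
have [d [d0 Hd]] := time_gap.
set L1 := C + mu * C; have L10 : 0 < L1 by rewrite /L1; nra.
set de := e0 / (4 * L1); have de0 : 0 < de by apply: Rdiv_lt_0_compat; lra.
have Lde : L1 * (2 * de) = e0 / 2 by rewrite /de; field; lra.
have [nu [nu0 Hnu]] := ell de0.
have [CR [CR0 HCR]] := HL (ltac:(lra) : 0 < C + 1 + 1).
have dd : 0 < de * de by pos.
set k1 := (C * C / (de * de) + CR / de) / nu.
have k10 : 0 <= k1.
  apply: Rlt_le; apply: Rdiv_lt_0_compat => //; have : 0 < C * C / (de * de) by apply: Rdiv_lt_0_compat => //; nra.
  have : 0 < CR / de by exact: Rdiv_lt_0_compat.
  lra.
set al := 1 + k1; have al1 : 1 <= al by rewrite /al; lra.
have aln : C * C / (de * de) + CR / de <= al * nu.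
  have -> : C * C / (de * de) + CR / de = k1 * nu by rewrite /k1; field; lra.
  by apply: Rmult_le_compat_r; rewrite /al; lra.
(* Here [la] is the strictness constant of the barrier; its growth rate in time is zero. *)
set la := al * al * nu * (de * de).
have la0 : 0 < la by rewrite /la; apply: Rmult_lt_0_compat => //; apply: Rmult_lt_0_compat => //; nra.
set b := fun x => barrier 0 al 0 x1 x 0.
have bE t1 x t : barrier 0 al t1 x1 x t = b x by rewrite /b /barrier; congr exp; ring.
set bm := exp (- (al * (INR N * INR N))).
have bm0 : 0 < bm by exact: exp_pos.
have bN x : vnorm (vsub x x1) <= INR N -> bm <= b x.
  move=> hx; apply: barrier_ge; rewrite Rmult_0_l Rplus_0_l -vnorm_mul; apply: Rmult_le_compat_l; first lra.
  have vn := vnorm_ge0 (vsub x x1); exact: Rmult_le_compat.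
have b1 x : b x <= 1 by apply: (barrier_le1 _ (Rle_refl 0) al1); lra.
have bp x : 0 < b x by exact: barrier_gt0.
have bfar x : INR N + 1 < vnorm (vsub x x1) -> b x <= bm / 2.
  move=> hx; have N0 := pos_INR N.
  have D : al * (INR N * INR N) + 1 <= al * dot (vsub x x1) (vsub x x1).
    rewrite -vnorm_mul; have h1 : INR N * INR N + 1 <= vnorm (vsub x x1) * vnorm (vsub x x1) by nra.
    have := Rmult_le_compat_l al _ _ ltac:(lra) h1; lra.
  apply: Rle_trans (barrier_le (Rle_refl 0) (Rle_refl 0) D) _.
  have -> : - (al * (INR N * INR N) + 1) = - (al * (INR N * INR N)) + - (1) by ring.
  rewrite exp_plus -/bm exp_Ropp; apply: Rmult_le_compat_l; first lra.
  apply: Rinv_le_contravar; [lra|have := exp_ineq1_le 1; lra].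
set z := Rmin (Rmin (g / 4) (e0 / 8)) (/ (2 * al)).
have ial : 0 < / (2 * al) by apply: Rinv_0_lt_compat; lra.
have z0 : 0 < z by apply: Rmin_glb_lt => //; apply: Rmin_glb_lt; lra.
have zg : z <= g / 4 := Rle_trans _ _ _ (Rmin_l _ _) (Rmin_l _ _).
have ze : z <= e0 / 8 := Rle_trans _ _ _ (Rmin_l _ _) (Rmin_r _ _).
have zal : z * (2 * al) <= 1.
  have : z <= / (2 * al) := Rmin_r _ _.
  have : / (2 * al) * (2 * al) = 1 by field; lra.
  nra.
set f := fun x => z * b x.
have f0 x : 0 <= f x by apply: Rmult_le_pos; [lra|exact: Rlt_le].
have fz x : f x <= z by rewrite /f; have := b1 x; nra.
have fL : Lip 1 f.
  move=> x y; have := barrier_Lip x1 (Rle_refl 0) al1 (Rle_refl 0) x y; rewrite -/(b x) -/(b y) => h.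
  have -> : f x - f y = z * (b x - b y) by rewrite /f; ring.
  rewrite Rabs_mult Rabs_pos_eq; last lra.
  apply: Rle_trans (Rmult_le_compat_l _ _ _ (Rlt_le _ _ z0) h) _.
  have -> : z * (2 * al * vnorm (vsub x y)) = z * (2 * al) * vnorm (vsub x y) by ring.
  by apply: Rmult_le_compat_r => //; exact: vnorm_ge0.
have WF x t s : gap u mu eta f x t s = W x t s + f x by rewrite /W /gap; ring.
set zb := z * bm; have zb0 : 0 < zb by exact: Rmult_lt_0_compat.
set G := la * (zb / 2); have G0 : 0 < G by apply: Rmult_lt_0_compat; lra.
(* Near-maxima of [W] can be translated to within [N] of [x1], so the barrier raises the asymptotic
   supremum by at least [7 zb / 8]. Conversely, near-maxima of the sum must have a barrier part of
   at least [zb / 2]. Times are counted from [T0], after which the bound on the degenerate set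
   holds. *)
have [Mz [Mz1 Mz2 Mz3]] := @asymptotic_sup (vec N) (fun x t s => gap u mu eta f x (T0 + t) (T0 + s)) (B + z + mu * B) (M + zb - zb / 8)
  ltac:(move=> x t s t0 ts; have /Rabs_leD h1 := ub x (ltac:(lra) : 0 <= T0 + t); have /Rabs_leD h2 := ub x (ltac:(lra) : 0 <= T0 + s);
    have := fz x; have h3 := Rmult_le_compat_l mu _ _ ltac:(lra) (proj1 h2);
    have : 0 <= mu * eta * (s - t) by [apply: Rmult_le_pos; [apply: Rmult_le_pos|]; lra];
    rewrite /gap; lra)
  ltac:(move=> T hT; have [y [t [s [h1 h2 h3]]]] := @Mlo (T0 + T) (zb / 8) ltac:(lra) ltac:(lra);
    have [k hk] := cell_representative y x1; exists (zshift y k), (t - T0), (s - T0);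
    split; [lra|lra|]; have -> : T0 + (t - T0) = t by [ring]; have -> : T0 + (s - T0) = s by [ring];
    rewrite WF Wp; have := bN _ hk => h4; have := Rmult_le_compat_l _ _ _ (Rlt_le _ _ z0) h4; rewrite -/zb /f; lra).
set e := Rmin (zb / 32) (G * d / 32).
have e1 : 0 < e by apply: Rmin_glb_lt; [lra|have := Rmult_lt_0_compat _ _ G0 d0; lra].
have ezb : e <= zb / 32 := Rmin_l _ _.
have eG : 8 * e / d <= G / 4.
  apply: (Rmult_le_reg_r d) => //; have -> : 8 * e / d * d = 8 * e by field; lra.
  have : e <= G * d / 32 := Rmin_r _ _; lra.
have zbz : zb <= z by rewrite /zb; have := b1 x1; have := bN x1; have -> : vsub x1 x1 = zerov by [vring]; rewrite vnorm0 => h h'; have := Rmult_le_compat_l z _ _ (Rlt_le _ _ z0) (Rle_trans _ _ _ (h (pos_INR N)) h'); lra.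
have [T1 [T10 HT1]] := Mz2 e e1.
have [T2 [T20 HT2]] := Mup (ltac:(lra) : 0 < zb / 8).
set T := T0 + T1 + T2.
have FT x t s : T <= t -> t <= s -> gap u mu eta f x t s <= Mz + e.
  move=> h1 h2; have := HT1 x (t - T0) (s - T0) ltac:(rewrite /T in h1; lra) ltac:(lra).
  by have -> : T0 + (t - T0) = t by [ring]; have -> : T0 + (s - T0) = s by ring.
have WT x t s : T <= t -> t <= s -> W x t s <= M + zb / 8.
  by move=> h1 h2; apply: HT2 => //; rewrite /T in h1; lra.
have [xg [t0 [s0 [ht0 ts0 hF]]]] := Mz3 (T + d) e ltac:(rewrite /T; lra) e1.
have Wlow x t s : T <= t -> t <= s -> Mz - 2 * e <= gap u mu eta f x t s ->
   [/\ M - g / 2 <= W x t s, M - e0 / 2 < W x t s & zb / 2 <= f x].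
  move=> h1 h2; rewrite WF => h3; have := WT x t s h1 h2; have := fz x => h4 h5; split; lra.
set tt := T0 + t0 in hF; set st := T0 + s0 in hF.
have tT : T <= tt - d by rewrite /tt; lra.
have tsT : tt + d <= st - d.
  have [h1 _ _] := Wlow xg tt st ltac:(lra) ltac:(rewrite /tt /st; lra) ltac:(lra).
  have := Hd xg tt st ltac:(rewrite /tt; rewrite /T in ht0; lra) ltac:(rewrite /tt /st; lra) h1; lra.
have T0' : 0 <= T by rewrite /T; lra.
have [U [V [UVup UVlo [UL VL] Uj Vj]]] := time_windows uc uL mu1 T0' e1 d0 fL FT tT tsT.
have muC : 0 < mu * C by pos.
set L2 := mu * C + C + 1; have L20 : 0 <= L2 by rewrite /L2; lra.
have UL2 : Lip L2 U by apply: Lip_weaken UL; rewrite /L2; lra.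
have VL2 : Lip L2 (fun x => - V x) by apply: Lip_opp; apply: Lip_weaken VL; rewrite /L2; lra.
have Mzg : Mz - e <= U xg + V xg := Rle_trans _ _ _ hF (UVlo xg).
have UVlow x : Mz - 2 * e <= U x + V x -> [/\ zb / 2 <= f x, de <= vnorm (vsub x x1) & SigmaC sg de x].
  move=> h; have [t [s [h1 h2 h3]]] := UVup x.
  have [_ h4 h5] := Wlow x t s h1 h2 (Rle_trans _ _ _ h h3).
  have far y : Sigma sg y -> 2 * de <= vnorm (vsub x y).
    move=> Sy; apply: Rnot_lt_le => lt; have := WL x y (ltac:(lra) : 0 <= t) (ltac:(lra) : 0 <= s).
    have := HW y t s Sy ltac:(rewrite /T in h1; lra) h2.
    have : L1 * vnorm (vsub x y) <= L1 * (2 * de) by apply: Rmult_le_compat_l; lra.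
    rewrite -/L1; lra.
  split => //; first by have := far x1 S1; lra.
  by exists de; split => // y /far; lra.
have [xh mxh] : exists x, forall y, U y - - V y <= U x - - V x.
  apply: (@coercive_max _ (fun x => U x - - V x) x1 xg (INR N + 1)).
    exact: (Lip_QL (ltac:(lra) : 0 <= L2 + L2) (Lip_sub UL2 VL2)).
  move=> x hx; have [t [s [h1 h2]]] := UVup x; rewrite WF.
  have := WT x t s h1 h2; have := Rmult_le_compat_l _ _ _ (Rlt_le _ _ z0) (bfar x hx).
  rewrite -/(f x); have -> : z * (bm / 2) = zb / 2 by rewrite /zb; field.
  lra.
set r := e / (2 * L2); have r0 : 0 < r by apply: Rdiv_lt_0_compat => //; rewrite /L2; lra.
have rE : (L2 + L2) * r = e by rewrite /r; field; rewrite /L2; lra.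
have near x : vnorm (vsub x xh) < r -> Mz - 2 * e <= U x + V x.
  move=> hx; have /Rabs_leD [h _] := Lip_sub UL2 VL2 x xh; have := mxh xg.
  have : (L2 + L2) * vnorm (vsub x xh) <= (L2 + L2) * r by apply: Rmult_le_compat_l; lra.
  lra.
have := @strict_comparison N Th C sg H C0 sgB sgL HB HL U (fun x => - V x) L2 xh r (mu * eta + G / 4 - G) (mu * eta - G / 4) L20 r0 UL2 VL2 mxh.
suff h1 : forall x p X, vnorm (vsub x xh) < r -> symmetric X -> ell_superjet U x p X ->
     forall th, - tr2 (sg th x) X + H th x p <= mu * eta + G / 4 - G.
  move=> /(_ h1) h2; suff h3 : forall x p X, vnorm (vsub x xh) < r -> symmetric X -> ell_subjet (fun x => - V x) x p X ->
     forall eps, 0 < eps -> exists th, mu * eta - G / 4 - eps <= - tr2 (sg th x) X + H th x p by have := h2 h3; lra.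
  move=> x p X hx sX /subjet_opp sj eps eps0.
  have sj' : ell_superjet V x (vscal (-1) p) (fun i j => -1 * X i j).
    by move: sj; have -> : (fun y => - - V y) = V by apply: functional_extensionality => y; ring.
  have [s [a [ss0 ha pj]]] := Vj x _ _ (near x hx) sj'.
  have mu0 : 0 < mu by lra.
  have := par_superjet_opp mu0 pj.
  have -> : vscal (- / mu) (vscal (-1) p) = vscal (/ mu) p by vring.
  have -> : (fun i j => - / mu * (-1 * X i j)) = (fun i j => / mu * X i j).
    by apply: functional_extensionality => i; apply: functional_extensionality => j; ring.
  have sX' : symmetric (fun i j => / mu * X i j) by move=> i j; rewrite sX.
  move=> pj'; have [th hth] := usup ss0 sX' pj' (Rdiv_lt_0_compat _ _ eps0 mu0).
  exists th; have := Hmu th x (vscal (/ mu) p).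
  have -> : vscal mu (vscal (/ mu) p) = p.
    by apply: functional_extensionality => i; rewrite /vscal; field; lra.
  rewrite tr2_scal in hth; have := Rmult_le_compat_l _ _ _ (Rlt_le _ _ mu0) hth.
  set h := H th x (vscal _ _); set q := tr2 _ _.
  have -> : mu * - (eps / mu) = - eps by field; lra.
  have -> : mu * (- (a / mu) - / mu * q + h) = - a - q + mu * h by field; lra.
  lra.
move=> x p X hx sX sj th.
have [fx far sC] := UVlow x (near x hx).
have [t [a [t00 ha pj]]] := Uj x p X (near x hx) sj.
have pR := superjet_Lip (ltac:(lra) : 0 <= C + 1) UL sj.
have pj' : par_superjet (fun y s => u y s + z * barrier 0 al t x1 y s) x t a p X.
  move: pj; have -> // : (fun (y : vec N) (s : R) => u y s + f y) = (fun y s => u y s + z * barrier 0 al t x1 y s).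
  by apply: functional_extensionality => y; apply: functional_extensionality => s; rewrite bE.
have HH th' (y p' q' : vec N) : vnorm p' <= C + 1 + 1 -> vnorm q' <= C + 1 + 1 -> Rabs (H th' y p' - H th' y q') <= CR * vnorm (vsub p' q').
  move=> h1 h2; have := HCR th' y y p' q' h1 h2; have -> : vsub y y = zerov by vring.
  by rewrite vnorm0 Rplus_0_l.
have := @barrier_subsolution N Th C sg H sgB u 0 al t x1 z (C + 1) CR nu de x t a p X usub (Rle_refl 0) al1 z0 zal
  (Rle_refl t) HH CR0 nu0 de0 far (fun th => Hnu th x sC) aln (Rlt_le _ _ la0) t00 sX pR pj' th.
rewrite bE -/la -/(f x) => h.
have := Rmult_le_compat_l _ _ _ (Rlt_le _ _ la0) fx; rewrite -/G; lra.
Qed.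

(* On [Sigma] the diffusion is quadratically small, so a first-order doubling suffices. *)
Lemma degenerate_doubling xh w : Sigma sg xh -> asymptotic_max xh -> 0 < w ->
  exists th q, [/\ vnorm q <= 2 * (mu * C), H th xh q - mu * H th xh (vscal (/ mu) q) <= w &
    mu * eta - w <= mu * H th xh (vscal (/ mu) q)].
Proof.
move=> Sx mx w0.
have [d [d0 Hd]] := time_gap.
set R := mu * C; have R0 : 0 < R by rewrite /R; nra.
have CR' : C <= R by rewrite /R; nra.
have [K [K0 HK]] := HL (ltac:(lra) : 0 < 6 * R).
set Z := 16 * (R * R) / d + 34 * (C * C * (R * R)) + (6 + 3 * mu) * (K * R) + mu.
have RR : 0 < R * R by nra.
have Z1 : 0 < 16 * (R * R) / d by apply: Rdiv_lt_0_compat; lra.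
have Z2 : 0 < C * C * (R * R) by apply: Rmult_lt_0_compat; nra.
have Z3 : 0 < K * R by nra.
have Z30 : 0 < mu * (K * R) by apply: Rmult_lt_0_compat; lra.
have Z0 : 0 < Z by rewrite /Z; lra.
set si := 1 + 2 * (R * R) / g + Z / w.
have s1 : 0 < 2 * (R * R) / g by apply: Rdiv_lt_0_compat; lra.
have s2 : 0 < Z / w by apply: Rdiv_lt_0_compat; lra.
have si1 : 1 <= si by rewrite /si; lra.
have siw : Z <= w * si.
  have E : w * (Z / w) = Z by field; lra.
  rewrite -{1}E; apply: Rmult_le_compat_l; rewrite /si; lra.
have sig : 2 * (R * R) <= g * si.
  have E : g * (2 * (R * R) / g) = 2 * (R * R) by field; lra.
  rewrite -{1}E; apply: Rmult_le_compat_l; rewrite /si; lra.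
set t_ := / si; have t0 : 0 < t_ by apply: Rinv_0_lt_compat; lra.
have tsi : t_ * si = 1 by rewrite /t_; field; lra.
have t1 : t_ <= 1 by nra.
have Zt : Z * t_ <= w.
  have := Rmult_le_compat_r t_ _ _ (Rlt_le _ _ t0) siw; have -> : w * si * t_ = w * (t_ * si) by ring.
  by rewrite tsi; lra.
have gt : R * R * t_ <= g / 2.
  have := Rmult_le_compat_r t_ _ _ (Rlt_le _ _ t0) sig; have -> : g * si * t_ = g * (t_ * si) by ring.
  by rewrite tsi; lra.
(* The scales are [rho = t_^-2] and [e = R^2 t_^4], with weight [rho^2] on [|x - y|^2] and [rho] on
   [|x - xh|^2]. Both [rho |x - xh|] and [rho |y - xh|] are then of order [t_], so Hessians of order
   [rho^2] against a diffusion quadratic in the distance to [xh] give a vanishing term. *)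
set rho := si * si; have rho1 : 1 <= rho by rewrite /rho; nra.
have rt : rho * (t_ * t_) = 1 by have -> : rho * (t_ * t_) = (t_ * si) * (t_ * si) by [rewrite /rho; ring]; rewrite tsi; ring.
set e := R * R * (t_ * t_) * (t_ * t_).
have tt1 : t_ * t_ <= t_ by nra.
have tt0 : 0 < t_ * t_ by nra.
have e0 : 0 < e by rewrite /e; apply: Rmult_lt_0_compat => //; exact: Rmult_lt_0_compat.
have e1 : e <= R * R * t_.
  rewrite /e Rmult_assoc; apply: Rmult_le_compat_l; nra.
have e2 : rho * rho * e = R * R.
  have -> : rho * rho * e = R * R * (rho * (t_ * t_)) * (rho * (t_ * t_)) by rewrite /e; ring.
  by rewrite rt; ring.
have [T [T0 HT]] := Mup e0.
have [ta [sa [h1 h2 h3]]] := mx (T + d) e ltac:(lra) e0.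
have h4 := Hd xh ta sa ltac:(lra) h2 ltac:(lra).
have zL : Lip 0 (fun _ : vec N => 0).
  by move=> a b; rewrite Rminus_diag Rabs_R0 Rmult_0_l; lra.
have [U [V [UVup UVlo [UL VL] Uj Vj]]] := time_windows uc uL mu1 T0 e0 d0 zL HT (ltac:(lra) : T <= ta - d) (ltac:(lra) : ta + d <= sa - d).
rewrite Rplus_0_r in UL; rewrite -/R in VL.
have UVM x : U x + V x <= M + e by have [t [s [a1 a2 a3]]] := UVup x; have := HT x t s a1 a2; rewrite /W; lra.
have UVh : M - e <= U xh + V xh := Rle_trans _ _ _ h3 (UVlo xh).
have k0 : 0 < 2 * (rho * rho) by pos.
have [S [m [SL SE Sge]]] := sup_convolution_argmax k0 (Rlt_le _ _ R0) VL.
have k2 : 2 * (rho * rho) / 2 = rho * rho by field.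
rewrite k2 in SE Sge.
have VS x : V x <= S x.
  by have := Sge x x; have -> : vsub x x = zerov by [vring]; rewrite dot0l; lra.
have USL : Lip (C + R) (fun x => U x + S x).
  move=> x y; have /Rabs_leD a1 := UL x y; have /Rabs_leD a2 := SL x y; apply: Rabs_le; lra.
have [x [mxx _]] := paraboloid_max xh (ltac:(lra) : 0 <= C + R) (ltac:(lra) : 0 < rho) USL.
set y := m x.
set n := vnorm (vsub y x); have n0 : 0 <= n by exact: vnorm_ge0.
set de := vnorm (vsub x xh); have de0 : 0 <= de by exact: vnorm_ge0.
have Sx' : S x = V y - rho * rho * (n * n) by rewrite SE -vnorm_mul.
have /Rabs_leD Vyx := VL y x; rewrite -/n in Vyx.
have rr2 : rho <= rho * rho by apply: Rle_mul1l => //; lra.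
have rr1 : 1 <= rho * rho by lra.
have n1 : rho * rho * n <= R.
  have := VS x; rewrite Sx' => a1; have a2 : rho * rho * n * n <= R * n by lra.
  by case: (Req_dec n 0) => [->|nz]; [lra|apply: (Rmult_le_reg_r n); lra].
have n2 : R * n <= e.
  have a1 : rho * rho * (R * n) <= rho * rho * e by rewrite e2; have := Rmult_le_compat_l R _ _ (Rlt_le _ _ R0) n1; lra.
  by apply: (Rmult_le_reg_l (rho * rho)) => //; lra.
have mxh : M - e + rho * (de * de) <= U x + S x.
  have := mxx xh; have -> : vsub xh xh = zerov by vring.
  rewrite dot0l -vnorm_mul -/de; have := VS xh; lra.
have nn : 0 <= rho * rho * (n * n) by pos.
have dd : rho * (de * de) <= 3 * e by have := UVM x; lra.
have rde0 : 0 <= rho * (de * de) by pos.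
have rd : rho * de <= 2 * R * t_.
  have a1 : rho * rho * (rho * (de * de)) <= 3 * (R * R) by have := Rmult_le_compat_l (rho * rho) _ _ ltac:(lra) dd; lra.
  have a2 : (rho * de) * (rho * de) <= 3 * (R * R) * (t_ * t_).
    have := Rmult_le_compat_r (t_ * t_) _ _ (Rlt_le _ _ tt0) a1.
    have -> : rho * rho * (rho * (de * de)) * (t_ * t_) = (rho * de) * (rho * de) * (rho * (t_ * t_)) by ring.
    by rewrite rt; lra.
  apply: Rnot_lt_le => lt.
  have a3 : (2 * R * t_) * (2 * R * t_) <= (rho * de) * (rho * de).
    by have : 0 < R * t_ by [pos]; move=> a4; apply: Rmult_le_compat; lra.
  have : 0 < R * R * (t_ * t_) by exact: Rmult_lt_0_compat.
  lra.
have rn : rho * n <= R * t_.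
  have a1 : rho * (rho * n) <= R by lra.
  have := Rmult_le_compat_r (t_ * t_) _ _ (Rlt_le _ _ tt0) a1.
  have -> : rho * (rho * n) * (t_ * t_) = rho * n * (rho * (t_ * t_)) by ring.
  rewrite rt; have : R * (t_ * t_) <= R * t_ by apply: Rmult_le_compat_l; lra.
  lra.
set de' := vnorm (vsub y xh); have de'0 : 0 <= de' by exact: vnorm_ge0.
have rd' : rho * de' <= 3 * R * t_.
  have a1 : de' <= n + de by rewrite /de' /n /de; exact: vnorm_tri.
  have := Rmult_le_compat_l rho _ _ ltac:(lra) a1; lra.
have Rt : 0 < R * t_ by pos.
have RtR : R * t_ <= R by have := Rmult_le_compat_l R _ _ (Rlt_le _ _ R0) t1; lra.
have Ux : M - 2 * e <= U x + V x by lra.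
have Uy : M - 2 * e <= U y + V y.
  have /Rabs_leD a1 := UL y x; rewrite -/n in a1.
  have : C * n <= R * n by exact: Rmult_le_compat_r.
  lra.
(* The gradient shared by the two jets; on the side of [U] the localization adds a vector of order
   [t_]. *)
have [q Eq] : exists q, q = vscal (2 * (rho * rho)) (vsub x y) by eexists.
have qn : vnorm q <= 2 * R.
  by rewrite Eq vnormZ Rabs_pos_eq; [rewrite vnorm_subC -/n; lra|lra].
have jU : ell_superjet U x (vadd q (vscal (2 * rho) (vsub x xh))) (fun i j => 2 * (rho * rho + rho) * idm i j).
  apply: (superjet_cubic (c := 0)) => h; have a1 := mxx (vadd x h); have a2 := Sge (vadd x h) y.
  move: a1; rewrite (SE x) -/y => a1.
  rewrite quad_matZ quad_idm Eq.
  have E1 : vsub y (vadd x h) = vsub (vsub y x) h by vring.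
  have E2 : vsub (vadd x h) xh = vadd (vsub x xh) h by vring.
  have E3 : vsub x y = vscal (-1) (vsub y x) by vring.
  rewrite E1 in a2; rewrite E2 in a1; rewrite E3.
  move: a1 a2; have [v1 ->] : exists v1, vsub y x = v1 by eexists.
  have [v2 ->] : exists v2, vsub x xh = v2 by eexists.
  rewrite !dotE (dotC h v1) (dotC h v2); lra.
have jV : ell_superjet V y (vscal (2 * (rho * rho)) (vsub y x)) (fun i j => 2 * (rho * rho) * idm i j).
  by apply: paraboloid_jet => z; have := Sge x z; rewrite SE -/y.
have mu0 : 0 < mu by lra.
have [s [a [ss0 ha pj]]] := Vj y _ _ Uy jV.
have := par_superjet_opp mu0 pj.
have -> : vscal (- / mu) (vscal (2 * (rho * rho)) (vsub y x)) = vscal (/ mu) q by rewrite Eq; vring.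
have sX : symmetric (fun i j : 'I_N => - / mu * (2 * (rho * rho) * idm i j)) by move=> i j; rewrite idm_sym.
move=> pj'; have [th hth] := usup ss0 sX pj' t0.
have [t [b [tt00 hb pjU]]] := Uj x _ _ Ux jU.
have sX2 : symmetric (fun i j : 'I_N => 2 * (rho * rho + rho) * idm i j) by move=> i j; rewrite idm_sym.
have pjU' : par_superjet u x t b (vadd q (vscal (2 * rho) (vsub x xh))) (fun i j => 2 * (rho * rho + rho) * idm i j).
  move: pjU; have -> // : (fun (y : vec N) s => u y s + 0) = u.
  by apply: functional_extensionality => z; apply: functional_extensionality => r; rewrite Rplus_0_r.
have hU := usub tt00 sX2 pjU' th.
have trU := tr2_idm_near sgL x th (ltac:(lra) : 0 <= 2 * (rho * rho + rho)) Sx.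
have trV := tr2_idm_near sgL y th (ltac:(lra) : 0 <= 2 * (rho * rho)) Sx.
rewrite -vnorm_mul -/de in trU; rewrite -vnorm_mul -/de' in trV.
set p := vadd q _ in hU.
have pn : vnorm p <= 6 * R.
  apply: Rle_trans (vnorm_add _ _) _; rewrite vnormZ Rabs_pos_eq; last lra.
  rewrite -/de; lra.
have /Rabs_leD [a1 _] := HK th x xh p q pn ltac:(lra).
have pq : vnorm (vsub p q) = 2 * (rho * de).
  have -> : vsub p q = vscal (2 * rho) (vsub x xh) by rewrite /p; vring.
  by rewrite vnormZ Rabs_pos_eq -/de; lra.
rewrite pq -/de in a1.
have qm : vnorm (vscal (/ mu) q) <= 6 * R.
  have im : 0 < / mu by exact: Rinv_0_lt_compat.
  have im1 : / mu <= 1 by rewrite -Rinv_1; apply: Rinv_le_contravar; lra.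
  rewrite vnormZ Rabs_pos_eq; last lra.
  by have := Rmult_le_compat_r _ _ _ (vnorm_ge0 q) im1; lra.
have /Rabs_leD [_ a2] := HK th y xh _ _ qm qm.
have E0 : vsub (vscal (/ mu) q) (vscal (/ mu) q) = zerov by vring.
rewrite E0 vnorm0 Rplus_0_r -/de' in a2.
have dR : de <= rho * de by exact: Rle_mul1l.
have dR' : de' <= rho * de' by exact: Rle_mul1l.
have b1 : K * (de + 2 * (rho * de)) <= 6 * (K * R) * t_.
  apply: (Rle_trans _ (K * (6 * R * t_))); last lra.
  by apply: Rmult_le_compat_l; lra.
have b2 : mu * (K * de') <= 3 * (mu * (K * R)) * t_.
  apply: (Rle_trans _ (mu * (K * (3 * R * t_)))); last lra.
  by apply: Rmult_le_compat_l; [lra|apply: Rmult_le_compat_l; lra].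
have sq v c : 0 <= v -> v <= c * R * t_ -> 0 <= c -> v * v <= c * c * (R * R) * t_.
  move=> v0 vc c0; apply: (Rle_trans _ ((c * R * t_) * (c * R * t_))); first exact: Rmult_le_compat.
  have -> : c * R * t_ * (c * R * t_) = c * c * (R * R) * (t_ * t_) by ring.
  by apply: Rmult_le_compat_l => //; pos.
have b3 : 2 * (rho * rho + rho) * (C * C) * (de * de) <= 16 * (C * C * (R * R)) * t_.
  have c1 := sq (rho * de) 2 ltac:(pos) rd ltac:(lra).
  have c2 : (rho * rho + rho) * (de * de) <= 2 * ((rho * de) * (rho * de)).
    have -> : 2 * (rho * de * (rho * de)) = (rho * rho + rho * rho) * (de * de) by ring.
    by apply: Rmult_le_compat_r; [pos|lra].
  have := Rmult_le_compat_l (C * C) _ _ ltac:(pos) (Rle_trans _ _ _ c2 (Rmult_le_compat_l 2 _ _ ltac:(lra) c1)); lra.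
have b4 : 2 * (rho * rho) * (C * C) * (de' * de') <= 18 * (C * C * (R * R)) * t_.
  have c1 := sq (rho * de') 3 ltac:(pos) rd' ltac:(lra).
  have := Rmult_le_compat_l (C * C) _ _ ltac:(pos) c1; lra.
have b5 : 8 * e / d <= 8 * (R * R) / d * t_.
  have -> : 8 * (R * R) / d * t_ = 8 * (R * R * t_) / d by field; lra.
  by apply: Rmult_le_compat_r; [apply: Rlt_le; exact: Rinv_0_lt_compat|lra].
have h5 : a - mu * t_ - 2 * (rho * rho) * (C * C) * (de' * de') <= mu * H th y (vscal (/ mu) q).
  have := Rmult_le_compat_l _ _ _ (Rlt_le _ _ mu0) hth; rewrite tr2_scal.
  set h := H th y _; set tr := tr2 _ _ in trV *.
  have -> : mu * - t_ = - (mu * t_) by ring.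
  have -> : mu * (- (a / mu) - - / mu * tr + h) = - a + tr + mu * h by field; lra.
  lra.
have h6 := Rmult_le_compat_l _ _ _ (Rlt_le _ _ mu0) a2.
have ZE : Z * t_ = 16 * (R * R) / d * t_ + 34 * (C * C * (R * R)) * t_ + 6 * (K * R) * t_ + 3 * (mu * (K * R)) * t_ + mu * t_.
  rewrite /Z; ring.
have E16 : 16 * (R * R) / d * t_ = 8 * (R * R) / d * t_ + 8 * (R * R) / d * t_ by field; lra.
have p1 : 0 < 8 * (R * R) / d * t_ by apply: Rmult_lt_0_compat => //; apply: Rdiv_lt_0_compat; lra.
have p2 : 0 < C * C * (R * R) * t_ by exact: Rmult_lt_0_compat.
have p3 : 0 < K * R * t_ by exact: Rmult_lt_0_compat.
exists th, q; split => //; lra.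
Qed.
End DegenerateMaximum.

(** * Asymptotic monotonicity in time *)

Section AlmostIncreasing.
Variables (N : nat) (Th : Type) (C : R) (sg : Th -> vec N -> mat N) (H : Th -> vec N -> vec N -> R).
Hypothesis C0 : 0 < C.
Hypothesis sgp : forall th, periodic (sg th).
Hypothesis sgB : forall th x, mnorm (sg th x) <= C.
Hypothesis sgL : forall th x y, mnorm (msub (sg th x) (sg th y)) <= C * vnorm (vsub x y).
Hypothesis HB : forall th x, Rabs (H th x zerov) <= C.
Hypothesis HL : forall Rr, 0 < Rr -> exists CR, 0 < CR /\
     forall th x y p q, vnorm p <= Rr -> vnorm q <= Rr ->
       Rabs (H th x p - H th y q) <= CR * (vnorm (vsub x y) + vnorm (vsub p q)).
Hypothesis ell : forall delta, 0 < delta -> exists nu, 0 < nu /\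
     forall th x, SigmaC sg delta x -> forall xi, nu * dot xi xi <= quad (diffusion (sg th x)) xi.

Variable u : vec N -> R -> R.
Hypotheses (uc : cont_par u) (up : forall t, periodic (fun x => u x t)).
Hypothesis uL : forall x y t, 0 <= t -> Rabs (u x t - u y t) <= C * vnorm (vsub x y).
Hypotheses (usub : parabolic_sub sg H u) (usup : parabolic_super sg H u).
Variable B : R.
Hypothesis ub : forall x t, 0 <= t -> Rabs (u x t) <= B.
Variable x1 : vec N.
Hypothesis Sx1 : Sigma sg x1.
Variables (mu0 : R) (K : vec N -> Prop).
Hypotheses (mu01 : 1 < mu0) (Kc : closed_vset K).
Hypothesis HK : forall th x p, K x -> 0 <= H th x p.
Hypothesis Hmu : forall th x p mu, 1 < mu -> mu < mu0 -> mu * H th x p <= H th x (vscal mu p).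
Hypothesis Hstrict : forall x, Sigma sg x -> (exists r, 0 < r /\ forall y, K y -> r <= vnorm (vsub x y)) ->
  forall p, p <> zerov -> forall mu, 1 < mu -> mu <= mu0 ->
    exists r, 0 < r /\ forall th, r <= H th x (vscal mu p) - mu * H th x p.
Variable th0 : Th.

(** At [p = 0] condition (ii)(a) reads [mu H <= H] with [mu > 1]. *)
Lemma H_origin th x : H th x zerov <= 0.
Proof.
have m : 1 < (1 + mu0) / 2 by lra.
have := Hmu th x zerov m ltac:(lra).
have -> : vscal ((1 + mu0) / 2) zerov = zerov :> vec N by vring.
nra.
Qed.

Section FixedMu.
Variables (mu eta M g : R).
Hypotheses (mu1 : 1 < mu) (mum : mu < mu0) (eta0 : 0 < eta) (g0 : 0 < g) (Mg : (mu - 1) * B + g <= M).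
Let W := gap u mu eta (fun _ => 0).
Hypothesis Mup : forall e, 0 < e -> exists T, 0 <= T /\ forall x t s, T <= t -> t <= s -> W x t s <= M + e.
Hypothesis Mlo : forall T e, 0 <= T -> 0 < e -> exists x t s, [/\ T <= t, t <= s & M - e <= W x t s].

(** At such a point [u] is nonincreasing and bounded, so late variations are below [g / 4] and the
    functional is below [(mu - 1) B + g / 2], short of [M - g / 4]. *)
Lemma asymptotic_max_notin_K xh : Sigma sg xh -> asymptotic_max u mu eta M xh -> ~ K xh.
Proof.
move=> Sx mx Kx.
have dec := decreasing_on_K C0 sgL HL uc uL th0 usub ub Sx (fun th p => HK th p Kx).
pose S r := exists t, 0 <= t /\ r = - u xh t.
have [l [lub llub]] : exists l, is_lub S l.
  have Sb : bound S by exists B => r [t [t0 ->]]; have /Rabs_leD := ub xh t0; lra.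
  have Sn : exists r, S r by exists (- u xh 0), 0; split => //; lra.
  by have [l hl] := completeness S Sb Sn; exists l.
have g4 : 0 < g / 4 by lra.
have [T [T0 hT]] : exists T, 0 <= T /\ l - g / 4 < - u xh T.
  apply: NNPP => h; have : l <= l - g / 4; last lra.
  by apply: llub => r [t [t0 ->]]; apply: Rnot_lt_le => h2; apply: h; exists t.
have [t [s [h1 h2 h3]]] := mx T (g / 4) T0 g4.
have h4 := dec T t T0 h1.
have h5 := lub (- u xh s) (ex_intro _ s (conj (ltac:(lra) : 0 <= s) (erefl _))).
have /Rabs_leD [h6 _] := ub xh (ltac:(lra) : 0 <= s).
have h7 := Rmult_le_compat_l (mu - 1) _ _ ltac:(lra) h6.
have h8 : 0 <= mu * eta * (s - t) by apply: Rmult_le_pos; [apply: Rmult_le_pos|]; lra.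
move: h3; rewrite /gap; lra.
Qed.

(** The gradients produced by [degenerate_doubling] have a limit [q]. If [q = 0], the lower bound
    [mu eta] contradicts [H <= 0] at the origin; if not, (ii)(b) is contradicted. The parameter
    varies along the sequence, so the strictness has to be uniform in it, as the infimum in (ii)(b)
    provides. *)
Lemma no_asymptotic_max xh : Sigma sg xh -> asymptotic_max u mu eta M xh -> False.
Proof.
move=> Sx mx; have nK := asymptotic_max_notin_K Sx mx.
have far : exists r, 0 < r /\ forall y, K y -> r <= vnorm (vsub xh y).
  apply: NNPP => h; apply: nK; apply: Kc => e e0; apply: NNPP => h2; apply: h.
  exists e; split => // y Ky; apply: Rnot_lt_le => lt; apply: h2; exists y; split => //.
  by rewrite vnorm_subC.
have me : 0 < mu * eta by nra.
have R0 : 0 < 2 * (mu * C) by nra.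
have [CR [CR0 HCR]] := HL R0.
have /choice [a Ha] : forall n, exists a : Th * vec N, [/\ vnorm a.2 <= 2 * (mu * C),
    H a.1 xh a.2 - mu * H a.1 xh (vscal (/ mu) a.2) <= / (INR n + 1) &
    mu * eta - / (INR n + 1) <= mu * H a.1 xh (vscal (/ mu) a.2)].
  move=> n; have w0 : 0 < / (INR n + 1) by apply: Rinv_0_lt_compat; have := pos_INR n; lra.
  have [th [q h]] := degenerate_doubling C0 sgB sgL HB HL uc uL usub usup ub mu1 eta0 g0 Mg Mup Sx mx w0.
  by exists (th, q).
have [q lq] := vulim_ex (fun n => ltac:(by case: (Ha n)) : vnorm (a n).2 <= 2 * (mu * C)).
have im : 0 < / mu by apply: Rinv_0_lt_compat; lra.
have im1 : / mu <= 1 by rewrite -Rinv_1; apply: Rinv_le_contravar; lra.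
have scal (v : vec N) : vnorm (vscal (/ mu) v) <= vnorm v.
  by rewrite vnormZ Rabs_pos_eq; [have := vnorm_ge0 v; nra|lra].
have diff th p p' : vnorm p <= 2 * (mu * C) -> vnorm p' <= 2 * (mu * C) -> Rabs (H th xh p - H th xh p') <= CR * vnorm (vsub p p').
  move=> h1 h2; have := HCR th xh xh p p' h1 h2; have -> : vsub xh xh = zerov by vring.
  by rewrite vnorm0 Rplus_0_l.
case: (classic (q = zerov)) => [q0|q0].
  have e0 : 0 < mu * eta / 4 by lra.
  have e1 : 0 < mu * eta / 4 / (mu * CR) by apply: Rdiv_lt_0_compat => //; nra.
  have [n [h1 h2]] := om_ex (omI (om_inv e0) (lq _ e1)).
  have [h3 h4 h5] := Ha n.
  move: h2; rewrite q0; have -> : vsub (a n).2 zerov = (a n).2 by vring.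
  move=> h2; have h6 := diff (a n).1 (vscal (/ mu) (a n).2) zerov (Rle_trans _ _ _ (scal _) h3) ltac:(rewrite vnorm0; lra).
  move: h6; have -> : vsub (vscal (/ mu) (a n).2) zerov = vscal (/ mu) (a n).2 by vring.
  move=> /Rabs_leD [_ h6]; have h7 := H_origin (a n).1 xh.
  have h8 := Rmult_le_compat_l CR _ _ (Rlt_le _ _ CR0) (scal (a n).2).
  have h9 : mu * CR * vnorm (a n).2 <= mu * eta / 4.
    have -> : mu * eta / 4 = mu * CR * (mu * eta / 4 / (mu * CR)) by field; lra.
    by apply: Rmult_le_compat_l; nra.
  have h10 : mu * H (a n).1 xh (vscal (/ mu) (a n).2) <= mu * (CR * vnorm (a n).2) by apply: Rmult_le_compat_l; lra.
  lra.
have q1 : vscal (/ mu) q <> zerov.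
  move=> E; apply: q0; have -> : q = vscal mu (vscal (/ mu) q).
    by apply: functional_extensionality => i; rewrite /vscal; field; lra.
  rewrite E; vring.
have [r [r0 hr]] := Hstrict Sx far q1 mu1 (Rlt_le _ _ mum).
have qE : vscal mu (vscal (/ mu) q) = q.
  by apply: functional_extensionality => i; rewrite /vscal; field; lra.
rewrite qE in hr.
have qb : vnorm q <= 2 * (mu * C).
  apply: Rle_plus_epsilon => e e0; have [n hn] := om_ex (lq e e0); have [h3 _ _] := Ha n.
  have -> : q = vsub (a n).2 (vsub (a n).2 q) by vring.
  by apply: Rle_trans (vnorm_sub _ _) _; lra.
have r4 : 0 < r / 4 by lra.
have e1 : 0 < r / 4 / (mu * CR) by apply: Rdiv_lt_0_compat => //; nra.
have [n [h1 h2]] := om_ex (omI (om_inv r4) (lq _ e1)).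
have [h3 h4 h5] := Ha n.
have /Rabs_leD [h6 _] := diff (a n).1 _ _ h3 qb.
have /Rabs_leD [_ h7] := diff (a n).1 _ _ (Rle_trans _ _ _ (scal _) h3) (Rle_trans _ _ _ (scal _) qb).
have vE : vsub (vscal (/ mu) (a n).2) (vscal (/ mu) q) = vscal (/ mu) (vsub (a n).2 q) by vring.
rewrite vE in h7.
have h8 := Rmult_le_compat_l CR _ _ (Rlt_le _ _ CR0) (scal (vsub (a n).2 q)).
have h9 : mu * CR * vnorm (vsub (a n).2 q) <= r / 4.
  have -> : r / 4 = mu * CR * (r / 4 / (mu * CR)) by field; lra.
  by apply: Rmult_le_compat_l; nra.
have h10 : mu * (H (a n).1 xh (vscal (/ mu) (a n).2) - H (a n).1 xh (vscal (/ mu) q)) <= mu * (CR * vnorm (vsub (a n).2 q)) by apply: Rmult_le_compat_l; lra.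
have h11 : CR * vnorm (vsub (a n).2 q) <= mu * (CR * vnorm (vsub (a n).2 q)).
  have : 0 <= CR * vnorm (vsub (a n).2 q) by apply: Rmult_le_pos; [lra|exact: vnorm_ge0].
  nra.
have := hr (a n).1; lra.
Qed.
End FixedMu.

Lemma gap_asymptotic mu eta g : 1 < mu -> mu < mu0 -> 0 < eta -> 0 < g ->
  exists T, forall x t s, T <= t -> 0 <= t -> t <= s -> gap u mu eta (fun _ => 0) x t s <= (mu - 1) * B + g.
Proof.
move=> mu1 mum eta0 g0; apply: NNPP => h.
have lo T : 0 <= T -> exists x t s, [/\ T <= t, t <= s & (mu - 1) * B + g <= gap u mu eta (fun _ => 0) x t s].
  move=> T0; apply: NNPP => h2; apply: h; exists T => x t s h3 _ h4; apply: Rnot_lt_le => lt.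
  by apply: h2; exists x, t, s; split => //; lra.
have upb x t s : 0 <= t -> t <= s -> gap u mu eta (fun _ => 0) x t s <= B + mu * B.
  move=> t0 ts; rewrite /gap; have /Rabs_leD h1 := ub x t0; have /Rabs_leD h2 := ub x (ltac:(lra) : 0 <= s).
  have h3 := Rmult_le_compat_l mu _ _ ltac:(lra) (proj1 h2).
  have : 0 <= mu * eta * (s - t) by apply: Rmult_le_pos; [apply: Rmult_le_pos|]; lra.
  lra.
have [M [Mg Mup Mlo]] := asymptotic_sup upb lo.
have [xh [Sx mx]] := degenerate_maximum C0 sgp sgB sgL HB HL ell uc up uL usub usup ub mu1 eta0
  (fun th x p => Hmu th x p mu1 mum) g0 Mg Mup Mlo Sx1.
exact: (no_asymptotic_max mu1 mum eta0 g0 Mg Mup Sx mx).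
Qed.

Lemma almost_increasing tau e : 0 < tau -> 0 < e ->
  exists T, forall x t s, T <= t -> 0 <= t -> t <= s -> s <= t + tau -> u x t <= u x s + e.
Proof.
move=> tau0 e0.
have B0 : 0 <= B by apply: Rle_trans (ub x1 (Rle_refl 0)); exact: Rabs_pos.
(* With [mu = 1 + k], replacing [mu u] by [u] and the bound [(mu - 1) B] cost [e / 8] each, the
   drift [mu eta (s - t)] at most [e / 4], and the slack in the supremum another [e / 4]. *)
set k := Rmin ((mu0 - 1) / 2) (Rmin 1 (e / (8 * (B + 1)))).
have k0 : 0 < k by apply: Rmin_glb_lt; [lra|apply: Rmin_glb_lt; [lra|apply: Rdiv_lt_0_compat; lra]].
have k1 : k <= (mu0 - 1) / 2 := Rmin_l _ _.
have k2 : k <= 1 := Rle_trans _ _ _ (Rmin_r _ _) (Rmin_l _ _).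
have k3 : k * B <= e / 8.
  have : k <= e / (8 * (B + 1)) := Rle_trans _ _ _ (Rmin_r _ _) (Rmin_r _ _).
  have E : e / (8 * (B + 1)) * (B + 1) = e / 8 by field; lra.
  move=> h; have : k * (B + 1) <= e / 8 by rewrite -E; apply: Rmult_le_compat_r; lra.
  lra.
set eta := e / (8 * tau); have eta0 : 0 < eta by apply: Rdiv_lt_0_compat; lra.
have etE : eta * tau = e / 8 by rewrite /eta; field; lra.
have e4 : 0 < e / 4 by lra.
have [T HT] := gap_asymptotic (ltac:(lra) : 1 < 1 + k) (ltac:(lra) : 1 + k < mu0) eta0 e4.
exists T => x t s h1 h2 h3 h4; have := HT x t s h1 h2 h3; rewrite /gap.
have /Rabs_leD [_ h5] := ub x (ltac:(lra) : 0 <= s).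
have h6 := Rmult_le_compat_l k _ _ (Rlt_le _ _ k0) h5.
have h7 : eta * (s - t) <= eta * tau by apply: Rmult_le_compat_l; lra.
have h8 : 0 <= eta * (s - t) by apply: Rmult_le_pos; lra.
have h9 : k * (eta * (s - t)) <= 1 * (eta * (s - t)) by apply: Rmult_le_compat_r.
have -> : 1 + k - 1 = k by ring.
lra.
Qed.
End AlmostIncreasing.

(** * Reduction to vanishing ergodic constant *)

Section Normalization.
Variables (N : nat) (Th : Type) (sg : Th -> vec N -> mat N) (H : Th -> vec N -> vec N -> R) (c : R).
Let Hc th x p := H th x p - c.

Lemma HopE x p X th : Hop sg H x p X th = - tr2 (sg th x) X + H th x p.
Proof. by rewrite /Hop trprod_diffusion. Qed.

Lemma normalized_solution u : visc_E sg H u ->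
  [/\ cont_par (fun x t => u x t + c * t), parabolic_sub sg Hc (fun x t => u x t + c * t) &
      parabolic_super sg Hc (fun x t => u x t + c * t)].
Proof.
move=> [uc [us up]]; split.
- move=> x t t0 e e0; have e2 : 0 < e / 2 by lra.
  have [d [d0 Hd]] := uc x t t0 _ e2; have cp := Rabs_pos c.
  set k := e / 2 / (Rabs c + 1); have k0 : 0 < k by apply: Rdiv_lt_0_compat; lra.
  exists (Rmin d k); split; first exact: Rmin_glb_lt.
  move=> y s s0 hy hs.
  have h1 := Hd y s s0 (Rlt_le_trans _ _ _ hy (Rmin_l _ _)) (Rlt_le_trans _ _ _ hs (Rmin_l _ _)).
  have h2 := Rlt_le_trans _ _ _ hs (Rmin_r _ _).
  have -> : u y s + c * s - (u x t + c * t) = (u y s - u x t) + c * (s - t) by ring.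
  apply: Rle_lt_trans (Rabs_triang _ _) _; rewrite Rabs_mult.
  have E : (Rabs c + 1) * k = e / 2 by rewrite /k; field; lra.
  have : (Rabs c + 1) * Rabs (s - t) <= (Rabs c + 1) * k by apply: Rmult_le_compat_l; lra.
  have := Rabs_pos (s - t); lra.
- move=> x t a p X t0 sX sj th.
  have sj' : par_superjet u x t (a - c) p X.
    move=> e e0; have [d [d0 Hd]] := sj e e0; exists d; split => // y s s0 hy hs.
    have := Hd y s s0 hy hs; lra.
  have := us x t _ p X t0 sX sj' th; rewrite HopE /Hc; lra.
move=> x t a p X t0 sX sj e e0.
have sj' : par_subjet u x t (a - c) p X.
  move=> r r0; have [d [d0 Hd]] := sj r r0; exists d; split => // y s s0 hy hs.
  have := Hd y s s0 hy hs; lra.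
have [th h] := up x t _ p X t0 sX sj' e e0; exists th; move: h; rewrite HopE /Hc; lra.
Qed.

Lemma visc_SE v : visc_S sg H c v <-> [/\ cont_ell v, elliptic_sub sg Hc v & elliptic_super sg Hc v].
Proof.
split=> [[vc [vs vp]]|[vc vs vp]]; split => //.
- by move=> x p X sX sj th; have := vs x p X sX sj th; rewrite HopE /Hc; lra.
- move=> x p X sX sj e e0; have [th h] := vp x p X sX sj e e0; exists th; move: h; rewrite HopE /Hc; lra.
split=> x p X sX sj.
- by move=> th; have := vs x p X sX sj th; rewrite HopE /Hc; lra.
move=> e e0; have [th h] := vp x p X sX sj e e0; exists th; move: h; rewrite HopE /Hc; lra.
Qed.
End Normalization.

Lemma Lip_cont N L (f : vec N -> R) : Lip L f -> cont_ell f.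
Proof.
move=> fL x e e0; have L0 := Rabs_pos L.
set k := e / (Rabs L + 1); have k0 : 0 < k by apply: Rdiv_lt_0_compat; lra.
have E : (Rabs L + 1) * k = e by rewrite /k; field; lra.
exists k; split => // y hy; have := fL y x; have vn := vnorm_ge0 (vsub y x).
have : (Rabs L + 1) * vnorm (vsub y x) < (Rabs L + 1) * k by apply: Rmult_lt_compat_l; lra.
have : L * vnorm (vsub y x) <= Rabs L * vnorm (vsub y x) by apply: Rmult_le_compat_r => //; exact: Rle_abs.
lra.
Qed.

Lemma convergence_nearly_stationary N (u : vec N -> R -> R) phi :
  (forall eps, 0 < eps -> exists T, forall t x, T <= t -> Rabs (u x t - phi x) <= eps) -> nearly_stationary u phi.
Proof.
move=> h e R0 e0 R00; have [T HT] := h e e0; have := Rabs_pos T; have := Rle_abs T => h1 h2.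
exists (Rabs T + R0 + 1); split; first lra.
by move=> x s /Rabs_leD hs; apply: HT; lra.
Qed.

Theorem theorem2p2 (N : nat) (Th : Type) (C : R)
    (sg : Th -> vec N -> mat N) (H : Th -> vec N -> vec N -> R)
    (u : vec N -> R -> R) (c : R) :
  0 < C ->
  (* standing assumptions on sigma_theta *)
  (forall th, periodic (sg th)) ->
  (forall th x, mnorm (sg th x) <= C) ->
  (forall th x y, mnorm (msub (sg th x) (sg th y)) <= C * vnorm (vsub x y)) ->
  (* standing assumptions on H_theta *)
  (forall th p, periodic (fun x => H th x p)) ->
  (forall th x, Rabs (H th x zerov) <= C) ->
  (forall Rr, 0 < Rr -> exists CR, 0 < CR /\
     forall th x y p q, vnorm p <= Rr -> vnorm q <= Rr ->
       Rabs (H th x p - H th y q) <= CR * (vnorm (vsub x y) + vnorm (vsub p q))) ->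
  (* u : the (C-Lipschitz in x) viscosity solution of (E) *)
  (forall t, periodic (fun x => u x t)) ->
  visc_E sg H u ->
  (forall x y t, 0 <= t -> Rabs (u x t - u y t) <= C * vnorm (vsub x y)) ->
  (* existence of C-Lipschitz solutions of (E_lambda) *)
  (forall lam, 0 < lam -> exists v, periodic v /\
     (forall x y, Rabs (v x - v y) <= C * vnorm (vsub x y)) /\ visc_Elam sg H lam v) ->
  (* c is the ergodic constant: (S) has a W^{1,oo} solution *)
  (exists v, periodic v /\
     (exists L, forall x y, Rabs (v x - v y) <= L * vnorm (vsub x y)) /\ visc_S sg H c v) ->
  (* (i) *)
  (forall delta, 0 < delta -> exists nu, 0 < nu /\
     forall th x, SigmaC sg delta x ->
       forall xi, nu * dot xi xi <= quad (diffusion (sg th x)) xi) ->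
  (* (ii) *)
  (exists mu0, 1 < mu0 /\
     (forall th x p mu, 1 < mu -> mu < mu0 ->
        H th x (vscal mu p) - mu * H th x p >= (1 - mu) * c) /\
     (exists K : vec N -> Prop,
        periodic_set K /\ closed_vset K /\ (forall x : vec N, K x -> Sigma sg x) /\
        (forall th (x p : vec N), K x -> H th x p >= c) /\
        (forall x : vec N, Sigma sg x ->
           (exists eta, 0 < eta /\ forall y, K y -> eta <= vnorm (vsub x y)) ->
           forall p, p <> zerov -> forall mu, 1 < mu -> mu <= mu0 ->
             exists eta, 0 < eta /\ forall th,
               (1 - mu) * c + eta <= H th x (vscal mu p) - mu * H th x p))) ->
  exists uinf : vec N -> R,
    periodic uinf /\ visc_S sg H c uinf /\
    (forall eps, 0 < eps -> exists T, forall t x, T <= t ->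
       Rabs (u x t + c * t - uinf x) <= eps).
Proof.
move=> C0 sgp sgB sgL _ HB HL up uE uL _ [v [vp [[L vL] vS]]] ell [mu0 [mu01 [Hmu [K [_ [Kc [_ [HK Hstrict]]]]]]]].
have [uc usub usup] := normalized_solution c uE.
have [vc vsub' vsup'] := proj1 (visc_SE sg H c v) vS.
set w := fun x t => u x t + c * t in uc usub usup.
set Hc := fun th x p => H th x p - c in usub usup vsub' vsup'.
have cp := Rabs_pos c.
(* One constant for all data: subtracting [c] from [H] enlarges its bound at the origin by [|c|]. *)
set C1 := C + Rabs c; have C10 : 0 < C1 by rewrite /C1; lra.
have CC a b : a <= C * vnorm b -> a <= C1 * vnorm (b : vec N).
  by have := vnorm_ge0 b; rewrite /C1 => h1 h2; have : 0 <= Rabs c * vnorm b by [exact: Rmult_le_pos]; lra.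
have sgB1 th x : mnorm (sg th x) <= C1 by have := sgB th x; rewrite /C1; lra.
have sgL1 th x y := CC _ _ (sgL th x y).
have HB1 th x : Rabs (Hc th x zerov) <= C1.
  rewrite /Hc /C1; have := Rabs_triang (H th x zerov) (- c); rewrite Rabs_Ropp; have := HB th x; rewrite /Rminus; lra.
have HL1 Rr : 0 < Rr -> exists CR, 0 < CR /\ forall th x y p q, vnorm p <= Rr -> vnorm q <= Rr ->
    Rabs (Hc th x p - Hc th y q) <= CR * (vnorm (vsub x y) + vnorm (vsub p q)).
  move=> /HL [CR [CR0 h]]; exists CR; split => // th x y p q hp hq; have := h th x y p q hp hq.
  by congr (Rabs _ <= _); rewrite /Hc; ring.
have wp t : periodic (fun x => w x t) by move=> x k; have := up t x k; rewrite /w /= => ->.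
have wL x y t : 0 <= t -> Rabs (w x t - w y t) <= C1 * vnorm (vsub x y).
  by move=> t0; apply: CC; have := uL x y t t0; congr (Rabs _ <= _); rewrite /w; ring.
have vL1 : Lip (Rabs L) v by apply: Lip_weaken vL; exact: Rle_abs.
have L0 := Rabs_pos L.
have [th0 _] := parameters_inhabited L0 vL1 vp vsup'.
have [B [B0 wB]] := solution_bounded C10 sgB1 sgL1 HB1 HL1 uc wp wL usub usup L0 vL1 vp vsub' vsup'.
suff [phi [L1 [phiL phip conv]]] : exists phi L1, [/\ Lip L1 phi, periodic phi &
    forall eps, 0 < eps -> exists T, forall t x, T <= t -> Rabs (w x t - phi x) <= eps].
  have ns := convergence_nearly_stationary conv.
  exists phi; split => //; split => //; apply/visc_SE; split.
  - exact: Lip_cont phiL.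
  - exact: (stability_sub C10 sgB1 sgL1 HL1 uc wL usub ns).
  - exact: (stability_super C10 sgB1 sgL1 HL1 uc wL usup ns).
case: (classic (exists x, Sigma sg x)) => [[x1 Sx1]|no].
  have HKc th x p : K x -> 0 <= Hc th x p by move=> /(HK th x p); rewrite /Hc; lra.
  have Hmuc th x p mu : 1 < mu -> mu < mu0 -> mu * Hc th x p <= Hc th x (vscal mu p).
    by move=> h1 h2; have := Hmu th x p mu h1 h2; rewrite /Hc; lra.
  have Hsc x : Sigma sg x -> (exists r, 0 < r /\ forall y, K y -> r <= vnorm (vsub x y)) ->
      forall p, p <> zerov -> forall mu, 1 < mu -> mu <= mu0 ->
      exists r, 0 < r /\ forall th, r <= Hc th x (vscal mu p) - mu * Hc th x p.
    move=> Sx far p p0 mu h1 h2; have [r [r0 h]] := Hstrict x Sx far p p0 mu h1 h2.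
    by exists r; split => // th; have := h th; rewrite /Hc; lra.
  have incr := almost_increasing C10 sgp sgB1 sgL1 HB1 HL1 ell uc wp wL usub usup wB Sx1 mu01 Kc HKc Hmuc Hsc th0.
  have [phi [phiL phip ns]] := limit_of_increasing C10 wp wL wB incr.
  exists phi, C1; split => //.
  exact: (nearly_stationary_convergence C10 sgB1 sgL1 HB1 HL1 uc wp wL usub usup phiL phip ns).
(* With an empty degenerate set every point lies at infinite distance from it, so a single [delta]
   gives ellipticity everywhere. *)
have [nu [nu0 hnu]] := ell 1 Rlt_0_1.
have unif th x xi : nu * dot xi xi <= quad (diffusion (sg th x)) xi.
  by apply: hnu; exists 1; split; [lra|move=> y Sy; case: no; exists y].
have [phi [h1 h2 h3]] := convergence_elliptic C10 sgB1 sgL1 HB1 HL1 nu0 unif uc wp wL usub usup wB L0 vL1 vp vsup'.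
by exists phi, (C1 + Rabs L).
Qed.
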